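(* Let $g:\mathbb{T}\times I\to\mathbb{T}\times I$, $I=(0,\pi)$, be the billiard map of an analytic strictly convex closed curve $\Gamma$ of constant width in the Euclidean plane. Let $a_*>0$ be the analyticity strip width of the $(1,2)$-resonant RIC $C=\mathbb{T}\times\{\pi/2\}$ of $g$ (that is, $C$ is an $(a_*,b_* )$-analytic $(1,2)$-resonant RIC of $g$ for some $b_*>0$). Let $\alpha\in(0,a_* )$ and $L\ge1$. Then there exist a constant $K>0$ and a period $q_*\ge1$ such that $$\mathcal{L}^{(p,q)}\le K\exp\left(-\frac{\pi\alpha}{|p/q-1/2|}\right)$$ for all relatively prime integers $p$ and $q$ such that $1\le|2p-q|\le L$ and $q\ge q_*$.
   Context: $\mathbb{T}=\mathbb{R}/\mathbb{Z}$. The closed curve $\Gamma$ is strictly convex with positive curvature, and oriented counterclockwise. A smooth closed convex curve is of constant width if and only if it has a chord in any direction perpendicular to the curve at both ends. Let $M:\mathbb{T}\to\Gamma$ be a parametrization by arc-length divided by the total length of $\Gamma$. Billiard map: $g:\mathbb{T}\times(0,\pi)\to\mathbb{T}\times(0,\pi)$, $(s_1,r_1)=g(s,r)$, where the ray from $M(s)$ into the interior making angle $r$ with $M'(s)$ hits $\Gamma$ again at $M(s_1)$, and $r_1$ is the angle between $M'(s_1)$ and the reflected ray (angle of reflection equals angle of incidence). Its lift $G$ to $\mathbb{R}\times(0,\pi)$ is chosen with $s<s_1<s+1$. For constant width curves, $C=\mathbb{T}\times\{\pi/2\}$ is invariant and $G^2(s,r)=(s+1,r)$ on $C$, i.e.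 $C$ is a $(1,2)$-resonant RIC (rotational invariant curve). A map on a cylinder has the intersection property if the image of any closed homotopically non trivial loop of the cylinder intersects the loop. $C$ is an $(a_*,b_* )$-analytic $(1,2)$-resonant RIC when there exist analytic coordinates $(x,y)$, $x\in\mathbb{T}$, in a neighbourhood of $C$, such that $C\equiv\{y=0\}$ and $f=g^2$, written as $(x_1,y_1)=f(x,y)$, satisfies: (1) it is real analytic on $\mathbb{T}\times(-b_*,b_* )$ and extends analytically to $D_{a_*,b_*}=\{(x,y)\in(\mathbb{C}/\mathbb{Z})\times\mathbb{C}:|\Im x|<a_*,|y|<b_*\}$; (2) it has the intersection property on $\mathbb{T}\times(-b_*,b_* )$; (3) $x_1=x+y+\mathrm{O}(y^2)$, $y_1=y+\mathrm{O}(y^3)$. For relatively prime integers $p,q$ with $q\ge1$, a $(p,q)$-periodic billiard trajectory is an orbit $\{(s_k,r_k)\}_{k\in\mathbb{Z}}$ of $G$ with $s_{k+q}=s_k+p$, $r_{k+q}=r_k$; it is Birkhoff if for all $k,k',j\in\mathbb{Z}$, $s_k<s_{k'}+j$ if and only if $kp/q<k'p/q+j$. Its length is $\sum_{k=0}^{q-1}|M(s_{k+1})-M(s_k)|$. $\mathcal{L}^{(p,q)}$ is the supremum of the absolute values of the differences of the lengths of all Birkhoff $(p,q)$-periodic billiard trajectories inside $\Gamma$ (with $\sup\emptyset=0$). *)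

(* Defs.v *)
(* Stdlib real numbers with Coquelicot. The Euclidean plane is Coquelicot's
   complex plane [C = R * R], so that rotations are multiplications. Points of
   the circle R/Z are represented by real numbers, and maps of the cylinder by
   lifts to its universal cover. *)
From Stdlib Require Import Reals ZArith Znumtheory.
From Coquelicot Require Import Coquelicot.
Open Scope R_scope.

(** * Analyticity *)

Definition analytic1_at (f : R -> R) (s0 : R) : Prop :=
  exists (rho : posreal) (c : nat -> R),
    forall s, Rabs (s - s0) < rho -> is_pseries c (s - s0) (f s).

(* Analyticity in two real ([K = R_AbsRing]) or complex ([K = C_AbsRing])
   variables. The bound makes the double series absolutely convergent on the
   open polydisc of radius [rho], so the order of summation is irrelevant. *)
Definition analytic2_at {K : AbsRing} (f : K * K -> K) (P : K * K) : Prop :=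
  exists (rho : posreal) (c : nat -> nat -> K),
    (exists B : R, forall m n : nat, abs (c m n) * rho ^ (m + n) <= B) /\
    forall z w : K,
      abs (minus z (fst P)) < rho -> abs (minus w (snd P)) < rho ->
      filterlim
        (fun N : nat => sum_n (fun m => sum_n (fun n =>
           mult (c m n) (mult (pow_n (minus z (fst P)) m)
                              (pow_n (minus w (snd P)) n))) N) N)
        eventually
        (locally (T := AbsRing_UniformSpace K) (f (z, w))).

Definition analytic_map_on {K : AbsRing}
    (D : K * K -> Prop) (F : K * K -> K * K) : Prop :=
  forall P, D P ->
    analytic2_at (fun Q => fst (F Q)) P /\ analytic2_at (fun Q => snd (F Q)) P.

(** * Convex curves *)

Definition inner (u v : C) : R := Re u * Re v + Im u * Im v.
Definition cis (t : R) : C := (cos t, sin t).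

Definition interior (Om : C -> Prop) (P : C) : Prop := locally P Om.
Definition boundary (Om : C -> Prop) (P : C) : Prop :=
  ~ locally P Om /\ ~ locally P (fun Q => ~ Om Q).

Definition strictly_convex_body (Om : C -> Prop) : Prop :=
  closed Om /\
  (exists B : R, forall P, Om P -> Cmod P <= B) /\
  (exists P, interior Om P) /\
  (forall (P Q : C) (t : R), Om P -> Om Q -> P <> Q -> 0 < t < 1 ->
     interior Om (RtoC (1 - t) * P + RtoC t * Q)%C).

Definition velocity (M : R -> C) (s : R) : C :=
  (Derive (fun t => Re (M t)) s, Derive (fun t => Im (M t)) s).
Definition acceleration (M : R -> C) (s : R) : C :=
  (Derive_n (fun t => Re (M t)) 2 s, Derive_n (fun t => Im (M t)) 2 s).
Definition unit_tangent (M : R -> C) (s : R) : C :=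
  (velocity M s / RtoC (Cmod (velocity M s)))%C.
Definition signed_curvature (M : R -> C) (s : R) : R :=
  (Re (velocity M s) * Im (acceleration M s)
   - Im (velocity M s) * Re (acceleration M s)) / Cmod (velocity M s) ^ 3.

(* [M] is the 1-periodic lift of a parametrization by arc length divided by
   the total length: its speed is constant, and that constant is then the
   total length. For a simple closed curve, positivity of the signed curvature
   also says that the orientation is counterclockwise. *)
Definition analytic_convex_curve (M : R -> C) : Prop :=
  (forall s, analytic1_at (fun t => Re (M t)) s /\
             analytic1_at (fun t => Im (M t)) s) /\
  (forall s t, M s = M t <-> exists k : Z, t = s + IZR k) /\
  (exists l : R, 0 < l /\ forall s, Cmod (velocity M s) = l) /\
  (forall s, 0 < signed_curvature M s) /\
  (exists Om, strictly_convex_body Om /\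
     forall P, (exists s, M s = P) <-> boundary Om P).

Definition support_function (M : R -> C) (t : R) : R :=
  real (Lub_Rbar (fun v => exists s, v = inner (M s) (cis t))).

(* The distance between the two supporting lines orthogonal to [cis t] does
   not depend on [t]. *)
Definition constant_width (M : R -> C) : Prop :=
  exists w : R, forall t : R,
    support_function M t + support_function M (t + PI) = w.

(** * Billiard map *)

(* [G] is the lift of the billiard map with [s < s1 < s + 1]: the unit vector
   [u] at angle [r] with the tangent at [M s] points from [M s] to [M s1], and
   its mirror image with respect to the tangent line at [M s1], which is
   [2 <u, T> T - u] with [T] the unit tangent there, makes the angle [r1] with
   that tangent. *)
Definition billiard_lift (M : R -> C) (G : R * R -> R * R) : Prop :=
  forall s r : R, 0 < r < PI ->
    let s1 := fst (G (s, r)) in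
    let r1 := snd (G (s, r)) in
    let u := (unit_tangent M s * cis r)%C in
    let T := unit_tangent M s1 in
    s < s1 < s + 1 /\ 0 < r1 < PI /\
    (exists tau : R, 0 < tau /\ (M s1 - M s)%C = (RtoC tau * u)%C) /\
    (RtoC (2 * inner u T) * T - u)%C = (T * cis r1)%C.

(** * Resonant rotational invariant curve *)

(* [P] and [Q] represent the same point of the cylinder. *)
Definition cyl_eq (P Q : R * R) : Prop :=
  (exists k : Z, fst Q = fst P + IZR k) /\ snd Q = snd P.

Definition saturated (D : R * R -> Prop) : Prop :=
  forall P Q, cyl_eq P Q -> D P -> D Q.
Definition cyl_map (D : R * R -> Prop) (F : R * R -> R * R) : Prop :=
  forall P Q, D P -> D Q -> cyl_eq P Q -> cyl_eq (F P) (F Q).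

Definition strip (b : R) (P : R * R) : Prop := Rabs (snd P) < b.
Definition complex_strip (a b : R) (P : C * C) : Prop :=
  Rabs (Im (fst P)) < a /\ Cmod (snd P) < b.

(* [(c1, c2)] is the lift of a loop of the cylinder; the loop is homotopically
   non trivial when its winding number [n] is nonzero. *)
Definition intersection_property (b : R) (F : R * R -> R * R) : Prop :=
  forall (c1 c2 : R -> R) (n : Z),
    n <> 0%Z ->
    (forall t, continuous c1 t) -> (forall t, continuous c2 t) ->
    (forall t, c1 (t + 1) = c1 t + IZR n /\ c2 (t + 1) = c2 t) ->
    (forall t, strip b (c1 t, c2 t)) ->
    exists t t' : R, cyl_eq (F (c1 t, c2 t)) (c1 t', c2 t').

(* [H : V -> U], with inverse [Hi], gives the point [(s, r)] with coordinates
   [(x, y)]; [F] is the lift of [f = g^2] in these coordinates that is close to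
   the identity near [y = 0], and [Fc] is its complex extension. *)
Definition analytic_resonant_RIC (G : R * R -> R * R) (a b : R) : Prop :=
  0 < a /\ 0 < b /\
  exists (V U : R * R -> Prop) (H Hi F : R * R -> R * R) (Fc : C * C -> C * C),
    (open V /\ saturated V /\ open U /\ saturated U) /\
    (forall P, U P -> 0 < snd P < PI) /\
    (forall s, U (s, PI / 2)) /\
    (forall P, V P -> U (H P) /\ Hi (H P) = P) /\
    (forall Q, U Q -> V (Hi Q) /\ H (Hi Q) = Q) /\
    (cyl_map V H /\ cyl_map U Hi) /\
    (analytic_map_on (K := R_AbsRing) V H /\
     analytic_map_on (K := R_AbsRing) U Hi) /\
    (forall P, V P -> (snd (H P) = PI / 2 <-> snd P = 0)) /\
    (forall P, strip b P ->
       V P /\ V (F P) /\ cyl_eq (G (G (H P))) (H (F P))) /\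
    (forall x y, strip b (x, y) ->
       F (x + 1, y) = (fst (F (x, y)) + 1, snd (F (x, y)))) /\
    analytic_map_on (K := R_AbsRing) (strip b) F /\
    analytic_map_on (K := C_AbsRing) (complex_strip a b) Fc /\
    (forall x y, complex_strip a b (x, y) ->
       Fc ((x + 1)%C, y) = ((fst (Fc (x, y)) + 1)%C, snd (Fc (x, y)))) /\
    (forall x y, strip b (x, y) ->
       Fc (RtoC x, RtoC y) = (RtoC (fst (F (x, y))), RtoC (snd (F (x, y))))) /\
    intersection_property b F /\
    (exists c d : R, 0 < d <= b /\ forall x y, Rabs y < d ->
       Rabs (fst (F (x, y)) - (x + y)) <= c * Rabs y ^ 2 /\
       Rabs (snd (F (x, y)) - y) <= c * Rabs y ^ 3).

(** * Length spectrum *)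

Definition birkhoff_trajectory (G : R * R -> R * R) (p q : Z)
    (s r : Z -> R) : Prop :=
  (forall k, 0 < r k < PI /\ G (s k, r k) = (s (k + 1)%Z, r (k + 1)%Z)) /\
  (forall k, s (k + q)%Z = s k + IZR p /\ r (k + q)%Z = r k) /\
  (forall k k' j : Z, s k < s k' + IZR j <->
     IZR k * IZR p / IZR q < IZR k' * IZR p / IZR q + IZR j).

(* Used for [1 <= q] only: [sum_n] has the terms [0, ..., q - 1]. *)
Definition trajectory_length (M : R -> C) (q : Z) (s : Z -> R) : R :=
  sum_n (fun k : nat => Cmod (M (s (Z.of_nat k + 1)%Z) - M (s (Z.of_nat k)))%C)
        (Z.to_nat q - 1).

(* The value [0] is adjoined so that the supremum is [0] when there is no
   trajectory; otherwise it is already the difference of a length with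
   itself. *)
Definition length_gap (M : R -> C) (G : R * R -> R * R) (p q : Z) : Rbar :=
  Lub_Rbar (fun d => d = 0 \/
    exists s r s' r' : Z -> R,
      birkhoff_trajectory G p q s r /\ birkhoff_trajectory G p q s' r' /\
      d = Rabs (trajectory_length M q s - trajectory_length M q s')).

(* Main.v *)
(* In the coordinates near the resonant curve, f = g^2 is a small perturbation of the
   integrable twist (x, y) -> (x + y, y). Let 2 N be an even period of the trajectories,
   with N and kap coprime and kap / N = (2 p - q) / q. Over a complex strip of width
   almost a, the points that f^N translates by +kap or -kap along x form a
   holomorphic curve y = Y x, and the defect h x = (second coordinate of
   f^N (x, Y x)) - Y x is bounded and 1-periodic. A Birkhoff trajectory provides N real
   zeros of h that nearly follow a rotation, so two different trajectories provide 2 N of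
   them; dividing by these zeros, the maximum principle in the strip gives
   |h| <= K exp (- 2 pi alpha N) on the real line. By the reflection law the derivative
   of the length of the orbits starting on the curve is of the size of h, and so is the
   difference of the lengths of the two trajectories. *)
Require Import Defs.
From Stdlib Require Import Reals ZArith Znumtheory Lra Lia List.
From Stdlib Require Import ClassicalEpsilon FunctionalExtensionality.
From Coquelicot Require Import Coquelicot.
Open Scope R_scope.

(** * Double power series *)

(** Why two trajectories are compared: [expi] turns the strip of half-width b into an annulus, in
    which a bounded function with n zeros on the unit circle has size about exp(-pi b n) on that
    circle. The target exponent is 2 pi alpha N when |kap| = 1, so the N zeros of a single
    trajectory would give only half of it. If the second trajectory brings no full set of new zeros,
    the two share a phase point and their lengths are equal. Two obstacles shape the proof. The
    expansions of f are assumed at real points only and have to be continued over the complex strip;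
    N iterates stay under control there because the relevant heights y are of order 1/N, so that N
    steps change y by O(1/N^2) and x, beyond the twist, by O(1/N). And the coordinates conjugate f
    to g^2 only near the resonant curve and only modulo integers, so that a trajectory has to be
    brought into their domain and its winding number recovered from small displacements. *)

Lemma Cmod_sub_sym (x y : C) : Cmod (x - y) = Cmod (y - x).
Proof. rewrite <- Cmod_opp. f_equal. ring. Qed.

Lemma Cmod_triangle_sub (x y : C) : Cmod (x - y) <= Cmod x + Cmod y.
Proof. unfold Cminus. rewrite <- (Cmod_opp y). apply Cmod_triangle. Qed.

Lemma Cmod_reverse_triangle (x y : C) : Cmod x - Cmod y <= Cmod (x - y).
Proof.
  assert (H := Cmod_triangle (x - y) y).
  replace (x - y + y)%C with x in H by ring. lra.
Qed.

Lemma Cmod_triangle3 (x y z : C) : Cmod (x - z) <= Cmod (x - y) + Cmod (y - z).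
Proof. replace (x - z)%C with ((x - y) + (y - z))%C by ring. apply Cmod_triangle. Qed.

Lemma csum_Sn (a : nat -> C) (N : nat) :
  sum_n a (S N) = (sum_n a N + a (S N))%C :> C.
Proof. exact (sum_Sn a N). Qed.

Lemma Cmod_sum_n_geom (a : nat -> C) (B : R) (N : nat) :
  (forall m, Cmod (a m) <= B * (1/2)^m) -> Cmod (sum_n a N) <= 2 * B.
Proof.
  intros H.
  assert (HB : 0 <= B).
  { assert (h := H 0%nat). simpl in h. assert (h2 := Cmod_ge_0 (a 0%nat)). lra. }
  assert (G : Cmod (sum_n a N) <= B * (2 - (1/2)^N)).
  { induction N as [|N IH].
    - rewrite sum_O. assert (h := H 0%nat). simpl in *. lra.
    - rewrite sum_Sn. eapply Rle_trans; [apply Cmod_triangle|].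
      assert (h := H (S N)). simpl in *. lra. }
  assert (0 <= (1/2)^N) by (apply pow_le; lra). nra.
Qed.

(** Square partial sums, as in [analytic2_at]. Estimates on them are uniform in [N] and pass to the
    sum of the series through [psum_cv]. *)
Definition dsum (N : nat) (a : nat -> nat -> C) : C :=
  sum_n (fun m => sum_n (fun k => a m k) N) N.

Lemma Cmod_dsum_geom (a : nat -> nat -> C) (B : R) (N : nat) :
  (forall m k, Cmod (a m k) <= B * (1/2)^m * (1/2)^k) -> Cmod (dsum N a) <= 4 * B.
Proof.
  intros H. unfold dsum. replace (4 * B) with (2 * (2 * B)) by ring.
  apply Cmod_sum_n_geom. intros m.
  replace (2 * B * (1/2)^m) with (2 * (B * (1/2)^m)) by ring.
  apply Cmod_sum_n_geom. intros k. apply H.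
Qed.

Lemma sum_n_Cminus (a b : nat -> C) (N : nat) :
  (sum_n a N - sum_n b N)%C = sum_n (fun m => (a m - b m)%C) N :> C.
Proof.
  induction N as [|N IH].
  - rewrite !sum_O. reflexivity.
  - rewrite !csum_Sn, <- IH. ring.
Qed.

Lemma dsum_minus (a b : nat -> nat -> C) (N : nat) :
  (dsum N a - dsum N b)%C = dsum N (fun m k => (a m k - b m k)%C).
Proof.
  unfold dsum. rewrite sum_n_Cminus. apply sum_n_ext. intros m. apply sum_n_Cminus.
Qed.

Lemma dsum_ext (a b : nat -> nat -> C) (N : nat) :
  (forall m k, a m k = b m k) -> dsum N a = dsum N b.
Proof. intros H. apply sum_n_ext. intros m. apply sum_n_ext. intros k. apply H. Qed.

Lemma sum_n_stationary (a : nat -> C) (n N : nat) :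
  (n <= N)%nat -> (forall m, (n < m)%nat -> a m = 0%C) -> sum_n a N = sum_n a n :> C.
Proof.
  intros Hn Ha. induction Hn as [|N Hn IH]; [reflexivity|].
  rewrite csum_Sn, IH, Ha by lia. ring.
Qed.

Lemma sum_n_zero (a : nat -> C) (N : nat) : (forall m, a m = 0%C) -> sum_n a N = 0%C :> C.
Proof.
  intros Ha. induction N as [|N IH].
  - rewrite sum_O. apply Ha.
  - rewrite csum_Sn, IH, Ha. ring.
Qed.

Lemma dsum_stationary (a : nat -> nat -> C) (n N : nat) :
  (n <= N)%nat -> (forall m k, (n < m)%nat \/ (n < k)%nat -> a m k = 0%C) ->
  dsum N a = dsum n a.
Proof.
  intros Hn Ha. unfold dsum.
  rewrite (sum_n_stationary _ n N Hn).
  - apply sum_n_ext. intros m. apply sum_n_stationary; auto.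
  - intros m Hm. apply sum_n_zero. intros k. apply Ha. auto.
Qed.

Definition psum (c : nat -> nat -> C) (N : nat) (z w : C) : C :=
  dsum N (fun m k => (c m k * (z ^ m * w ^ k))%C).

(** Cauchy estimates on a polydisc of radius [rho]. The bounds below are taken at half or a quarter
    of that radius, where the terms decay geometrically. *)
Definition coef_bound (c : nat -> nat -> C) (rho B : R) : Prop :=
  0 < rho /\ 0 <= B /\ forall m k, Cmod (c m k) * rho ^ (m + k) <= B.

Lemma Cmod_monomial (c z w : C) (m k : nat) :
  Cmod (c * (z ^ m * w ^ k)) = Cmod c * (Cmod z ^ m * Cmod w ^ k).
Proof. rewrite !Cmod_mult, !Cmod_pow. reflexivity. Qed.

Lemma coef_le (c : nat -> nat -> C) (rho B : R) (m k : nat) :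
  coef_bound c rho B -> Cmod (c m k) <= B * (/ rho) ^ m * (/ rho) ^ k.
Proof.
  intros (Hr & HB & H). specialize (H m k).
  rewrite pow_add in H. rewrite !pow_inv.
  assert (0 < rho ^ m) by (apply pow_lt; lra).
  assert (0 < rho ^ k) by (apply pow_lt; lra).
  replace (B * / rho ^ m * / rho ^ k) with (B / (rho ^ m * rho ^ k)) by (field; lra).
  apply Rle_div_r; nra.
Qed.

(** The Taylor polynomial of total degree less than [n], written as a square sum padded with zeros
    so that it can be subtracted from [psum] term by term. *)
Definition tpoly (c : nat -> nat -> C) (n : nat) (z w : C) : C :=
  dsum n (fun m k => if Nat.ltb (m + k) n then (c m k * (z ^ m * w ^ k))%C else 0%C).

(** The power of [t] is shared between two tasks: [n] factors keep the order of vanishing, and the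
    remaining ones give a summable factor. *)
Lemma pow_le_geom (t : R) (n j : nat) :
  0 <= t <= 1/2 -> (n <= j)%nat -> t ^ j <= (2 * t) ^ n * (1/2) ^ j.
Proof.
  intros Ht Hj. replace j with (n + (j - n))%nat by lia.
  rewrite !pow_add, Rpow_mult_distr.
  assert (0 <= t ^ n) by (apply pow_le; lra).
  assert (t ^ (j - n) <= (1/2) ^ (j - n)) by (apply pow_incr; lra).
  assert (E : 2 ^ n * (1/2) ^ n = 1).
  { rewrite <- Rpow_mult_distr. replace (2 * (1/2)) with 1 by lra. apply pow1. }
  replace (2 ^ n * t ^ n * ((1 / 2) ^ n * (1 / 2) ^ (j - n)))
    with ((2 ^ n * (1/2) ^ n) * (t ^ n * (1/2) ^ (j - n))) by ring.
  rewrite E, Rmult_1_l. apply Rmult_le_compat_l; assumption.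
Qed.

Lemma psum_taylor (c : nat -> nat -> C) (rho B : R) (n : nat) :
  coef_bound c rho B ->
  forall N z w, (n <= N)%nat -> Cmod z + Cmod w <= rho / 2 ->
    Cmod (psum c N z w - tpoly c n z w) <= 4 * (B * (2 / rho) ^ n) * (Cmod z + Cmod w) ^ n.
Proof.
  intros Hc N z w HN Hzw. assert (Hr := proj1 Hc). assert (HB := proj1 (proj2 Hc)).
  set (t := Cmod z + Cmod w) in *.
  assert (Hz := Cmod_ge_0 z). assert (Hw := Cmod_ge_0 w).
  unfold tpoly. rewrite <- (dsum_stationary _ n N HN).
  2:{ intros m k Hmk. destruct (Nat.ltb_spec (m + k) n); [lia|reflexivity]. }
  unfold psum. rewrite dsum_minus.
  rewrite Rmult_assoc. apply Cmod_dsum_geom. intros m k.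
  assert (Hnn : 0 <= B * (2 / rho) ^ n * t ^ n).
  { apply Rmult_le_pos; [apply Rmult_le_pos|]; try apply pow_le; unfold t; try lra.
    apply Rlt_le, Rdiv_lt_0_compat; lra. }
  assert (0 <= (1/2)^m) by (apply pow_le; lra).
  assert (0 <= (1/2)^k) by (apply pow_le; lra).
  destruct (Nat.ltb_spec (m + k) n) as [Hl|Hl].
  - replace (c m k * (z ^ m * w ^ k) - c m k * (z ^ m * w ^ k))%C with (RtoC 0) by ring.
    rewrite Cmod_0. apply Rmult_le_pos; auto. apply Rmult_le_pos; auto.
  - replace (c m k * (z ^ m * w ^ k) - 0)%C with (c m k * (z ^ m * w ^ k))%C by ring.
    rewrite Cmod_monomial.
    assert (H1 := coef_le _ _ _ m k Hc).
    assert (Hi : 0 < / rho) by (apply Rinv_0_lt_compat; lra).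
    apply Rle_trans with ((B * (/ rho) ^ m * (/ rho) ^ k) * (t ^ m * t ^ k)).
    { apply Rmult_le_compat; auto using Cmod_ge_0.
      - apply Rmult_le_pos; apply pow_le; lra.
      - apply Rmult_le_compat; try (apply pow_le; lra); apply pow_incr; unfold t; lra. }
    assert (G := pow_le_geom (t / rho) n (m + k)).
    assert (Ht : 0 <= t / rho <= 1/2).
    { split. apply Rdiv_le_0_compat; unfold t; lra. apply Rle_div_l; lra. }
    specialize (G Ht Hl). apply (Rmult_le_compat_l B) in G; auto.
    replace (B * (/ rho) ^ m * (/ rho) ^ k * (t ^ m * t ^ k)) with (B * (t / rho) ^ (m + k)).
    2:{ unfold Rdiv. rewrite !pow_add, !Rpow_mult_distr. ring. }
    replace (B * (2 / rho) ^ n * t ^ n * (1 / 2) ^ m * (1 / 2) ^ k)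
      with (B * ((2 * (t / rho)) ^ n * (1 / 2) ^ (m + k))); [exact G|].
    replace (2 * (t / rho)) with (2 / rho * t) by (field; lra).
    rewrite pow_add, Rpow_mult_distr. ring.
Qed.

Lemma Cmod_pow_diff (z z' : C) (W : R) (k : nat) :
  Cmod z <= W -> Cmod z' <= W ->
  Cmod (z ^ k - z' ^ k) <= INR k * W ^ (pred k) * Cmod (z - z').
Proof.
  intros Hz Hz'. assert (h := Cmod_ge_0 z). induction k as [|k IH].
  - simpl. replace (1 - 1)%C with (RtoC 0) by ring. rewrite Cmod_0. lra.
  - replace (z ^ S k - z' ^ S k)%C with (z * (z ^ k - z' ^ k) + (z - z') * z' ^ k)%C
      by (simpl; ring).
    eapply Rle_trans; [apply Cmod_triangle|]. rewrite !Cmod_mult, Cmod_pow.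
    simpl pred. rewrite S_INR.
    assert (H1 : Cmod z' ^ k <= W ^ k) by (apply pow_incr; split; auto using Cmod_ge_0).
    assert (H2 : Cmod z * Cmod (z ^ k - z' ^ k) <= INR k * W ^ k * Cmod (z - z')).
    { destruct k as [|k].
      - simpl. replace (1 - 1)%C with (RtoC 0) by ring. rewrite Cmod_0. lra.
      - eapply Rle_trans; [apply Rmult_le_compat; [auto|apply Cmod_ge_0|exact Hz|exact IH]|].
        simpl pred. right. simpl. ring. }
    assert (h3 := Cmod_ge_0 (z - z')).
    nra.
Qed.

(** The factor [m] created by a difference of m-th powers is absorbed by doubling the ratio from 1/4
    to 1/2; this is why differences are bounded on a quarter of the radius only. *)
Lemma INR_quarter_pow (m : nat) : INR m * (1/4)^m <= (1/2)^m.
Proof.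
  replace ((1/4)^m) with ((1/2)^m * (1/2)^m) by (rewrite <- Rpow_mult_distr; f_equal; lra).
  assert (H : INR m * (1/2)^m <= 1).
  { induction m as [|m IH]; [simpl; lra|]. rewrite S_INR. simpl.
    assert ((1/2)^m <= 1) by (apply Rle_trans with (1 ^ m); [apply pow_incr; lra|rewrite pow1; lra]).
    nra. }
  assert (0 <= (1/2)^m) by (apply pow_le; lra).
  nra.
Qed.

(** A series divisible by w^k0 keeps this order under a change of [z] and loses one power under a
    change of [w]; [W] bounds the two heights. With [k0 = 0], where [pred 0 = 0], it is the plain
    Lipschitz bound used for real charts. *)
Lemma psum_lipschitz (c : nat -> nat -> C) (rho B : R) (k0 : nat) :
  coef_bound c rho B -> (forall m k, (k < k0)%nat -> c m k = 0%C) ->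
  exists C0, 0 < C0 /\ forall N z w z' w' W,
    Cmod z <= rho / 4 -> Cmod z' <= rho / 4 -> W <= rho / 4 ->
    Cmod w <= W -> Cmod w' <= W ->
    Cmod (psum c N z w - psum c N z' w')
      <= C0 * (W ^ k0 * Cmod (z - z') + W ^ (pred k0) * Cmod (w - w')).
Proof.
  intros Hc H0. assert (Hr := proj1 Hc). assert (HB := proj1 (proj2 Hc)).
  set (r := rho / 4) in *. assert (Hrr : 0 < r) by (unfold r; lra).
  assert (P0 : 0 < r ^ k0) by (apply pow_lt; lra).
  assert (P1 : 0 < r ^ (pred k0)) by (apply pow_lt; lra).
  exists (4 * ((B + 1) * (/ (r * r ^ k0) + / (r * r ^ (pred k0))))).
  split.
  { apply Rmult_lt_0_compat; [lra|]. apply Rmult_lt_0_compat; [lra|].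
    apply Rplus_lt_0_compat; apply Rinv_0_lt_compat; apply Rmult_lt_0_compat; lra. }
  intros N z w z' w' W Hz Hz' HW Hw Hw'.
  assert (HW0 : 0 <= W) by (eapply Rle_trans; [apply Cmod_ge_0|exact Hw]).
  unfold psum. rewrite dsum_minus. rewrite Rmult_assoc. apply Cmod_dsum_geom. intros m k.
  assert (G0 : 0 <= W ^ k0) by (apply pow_le; lra).
  assert (G1 : 0 <= W ^ (pred k0)) by (apply pow_le; lra).
  assert (Q0 : 0 <= / (r * r ^ k0)) by (apply Rlt_le, Rinv_0_lt_compat, Rmult_lt_0_compat; lra).
  assert (Q1 : 0 <= / (r * r ^ pred k0)) by (apply Rlt_le, Rinv_0_lt_compat, Rmult_lt_0_compat; lra).
  assert (D1 := Cmod_ge_0 (z - z')). assert (D2 := Cmod_ge_0 (w - w')).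
  assert (hm : 0 <= (1/2)^m) by (apply pow_le; lra).
  assert (hk : 0 <= (1/2)^k) by (apply pow_le; lra).
  destruct (Nat.lt_ge_cases k k0) as [Hk|Hk].
  { rewrite H0 by auto.
    replace (0 * (z ^ m * w ^ k) - 0 * (z' ^ m * w' ^ k))%C with (RtoC 0) by ring.
    rewrite Cmod_0. repeat apply Rmult_le_pos; try lra.
    apply Rplus_le_le_0_compat; apply Rmult_le_pos; auto. }
  replace (c m k * (z ^ m * w ^ k) - c m k * (z' ^ m * w' ^ k))%C
    with (c m k * ((z ^ m - z' ^ m) * w ^ k + z' ^ m * (w ^ k - w' ^ k)))%C by ring.
  rewrite Cmod_mult.
  assert (A1 : Cmod ((z ^ m - z' ^ m) * w ^ k) <=
            (INR m * r ^ m) * r ^ k * (/ (r * r ^ k0)) * (W ^ k0 * Cmod (z - z'))).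
  { rewrite Cmod_mult, Cmod_pow.
    assert (h1 : Cmod (z ^ m - z' ^ m) <= INR m * r ^ m * / r * Cmod (z - z')).
    { eapply Rle_trans; [apply (Cmod_pow_diff z z' r m Hz Hz')|].
      apply Rmult_le_compat_r; auto.
      destruct m as [|m]; [simpl; lra|]. simpl pred. right. simpl pow. field. lra. }
    assert (h2 : Cmod w ^ k <= W ^ k0 * (r ^ k * / r ^ k0)).
    { apply Rle_trans with (W ^ k). apply pow_incr; split; auto using Cmod_ge_0.
      replace k with (k0 + (k - k0))%nat at 1 2 by lia. rewrite !pow_add.
      apply Rmult_le_compat_l; auto.
      replace (r ^ k0 * r ^ (k - k0) * / r ^ k0) with (r ^ (k - k0)) by (field; lra).
      apply pow_incr; lra. }
    eapply Rle_trans; [apply Rmult_le_compat; [apply Cmod_ge_0|apply pow_le, Cmod_ge_0|exact h1|exact h2]|].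
    right. field. lra. }
  assert (A2 : Cmod (z' ^ m * (w ^ k - w' ^ k)) <=
            r ^ m * (INR k * r ^ k) * (/ (r * r ^ pred k0)) * (W ^ pred k0 * Cmod (w - w'))).
  { rewrite Cmod_mult, Cmod_pow.
    assert (h1 : Cmod z' ^ m <= r ^ m) by (apply pow_incr; split; auto using Cmod_ge_0).
    assert (h2 : Cmod (w ^ k - w' ^ k) <= INR k * r ^ k * (/ (r * r ^ pred k0)) * (W ^ pred k0 * Cmod (w - w'))).
    { eapply Rle_trans; [apply (Cmod_pow_diff w w' W k Hw Hw')|].
      destruct k as [|k]; [simpl; right; ring|]. simpl pred.
      assert (E : W ^ k <= W ^ pred k0 * (r ^ S k * / (r * r ^ pred k0))).
      { replace (r ^ S k * / (r * r ^ pred k0)) with (r ^ (k - pred k0)).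
        2:{ replace (S k) with (1 + (pred k0 + (k - pred k0)))%nat by lia.
            rewrite !pow_add. simpl (r ^ 1). field. lra. }
        replace (W ^ k) with (W ^ pred k0 * W ^ (k - pred k0))
          by (rewrite <- pow_add; f_equal; lia).
        apply Rmult_le_compat_l; auto. apply pow_incr; lra. }
      assert (0 <= INR (S k)) by apply pos_INR.
      replace (INR (S k) * r ^ S k * / (r * r ^ pred k0) * (W ^ pred k0 * Cmod (w - w')))
        with (INR (S k) * (W ^ pred k0 * (r ^ S k * / (r * r ^ pred k0))) * Cmod (w - w')) by ring.
      apply Rmult_le_compat_r; auto. apply Rmult_le_compat_l; auto. }
    eapply Rle_trans; [apply Rmult_le_compat; [apply pow_le, Cmod_ge_0|apply Cmod_ge_0|exact h1|exact h2]|].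
    right. ring. }
  assert (HC := coef_le _ _ _ m k Hc).
  set (X := W ^ k0 * Cmod (z - z')) in *. set (Y := W ^ pred k0 * Cmod (w - w')) in *.
  assert (HX : 0 <= X) by (apply Rmult_le_pos; auto).
  assert (HY : 0 <= Y) by (apply Rmult_le_pos; auto).
  set (q0 := / (r * r ^ k0)) in *. set (q1 := / (r * r ^ pred k0)) in *.
  eapply Rle_trans; [apply Rmult_le_compat; [apply Cmod_ge_0|apply Cmod_ge_0|exact HC|
     eapply Rle_trans; [apply Cmod_triangle|apply Rplus_le_compat; [exact A1|exact A2]]]|].
  assert (E : forall j, (/ rho) ^ j * r ^ j = (1/4)^j).
  { intros j. rewrite <- Rpow_mult_distr. f_equal. unfold r. field. lra. }
  replace (B * (/ rho) ^ m * (/ rho) ^ k * (INR m * r ^ m * r ^ k * q0 * X + r ^ m * (INR k * r ^ k) * q1 * Y))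
    with (B * ((INR m * ((/ rho) ^ m * r ^ m)) * ((/ rho) ^ k * r ^ k) * q0 * X
             + ((/ rho) ^ m * r ^ m) * (INR k * ((/ rho) ^ k * r ^ k)) * q1 * Y)) by ring.
  rewrite !E.
  assert (F : forall j, 0 <= (1/4)^j <= (1/2)^j).
  { intros j. split. apply pow_le; lra. apply pow_incr; lra. }
  assert (F1 := INR_quarter_pow m). assert (F2 := INR_quarter_pow k).
  assert (F3 := F m). assert (F4 := F k).
  assert (U1 : INR m * (1/4)^m * (1/4)^k <= (1/2)^m * (1/2)^k).
  { apply Rmult_le_compat; try lra. apply Rmult_le_pos; [apply pos_INR|lra]. }
  assert (U2 : (1/4)^m * (INR k * (1/4)^k) <= (1/2)^m * (1/2)^k).
  { apply Rmult_le_compat; try lra. apply Rmult_le_pos; [apply pos_INR|lra]. }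
  set (h := (1/2)^m * (1/2)^k) in *.
  assert (Hh : 0 <= h) by (apply Rmult_le_pos; auto).
  replace ((B + 1) * (q0 + q1) * (X + Y) * (1 / 2) ^ m * (1 / 2) ^ k)
    with ((B + 1) * ((q0 + q1) * (X + Y)) * h) by (unfold h; ring).
  assert (V1 : INR m * (1/4)^m * (1/4)^k * q0 * X <= h * (q0 * X)).
  { rewrite Rmult_assoc. apply Rmult_le_compat_r; auto. apply Rmult_le_pos; auto. }
  assert (V2 : (1/4)^m * (INR k * (1/4)^k) * q1 * Y <= h * (q1 * Y)).
  { rewrite (Rmult_assoc _ q1). apply Rmult_le_compat_r; auto. apply Rmult_le_pos; auto. }
  assert (Z1 : 0 <= q0 * X) by (apply Rmult_le_pos; auto).
  assert (Z2 : 0 <= q1 * Y) by (apply Rmult_le_pos; auto).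
  assert (Z3 : 0 <= q0 * Y) by (apply Rmult_le_pos; auto).
  assert (Z4 : 0 <= q1 * X) by (apply Rmult_le_pos; auto).
  apply Rle_trans with (B * (h * (q0 * X) + h * (q1 * Y))).
  { apply Rmult_le_compat_l; lra. }
  replace (B * (h * (q0 * X) + h * (q1 * Y))) with (B * (q0 * X + q1 * Y) * h) by ring.
  apply Rmult_le_compat_r; auto.
  apply Rmult_le_compat; try lra.
Qed.

Lemma psum_vanishing_order (c : nat -> nat -> C) (rho B : R) (k0 : nat) :
  coef_bound c rho B -> (forall m k, (k < k0)%nat -> c m k = 0%C) ->
  exists C0, 0 < C0 /\ forall N z w,
    Cmod z <= rho / 4 -> Cmod w <= rho / 4 ->
    Cmod (psum c N z w) <= C0 * Cmod w ^ k0.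
Proof.
  intros Hc H0. assert (Hr := proj1 Hc). assert (HB := proj1 (proj2 Hc)).
  set (r := rho / 4) in *. assert (Hrr : 0 < r) by (unfold r; lra).
  assert (P0 : 0 < r ^ k0) by (apply pow_lt; lra).
  exists (4 * ((B + 1) * / r ^ k0)). split.
  { apply Rmult_lt_0_compat; [lra|]. apply Rmult_lt_0_compat; [lra|].
    apply Rinv_0_lt_compat; lra. }
  intros N z w Hz Hw. unfold psum. rewrite Rmult_assoc. apply Cmod_dsum_geom. intros m k.
  assert (hz := Cmod_ge_0 z). assert (hw := Cmod_ge_0 w).
  assert (Q : 0 < / r ^ k0) by (apply Rinv_0_lt_compat; lra).
  assert (G0 : 0 <= Cmod w ^ k0) by (apply pow_le; lra).
  assert (hm : 0 <= (1/2)^m) by (apply pow_le; lra).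
  assert (hk : 0 <= (1/2)^k) by (apply pow_le; lra).
  destruct (Nat.lt_ge_cases k k0) as [Hk|Hk].
  { rewrite H0 by auto. rewrite Cmult_0_l, Cmod_0. repeat apply Rmult_le_pos; lra. }
  rewrite Cmod_monomial.
  assert (HC := coef_le _ _ _ m k Hc).
  assert (A1 : Cmod z ^ m <= r ^ m) by (apply pow_incr; lra).
  assert (A2 : Cmod w ^ k <= Cmod w ^ k0 * (r ^ k * / r ^ k0)).
  { replace k with (k0 + (k - k0))%nat at 1 2 by lia. rewrite !pow_add.
    apply Rmult_le_compat_l; auto.
    replace (r ^ k0 * r ^ (k - k0) * / r ^ k0) with (r ^ (k - k0)) by (field; lra).
    apply pow_incr; lra. }
  eapply Rle_trans; [apply Rmult_le_compat; [apply Cmod_ge_0|apply Rmult_le_pos; apply pow_le; lra|exact HC|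
     apply Rmult_le_compat; [apply pow_le; lra|apply pow_le; lra|exact A1|exact A2]]|].
  assert (E : forall j, (/ rho) ^ j * r ^ j = (1/4)^j).
  { intros j. rewrite <- Rpow_mult_distr. f_equal. unfold r. field. lra. }
  replace (B * (/ rho) ^ m * (/ rho) ^ k * (r ^ m * (Cmod w ^ k0 * (r ^ k * / r ^ k0))))
    with ((B * (/ r ^ k0) * Cmod w ^ k0) * (((/ rho) ^ m * r ^ m) * ((/ rho) ^ k * r ^ k))) by ring.
  rewrite !E.
  replace ((B + 1) * / r ^ k0 * Cmod w ^ k0 * (1 / 2) ^ m * (1 / 2) ^ k)
    with (((B + 1) * / r ^ k0 * Cmod w ^ k0) * ((1 / 2) ^ m * (1 / 2) ^ k)) by ring.
  assert (F : forall j, 0 <= (1/4)^j <= (1/2)^j).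
  { intros j. split. apply pow_le; lra. apply pow_incr; lra. }
  apply Rmult_le_compat.
  - repeat apply Rmult_le_pos; lra.
  - apply Rmult_le_pos; apply F.
  - apply Rmult_le_compat_r; auto. apply Rmult_le_compat_r; lra.
  - apply Rmult_le_compat; apply F.
Qed.

Lemma sum_n_single (x : C) (i N : nat) :
  (i <= N)%nat -> sum_n (fun j => if Nat.eqb j i then x else RtoC 0) N = x :> C.
Proof.
  intros Hi. rewrite (sum_n_stationary _ i N Hi).
  2:{ intros m Hm. destruct (Nat.eqb_spec m i); [lia|reflexivity]. }
  destruct i as [|i].
  - rewrite sum_O. reflexivity.
  - rewrite csum_Sn, Nat.eqb_refl.
    assert (E : sum_n (fun j => if Nat.eqb j (S i) then x else RtoC 0) i = RtoC 0 :> C).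
    { rewrite (sum_n_ext_loc _ (fun _ => RtoC 0)).
      - apply sum_n_zero. reflexivity.
      - intros n Hn. destruct (Nat.eqb_spec n (S i)); [lia|reflexivity]. }
    rewrite E. ring.
Qed.

Lemma dsum_single (x : C) (m k N : nat) :
  (m <= N)%nat -> (k <= N)%nat ->
  dsum N (fun m' k' => if (Nat.eqb m' m && Nat.eqb k' k)%bool then x else RtoC 0) = x.
Proof.
  intros Hm Hk. unfold dsum.
  rewrite (sum_n_ext _ (fun m' => if Nat.eqb m' m then x else RtoC 0)).
  - apply sum_n_single; auto.
  - intros m'. destruct (Nat.eqb_spec m' m); simpl.
    + apply sum_n_single; auto.
    + apply sum_n_zero. reflexivity.
Qed.

(** [c m k] is the first coefficient that may be nonzero when monomials are ordered by their power
    of [w], then of [z]. The others carry an additional factor [z] or [w], and disappear in the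
    limit where [w] and then [z] tend to 0. *)
Lemma psum_leading_term (c : nat -> nat -> C) (rho B : R) (m k : nat) :
  coef_bound c rho B -> (forall m' k', (k' < k)%nat -> c m' k' = 0%C) ->
  (forall m', (m' < m)%nat -> c m' k = 0%C) ->
  exists C0, 0 <= C0 /\ forall N z w, (m <= N)%nat -> (k <= N)%nat ->
    Cmod z <= rho / 2 -> Cmod w <= rho / 2 ->
    Cmod (psum c N z w - c m k * (z ^ m * w ^ k))
      <= C0 * (Cmod w ^ k * Cmod z ^ (S m) + Cmod w ^ (S k)).
Proof.
  intros Hc Hk0 Hm0. assert (Hr := proj1 Hc). assert (HB := proj1 (proj2 Hc)).
  assert (Hq : 0 < 2 / rho) by (apply Rdiv_lt_0_compat; lra).
  set (q := 2 / rho) in *.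
  assert (Pq : forall j, 0 <= q ^ j) by (intros; apply pow_le; lra).
  exists (4 * (B * (q ^ (S m) * q ^ k + q ^ (S k)))). split.
  { apply Rmult_le_pos; [lra|]. apply Rmult_le_pos; auto.
    apply Rplus_le_le_0_compat; auto. apply Rmult_le_pos; auto. }
  intros N z w HmN HkN Hz Hw.
  rewrite <- (dsum_single (c m k * (z ^ m * w ^ k)) m k N HmN HkN) at 1.
  unfold psum. rewrite dsum_minus, Rmult_assoc. apply Cmod_dsum_geom. intros m' k'.
  assert (hz := Cmod_ge_0 z). assert (hw := Cmod_ge_0 w).
  set (X := Cmod w ^ k * Cmod z ^ S m). set (Y := Cmod w ^ S k).
  assert (HX : 0 <= X) by (apply Rmult_le_pos; apply pow_le; lra).
  assert (HY : 0 <= Y) by (apply pow_le; lra).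
  assert (hm : 0 <= (1/2)^m') by (apply pow_le; lra).
  assert (hk : 0 <= (1/2)^k') by (apply pow_le; lra).
  assert (Hh : 0 <= (1/2)^m' * (1/2)^k') by (apply Rmult_le_pos; auto).
  assert (Hpos : 0 <= B * (q ^ S m * q ^ k + q ^ S k) * (X + Y) * (1 / 2) ^ m' * (1 / 2) ^ k').
  { rewrite Rmult_assoc. apply Rmult_le_pos; auto. apply Rmult_le_pos; [|lra].
    apply Rmult_le_pos; auto. apply Rplus_le_le_0_compat; auto. apply Rmult_le_pos; auto. }
  assert (Triv : forall x : C, x = RtoC 0 ->
    Cmod x <= B * (q ^ S m * q ^ k + q ^ S k) * (X + Y) * (1 / 2) ^ m' * (1 / 2) ^ k').
  { intros x ->. rewrite Cmod_0. exact Hpos. }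
  destruct (Nat.eqb_spec m' m) as [Em|Em]; destruct (Nat.eqb_spec k' k) as [Ek|Ek]; cbn [andb].
  { subst. apply Triv. ring. }
  all: destruct (Nat.lt_ge_cases k' k) as [Hlt|Hge];
    [apply Triv; rewrite Hk0 by auto; ring|].
  2: destruct (Nat.lt_ge_cases m' m) as [Hlt|Hge'];
    [apply Triv; subst k'; rewrite Hm0 by auto; ring|].
  all: replace (c m' k' * (z ^ m' * w ^ k') - 0)%C with (c m' k' * (z ^ m' * w ^ k'))%C by ring.
  all: rewrite Cmod_monomial.
  all: assert (HC := coef_le _ _ _ m' k' Hc).
  all: assert (Tz : 0 <= Cmod z / rho <= 1/2) by
    (split; [apply Rdiv_le_0_compat; lra|apply Rle_div_l; lra]).
  all: assert (Tw : 0 <= Cmod w / rho <= 1/2) by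
    (split; [apply Rdiv_le_0_compat; lra|apply Rle_div_l; lra]).
  all: apply Rle_trans with (B * ((Cmod z / rho) ^ m' * (Cmod w / rho) ^ k'));
    [apply Rle_trans with ((B * (/ rho) ^ m' * (/ rho) ^ k') * (Cmod z ^ m' * Cmod w ^ k'));
      [apply Rmult_le_compat_r; auto; apply Rmult_le_pos; apply pow_le; lra
      |unfold Rdiv; rewrite !Rpow_mult_distr; right; ring]|].
  all: replace (B * (q ^ S m * q ^ k + q ^ S k) * (X + Y) * (1 / 2) ^ m' * (1 / 2) ^ k')
    with (B * ((q ^ S m * q ^ k + q ^ S k) * (X + Y) * ((1 / 2) ^ m' * (1 / 2) ^ k'))) by ring.
  all: apply Rmult_le_compat_l; auto.
  all: assert (Hzm : forall j, (Cmod z / rho) ^ j <= (1/2)^j) by (intros; apply pow_incr; lra).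
  all: assert (E : forall t j, (2 * (t / rho)) ^ j = q ^ j * t ^ j) by
    (intros; rewrite <- Rpow_mult_distr; f_equal; unfold q; field; lra).
  2:{ subst k'.
      assert (G1 := pow_le_geom _ (S m) m' Tz ltac:(lia)).
      assert (G2 := pow_le_geom _ k k Tw ltac:(lia)).
      rewrite E in G1, G2.
      eapply Rle_trans; [apply Rmult_le_compat; [apply pow_le; lra|apply pow_le; lra|exact G1|exact G2]|].
      replace (q ^ S m * Cmod z ^ S m * (1 / 2) ^ m' * (q ^ k * Cmod w ^ k * (1 / 2) ^ k))
        with (q ^ S m * q ^ k * X * ((1 / 2) ^ m' * (1 / 2) ^ k)) by (unfold X; ring).
      apply Rmult_le_compat_r; auto.
      assert (0 <= q ^ S m * q ^ k) by (apply Rmult_le_pos; auto).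
      apply Rmult_le_compat; auto; try lra. assert (h := Pq (S k)). lra. }
  all: assert (G2 := pow_le_geom _ (S k) k' Tw ltac:(lia)); rewrite E in G2.
  all: eapply Rle_trans; [apply Rmult_le_compat; [apply pow_le; lra|apply pow_le; lra|apply Hzm|exact G2]|].
  all: replace ((1 / 2) ^ m' * (q ^ S k * Cmod w ^ S k * (1 / 2) ^ k'))
        with (q ^ S k * Y * ((1 / 2) ^ m' * (1 / 2) ^ k')) by (unfold Y; ring).
  all: apply Rmult_le_compat_r; auto.
  all: assert (0 <= q ^ S m * q ^ k) by (apply Rmult_le_pos; auto).
  all: apply Rmult_le_compat; auto; lra.
Qed.

(** * Vanishing of coefficients from bounds along one ray *)

Lemma le_of_le_plus_mult (x y A d : R) :
  0 < d -> (forall t, 0 < t < d -> x <= y + A * t) -> x <= y.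
Proof.
  intros Hd H. apply Rnot_lt_le. intros Hlt.
  set (A' := Rmax A 1). assert (HA : A <= A') by apply Rmax_l. assert (HA1 : 1 <= A') by apply Rmax_r.
  set (t := Rmin (d / 2) ((x - y) / (2 * A'))).
  assert (Hq : 0 < (x - y) / (2 * A')) by (apply Rdiv_lt_0_compat; lra).
  assert (Ht : 0 < t) by (unfold t; apply Rmin_pos; lra).
  assert (Ht1 : t <= d / 2) by apply Rmin_l.
  assert (Ht2 : t <= (x - y) / (2 * A')) by apply Rmin_r.
  assert (h := H t ltac:(lra)).
  assert (A' * t <= (x - y) / 2).
  { replace ((x - y) / 2) with (A' * ((x - y) / (2 * A'))) by (field; lra).
    apply Rmult_le_compat_l; lra. }
  assert (A * t <= A' * t) by (apply Rmult_le_compat_r; lra). lra.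
Qed.

(** Induction on [k], then on [m]. The bound is assumed only for [z] on one ray of direction [e] and
    for small positive [y], with [A] and [d] free to depend on [t]: this is all that analytic
    continuation provides at a limit point. The term [eps] is there because the bound will be known
    for the sum, not for its partial sums. *)
Lemma coef_vanish (c : nat -> nat -> C) (rho B delta : R) (k0 : nat) (e : C) :
  coef_bound c rho B -> Cmod e = 1 -> 0 < delta ->
  (forall t, 0 < t < delta -> exists A d, 0 < d /\ forall y, 0 < y < d ->
     forall eps, 0 < eps -> exists N0, forall N, (N0 <= N)%nat ->
       Cmod (psum c N (RtoC t * e) (RtoC y)) <= A * y ^ k0 + eps) ->
  forall m k, (k < k0)%nat -> c m k = 0%C.
Proof.
  intros Hc He Hd H. assert (Hr := proj1 Hc).
  enough (G : forall k, (k < k0)%nat -> forall m, c m k = 0%C) by auto.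
  induction k as [k IHk] using lt_wf_ind. intros Hk.
  induction m as [m IHm] using lt_wf_ind.
  destruct (psum_leading_term c rho B m k Hc) as (C0 & HC0 & HT).
  { intros m' k' Hk'. apply IHk; lia. }
  { exact IHm. }
  apply Cmod_eq_0. apply Rle_antisym; [|apply Cmod_ge_0].
  set (d0 := Rmin delta (rho / 2)).
  assert (Hd0 : 0 < d0) by (apply Rmin_pos; lra).
  apply (le_of_le_plus_mult _ 0 C0 d0 Hd0). intros t Ht.
  assert (Ht1 : t < delta) by (eapply Rlt_le_trans; [apply Ht|apply Rmin_l]).
  assert (Ht2 : t < rho / 2) by (eapply Rlt_le_trans; [apply Ht|apply Rmin_r]).
  destruct (H t ltac:(lra)) as (A & d & Hdd & HA).
  assert (Ptm : 0 < t ^ m) by (apply pow_lt; lra).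
  (* At fixed [t], divide by y^k and let [y] tend to 0: the assumed bound contributes A y^(k0 - k),
     which vanishes since k < k0. Dividing by t^m and letting [t] tend to 0 then gives the claim. *)
  assert (Main : Cmod (c m k) * t ^ m <= C0 * t ^ (S m)).
  { set (d1 := Rmin d (Rmin (rho / 2) 1)).
    assert (Hd1 : 0 < d1) by (repeat apply Rmin_pos; lra).
    apply (le_of_le_plus_mult _ _ (Rabs A + C0) d1 Hd1). intros y Hy.
    assert (Hy1 : y < d) by (eapply Rlt_le_trans; [apply Hy|apply Rmin_l]).
    assert (Hy2 : y < rho / 2 /\ y < 1).
    { split; (eapply Rlt_le_trans; [apply Hy|]); unfold d1;
      (eapply Rle_trans; [apply Rmin_r|]); [apply Rmin_l|apply Rmin_r]. }
    assert (Pyk : 0 < y ^ k) by (apply pow_lt; lra).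
    assert (Key : Cmod (c m k) * t ^ m * y ^ k
        <= A * y ^ k0 + C0 * (y ^ k * t ^ S m + y ^ S k)).
    { apply (le_of_le_plus_mult _ _ 1 1 Rlt_0_1). intros eps Heps.
      destruct (HA y ltac:(lra) eps ltac:(lra)) as (N0 & HN0).
      set (N := Nat.max N0 (Nat.max m k)).
      specialize (HN0 N ltac:(lia)).
      assert (Ez : Cmod (RtoC t * e) = t).
      { rewrite Cmod_mult, He, Cmod_R, Rabs_pos_eq; lra. }
      assert (Ew : Cmod (RtoC y) = y) by (rewrite Cmod_R, Rabs_pos_eq; lra).
      assert (G := HT N (RtoC t * e)%C (RtoC y) ltac:(lia) ltac:(lia) ltac:(lra) ltac:(lra)).
      rewrite Ez, Ew in G.
      assert (G2 := Cmod_reverse_triangle (c m k * ((RtoC t * e) ^ m * RtoC y ^ k))%C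
                      (psum c N (RtoC t * e) (RtoC y))).
      rewrite Cmod_sub_sym in G2. rewrite Cmod_monomial, Ez, Ew in G2. lra. }
    assert (Eyk : A * y ^ k0 <= Rabs A * (y * y ^ k)).
    { replace k0 with (S k + (k0 - S k))%nat by lia. rewrite pow_add. simpl.
      assert (0 <= y ^ (k0 - S k) <= 1).
      { split. apply pow_le; lra.
        apply Rle_trans with (1 ^ (k0 - S k)); [apply pow_incr; lra|rewrite pow1; lra]. }
      assert (A <= Rabs A) by apply Rle_abs. assert (0 <= Rabs A) by apply Rabs_pos.
      assert (P : 0 <= y * y ^ k) by (apply Rmult_le_pos; lra).
      apply Rle_trans with (Rabs A * (y * y ^ k * y ^ (k0 - S k))).
      - apply Rmult_le_compat_r; auto. apply Rmult_le_pos; lra.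
      - apply Rmult_le_compat_l; auto. rewrite <- (Rmult_1_r (y * y ^ k)) at 2.
        apply Rmult_le_compat_l; lra. }
    apply Rmult_le_reg_r with (y ^ k); auto.
    simpl in Key |- *. nra. }
  apply Rmult_le_reg_r with (t ^ m); auto. simpl in Main. nra.
Qed.

(** * Passage from partial sums to sums *)

Definition psum_cv (c : nat -> nat -> C) (z w v : C) : Prop :=
  forall eps, 0 < eps -> exists N0, forall N, (N0 <= N)%nat -> Cmod (psum c N z w - v) < eps.

Lemma psum_cv_le (c : nat -> nat -> C) (z w v a : C) (K : R) (n : nat) :
  psum_cv c z w v -> (forall N, (n <= N)%nat -> Cmod (psum c N z w - a) <= K) ->
  Cmod (v - a) <= K.
Proof.
  intros H HK. apply (le_of_le_plus_mult _ _ 1 1 Rlt_0_1). intros eps He.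
  destruct (H eps ltac:(lra)) as (N0 & HN0).
  specialize (HN0 (Nat.max N0 n) ltac:(lia)). specialize (HK (Nat.max N0 n) ltac:(lia)).
  assert (T := Cmod_triangle3 v (psum c (Nat.max N0 n) z w) a).
  rewrite (Cmod_sub_sym v (psum _ _ _ _)) in T. lra.
Qed.

Lemma psum_cv_diff_le (c : nat -> nat -> C) (z w v z' w' v' : C) (K : R) :
  psum_cv c z w v -> psum_cv c z' w' v' ->
  (forall N, Cmod (psum c N z w - psum c N z' w') <= K) -> Cmod (v - v') <= K.
Proof.
  intros H H' HK. apply (le_of_le_plus_mult _ _ 2 1 Rlt_0_1). intros eps He.
  destruct (H eps ltac:(lra)) as (N0 & HN0). destruct (H' eps ltac:(lra)) as (N1 & HN1).
  specialize (HN0 (Nat.max N0 N1) ltac:(lia)). specialize (HN1 (Nat.max N0 N1) ltac:(lia)).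
  specialize (HK (Nat.max N0 N1)).
  assert (T := Cmod_triangle3 v (psum c (Nat.max N0 N1) z w) v').
  assert (T2 := Cmod_triangle3 (psum c (Nat.max N0 N1) z w) (psum c (Nat.max N0 N1) z' w') v').
  rewrite (Cmod_sub_sym v (psum _ _ _ _)) in T. lra.
Qed.

Lemma Cpow_n (z : C) (m : nat) : @pow_n C_Ring z m = (z ^ m)%C.
Proof. induction m as [|m IH]; [reflexivity|]. simpl. rewrite IH. reflexivity. Qed.

Lemma RtoC_pow_n (x : R) (m : nat) : RtoC (@pow_n R_Ring x m) = (RtoC x ^ m)%C.
Proof.
  induction m as [|m IH]; [reflexivity|]. simpl pow_n. simpl Cpow.
  change mult with Rmult. rewrite RtoC_mult, IH. reflexivity.
Qed.

Lemma RtoC_sum_n (a : nat -> R) (N : nat) :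
  RtoC (sum_n a N) = sum_n (fun m => RtoC (a m)) N :> C.
Proof.
  induction N as [|N IH].
  - rewrite !sum_O. reflexivity.
  - rewrite csum_Sn, <- IH, sum_Sn. apply RtoC_plus.
Qed.

Lemma analytic2_at_C (f : C * C -> C) (x y : C) :
  analytic2_at (K := C_AbsRing) f (x, y) ->
  exists c rho B, coef_bound c rho B /\
    forall z w, Cmod z < rho -> Cmod w < rho -> psum_cv c z w (f (x + z, y + w)%C).
Proof.
  intros (rho & c & (B & HB) & H). exists c, rho, B. split.
  { split; [apply cond_pos|]. split; [|exact HB].
    eapply Rle_trans; [|exact (HB 0%nat 0%nat)].
    apply Rmult_le_pos; [apply Cmod_ge_0|simpl; lra]. }
  intros z w Hz Hw eps Heps.
  assert (Ez : @minus C_AbsRing (x + z)%C x = z) by (change ((x + z - x)%C = z); ring).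
  assert (Ew : @minus C_AbsRing (y + w)%C y = w) by (change ((y + w - y)%C = w); ring).
  specialize (H (x + z)%C (y + w)%C). simpl fst in H. simpl snd in H.
  rewrite Ez, Ew in H. specialize (H Hz Hw).
  destruct (H (fun v => Cmod (v - f (x + z, y + w)%C) < eps)) as (N0 & HN0).
  { exists (mkposreal eps Heps). intros v Hv. exact Hv. }
  exists N0. intros N HN. specialize (HN0 N HN). 
  replace (psum c N z w) with (sum_n (fun m => sum_n (fun n =>
     @mult C_AbsRing (c m n) (mult (pow_n z m) (pow_n w n))) N) N); [exact HN0|].
  unfold psum, dsum. apply sum_n_ext. intros m. apply sum_n_ext. intros k.
  rewrite !Cpow_n. reflexivity.
Qed.

Lemma analytic2_at_R (f : R * R -> R) (x y : R) :
  analytic2_at (K := R_AbsRing) f (x, y) ->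
  exists c rho B, coef_bound c rho B /\
    forall z w, Rabs z < rho -> Rabs w < rho ->
      psum_cv c (RtoC z) (RtoC w) (RtoC (f (x + z, y + w))).
Proof.
  intros (rho & c & (B & HB) & H). exists (fun m k => RtoC (c m k)), rho, B. split.
  { split; [apply cond_pos|]. split.
    - eapply Rle_trans; [|exact (HB 0%nat 0%nat)].
      apply Rmult_le_pos; [apply Rabs_pos|simpl; lra].
    - intros m k. rewrite Cmod_R. apply HB. }
  intros z w Hz Hw eps Heps.
  assert (Ez : @minus R_AbsRing (x + z) x = z) by (change (x + z - x = z); ring).
  assert (Ew : @minus R_AbsRing (y + w) y = w) by (change (y + w - y = w); ring).
  specialize (H (x + z) (y + w)). simpl fst in H. simpl snd in H.
  rewrite Ez, Ew in H. specialize (H Hz Hw).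
  destruct (H (fun v => Rabs (v - f (x + z, y + w)) < eps)) as (N0 & HN0).
  { exists (mkposreal eps Heps). intros v Hv. exact Hv. }
  exists N0. intros N HN. specialize (HN0 N HN). cbv beta in HN0.
  rewrite <- Cmod_R, RtoC_minus, RtoC_sum_n in HN0.
  replace (psum (fun m k => RtoC (c m k)) N (RtoC z) (RtoC w))
    with (sum_n (fun m => RtoC (sum_n (fun n =>
     @mult R_AbsRing (c m n) (mult (pow_n z m) (pow_n w n))) N)) N : C); [exact HN0|].
  unfold psum, dsum. apply sum_n_ext. intros m. rewrite RtoC_sum_n.
  apply sum_n_ext. intros k.
  change (@mult R_AbsRing) with Rmult. rewrite !RtoC_mult, <- !RtoC_pow_n. reflexivity.
Qed.

(** * Polynomial jets *)

(** Polynomial functions, given by their construction instead of their coefficients: composition,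
    linearization and factorization follow by induction on it. *)
Inductive poly2 : (C * C -> C) -> Prop :=
| poly2_cst c : poly2 (fun _ => c)
| poly2_fst : poly2 (fun w => fst w)
| poly2_snd : poly2 (fun w => snd w)
| poly2_plus p q : poly2 p -> poly2 q -> poly2 (fun w => (p w + q w)%C)
| poly2_mult p q : poly2 p -> poly2 q -> poly2 (fun w => (p w * q w)%C).

Definition nrm (w : C * C) : R := Cmod (fst w) + Cmod (snd w).
Definition shift (P w : C * C) : C * C := ((fst P + fst w)%C, (snd P + snd w)%C).

(** No bound is put on the degree of [p], so that jets can be composed without truncation. *)
Definition jet (n : nat) (f : C * C -> C) (P : C * C) : Prop :=
  exists p d K, poly2 p /\ 0 < d /\ 0 <= K /\
    forall w, nrm w < d -> Cmod (f (shift P w) - p w) <= K * nrm w ^ n.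

(* A pointwise notion: nothing is assumed about derivatives at nearby points, but it is
   stable under composition, inverse and implicit functions, and it is enough for the
   maximum principle. *)
Definition smooth (f : C * C -> C) (P : C * C) : Prop := forall n, jet n f P.

Lemma nrm_ge_0 (w : C * C) : 0 <= nrm w.
Proof. unfold nrm. assert (h := Cmod_ge_0 (fst w)). assert (h2 := Cmod_ge_0 (snd w)). lra. Qed.

Lemma nrm_0 : nrm (RtoC 0, RtoC 0) = 0.
Proof. unfold nrm. simpl. rewrite Cmod_0. lra. Qed.

Lemma shift_0 (P : C * C) : shift P (RtoC 0, RtoC 0) = P.
Proof. unfold shift. destruct P. simpl. f_equal; ring. Qed.

Lemma poly2_comp (p q1 q2 : C * C -> C) :
  poly2 p -> poly2 q1 -> poly2 q2 -> poly2 (fun w => p (q1 w, q2 w)).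
Proof.
  intros Hp H1 H2. induction Hp; simpl.
  - apply poly2_cst.
  - exact H1.
  - exact H2.
  - apply (poly2_plus (fun w => p (q1 w, q2 w)) (fun w => q (q1 w, q2 w))); auto.
  - apply (poly2_mult (fun w => p (q1 w, q2 w)) (fun w => q (q1 w, q2 w))); auto.
Qed.

Lemma poly2_opp (p : C * C -> C) : poly2 p -> poly2 (fun w => (- p w)%C).
Proof.
  intros H. replace (fun w => (- p w)%C) with (fun w => (RtoC (Ropp 1) * p w)%C).
  - apply (poly2_mult (fun _ => RtoC (Ropp 1)) p); auto. apply poly2_cst.
  - apply functional_extensionality. intros w. rewrite RtoC_opp. ring.
Qed.

Lemma poly2_minus (p q : C * C -> C) : poly2 p -> poly2 q -> poly2 (fun w => (p w - q w)%C).
Proof. intros H1 H2. apply (poly2_plus p (fun w => (- q w)%C)); auto. apply poly2_opp; auto. Qed.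

Definition nrm_diff (v v' : C * C) : R := nrm ((fst v - fst v')%C, (snd v - snd v')%C).

Lemma nrm_diff_ge_0 v v' : 0 <= nrm_diff v v'.
Proof. apply nrm_ge_0. Qed.

Lemma lipschitz_of_linearization (p : C * C -> C) (a b : C) (K : R) :
  0 <= K -> (forall v v', nrm v <= 1 -> nrm v' <= 1 ->
    Cmod (p v - p v' - (a * (fst v - fst v') + b * (snd v - snd v')))
      <= K * (nrm v + nrm v') * nrm_diff v v') ->
  forall v v', nrm v <= 1 -> nrm v' <= 1 ->
    Cmod (p v - p v') <= (Cmod a + Cmod b + 2 * K) * nrm_diff v v'.
Proof.
  intros HK H v v' Hv Hv'. specialize (H v v' Hv Hv').
  assert (T := Cmod_reverse_triangle (p v - p v') (a * (fst v - fst v') + b * (snd v - snd v'))).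
  assert (T2 := Cmod_triangle (a * (fst v - fst v')) (b * (snd v - snd v'))).
  rewrite !Cmod_mult in T2.
  assert (ha := Cmod_ge_0 a). assert (hb := Cmod_ge_0 b).
  assert (D := nrm_diff_ge_0 v v').
  assert (K * (nrm v + nrm v') * nrm_diff v v' <= 2 * K * nrm_diff v v').
  { apply Rmult_le_compat_r; auto. nra. }
  assert (h1 := Cmod_ge_0 (fst v - fst v')). assert (h2 := Cmod_ge_0 (snd v - snd v')).
  unfold nrm_diff, nrm in *. simpl in *. nra.
Qed.

(** Strict differentiability at the origin: the error bound compares two arbitrary small points. The
    Newton iteration of [smooth1_implicit] needs this form, since it compares an approximate and the
    exact solution, neither of which is the origin. *)
Lemma poly2_linearization (p : C * C -> C) :
  poly2 p -> exists a b K, 0 <= K /\ forall v v', nrm v <= 1 -> nrm v' <= 1 ->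
    Cmod (p v - p v' - (a * (fst v - fst v') + b * (snd v - snd v')))
      <= K * (nrm v + nrm v') * nrm_diff v v'.
Proof.
  intros Hp. induction Hp as [c| | |p q Hp IHp Hq IHq|p q Hp IHp Hq IHq].
  - exists 0%C, 0%C, 0. split; [lra|]. intros v v' _ _.
    match goal with |- Cmod ?X <= _ => replace X with (RtoC 0) by ring end.
    rewrite Cmod_0. lra.
  - exists 1%C, 0%C, 0. split; [lra|]. intros v v' _ _.
    match goal with |- Cmod ?X <= _ => replace X with (RtoC 0) by ring end.
    rewrite Cmod_0. lra.
  - exists 0%C, 1%C, 0. split; [lra|]. intros v v' _ _.
    match goal with |- Cmod ?X <= _ => replace X with (RtoC 0) by ring end.
    rewrite Cmod_0. lra.
  - destruct IHp as (a & b & K & HK & H). destruct IHq as (a' & b' & K' & HK' & H').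
    exists (a + a')%C, (b + b')%C, (K + K'). split; [lra|]. intros v v' Hv Hv'.
    match goal with |- Cmod ?X <= _ => replace X with
      ((p v - p v' - (a * (fst v - fst v') + b * (snd v - snd v')))
       + (q v - q v' - (a' * (fst v - fst v') + b' * (snd v - snd v'))))%C by ring end.
    eapply Rle_trans; [apply Cmod_triangle|].
    specialize (H v v' Hv Hv'). specialize (H' v v' Hv Hv'). lra.
  - destruct IHp as (a & b & K & HK & H). destruct IHq as (a' & b' & K' & HK' & H').
    set (o := (RtoC 0, RtoC 0)).
    set (Lp := Cmod a + Cmod b + 2 * K). set (Lq := Cmod a' + Cmod b' + 2 * K').
    assert (ha := Cmod_ge_0 a). assert (hb := Cmod_ge_0 b).
    assert (ha' := Cmod_ge_0 a'). assert (hb' := Cmod_ge_0 b').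
    assert (HLp := lipschitz_of_linearization p a b K HK H). assert (HLq := lipschitz_of_linearization q a' b' K' HK' H').
    fold Lp in HLp. fold Lq in HLq. 
    assert (Ho : nrm o <= 1) by (unfold o; rewrite nrm_0; lra).
    exists (a * q o + p o * a')%C, (b * q o + p o * b')%C,
      (K * (Cmod (q o) + Lq) + (Cmod a + Cmod b) * Lq + Lp * Lq + K' * Cmod (p o)).
    assert (hq := Cmod_ge_0 (q o)). assert (hp := Cmod_ge_0 (p o)).
    assert (HLp0 : 0 <= Lp) by (unfold Lp; lra). assert (HLq0 : 0 <= Lq) by (unfold Lq; lra).
    split.
    { repeat apply Rplus_le_le_0_compat; apply Rmult_le_pos; lra. }
    intros v v' Hv Hv'.
    set (l := (a * (fst v - fst v') + b * (snd v - snd v'))%C).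
    set (l' := (a' * (fst v - fst v') + b' * (snd v - snd v'))%C).
    match goal with |- Cmod ?X <= _ => replace X with
      ((p v - p v' - l) * q v + l * (q v - q o)
       + ((p v' - p o) * (q v - q v') + p o * (q v - q v' - l')))%C by (unfold l, l'; ring) end.
    assert (D := nrm_diff_ge_0 v v').
    assert (N1 := nrm_ge_0 v). assert (N2 := nrm_ge_0 v').
    assert (Do : forall v, nrm_diff v o = nrm v).
    { intros u. unfold nrm_diff, o, nrm. simpl. f_equal; f_equal; ring. }
    assert (E1 := H v v' Hv Hv'). fold l in E1.
    assert (E2 := H' v v' Hv Hv'). fold l' in E2.
    assert (E3 := HLq v o Hv Ho). rewrite Do in E3.
    assert (E4 := HLp v' o Hv' Ho). rewrite Do in E4.
    assert (E5 := HLq v v' Hv Hv').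
    assert (E6 : Cmod l <= (Cmod a + Cmod b) * nrm_diff v v').
    { unfold l. eapply Rle_trans; [apply Cmod_triangle|]. rewrite !Cmod_mult.
      assert (h1 := Cmod_ge_0 (fst v - fst v')). assert (h2 := Cmod_ge_0 (snd v - snd v')).
      unfold nrm_diff, nrm. simpl. nra. }
    assert (E7 : Cmod (q v) <= Cmod (q o) + Lq).
    { replace (q v) with (q o + (q v - q o))%C by ring. eapply Rle_trans; [apply Cmod_triangle|].
      assert (Lq * nrm v <= Lq) by nra. lra. }
    eapply Rle_trans; [apply Cmod_triangle|].
    set (S := (nrm v + nrm v') * nrm_diff v v').
    assert (HS : 0 <= S) by (apply Rmult_le_pos; lra).
    assert (B1 : Cmod ((p v - p v' - l) * q v) <= K * (Cmod (q o) + Lq) * S).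
    { rewrite Cmod_mult. eapply Rle_trans; [apply Rmult_le_compat; [apply Cmod_ge_0|apply Cmod_ge_0|exact E1|exact E7]|].
      right. unfold S. ring. }
    assert (B2 : Cmod (l * (q v - q o)) <= (Cmod a + Cmod b) * Lq * S).
    { rewrite Cmod_mult. eapply Rle_trans; [apply Rmult_le_compat; [apply Cmod_ge_0|apply Cmod_ge_0|exact E6|exact E3]|].
      replace ((Cmod a + Cmod b) * nrm_diff v v' * (Lq * nrm v)) with
       ((Cmod a + Cmod b) * Lq * (nrm v * nrm_diff v v')) by ring.
      apply Rmult_le_compat_l; [apply Rmult_le_pos; lra|]. unfold S. nra. }
    assert (B3 : Cmod ((p v' - p o) * (q v - q v')) <= Lp * Lq * S).
    { rewrite Cmod_mult. eapply Rle_trans; [apply Rmult_le_compat; [apply Cmod_ge_0|apply Cmod_ge_0|exact E4|exact E5]|].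
      replace (Lp * nrm v' * (Lq * nrm_diff v v')) with
       (Lp * Lq * (nrm v' * nrm_diff v v')) by ring.
      apply Rmult_le_compat_l; [apply Rmult_le_pos; lra|]. unfold S. nra. }
    assert (B4 : Cmod (p o * (q v - q v' - l')) <= K' * Cmod (p o) * S).
    { rewrite Cmod_mult. eapply Rle_trans; [apply Rmult_le_compat_l; [apply Cmod_ge_0|exact E2]|].
      right. unfold S. ring. }
    assert (T1 := Cmod_triangle ((p v - p v' - l) * q v) (l * (q v - q o))).
    assert (T2 := Cmod_triangle ((p v' - p o) * (q v - q v')) (p o * (q v - q v' - l'))).
    replace ((K * (Cmod (q o) + Lq) + (Cmod a + Cmod b) * Lq + Lp * Lq + K' * Cmod (p o)) * (nrm v + nrm v') * nrm_diff v v')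
      with (K * (Cmod (q o) + Lq) * S + (Cmod a + Cmod b) * Lq * S + Lp * Lq * S + K' * Cmod (p o) * S)
      by (unfold S; ring).
    lra.
Qed.

Lemma poly2_lipschitz (p : C * C -> C) :
  poly2 p -> exists K, 0 <= K /\ forall v v', nrm v <= 1 -> nrm v' <= 1 ->
    Cmod (p v - p v') <= K * nrm_diff v v'.
Proof.
  intros Hp. destruct (poly2_linearization p Hp) as (a & b & K & HK & H).
  exists (Cmod a + Cmod b + 2 * K).
  assert (ha := Cmod_ge_0 a). assert (hb := Cmod_ge_0 b). split; [lra|].
  apply lipschitz_of_linearization; auto.
Qed.

Lemma jet_elim (n : nat) (f : C * C -> C) (P : C * C) :
  (1 <= n)%nat -> jet n f P ->
  exists p d K, poly2 p /\ 0 < d <= 1 /\ 0 <= K /\ p (RtoC 0, RtoC 0) = f P /\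
    forall w, nrm w < d -> Cmod (f (shift P w) - p w) <= K * nrm w ^ n.
Proof.
  intros Hn (p & d & K & Hp & Hd & HK & H). exists p, (Rmin d 1), K.
  split; [auto|]. split; [split; [apply Rmin_pos; lra|apply Rmin_r]|]. split; [auto|]. split.
  - specialize (H (RtoC 0, RtoC 0)). rewrite nrm_0, shift_0, pow_i in H by lia.
    specialize (H Hd). rewrite Rmult_0_r in H.
    assert (E : (f P - p (RtoC 0, RtoC 0))%C = 0%C).
    { apply Cmod_eq_0. apply Rle_antisym; auto. apply Cmod_ge_0. }
    replace (f P) with ((f P - p (RtoC 0, RtoC 0)) + p (RtoC 0, RtoC 0))%C by ring.
    rewrite E. ring.
  - intros w Hw. apply H. eapply Rlt_le_trans; [exact Hw|apply Rmin_l].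
Qed.

Lemma jet_pred (n : nat) (f : C * C -> C) (P : C * C) : jet (S n) f P -> jet n f P.
Proof.
  intros (p & d & K & Hp & Hd & HK & H). exists p, (Rmin d 1), K.
  split; [auto|]. split; [apply Rmin_pos; lra|]. split; [auto|].
  intros w Hw. eapply Rle_trans; [apply H; eapply Rlt_le_trans; [exact Hw|apply Rmin_l]|].
  assert (h := nrm_ge_0 w). assert (h1 : nrm w < 1) by (eapply Rlt_le_trans; [exact Hw|apply Rmin_r]).
  apply Rmult_le_compat_l; auto. simpl.
  assert (0 <= nrm w ^ n) by (apply pow_le; auto). nra.
Qed.

(** A jet of positive order determines the value at the centre, which most constructions rely on;
    order 0 is recovered from order 1. *)
Lemma smooth_of_jets (f : C * C -> C) (P : C * C) :
  (forall n, (1 <= n)%nat -> jet n f P) -> smooth f P.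
Proof. intros H n. apply jet_pred. apply H. lia. Qed.

Lemma smooth_ext_loc (f g : C * C -> C) (P : C * C) (d : R) :
  0 < d -> (forall w, nrm w < d -> f (shift P w) = g (shift P w)) ->
  smooth f P -> smooth g P.
Proof.
  intros Hd E H n. destruct (H n) as (p & d' & K & Hp & Hd' & HK & Hj).
  exists p, (Rmin d d'), K. split; [auto|]. split; [apply Rmin_pos; lra|]. split; [auto|].
  intros w Hw. rewrite <- E by (eapply Rlt_le_trans; [exact Hw|apply Rmin_l]).
  apply Hj. eapply Rlt_le_trans; [exact Hw|apply Rmin_r].
Qed.

Lemma smooth_ext (f g : C * C -> C) (P : C * C) :
  (forall w, f w = g w) -> smooth f P -> smooth g P.
Proof. intros E. apply (smooth_ext_loc f g P 1 Rlt_0_1). intros w _. apply E. Qed.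

Lemma poly2_shift (p : C * C -> C) (P : C * C) : poly2 p -> poly2 (fun w => p (shift P w)).
Proof.
  intros Hp. apply (poly2_comp p (fun w => fst P + fst w)%C (fun w => snd P + snd w)%C Hp).
  - apply (poly2_plus (fun _ => fst P) (fun w => fst w)); constructor.
  - apply (poly2_plus (fun _ => snd P) (fun w => snd w)); constructor.
Qed.

Lemma smooth_poly2 (p : C * C -> C) (P : C * C) : poly2 p -> smooth p P.
Proof.
  intros Hp n. exists (fun w => p (shift P w)), 1, 0. split; [apply poly2_shift; auto|].
  split; [lra|]. split; [lra|]. intros w _.
  replace (p (shift P w) - p (shift P w))%C with (RtoC 0) by ring. rewrite Cmod_0. lra.
Qed.

Lemma smooth_lipschitz (f : C * C -> C) (P : C * C) :
  smooth f P -> exists d K, 0 < d <= 1 /\ 0 <= K /\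
    forall w, nrm w < d -> Cmod (f (shift P w) - f P) <= K * nrm w.
Proof.
  intros H. destruct (jet_elim 1 f P ltac:(lia) (H 1%nat)) as (p & d & K & Hp & Hd & HK & Hv & Hj).
  destruct (poly2_lipschitz p Hp) as (L & HL & Lip).
  exists d, (K + L). split; [auto|]. split; [lra|]. intros w Hw.
  specialize (Hj w Hw). rewrite pow_1 in Hj.
  specialize (Lip w (RtoC 0, RtoC 0) ltac:(lra) ltac:(rewrite nrm_0; lra)).
  assert (E : nrm_diff w (RtoC 0, RtoC 0) = nrm w).
  { unfold nrm_diff, nrm. simpl. f_equal; f_equal; ring. }
  rewrite E, Hv in Lip.
  assert (T := Cmod_triangle3 (f (shift P w)) (p w) (f P)). lra.
Qed.

(** The polynomials of [g1] and [g2] are recentred at the values of these functions before being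
    inserted in that of [f]; the constant [A] bounds how fast both the functions and their
    polynomials move away from these values. *)
Lemma jet_comp (n : nat) (f g1 g2 : C * C -> C) (P : C * C) :
  (1 <= n)%nat -> jet n f (g1 P, g2 P) -> jet n g1 P -> jet n g2 P ->
  jet n (fun Q => f (g1 Q, g2 Q)) P.
Proof.
  intros Hn Hf H1 H2.
  destruct (jet_elim n _ _ Hn Hf) as (p & d & K & Hp & Hd & HK & Hv & Hj).
  destruct (jet_elim n _ _ Hn H1) as (p1 & d1 & K1 & Hp1 & Hd1 & HK1 & Hv1 & Hj1).
  destruct (jet_elim n _ _ Hn H2) as (p2 & d2 & K2 & Hp2 & Hd2 & HK2 & Hv2 & Hj2).
  destruct (poly2_lipschitz p Hp) as (L & HL & Lip).
  destruct (poly2_lipschitz p1 Hp1) as (L1 & HL1 & Lip1).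
  destruct (poly2_lipschitz p2 Hp2) as (L2 & HL2 & Lip2).
  set (A := K1 + K2 + L1 + L2 + 1).
  assert (HA : 1 <= A) by (unfold A; lra).
  set (e := Rmin (Rmin d1 d2) (d / A)).
  assert (HdA : 0 < d / A) by (apply Rdiv_lt_0_compat; lra).
  assert (He : 0 < e) by (unfold e; repeat apply Rmin_pos; lra).
  exists (fun w => p ((p1 w - g1 P)%C, (p2 w - g2 P)%C)), e, (K * A ^ n + L * (K1 + K2)).
  split.
  { apply (poly2_comp p (fun w => p1 w - g1 P)%C (fun w => p2 w - g2 P)%C Hp).
    - apply (poly2_minus p1 (fun _ => g1 P)); auto. constructor.
    - apply (poly2_minus p2 (fun _ => g2 P)); auto. constructor. }
  assert (0 <= A ^ n) by (apply pow_le; lra).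
  split; [exact He|]. split.
  { apply Rplus_le_le_0_compat; apply Rmult_le_pos; lra. }
  intros w Hw.
  assert (W1 : nrm w < d1) by (eapply Rlt_le_trans; [exact Hw|eapply Rle_trans; [apply Rmin_l|apply Rmin_l]]).
  assert (W2 : nrm w < d2) by (eapply Rlt_le_trans; [exact Hw|eapply Rle_trans; [apply Rmin_l|apply Rmin_r]]).
  assert (W3 : nrm w < d / A) by (eapply Rlt_le_trans; [exact Hw|apply Rmin_r]).
  assert (Wn := nrm_ge_0 w).
  assert (W4 : A * nrm w < d).
  { apply Rmult_lt_compat_l with (r := A) in W3; [|lra].
    replace (A * (d / A)) with d in W3 by (field; lra). exact W3. }
  specialize (Hj1 w W1). specialize (Hj2 w W2).
  assert (Wpow : nrm w ^ n <= nrm w).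
  { destruct n as [|n]; [lia|]. simpl. 
    assert (nrm w ^ n <= 1).
    { apply Rle_trans with (1 ^ n); [apply pow_incr; lra|rewrite pow1; lra]. }
    assert (0 <= nrm w ^ n) by (apply pow_le; auto). nra. }
  assert (Wpow0 : 0 <= nrm w ^ n) by (apply pow_le; auto).
  assert (E : nrm_diff w (RtoC 0, RtoC 0) = nrm w).
  { unfold nrm_diff, nrm. simpl. f_equal; f_equal; ring. }
  specialize (Lip1 w (RtoC 0, RtoC 0) ltac:(lra) ltac:(rewrite nrm_0; lra)).
  specialize (Lip2 w (RtoC 0, RtoC 0) ltac:(lra) ltac:(rewrite nrm_0; lra)).
  rewrite E, Hv1 in Lip1. rewrite E, Hv2 in Lip2.
  set (u := ((g1 (shift P w) - g1 P)%C, (g2 (shift P w) - g2 P)%C)).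
  set (u' := ((p1 w - g1 P)%C, (p2 w - g2 P)%C)).
  assert (Eu : shift (g1 P, g2 P) u = (g1 (shift P w), g2 (shift P w))).
  { unfold u. generalize (shift P w). intros Q. unfold shift. simpl. f_equal; ring. }
  assert (Nu : nrm u <= A * nrm w).
  { unfold u, nrm at 1. simpl.
    assert (T1 := Cmod_triangle3 (g1 (shift P w)) (p1 w) (g1 P)).
    assert (T2 := Cmod_triangle3 (g2 (shift P w)) (p2 w) (g2 P)). unfold A. nra. }
  assert (Nu' : nrm u' <= A * nrm w).
  { unfold u', nrm at 1. simpl. unfold A. nra. }
  rewrite <- Eu. 
  assert (F1 := Hj u ltac:(lra)).
  assert (F2 := Lip u u' ltac:(lra) ltac:(lra)).
  assert (F3 : nrm_diff u u' <= (K1 + K2) * nrm w ^ n).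
  { unfold nrm_diff, u, u'. unfold nrm at 1. cbn [fst snd].
    replace (g1 (shift P w) - g1 P - (p1 w - g1 P))%C with (g1 (shift P w) - p1 w)%C by ring.
    replace (g2 (shift P w) - g2 P - (p2 w - g2 P))%C with (g2 (shift P w) - p2 w)%C by ring.
    lra. }
  assert (F4 : nrm u ^ n <= A ^ n * nrm w ^ n).
  { rewrite <- Rpow_mult_distr. apply pow_incr. split; [apply nrm_ge_0|lra]. }
  assert (T := Cmod_triangle3 (f (shift (g1 P, g2 P) u)) (p u) (p u')).
  assert (K * nrm u ^ n <= K * (A ^ n * nrm w ^ n)) by (apply Rmult_le_compat_l; lra).
  assert (L * nrm_diff u u' <= L * ((K1 + K2) * nrm w ^ n)) by (apply Rmult_le_compat_l; lra).
  lra.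
Qed.

Lemma smooth_comp (f g1 g2 : C * C -> C) (P : C * C) :
  smooth f (g1 P, g2 P) -> smooth g1 P -> smooth g2 P ->
  smooth (fun Q => f (g1 Q, g2 Q)) P.
Proof.
  intros Hf H1 H2. apply smooth_of_jets. intros n Hn. apply jet_comp; auto.
Qed.

Lemma smooth_minus (f g : C * C -> C) (P : C * C) :
  smooth f P -> smooth g P -> smooth (fun Q => (f Q - g Q)%C) P.
Proof.
  intros Hf Hg. apply (smooth_comp (fun Q => (fst Q - snd Q)%C) f g P); auto.
  apply smooth_poly2. apply (poly2_minus (fun w => fst w) (fun w => snd w)); constructor.
Qed.

Lemma smooth_mult (f g : C * C -> C) (P : C * C) :
  smooth f P -> smooth g P -> smooth (fun Q => (f Q * g Q)%C) P.
Proof.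
  intros Hf Hg. apply (smooth_comp (fun Q => (fst Q * snd Q)%C) f g P); auto.
  apply smooth_poly2. apply (poly2_mult (fun w => fst w) (fun w => snd w)); constructor.
Qed.

Lemma smooth_inv (f : C * C -> C) (P : C * C) :
  smooth f P -> f P <> 0%C -> smooth (fun Q => (/ f Q)%C) P.
Proof.
  intros Hf H0. apply smooth_of_jets. intros n Hn.
  destruct (jet_elim n f P Hn (Hf n)) as (p & d & K & Hp & Hd & HK & Hv & Hj).
  destruct (smooth_lipschitz f P Hf) as (d1 & L & Hd1 & HL & Lip).
  set (a := f P) in *.
  assert (Ha : 0 < Cmod a) by (apply Cmod_gt_0; auto).
  destruct (poly2_lipschitz p Hp) as (Lp & HLp & Lipp).
  (* Neumann series: [1 - p r = (1 - p / a)^k] *)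
  assert (N : forall k, exists r, poly2 r /\ forall w, (1 - p w * r w = (1 - p w / a) ^ k)%C).
  { induction k as [|k (r & Hr & E)].
    - exists (fun _ => 0%C). split; [constructor|]. intros w. simpl. ring.
    - exists (fun w => (/ a + (1 - p w * / a) * r w)%C). split.
      + apply (poly2_plus (fun _ => / a)%C (fun w => (1 - p w * / a) * r w)%C); [constructor|].
        apply (poly2_mult (fun w => 1 - p w * / a)%C r); auto.
        apply (poly2_minus (fun _ => 1%C) (fun w => p w * / a)%C); [constructor|].
        apply (poly2_mult p (fun _ => / a)%C); auto. constructor.
      + intros w. simpl. rewrite <- E. field. exact H0. }
  destruct (N n) as (r & Hr & E).
  destruct (poly2_lipschitz r Hr) as (Lr & HLr & Lipr).
  set (R0 := Cmod (r (RtoC 0, RtoC 0)) + Lr).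
  assert (HR0 : 0 <= R0) by (unfold R0; assert (h := Cmod_ge_0 (r (RtoC 0, RtoC 0))); lra).
  set (e := Rmin (Rmin d d1) (Cmod a / (2 * (L + 1)))).
  assert (He0 : 0 < Cmod a / (2 * (L + 1))) by (apply Rdiv_lt_0_compat; lra).
  assert (He : 0 < e) by (unfold e; repeat apply Rmin_pos; lra).
  exists r, e, ((2 / Cmod a) * ((Lp / Cmod a) ^ n + K * R0)).
  assert (Hla : 0 <= Lp / Cmod a) by (apply Rdiv_le_0_compat; lra).
  assert (Hla2 : 0 <= (Lp / Cmod a) ^ n) by (apply pow_le; auto).
  assert (H2a : 0 < 2 / Cmod a) by (apply Rdiv_lt_0_compat; lra).
  split; [auto|]. split; [auto|]. split.
  { apply Rmult_le_pos; [lra|]. apply Rplus_le_le_0_compat; auto. apply Rmult_le_pos; auto. }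
  intros w Hw.
  assert (W1 : nrm w < d) by (eapply Rlt_le_trans; [exact Hw|eapply Rle_trans; [apply Rmin_l|apply Rmin_l]]).
  assert (W2 : nrm w < d1) by (eapply Rlt_le_trans; [exact Hw|eapply Rle_trans; [apply Rmin_l|apply Rmin_r]]).
  assert (W3 : nrm w < Cmod a / (2 * (L + 1))) by (eapply Rlt_le_trans; [exact Hw|apply Rmin_r]).
  assert (Wn := nrm_ge_0 w).
  specialize (Hj w W1). specialize (Lip w W2).
  assert (E0 : nrm_diff w (RtoC 0, RtoC 0) = nrm w).
  { unfold nrm_diff, nrm. simpl. f_equal; f_equal; ring. }
  specialize (Lipp w (RtoC 0, RtoC 0) ltac:(lra) ltac:(rewrite nrm_0; lra)).
  specialize (Lipr w (RtoC 0, RtoC 0) ltac:(lra) ltac:(rewrite nrm_0; lra)).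
  rewrite E0 in Lipp, Lipr. rewrite Hv in Lipp.
  set (F := f (shift P w)) in *.
  assert (HF : Cmod a / 2 <= Cmod F).
  { assert (T := Cmod_reverse_triangle a F). rewrite Cmod_sub_sym in T.
    assert ((L + 1) * nrm w <= Cmod a / 2).
    { replace (Cmod a / 2) with ((L + 1) * (Cmod a / (2 * (L + 1)))) by (field; lra).
      apply Rmult_le_compat_l; lra. }
    nra. }
  assert (HF0 : F <> 0%C) by (apply Cmod_gt_0; lra).
  replace (/ F - r w)%C with (/ F * ((1 - p w * r w) + (p w - F) * r w))%C by (field; exact HF0).
  rewrite Cmod_mult, Cmod_inv by exact HF0.
  assert (HiF : / Cmod F <= 2 / Cmod a).
  { replace (2 / Cmod a) with (/ (Cmod a / 2)) by (field; lra). apply Rinv_le_contravar; lra. }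
  assert (Hr0 : Cmod (r w) <= R0).
  { replace (r w) with (r (RtoC 0, RtoC 0) + (r w - r (RtoC 0, RtoC 0)))%C by ring.
    eapply Rle_trans; [apply Cmod_triangle|]. unfold R0. nra. }
  rewrite E.
  assert (G1 : Cmod ((1 - p w / a) ^ n) <= (Lp / Cmod a) ^ n * nrm w ^ n).
  { rewrite Cmod_pow, <- Rpow_mult_distr. apply pow_incr. split; [apply Cmod_ge_0|].
    replace (1 - p w / a)%C with ((a - p w) / a)%C by (field; exact H0).
    rewrite Cmod_div by exact H0. rewrite Cmod_sub_sym.
    unfold Rdiv. rewrite Rmult_assoc, (Rmult_comm (/ Cmod a)), <- Rmult_assoc.
    apply Rmult_le_compat_r; [apply Rlt_le, Rinv_0_lt_compat; auto|exact Lipp]. }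
  assert (Wpow0 : 0 <= nrm w ^ n) by (apply pow_le; auto).
  assert (G2 : Cmod ((p w - F) * r w) <= K * R0 * nrm w ^ n).
  { rewrite Cmod_mult, Cmod_sub_sym.
    eapply Rle_trans; [apply Rmult_le_compat; [apply Cmod_ge_0|apply Cmod_ge_0|exact Hj|exact Hr0]|].
    right. ring. }
  rewrite Rmult_assoc.
  apply Rmult_le_compat; auto using Cmod_ge_0.
  { apply Rlt_le, Rinv_0_lt_compat. lra. }
  eapply Rle_trans; [apply Cmod_triangle|]. lra.
Qed.

Lemma poly2_sum_n (a : nat -> C * C -> C) (N : nat) :
  (forall m, poly2 (a m)) -> poly2 (fun w => sum_n (fun m => a m w) N).
Proof.
  intros H. induction N as [|N IH].
  - replace (fun w => sum_n (fun m => a m w) 0) with (a 0%nat); auto.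
    apply functional_extensionality. intros w. rewrite sum_O. reflexivity.
  - replace (fun w => sum_n (fun m => a m w) (S N))
      with (fun w => (sum_n (fun m => a m w) N + a (S N) w)%C).
    + apply (poly2_plus (fun w => sum_n (fun m => a m w) N) (a (S N))); auto.
    + apply functional_extensionality. intros w. rewrite csum_Sn. reflexivity.
Qed.

Lemma poly2_pow (p : C * C -> C) (m : nat) : poly2 p -> poly2 (fun w => (p w ^ m)%C).
Proof.
  intros Hp. induction m as [|m IH]; simpl.
  - constructor.
  - apply (poly2_mult p (fun w => p w ^ m)%C); auto.
Qed.

Lemma poly2_tpoly (c : nat -> nat -> C) (n : nat) : poly2 (fun w => tpoly c n (fst w) (snd w)).
Proof.
  unfold tpoly, dsum.
  apply (poly2_sum_n (fun m w => sum_n (fun k =>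
     if Nat.ltb (m + k) n then (c m k * (fst w ^ m * snd w ^ k))%C else RtoC 0) n)).
  intros m. apply (poly2_sum_n (fun k w => if Nat.ltb (m + k) n then (c m k * (fst w ^ m * snd w ^ k))%C else RtoC 0)).
  intros k. destruct (Nat.ltb (m + k) n); [|constructor].
  apply (poly2_mult (fun _ => c m k) (fun w => fst w ^ m * snd w ^ k)%C); [constructor|].
  apply (poly2_mult (fun w => fst w ^ m)%C (fun w => snd w ^ k)%C); apply poly2_pow; constructor.
Qed.

Lemma analytic2_smooth (f : C * C -> C) (P : C * C) :
  analytic2_at (K := C_AbsRing) f P -> smooth f P.
Proof.
  destruct P as [x y]. intros H n.
  destruct (analytic2_at_C f x y H) as (c & rho & B & Hc & Hcv).
  assert (Hr := proj1 Hc).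
  exists (fun w => tpoly c n (fst w) (snd w)), (rho / 2), (4 * (B * (2 / rho) ^ n)).
  split; [apply poly2_tpoly|]. split; [lra|]. split.
  { apply Rmult_le_pos; [lra|]. apply Rmult_le_pos; [apply Hc|]. apply pow_le.
    apply Rlt_le, Rdiv_lt_0_compat; lra. }
  intros [z w] Hzw. unfold nrm in *. simpl in *.
  assert (hz := Cmod_ge_0 z). assert (hw := Cmod_ge_0 w).
  apply (psum_cv_le c z w _ _ _ n (Hcv z w ltac:(lra) ltac:(lra))).
  intros N HN. apply (psum_taylor c rho B n Hc); auto. lra.
Qed.

(** A function of one variable is read as a function of two that ignores the second, so that the
    two-variable calculus applies to it directly. *)
Definition smooth1 (h : C -> C) (z : C) : Prop := smooth (fun Q => h (fst Q)) (z, RtoC 0).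

Lemma smooth1_comp (g h : C -> C) (z : C) :
  smooth1 g (h z) -> smooth1 h z -> smooth1 (fun x => g (h x)) z.
Proof.
  intros Hg Hh. apply (smooth_comp (fun Q => g (fst Q)) (fun Q => h (fst Q)) (fun _ => RtoC 0)).
  - exact Hg.
  - exact Hh.
  - apply (smooth_poly2 (fun _ => RtoC 0)). constructor.
Qed.

(** The solution [Y] and its Lipschitz bound are given, as they come from a contraction; only
    smoothness is at stake. The lower bound by [c] along the vertical expresses that the partial
    derivative in the second variable is nonzero. *)
Lemma smooth1_implicit (Psi : C * C -> C) (Y : C -> C) (x0 : C) (d c L : R) :
  smooth Psi (x0, Y x0) -> 0 < d -> 0 < c -> 0 <= L ->
  (forall w, Cmod w < d -> Psi (x0 + w, Y (x0 + w))%C = 0%C) ->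
  (forall w, Cmod w < d -> Cmod (Y (x0 + w) - Y x0)%C <= L * Cmod w) ->
  (forall h, Cmod h < d -> c * Cmod h <= Cmod (Psi (x0, (Y x0 + h)%C))) ->
  smooth1 Y x0.
Proof.
  intros Hs Hd Hc HL Hz HY Hlow. apply smooth_of_jets. intros n Hn.
  destruct (jet_elim (S n) Psi _ ltac:(lia) (Hs (S n))) as (p & d0 & K & Hp & Hd0 & HK & Hv & Hj).
  destruct (poly2_linearization p Hp) as (a & b & K1 & HK1 & Hlin).
  assert (HP0 : Psi (x0, Y x0) = 0%C).
  { specialize (Hz 0%C). rewrite Cmod_0, !Cplus_0_r in Hz. auto. }
  rewrite HP0 in Hv.
  (* Otherwise [Psi] would be quadratically small on the vertical through the solution, against the
     lower bound. *)
  assert (Hb : b <> 0%C).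
  { intros Hb. set (t := Rmin (d / 2) (Rmin (d0 / 2) (c / (2 * (K + K1 + 1))))).
    assert (Hq : 0 < c / (2 * (K + K1 + 1))) by (apply Rdiv_lt_0_compat; lra).
    assert (Ht : 0 < t) by (unfold t; repeat apply Rmin_pos; lra).
    assert (Ht1 : t <= d / 2) by apply Rmin_l.
    assert (Ht2 : t <= d0 / 2) by (eapply Rle_trans; [apply Rmin_r|apply Rmin_l]).
    assert (Ht3 : t <= c / (2 * (K + K1 + 1))) by (eapply Rle_trans; [apply Rmin_r|apply Rmin_r]).
    assert (Et : Cmod (RtoC t) = t) by (rewrite Cmod_R, Rabs_pos_eq; lra).
    assert (Nt : nrm (RtoC 0, RtoC t) = t) by (unfold nrm; simpl; rewrite Cmod_0, Et; lra).
    specialize (Hlow (RtoC t) ltac:(lra)). rewrite Et in Hlow.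
    specialize (Hj (RtoC 0, RtoC t) ltac:(lra)). rewrite Nt in Hj.
    unfold shift in Hj. simpl fst in Hj. simpl snd in Hj. rewrite Cplus_0_r in Hj.
    specialize (Hlin (RtoC 0, RtoC t) (RtoC 0, RtoC 0) ltac:(lra) ltac:(rewrite nrm_0; lra)).
    rewrite Hb, Hv, nrm_0, Nt in Hlin. unfold nrm_diff in Hlin. simpl fst in Hlin. simpl snd in Hlin.
    replace (RtoC 0 - RtoC 0)%C with (RtoC 0) in Hlin by ring.
    replace (RtoC t - RtoC 0)%C with (RtoC t) in Hlin by ring.
    rewrite Nt in Hlin.
    replace (p (RtoC 0, RtoC t) - 0 - (a * 0 + 0 * RtoC t))%C with (p (RtoC 0, RtoC t)) in Hlin by ring.
    assert (T := Cmod_reverse_triangle (Psi (x0, Y x0 + RtoC t)%C) (p (RtoC 0, RtoC t))).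
    assert (t ^ S n <= t * t).
    { destruct n as [|n]; [lia|]. simpl. rewrite <- Rmult_assoc. rewrite <- (Rmult_1_r (t * t)) at 2.
      apply Rmult_le_compat_l; [nra|].
      apply Rle_trans with (1 ^ n); [apply pow_incr; lra|rewrite pow1; lra]. }
    assert (K * t ^ S n <= K * (t * t)) by (apply Rmult_le_compat_l; lra).
    assert (c * t <= (K + K1) * (t * t)) by lra.
    assert (c <= (K + K1) * t) by nra.
    assert ((K + K1 + 1) * t <= c / 2).
    { replace (c / 2) with ((K + K1 + 1) * (c / (2 * (K + K1 + 1)))) by (field; lra).
      apply Rmult_le_compat_l; lra. }
    nra. }
  assert (Hb0 : 0 < Cmod b) by (apply Cmod_gt_0; auto).
  set (eta := fun w => (Y (x0 + w) - Y x0)%C).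
  (* Newton iteration: each step gains one order in [w]. *)
  assert (Newton : forall k, (k <= n)%nat -> exists q e Kk, poly2 q /\ 0 < e <= 1 /\ 0 <= Kk /\
     forall w, Cmod w < e -> Cmod (q (w, RtoC 0) - eta w) <= Kk * Cmod w ^ S k).
  { induction k as [|k IH]; intros Hk.
    - exists (fun _ => 0%C), (Rmin d 1), L. split; [constructor|].
      split; [split; [apply Rmin_pos; lra|apply Rmin_r]|]. split; [auto|].
      intros w Hw. rewrite pow_1, Cmod_sub_sym.
      replace (eta w - 0)%C with (eta w) by ring.
      apply HY. eapply Rlt_le_trans; [exact Hw|apply Rmin_l].
    - destruct (IH ltac:(lia)) as (q & e & Kk & Hq & He & HKk & Hqk).
      set (M := 1 + L + Kk).
      set (e' := Rmin (Rmin e d) (d0 / (2 * M))).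
      assert (HM : 1 <= M) by (unfold M; lra).
      assert (HdM : 0 < d0 / (2 * M)) by (apply Rdiv_lt_0_compat; lra).
      assert (He' : 0 < e') by (unfold e'; repeat apply Rmin_pos; lra).
      exists (fun w => (q w - p (fst w, q w) * / b)%C), e', (/ Cmod b * (K1 * (2 * M) * Kk + K * M ^ S n)).
      assert (HMn : 0 <= M ^ S n) by (apply pow_le; lra).
      assert (Hib : 0 < / Cmod b) by (apply Rinv_0_lt_compat; auto).
      split.
      { apply (poly2_minus q (fun w => p (fst w, q w) * / b)%C); auto.
        apply (poly2_mult (fun w => p (fst w, q w)) (fun _ => / b)%C); [|constructor].
        apply (poly2_comp p (fun w => fst w) q); auto. constructor. }
      split.
      { split; auto. eapply Rle_trans; [apply Rmin_l|]. eapply Rle_trans; [apply Rmin_l|]. lra. }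
      split.
      { apply Rmult_le_pos; [lra|]. apply Rplus_le_le_0_compat; [|apply Rmult_le_pos; lra].
        apply Rmult_le_pos; [apply Rmult_le_pos|]; lra. }
      intros w Hw. cbn [fst].
      assert (W1 : Cmod w < e) by (eapply Rlt_le_trans; [exact Hw|eapply Rle_trans; [apply Rmin_l|apply Rmin_l]]).
      assert (W2 : Cmod w < d) by (eapply Rlt_le_trans; [exact Hw|eapply Rle_trans; [apply Rmin_l|apply Rmin_r]]).
      assert (W3 : Cmod w < d0 / (2 * M)) by (eapply Rlt_le_trans; [exact Hw|apply Rmin_r]).
      assert (Wn := Cmod_ge_0 w).
      assert (W4 : M * Cmod w < d0 / 2).
      { apply Rmult_lt_compat_l with (r := M) in W3; [|lra].
        replace (M * (d0 / (2 * M))) with (d0 / 2) in W3 by (field; lra). exact W3. }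
      specialize (Hqk w W1). specialize (HY w W2). fold (eta w) in HY. specialize (Hz w W2).
      assert (Wp : Cmod w ^ S k <= Cmod w).
      { assert (h : Cmod w ^ k <= 1)
          by (apply Rle_trans with (1 ^ k); [apply pow_incr; lra|rewrite pow1; lra]).
        simpl. nra. }
      assert (Wp0 : 0 <= Cmod w ^ S k) by (apply pow_le; auto).
      set (qk := q (w, RtoC 0)) in *.
      assert (Hqb : Cmod qk <= (L + Kk) * Cmod w).
      { replace qk with ((qk - eta w) + eta w)%C by ring.
        eapply Rle_trans; [apply Cmod_triangle|]. nra. }
      assert (N1 : nrm (w, qk) <= M * Cmod w) by (unfold nrm, M; simpl; nra).
      assert (N2 : nrm (w, eta w) <= M * Cmod w) by (unfold nrm, M; simpl; nra).
      specialize (Hlin (w, qk) (w, eta w) ltac:(lra) ltac:(lra)).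
      specialize (Hj (w, eta w) ltac:(lra)).
      replace (shift (x0, Y x0) (w, eta w)) with ((x0 + w)%C, Y (x0 + w)%C) in Hj.
      2:{ unfold shift, eta. cbn [fst snd]. f_equal. ring. }
      rewrite Hz in Hj.
      replace (0 - p (w, eta w))%C with (- p (w, eta w))%C in Hj by ring. rewrite Cmod_opp in Hj.
      unfold nrm_diff in Hlin. cbn [fst snd] in Hlin.
      replace (w - w)%C with (RtoC 0) in Hlin by ring.
      replace (nrm (RtoC 0, (qk - eta w)%C)) with (Cmod (qk - eta w)) in Hlin
        by (unfold nrm; simpl; rewrite Cmod_0; lra).
      replace (qk - p (w, qk) * / b - eta w)%C with
        (/ b * (- (p (w, qk) - p (w, eta w) - (a * 0 + b * (qk - eta w))) - p (w, eta w)))%C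
        by (field; exact Hb).
      rewrite Cmod_mult, Cmod_inv by exact Hb. rewrite Rmult_assoc.
      apply Rmult_le_compat_l; [lra|].
      eapply Rle_trans; [apply Cmod_triangle_sub|]. rewrite Cmod_opp.
      assert (B1 : K1 * (nrm (w, qk) + nrm (w, eta w)) * Cmod (qk - eta w)
         <= K1 * (2 * M) * Kk * Cmod w ^ S (S k)).
      { apply Rle_trans with ((K1 * (2 * M * Cmod w)) * (Kk * Cmod w ^ S k)).
        - apply Rmult_le_compat; [|apply Cmod_ge_0| |exact Hqk].
          + apply Rmult_le_pos; auto. assert (h1 := nrm_ge_0 (w, qk)). assert (h2 := nrm_ge_0 (w, eta w)). lra.
          + apply Rmult_le_compat_l; auto. lra.
        - right. simpl. ring. }
      assert (B2 : K * nrm (w, eta w) ^ S n <= K * M ^ S n * Cmod w ^ S (S k)).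
      { rewrite Rmult_assoc. apply Rmult_le_compat_l; auto.
        apply Rle_trans with ((M * Cmod w) ^ S n).
        - apply pow_incr. split; [apply nrm_ge_0|auto].
        - rewrite Rpow_mult_distr. apply Rmult_le_compat_l; auto.
          replace (S n) with (S (S k) + (n - S k))%nat by lia. rewrite pow_add.
          rewrite <- (Rmult_1_r (Cmod w ^ S (S k))) at 2.
          apply Rmult_le_compat_l; [apply pow_le; auto|].
          apply Rle_trans with (1 ^ (n - S k)); [apply pow_incr; lra|rewrite pow1; lra]. }
      lra. }
  destruct (Newton n (Nat.le_refl n)) as (q & e & Kn & Hq & He & HKn & Hqn).
  apply jet_pred.
  exists (fun w => (Y x0 + q (fst w, RtoC 0))%C), e, Kn.
  split.
  { apply (poly2_plus (fun _ => Y x0) (fun w => q (fst w, RtoC 0))); [constructor|].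
    apply (poly2_comp q (fun w => fst w) (fun _ => RtoC 0)); auto; constructor. }
  split; [lra|]. split; [auto|]. intros w Hw. cbn [fst shift].
  assert (E : Cmod (fst w) <= nrm w) by (unfold nrm; assert (h := Cmod_ge_0 (snd w)); lra).
  specialize (Hqn (fst w) ltac:(lra)). unfold eta in Hqn.
  rewrite Cmod_sub_sym.
  replace (Y x0 + q (fst w, RtoC 0) - Y (x0 + fst w))%C
    with (q (fst w, RtoC 0) - (Y (x0 + fst w) - Y x0))%C by ring.
  eapply Rle_trans; [exact Hqn|]. apply Rmult_le_compat_l; auto.
  apply pow_incr. split; auto using Cmod_ge_0.
Qed.

(** * Maximum principle in a strip *)

(** Lebesgue number lemma: local scales chosen at the points of a compact rectangle may be taken
    bounded below by one [d]. It stands for every extraction of a finite cover; with a degenerate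
    second side it serves statements with one real parameter. *)
Lemma rectangle_compactness (a b a' b' : R) (P : R -> R -> R -> Prop) :
  (forall u v, a <= u <= b -> a' <= v <= b' -> exists d, 0 < d /\ P u v d) ->
  exists d, 0 < d /\ forall x y, a <= x <= b -> a' <= y <= b' ->
    exists u v e, a <= u <= b /\ a' <= v <= b' /\ Rabs (x - u) < e /\ Rabs (y - v) < e /\
      d <= e /\ P u v e.
Proof.
  intros H.
  assert (F : forall u v, exists d : posreal, a <= u <= b -> a' <= v <= b' -> P u v d).
  { intros u v. destruct (classic (a <= u <= b /\ a' <= v <= b')) as [[Hu Hv]|Hn].
    - destruct (H u v Hu Hv) as (d & Hd & HP). exists (mkposreal d Hd). auto.
    - exists (mkposreal 1 Rlt_0_1). tauto. }
  set (delta := fun u v => proj1_sig (constructive_indefinite_description _ (F u v))).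
  destruct (compactness_value_2d a b a' b' delta) as (d & Hd).
  exists d. split; [apply cond_pos|]. intros x y Hx Hy.
  destruct (NNPP _ (Hd x y Hx Hy)) as (u & v & Hu & Hv & H1 & H2 & H3).
  exists u, v, (delta u v). repeat (split; [assumption|]).
  unfold delta. apply (proj2_sig (constructive_indefinite_description _ (F u v))); auto.
Qed.

Lemma rectangle_max (a b a' b' : R) (g : R -> R -> R) :
  a <= b -> a' <= b' ->
  (forall u v, a <= u <= b -> a' <= v <= b' -> forall eps, 0 < eps ->
     exists d, 0 < d /\ forall x y, Rabs (x - u) < d -> Rabs (y - v) < d -> g x y <= g u v + eps) ->
  exists u v, a <= u <= b /\ a' <= v <= b' /\
    forall x y, a <= x <= b -> a' <= y <= b' -> g x y <= g u v.
Proof.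
  intros Hab Hab' Husc.
  set (S := fun r => exists x y, a <= x <= b /\ a' <= y <= b' /\ r = g x y).
  assert (Hbd : bound S).
  { destruct (rectangle_compactness a b a' b' (fun u v d => d <= / (1 + Rabs (g u v)) /\
       forall x y, Rabs (x - u) < d -> Rabs (y - v) < d -> g x y <= g u v + 1)) as (d & Hd & H).
    - intros u v Hu Hv. destruct (Husc u v Hu Hv 1 Rlt_0_1) as (d & Hd & H).
      assert (Hp : 0 < / (1 + Rabs (g u v))).
      { apply Rinv_0_lt_compat. assert (h := Rabs_pos (g u v)). lra. }
      exists (Rmin d (/ (1 + Rabs (g u v)))). split; [apply Rmin_pos; auto|]. split; [apply Rmin_r|].
      intros x y Hx Hy. apply H; (eapply Rlt_le_trans; [eassumption|apply Rmin_l]).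
    - exists (/ d + 1). intros r (x & y & Hx & Hy & ->).
      destruct (H x y Hx Hy) as (u & v & e & Hu & Hv & H1 & H2 & H3 & H4 & H5).
      specialize (H5 x y H1 H2).
      assert (h := Rabs_pos (g u v)). assert (h2 := Rle_abs (g u v)).
      assert (Hi : 1 + Rabs (g u v) <= / d).
      { rewrite <- (Rinv_inv (1 + Rabs (g u v))). apply Rinv_le_contravar; lra. }
      lra. }
  destruct (completeness S Hbd) as (m & Hm1 & Hm2).
  { exists (g a a'), a, a'. repeat split; lra. }
  apply NNPP. intros Hno.
  assert (Hlt : forall u v, a <= u <= b -> a' <= v <= b' -> g u v < m).
  { intros u v Hu Hv. destruct (Rle_lt_dec m (g u v)) as [Hle|Hl]; auto. exfalso. apply Hno.
    exists u, v. split; auto. split; auto. intros x y Hx Hy.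
    apply Rle_trans with m; auto. apply Hm1. exists x, y. auto. }
  (* If the supremum [m] is not attained, [g] stays, near each point, below the middle of [g u v]
     and [m]. Taking the scale at most half of the gap turns the lower bound [d] on the scales into
     a uniform gap, so that m - d is still an upper bound. *)
  destruct (rectangle_compactness a b a' b' (fun u v d => d <= (m - g u v) / 2 /\
       forall x y, Rabs (x - u) < d -> Rabs (y - v) < d -> g x y <= g u v + (m - g u v) / 2))
    as (d & Hd & H).
  - intros u v Hu Hv. specialize (Hlt u v Hu Hv).
    destruct (Husc u v Hu Hv ((m - g u v) / 2) ltac:(lra)) as (d & Hd & H).
    exists (Rmin d ((m - g u v) / 2)). split; [apply Rmin_pos; lra|]. split; [apply Rmin_r|].
    intros x y Hx Hy. apply H; (eapply Rlt_le_trans; [eassumption|apply Rmin_l]).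
  - assert (Hub : m <= m - d); [|lra].
    apply Hm2. intros r (x & y & Hx & Hy & ->).
    destruct (H x y Hx Hy) as (u & v & e & Hu & Hv & H1 & H2 & H3 & H4 & H5).
    specialize (H5 x y H1 H2). lra.
Qed.

Lemma periodic_ind (P : R -> Prop) :
  (forall x, 0 <= x <= 1 -> P x) -> (forall x, P x <-> P (x + 1)) -> forall x, P x.
Proof.
  intros H01 Hp.
  assert (Hn : forall (n : nat) x, P x <-> P (x + INR n)).
  { induction n as [|n IH]; intros x.
    - simpl. rewrite Rplus_0_r. tauto.
    - rewrite IH, S_INR, Hp, Rplus_assoc. tauto. }
  assert (Hz : forall (k : Z) x, P x <-> P (x + IZR k)).
  { intros k x. destruct (Z_le_dec 0 k) as [Hk|Hk].
    - rewrite <- (Z2Nat.id k Hk), <- INR_IZR_INZ. apply Hn.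
    - rewrite (Hn (Z.to_nat (- k)) (x + IZR k)), INR_IZR_INZ, Z2Nat.id by lia.
      rewrite opp_IZR. replace (x + IZR k + - IZR k) with x by ring. tauto. }
  intros x. apply (Hz (- Int_part x)%Z). apply H01.
  assert (h := base_Int_part x). rewrite opp_IZR. lra.
Qed.

(** * One-variable expansions and the four-point inequality *)

Lemma poly2_factor_fst (p : C * C -> C) :
  poly2 p -> exists p1, poly2 p1 /\
    forall w, p (w, RtoC 0) = (p (RtoC 0, RtoC 0) + w * p1 (w, RtoC 0))%C.
Proof.
  intros Hp. induction Hp as [c| | |p q Hp (p1 & Hp1 & E) Hq (q1 & Hq1 & F)|p q Hp (p1 & Hp1 & E) Hq (q1 & Hq1 & F)].
  - exists (fun _ => RtoC 0). split; [constructor|]. intros w. ring.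
  - exists (fun _ => RtoC 1). split; [constructor|]. intros w. simpl. ring.
  - exists (fun _ => RtoC 0). split; [constructor|]. intros w. simpl. ring.
  - exists (fun w => (p1 w + q1 w)%C). split; [apply (poly2_plus p1 q1); auto|].
    intros w. cbv beta. rewrite E, F at 1. ring.
  - exists (fun w => (p1 w * q w + p (RtoC 0, RtoC 0) * q1 w)%C). split.
    { apply (poly2_plus (fun w => p1 w * q w)%C (fun w => p (RtoC 0, RtoC 0) * q1 w)%C).
      - apply (poly2_mult p1 q); auto.
      - apply (poly2_mult (fun _ => p (RtoC 0, RtoC 0)) q1); auto. constructor. }
    intros w. cbv beta. rewrite E. 
    replace (q (w, RtoC 0)) with (q (RtoC 0, RtoC 0) + w * q1 (w, RtoC 0))%C by auto.
    ring.
Qed.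

Lemma smooth1_poly (f : C -> C) (z : C) (n : nat) :
  (1 <= n)%nat -> smooth1 f z -> exists p d K, poly2 p /\ 0 < d <= 1 /\ 0 <= K /\
    p (RtoC 0, RtoC 0) = f z /\
    forall w, Cmod w < d -> Cmod (f (z + w)%C - p (w, RtoC 0)) <= K * Cmod w ^ n.
Proof.
  intros Hn H. destruct (jet_elim n _ _ Hn (H n)) as (p & d & K & Hp & Hd & HK & Hv & Hj).
  exists p, d, K. repeat (split; [assumption|]). intros w Hw.
  assert (E : nrm (w, RtoC 0) = Cmod w) by (unfold nrm; simpl; rewrite Cmod_0; ring).
  specialize (Hj (w, RtoC 0)). rewrite E in Hj. apply (Hj Hw).
Qed.

Lemma smooth1_taylor2 (f : C -> C) (z : C) :
  smooth1 f z -> exists c1 c2 d K, 0 < d <= 1 /\ 0 <= K /\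
    forall w, Cmod w < d -> Cmod (f (z + w)%C - (f z + w * (c1 + w * c2))) <= K * Cmod w ^ 3.
Proof.
  intros H. destruct (smooth1_poly f z 3 ltac:(lia) H) as (p & d & K & Hp & Hd & HK & Hv & Hj).
  destruct (poly2_factor_fst p Hp) as (p1 & Hp1 & E1).
  destruct (poly2_factor_fst p1 Hp1) as (p2 & Hp2 & E2).
  destruct (poly2_lipschitz p2 Hp2) as (L & HL & Lip).
  exists (p1 (RtoC 0, RtoC 0)), (p2 (RtoC 0, RtoC 0)), d, (K + L).
  split; [auto|]. split; [lra|]. intros w Hw. specialize (Hj w Hw).
  assert (h := Cmod_ge_0 w).
  assert (E : forall w, nrm (w, RtoC 0) = Cmod w) by (intros; unfold nrm; simpl; rewrite Cmod_0; ring).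
  specialize (Lip (w, RtoC 0) (RtoC 0, RtoC 0) ltac:(rewrite E; lra) ltac:(rewrite nrm_0; lra)).
  assert (F : nrm_diff (w, RtoC 0) (RtoC 0, RtoC 0) = Cmod w).
  { unfold nrm_diff. simpl. replace (w - 0)%C with w by ring. replace (0 - 0)%C with (RtoC 0) by ring. apply E. }
  rewrite F in Lip.
  rewrite E1, E2, Hv in Hj.
  replace (f (z + w)%C - (f z + w * (p1 (RtoC 0, RtoC 0) + w * p2 (RtoC 0, RtoC 0))))%C with
   (f (z + w)%C - (f z + w * (p1 (RtoC 0, RtoC 0) + w * p2 (w, RtoC 0)))
    + w * w * (p2 (w, RtoC 0) - p2 (RtoC 0, RtoC 0)))%C by ring.
  eapply Rle_trans; [apply Cmod_triangle|]. rewrite !Cmod_mult.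
  assert (Cmod w * Cmod w * Cmod (p2 (w, RtoC 0) - p2 (RtoC 0, RtoC 0)) <= Cmod w * Cmod w * (L * Cmod w)).
  { apply Rmult_le_compat_l; auto. apply Rmult_le_pos; auto. }
  simpl in *. lra.
Qed.

Lemma Cmod_sq (z : C) : Cmod z * Cmod z = Re z * Re z + Im z * Im z.
Proof. assert (h := Cmod2_alt z). simpl in h. lra. Qed.

(** A substitute for the subharmonicity of |f|^2. Summing over the directions 1, -1, i, -i cancels
    all cross terms of |a + b w + c w^2|^2 and leaves 4 (|a|^2 + |b|^2 t^2 + |c|^2 t^4); the error
    comes from the Taylor remainder. *)
Lemma four_point_mean (f : C -> C) (z : C) :
  smooth1 f z -> exists d K, 0 < d <= 1 /\ 0 <= K /\ forall t, 0 < t < d ->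
    4 * (Cmod (f z) * Cmod (f z)) - K * t ^ 3 <=
      Cmod (f (z + (t, 0)%R))%C * Cmod (f (z + (t, 0)%R))%C
      + Cmod (f (z + (- t, 0)%R))%C * Cmod (f (z + (- t, 0)%R))%C
      + Cmod (f (z + (0, t)%R))%C * Cmod (f (z + (0, t)%R))%C
      + Cmod (f (z + (0, - t)%R))%C * Cmod (f (z + (0, - t)%R))%C.
Proof.
  intros H. destruct (smooth1_taylor2 f z H) as (c1 & c2 & d & K & Hd & HK & HT).
  set (A := Cmod (f z) + Cmod c1 + Cmod c2).
  assert (h0 := Cmod_ge_0 (f z)). assert (h1 := Cmod_ge_0 c1). assert (h2 := Cmod_ge_0 c2).
  exists d, (8 * A * K). split; [auto|]. split.
  { apply Rmult_le_pos; auto. unfold A. lra. }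
  intros t Ht. 
  assert (One : forall w, Cmod w = t ->
    Cmod (f z + w * (c1 + w * c2)) * Cmod (f z + w * (c1 + w * c2)) - 2 * A * K * t ^ 3
      <= Cmod (f (z + w)%C) * Cmod (f (z + w)%C)).
  { intros w Hw. specialize (HT w ltac:(lra)). rewrite Hw in HT.
    set (T := (f z + w * (c1 + w * c2))%C) in *.
    assert (HTA : Cmod T <= A).
    { unfold T. eapply Rle_trans; [apply Cmod_triangle|]. rewrite Cmod_mult, Hw.
      assert (h := Cmod_triangle c1 (w * c2)). rewrite Cmod_mult, Hw in h.
      assert (k1 := Cmod_ge_0 (c1 + w * c2)).
      assert (t * Cmod c2 <= Cmod c2) by nra.
      assert (t * Cmod (c1 + w * c2) <= Cmod (c1 + w * c2)) by nra. unfold A. lra. }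
    assert (R := Cmod_reverse_triangle T (f (z + w)%C)). rewrite Cmod_sub_sym in R.
    assert (k0 := Cmod_ge_0 T). assert (k1 := Cmod_ge_0 (f (z + w)%C)).
    assert (Ht3 : 0 <= t ^ 3) by (apply pow_le; lra).
    set (X := K * t ^ 3) in *. assert (HX : 0 <= X) by (apply Rmult_le_pos; auto).
    replace (2 * A * K * t ^ 3) with (2 * A * X) by (unfold X; ring).
    destruct (Rle_lt_dec (Cmod T) (Cmod (f (z + w)%C))); nra. }
  assert (Hm : forall x y, (x = 0 \/ y = 0) -> Rabs (x + y) = t -> Cmod (x, y) = t).
  { intros x y Hxy E. apply Rsqr_inj; [apply Cmod_ge_0|lra|]. unfold Rsqr. rewrite Cmod_sq. simpl.
    assert (E2 : (x + y) * (x + y) = t * t).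
    { rewrite <- E. rewrite <- Rabs_mult. rewrite Rabs_pos_eq; [ring|]. apply Rle_0_sqr. }
    destruct Hxy; subst; nra. }
  assert (O1 := One (t, 0)%R (Hm t 0 (or_intror eq_refl) ltac:(rewrite Rplus_0_r, Rabs_pos_eq; lra))).
  assert (O2 := One (- t, 0)%R (Hm (- t) 0 (or_intror eq_refl) ltac:(rewrite Rplus_0_r, Rabs_Ropp, Rabs_pos_eq; lra))).
  assert (O3 := One (0, t)%R (Hm 0 t (or_introl eq_refl) ltac:(rewrite Rplus_0_l, Rabs_pos_eq; lra))).
  assert (O4 := One (0, - t)%R (Hm 0 (- t) (or_introl eq_refl) ltac:(rewrite Rplus_0_l, Rabs_Ropp, Rabs_pos_eq; lra))).
  assert (Key : 4 * (Cmod (f z) * Cmod (f z)) <=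
    Cmod (f z + (t, 0)%R * (c1 + (t, 0)%R * c2)) * Cmod (f z + (t, 0)%R * (c1 + (t, 0)%R * c2))
    + Cmod (f z + (- t, 0)%R * (c1 + (- t, 0)%R * c2)) * Cmod (f z + (- t, 0)%R * (c1 + (- t, 0)%R * c2))
    + Cmod (f z + (0, t)%R * (c1 + (0, t)%R * c2)) * Cmod (f z + (0, t)%R * (c1 + (0, t)%R * c2))
    + Cmod (f z + (0, - t)%R * (c1 + (0, - t)%R * c2)) * Cmod (f z + (0, - t)%R * (c1 + (0, - t)%R * c2))).
  { rewrite !Cmod_sq. destruct (f z) as [p0 q0], c1 as [p1 q1], c2 as [p2 q2]. simpl.
    match goal with |- ?L <= ?R => assert (E : R = L + 4 * (p1 * p1 + q1 * q1) * (t * t)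
      + 4 * (p2 * p2 + q2 * q2) * ((t * t) * (t * t))) by ring end.
    rewrite E. assert (0 <= t * t) by nra. assert (0 <= p1 * p1 + q1 * q1) by nra.
    assert (0 <= p2 * p2 + q2 * q2) by nra. assert (0 <= t * t * (t * t)) by nra.
    assert (0 <= (p1 * p1 + q1 * q1) * (t * t)) by (apply Rmult_le_pos; auto).
    assert (0 <= (p2 * p2 + q2 * q2) * (t * t * (t * t))) by (apply Rmult_le_pos; auto). lra. }
  lra.
Qed.

(** Adding [eps] times (Im z)^2 to |f|^2 makes it strictly subharmonic: at an interior maximum the
    four-point inequality would give 2 eps t^2 <= L t^3 for small [t]. Periodicity of the modulus
    reduces the strip to one rectangle without making its vertical sides a boundary. *)
Lemma strip_max_principle (f : C -> C) (b K : R) :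
  0 < b -> 0 <= K ->
  (forall z, Rabs (Im z) <= b -> smooth1 f z) ->
  (forall z, Rabs (Im z) <= b -> Cmod (f (z + 1)%C) = Cmod (f z)) ->
  (forall z, Rabs (Im z) = b -> Cmod (f z) <= K) ->
  forall z, Rabs (Im z) <= b -> Cmod (f z) <= K.
Proof.
  intros Hb HK Hs Hper Hbd.
  assert (Main : forall eps, 0 < eps -> forall z, Rabs (Im z) <= b ->
    Cmod (f z) * Cmod (f z) <= K * K + eps * (b * b)).
  { intros eps Heps.
    set (g := fun x y => Cmod (f (x, y)) * Cmod (f (x, y)) + eps * (y * y)).
    destruct (rectangle_max 0 1 (- b) b g) as (u & v & Hu & Hv & Hmax); try lra.
    { intros u v Hu Hv e He. 
      assert (Hsm := Hs (u, v) ltac:(simpl; apply Rabs_le; lra)).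
      destruct (smooth_lipschitz _ _ Hsm) as (d & L & Hd & HL & Lip).
      set (F := Cmod (f (u, v))). assert (HF : 0 <= F) by apply Cmod_ge_0.
      set (Q := 2 * L * (2 * F + 2 * L) + eps * (2 * b + 1)).
      assert (HQ : 0 < Q).
      { unfold Q. assert (0 <= L * (2 * F + 2 * L)) by (apply Rmult_le_pos; lra). nra. }
      exists (Rmin (d / 2) (e / Q)). split; [apply Rmin_pos; [lra|apply Rdiv_lt_0_compat; lra]|].
      intros x y Hx Hy.
      set (s := Rmin (d / 2) (e / Q)) in *.
      assert (S1 : s <= d / 2) by apply Rmin_l. assert (S2 : s <= e / Q) by apply Rmin_r.
      assert (S3 : Q * s <= e).
      { apply Rmult_le_compat_l with (r := Q) in S2; [|lra]. replace (Q * (e / Q)) with e in S2 by (field; lra). exact S2. }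
      set (w := (x - u, y - v) : C).
      assert (Hs0 : 0 <= s) by (assert (h := Rabs_pos (x - u)); lra).
      assert (Hw : Cmod w <= 2 * s).
      { replace w with (RtoC (x - u) + (0, 1)%R * RtoC (y - v))%C.
        2:{ unfold w, RtoC, Cplus, Cmult. simpl. f_equal; ring. }
        eapply Rle_trans; [apply Cmod_triangle|]. rewrite Cmod_mult, !Cmod_R.
        change (0, 1)%R with Ci. rewrite Cmod_Ci. lra. }
      assert (Hw' : Cmod w < d).
      { replace w with (RtoC (x - u) + (0, 1)%R * RtoC (y - v))%C.
        2:{ unfold w, RtoC, Cplus, Cmult. simpl. f_equal; ring. }
        eapply Rle_lt_trans; [apply Cmod_triangle|]. rewrite Cmod_mult, !Cmod_R.
        change (0, 1)%R with Ci. rewrite Cmod_Ci. lra. }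
      assert (Nw : nrm (w, RtoC 0) = Cmod w) by (unfold nrm; simpl; rewrite Cmod_0; ring).
      specialize (Lip (w, RtoC 0) ltac:(lra)). rewrite Nw in Lip. simpl in Lip.
      replace ((u, v) + w)%C with (x, y) in Lip.
      2:{ unfold w, Cplus. simpl. f_equal; ring. }
      assert (T := Cmod_reverse_triangle (f (x, y)) (f (u, v))). fold F in T.
      assert (HG : Cmod (f (x, y)) <= F + 2 * L * s) by nra.
      assert (hG := Cmod_ge_0 (f (x, y))).
      unfold g. fold F.
      assert (P1 : Cmod (f (x, y)) * Cmod (f (x, y)) <= F * F + 2 * L * s * (2 * F + 2 * L)).
      { apply Rle_trans with ((F + 2 * L * s) * (F + 2 * L * s)); [apply Rmult_le_compat; lra|].
        assert (0 <= L * s) by (apply Rmult_le_pos; lra).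
        assert (L * s <= L) by nra. nra. }
      assert (P2 : y * y <= v * v + (2 * b + 1) * s).
      { apply Rabs_def2 in Hy. 
        assert (Hvv : Rabs v <= b) by (apply Rabs_le; lra).
        assert (E : y * y = v * v + (y - v) * (2 * v + (y - v))) by ring. rewrite E.
        assert ((y - v) * (2 * v + (y - v)) <= Rabs (y - v) * Rabs (2 * v + (y - v))).
        { rewrite <- Rabs_mult. apply Rle_abs. }
        assert (Rabs (2 * v + (y - v)) <= 2 * b + 1).
        { eapply Rle_trans; [apply Rabs_triang|]. rewrite Rabs_mult, (Rabs_pos_eq 2) by lra.
          assert (Rabs (y - v) <= 1) by (apply Rabs_le; lra). lra. }
        assert (Rabs (y - v) <= s) by (apply Rabs_le; lra).
        assert (Rabs (y - v) * Rabs (2 * v + (y - v)) <= s * (2 * b + 1)).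
        { apply Rmult_le_compat; auto using Rabs_pos. }
        lra. }
      assert (eps * (y * y) <= eps * (v * v + (2 * b + 1) * s)) by (apply Rmult_le_compat_l; lra).
      unfold Q in S3. lra. }
    assert (Hmax' : forall x y, - b <= y <= b -> g x y <= g u v).
    { intros x y Hy. revert x. apply periodic_ind.
      - intros x Hx. apply Hmax; auto.
      - intros x. unfold g.
        assert (E := Hper (x, y) ltac:(simpl; apply Rabs_le; lra)).
        replace ((x, y) + 1)%C with (x + 1, y) in E
          by (unfold Cplus, RtoC; simpl; f_equal; ring).
        rewrite E. tauto. }
    assert (Hg : g u v <= K * K + eps * (b * b)).
    { destruct (Req_dec (Rabs v) b) as [Ev|Ev].
      - specialize (Hbd (u, v) Ev). unfold g. assert (h := Cmod_ge_0 (f (u, v))).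
        assert (v * v <= b * b) by nra.
        assert (eps * (v * v) <= eps * (b * b)) by (apply Rmult_le_compat_l; lra). nra.
      - exfalso. assert (Hv' : Rabs v < b).
        { assert (Rabs v <= b) by (apply Rabs_le; lra). lra. }
        apply Rabs_def2 in Hv'.
        destruct (four_point_mean f (u, v) (Hs (u, v) ltac:(simpl; apply Rabs_le; lra))) as (d & L & Hd & HL & H4).
        set (t := Rmin (d / 2) (Rmin (Rmin (b - v) (b + v)) (eps / (L + 1)))).
        assert (He1 : 0 < eps / (L + 1)) by (apply Rdiv_lt_0_compat; lra).
        assert (Ht : 0 < t) by (unfold t; repeat apply Rmin_pos; lra).
        assert (T1 : t <= d / 2) by apply Rmin_l.
        assert (T2 : t <= b - v) by (eapply Rle_trans; [apply Rmin_r|eapply Rle_trans; [apply Rmin_l|apply Rmin_l]]).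
        assert (T3 : t <= b + v) by (eapply Rle_trans; [apply Rmin_r|eapply Rle_trans; [apply Rmin_l|apply Rmin_r]]).
        assert (T4 : t <= eps / (L + 1)) by (eapply Rle_trans; [apply Rmin_r|apply Rmin_r]).
        assert (T5 : (L + 1) * t <= eps).
        { apply Rmult_le_compat_l with (r := L + 1) in T4; [|lra].
          replace ((L + 1) * (eps / (L + 1))) with eps in T4 by (field; lra). exact T4. }
        specialize (H4 t ltac:(lra)).
        assert (M1 := Hmax' (u + t) v ltac:(lra)). assert (M2 := Hmax' (u + - t) v ltac:(lra)).
        assert (M3 := Hmax' u (v + t) ltac:(lra)). assert (M4 := Hmax' u (v + - t) ltac:(lra)).
        unfold g in M1, M2, M3, M4.
        unfold Cplus in H4. cbn [fst snd] in H4. rewrite !Rplus_0_r in H4.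
        assert (E : eps * ((v + t) * (v + t)) + eps * ((v + - t) * (v + - t)) = 2 * (eps * (v * v)) + 2 * eps * (t * t)) by ring.
        assert (Hcon : 2 * eps * (t * t) <= L * t ^ 3) by lra.
        simpl in Hcon. assert (0 < t * t) by nra. nra. }
    intros [x y] Hz. simpl in Hz. assert (Hy : - b <= y <= b) by (apply Rabs_le_between; auto).
    specialize (Hmax' x y Hy). unfold g in Hmax' at 1. assert (0 <= eps * (y * y)) by nra. lra. }
  intros z Hz.
  assert (Hsq : Cmod (f z) * Cmod (f z) <= K * K).
  { apply (le_of_le_plus_mult _ _ (b * b) 1 Rlt_0_1). intros eps He.
    assert (h := Main eps ltac:(lra) z Hz). lra. }
  assert (h := Cmod_ge_0 (f z)). nra.
Qed.

(** * The exponential of period one *)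

Definition cexp (w : C) : C := (exp (Re w) * cos (Im w), exp (Re w) * sin (Im w)).

Fixpoint exp_poly (n : nat) (z : C) : C :=
  match n with
  | O => RtoC 0
  | S n => (exp_poly n z + RtoC (/ INR (fact n)) * z ^ n)%C
  end.

Lemma cexp_plus (z w : C) : cexp (z + w) = (cexp z * cexp w)%C.
Proof.
  unfold cexp, Cmult, Re, Im. simpl. rewrite exp_plus, cos_plus, sin_plus. f_equal; ring.
Qed.

Lemma Cmod_cexp (z : C) : Cmod (cexp z) = exp (Re z).
Proof.
  apply Rsqr_inj; [apply Cmod_ge_0|apply Rlt_le, exp_pos|]. unfold Rsqr. rewrite Cmod_sq.
  unfold cexp. simpl.
  assert (h := sin2_cos2 (Im z)). unfold Rsqr in h.
  replace (exp (Re z) * cos (Im z) * (exp (Re z) * cos (Im z)) + exp (Re z) * sin (Im z) * (exp (Re z) * sin (Im z)))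
    with (exp (Re z) * exp (Re z) * (sin (Im z) * sin (Im z) + cos (Im z) * cos (Im z))) by ring.
  rewrite h. ring.
Qed.

Lemma poly2_exp_poly (n : nat) : poly2 (fun w => exp_poly n (fst w)).
Proof.
  induction n as [|n IH]; simpl; [constructor|].
  apply (poly2_plus (fun w => exp_poly n (fst w)) (fun w => RtoC (/ INR (fact n)) * fst w ^ n)%C); auto.
  apply (poly2_mult (fun _ => RtoC (/ INR (fact n))) (fun w => fst w ^ n)%C); [constructor|].
  apply poly2_pow. constructor.
Qed.

Lemma exp_monotone (x y : R) : x <= y -> exp x <= exp y.
Proof. intros [H|H]; [apply Rlt_le, exp_increasing; auto|subst; apply Rle_refl]. Qed.

Lemma mean_value_bound (f df : R -> R) (D a b : R) :
  a <= b -> (forall s, a <= s <= b -> is_derive f s (df s) /\ Rabs (df s) <= D) ->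
  Rabs (f b - f a) <= D * (b - a).
Proof.
  intros Hab H. destruct (MVT_gen f a b df) as (c & Hc & E).
  - rewrite Rmin_left, Rmax_right by auto. intros s Hs. apply H. lra.
  - rewrite Rmin_left, Rmax_right by auto. intros s Hs.
    apply derivable_continuous_pt. exists (df s). apply is_derive_Reals. apply H. auto.
  - rewrite Rmin_left, Rmax_right in Hc by auto. rewrite E, Rabs_mult, (Rabs_pos_eq (b - a)) by lra.
    apply Rmult_le_compat_r; [lra|]. apply H. auto.
Qed.

(** Differentiation is along the real parameter of the segment through 0 and [w], separately for
    real and imaginary parts, so that the real mean value theorem applies in [cexp_taylor]. *)
Lemma exp_poly_derive (n : nat) (w : C) (t : R) :
  is_derive (fun t => Re (exp_poly (S n) (RtoC t * w))) t (Re (w * exp_poly n (RtoC t * w))) /\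
  is_derive (fun t => Im (exp_poly (S n) (RtoC t * w))) t (Im (w * exp_poly n (RtoC t * w))).
Proof.
  assert (Pow : forall k t, (RtoC (/ INR (fact k)) * (RtoC t * w) ^ k)%C
     = (RtoC (/ INR (fact k) * t ^ k) * w ^ k)%C).
  { intros k s. rewrite Cpow_mult_l, RtoC_mult, RtoC_pow. ring. }
  induction n as [|n [IH1 IH2]].
  - simpl. split.
    + apply is_derive_ext with (fun _ => 1).
      * intros s. simpl. field.
      * match goal with |- is_derive _ _ ?v => replace v with 0 by ring end. apply (is_derive_const 1 t).
    + apply is_derive_ext with (fun _ => 0).
      * intros s. simpl. field.
      * match goal with |- is_derive _ _ ?v => replace v with 0 by ring end. apply (is_derive_const 0 t).
  - assert (D : is_derive (fun t => / INR (fact (S n)) * t ^ (S n)) t (/ INR (fact n) * t ^ n)).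
    { assert (h := INR_fact_neq_0 n). assert (h2 : INR (S n) <> 0) by (apply not_0_INR; lia).
      auto_derive; auto. change (pred (S n)) with n. 
      change (fact n + n * fact n)%nat with (S n * fact n)%nat. rewrite mult_INR.
      change (match n with | 0%nat => 1 | S _ => INR n + 1 end) with (INR (S n)).
      field. auto. }
    assert (E : forall t, (w * exp_poly (S n) (RtoC t * w))%C =
      (w * exp_poly n (RtoC t * w) + RtoC (/ INR (fact n) * t ^ n) * w ^ S n)%C).
    { intros s. simpl exp_poly. rewrite Pow. simpl Cpow. ring. }
    assert (E2 : forall t, exp_poly (S (S n)) (RtoC t * w) = 
      (exp_poly (S n) (RtoC t * w) + RtoC (/ INR (fact (S n)) * t ^ S n) * w ^ S n)%C).
    { intros s. change (exp_poly (S (S n)) (RtoC s * w)) with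
       (exp_poly (S n) (RtoC s * w) + RtoC (/ INR (fact (S n))) * (RtoC s * w) ^ S n)%C.
      rewrite Pow. reflexivity. }
    assert (Rr : forall r (z : C), Re (RtoC r * z) = r * Re z) by (intros; unfold Re; simpl; ring).
    assert (Ri : forall r (z : C), Im (RtoC r * z) = r * Im z) by (intros; unfold Im; simpl; ring).
    split.
    + apply is_derive_ext with (fun t => Re (exp_poly (S n) (RtoC t * w)) + (/ INR (fact (S n)) * t ^ S n) * Re (w ^ S n)).
      { intros s. rewrite E2, <- Rr. reflexivity. }
      rewrite E. replace (Re (w * exp_poly n (RtoC t * w) + RtoC (/ INR (fact n) * t ^ n) * w ^ S n))
        with (Re (w * exp_poly n (RtoC t * w)) + (/ INR (fact n) * t ^ n) * Re (w ^ S n)) by (rewrite <- Rr; reflexivity).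
      apply (is_derive_plus (fun t => Re (exp_poly (S n) (RtoC t * w)))); auto.
      apply is_derive_Reals. apply is_derive_Reals in D.
      assert (Q := derivable_pt_lim_mult _ (fun _ => Re (w ^ S n)) t _ 0 D (derivable_pt_lim_const _ t)).
      rewrite Rmult_0_r, Rplus_0_r in Q. exact Q.
    + apply is_derive_ext with (fun t => Im (exp_poly (S n) (RtoC t * w)) + (/ INR (fact (S n)) * t ^ S n) * Im (w ^ S n)).
      { intros s. rewrite E2, <- Ri. reflexivity. }
      rewrite E. replace (Im (w * exp_poly n (RtoC t * w) + RtoC (/ INR (fact n) * t ^ n) * w ^ S n))
        with (Im (w * exp_poly n (RtoC t * w)) + (/ INR (fact n) * t ^ n) * Im (w ^ S n)) by (rewrite <- Ri; reflexivity).
      apply (is_derive_plus (fun t => Im (exp_poly (S n) (RtoC t * w)))); auto.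
      apply is_derive_Reals. apply is_derive_Reals in D.
      assert (Q := derivable_pt_lim_mult _ (fun _ => Im (w ^ S n)) t _ 0 D (derivable_pt_lim_const _ t)).
      rewrite Rmult_0_r, Rplus_0_r in Q. exact Q.
Qed.

Lemma cexp_derive (w : C) (t : R) :
  is_derive (fun t => Re (cexp (RtoC t * w))) t (Re (w * cexp (RtoC t * w))) /\
  is_derive (fun t => Im (cexp (RtoC t * w))) t (Im (w * cexp (RtoC t * w))).
Proof.
  destruct w as [u v]. unfold cexp. simpl. split; auto_derive; auto; unfold Rminus; ring.
Qed.

Lemma Cmod_le_Re_Im (z : C) : Cmod z <= Rabs (Re z) + Rabs (Im z).
Proof.
  replace z with (RtoC (Re z) + Ci * RtoC (Im z))%C at 1.
  2:{ destruct z. unfold Ci, RtoC, Cplus, Cmult. simpl. f_equal; ring. }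
  eapply Rle_trans; [apply Cmod_triangle|]. rewrite Cmod_mult, !Cmod_R, Cmod_Ci. lra.
Qed.

Lemma im_le_Cmod (c : C) : Rabs (Im c) <= Cmod c.
Proof. eapply Rle_trans; [|apply Rmax_Cmod]. apply Rmax_r. Qed.

Lemma exp_poly_0 (n : nat) : exp_poly (S n) (RtoC 0) = RtoC 1.
Proof.
  induction n as [|n IH].
  - simpl. rewrite Rinv_1. ring.
  - change (exp_poly (S (S n)) (RtoC 0)) with (exp_poly (S n) (RtoC 0) + RtoC (/ INR (fact (S n))) * RtoC 0 ^ S n)%C.
    rewrite IH. simpl Cpow. ring.
Qed.

(** Induction on [n] along the segment from 0 to [w]: the derivative of the remainder after n + 1
    terms is [w] times the remainder after n terms. Treating real and imaginary parts separately
    costs the factor 2 in each step, and 3 bounds exp(1). *)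
Lemma cexp_taylor (n : nat) (w : C) (t : R) :
  Cmod w <= 1 -> 0 <= t <= 1 ->
  Cmod (cexp (RtoC t * w) - exp_poly n (RtoC t * w)) <= 3 * (2 * Cmod w) ^ n.
Proof.
  intros Hw. revert t. assert (h := Cmod_ge_0 w). induction n as [|n IH]; intros t Ht.
  - simpl. replace (cexp (RtoC t * w) - 0)%C with (cexp (RtoC t * w)) by ring.
    rewrite Cmod_cexp. rewrite Rmult_1_r. eapply Rle_trans; [|exact exp_le_3].
    apply exp_monotone. assert (hr := re_le_Cmod w). assert (hr2 := Rle_abs (Re w)).
    replace (Re (RtoC t * w)) with (t * Re w) by (unfold Re; simpl; ring). nra.
  - set (D := Cmod w * (3 * (2 * Cmod w) ^ n)).
    assert (HD : forall s, 0 <= s <= 1 -> Cmod (w * cexp (RtoC s * w) - w * exp_poly n (RtoC s * w)) <= D).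
    { intros s Hs. replace (w * cexp (RtoC s * w) - w * exp_poly n (RtoC s * w))%C
       with (w * (cexp (RtoC s * w) - exp_poly n (RtoC s * w)))%C by ring.
      rewrite Cmod_mult. apply Rmult_le_compat_l; auto. }
    assert (E0 : (cexp (RtoC 0 * w) - exp_poly (S n) (RtoC 0 * w))%C = RtoC 0).
    { rewrite Cmult_0_l, exp_poly_0. unfold cexp. simpl. rewrite exp_0, cos_0, sin_0.
      unfold RtoC, Cminus, Cplus, Copp. simpl. f_equal; ring. }
    assert (B : Rabs (Re (cexp (RtoC t * w) - exp_poly (S n) (RtoC t * w))) <= D /\
                Rabs (Im (cexp (RtoC t * w) - exp_poly (S n) (RtoC t * w))) <= D).
    { assert (HD0 : 0 <= D) by (eapply Rle_trans; [apply Cmod_ge_0|apply (HD 0); lra]).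
      split.
      - assert (V := mean_value_bound (fun s => Re (cexp (RtoC s * w)) - Re (exp_poly (S n) (RtoC s * w)))
          (fun s => Re (w * cexp (RtoC s * w)) - Re (w * exp_poly n (RtoC s * w))) D 0 t).
        assert (Z : Re (cexp (RtoC 0 * w)) - Re (exp_poly (S n) (RtoC 0 * w)) = 0)
          by (apply (f_equal Re) in E0; exact E0).
        cbv beta in V. rewrite Z, !Rminus_0_r in V.
        eapply Rle_trans; [apply V; [lra|]|nra].
        intros s Hs. split.
        + apply (is_derive_minus (fun s => Re (cexp (RtoC s * w))) (fun s => Re (exp_poly (S n) (RtoC s * w))));
          [apply cexp_derive|apply exp_poly_derive].
        + eapply Rle_trans; [|apply (HD s); lra].
          apply (re_le_Cmod (w * cexp (RtoC s * w) - w * exp_poly n (RtoC s * w))%C).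
      - assert (V := mean_value_bound (fun s => Im (cexp (RtoC s * w)) - Im (exp_poly (S n) (RtoC s * w)))
          (fun s => Im (w * cexp (RtoC s * w)) - Im (w * exp_poly n (RtoC s * w))) D 0 t).
        assert (Z : Im (cexp (RtoC 0 * w)) - Im (exp_poly (S n) (RtoC 0 * w)) = 0)
          by (apply (f_equal Im) in E0; exact E0).
        cbv beta in V. rewrite Z, !Rminus_0_r in V.
        eapply Rle_trans; [apply V; [lra|]|nra].
        intros s Hs. split.
        + apply (is_derive_minus (fun s => Im (cexp (RtoC s * w))) (fun s => Im (exp_poly (S n) (RtoC s * w))));
          [apply cexp_derive|apply exp_poly_derive].
        + eapply Rle_trans; [|apply (HD s); lra].
          apply (im_le_Cmod (w * cexp (RtoC s * w) - w * exp_poly n (RtoC s * w))%C). }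
    eapply Rle_trans; [apply Cmod_le_Re_Im|].
    replace (3 * (2 * Cmod w) ^ S n) with (2 * D) by (unfold D; simpl; ring). lra.
Qed.

Definition expi (z : C) : C := cexp (RtoC (2 * PI) * Ci * z).

Lemma two_PI_pos : 0 < 2 * PI.
Proof. assert (h := PI_RGT_0). lra. Qed.

Lemma expi_plus (z w : C) : expi (z + w) = (expi z * expi w)%C.
Proof. unfold expi. rewrite <- cexp_plus. f_equal. ring. Qed.

Lemma expi_exponent (z : C) : (RtoC (2 * PI) * Ci * z)%C = (- (2 * PI * Im z), 2 * PI * Re z).
Proof. destruct z. unfold Ci, RtoC, Cmult. simpl. f_equal; ring. Qed.

Lemma Cmod_expi (z : C) : Cmod (expi z) = exp (- (2 * PI * Im z)).
Proof. unfold expi. rewrite Cmod_cexp, expi_exponent. reflexivity. Qed.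

Lemma expi_neq_0 (z : C) : expi z <> 0%C.
Proof. apply Cmod_gt_0. rewrite Cmod_expi. apply exp_pos. Qed.

Lemma expi_int (k : Z) : expi (RtoC (IZR k)) = RtoC 1.
Proof.
  unfold expi. rewrite expi_exponent. unfold cexp. simpl.
  replace (- (2 * PI * 0)) with 0 by ring. rewrite exp_0.
  replace (2 * PI * IZR k) with (0 + 2 * IZR k * PI) by ring.
  assert (G : cos (0 + 2 * IZR k * PI) = cos 0 /\ sin (0 + 2 * IZR k * PI) = sin 0).
  { destruct (Z_le_dec 0 k) as [Hk|Hk].
    - rewrite <- (Z2Nat.id k Hk), <- INR_IZR_INZ. split; [apply cos_period|apply sin_period].
    - set (n := Z.to_nat (- k)). assert (En : IZR k = - INR n).
      { unfold n. rewrite INR_IZR_INZ, Z2Nat.id by lia. rewrite opp_IZR. ring. }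
      rewrite En. rewrite <- (cos_period (0 + 2 * - INR n * PI) n), <- (sin_period (0 + 2 * - INR n * PI) n).
      replace (0 + 2 * - INR n * PI + 2 * INR n * PI) with 0 by ring. auto. }
  destruct G as [G1 G2]. rewrite G1, G2, cos_0, sin_0. unfold RtoC. f_equal; ring.
Qed.

Lemma expi_periodic (z : C) : expi (z + 1) = expi z.
Proof. rewrite expi_plus. rewrite (expi_int 1). ring. Qed.

Lemma expi_pow (x : R) (n : nat) : (expi (RtoC x) ^ n)%C = expi (RtoC (INR n * x)).
Proof.
  induction n as [|n IH].
  - simpl. rewrite Rmult_0_l. symmetry. apply (expi_int 0).
  - simpl Cpow. rewrite IH, <- expi_plus, <- RtoC_plus. rewrite S_INR. f_equal. f_equal. ring.
Qed.

Lemma cexp_eq_1 (z : C) : cexp z = RtoC 1 -> Re z = 0 /\ exists k : Z, Im z = 2 * PI * IZR k.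
Proof.
  intros H. assert (Hr : Re z = 0).
  { assert (h := Cmod_cexp z). rewrite H, Cmod_1 in h. symmetry in h.
    rewrite <- exp_0 in h. apply exp_inv in h. exact h. }
  split; auto. unfold cexp in H. rewrite Hr, exp_0 in H. inversion H as [[H1 H2]].
  assert (Hc : cos (Im z) = 1) by lra.
  assert (Hs : sin (Im z / 2) = 0).
  { assert (h := cos_2a_sin (Im z / 2)). replace (2 * (Im z / 2)) with (Im z) in h by field.
    rewrite Hc in h. nra. }
  destruct (sin_eq_0_0 _ Hs) as [k Hk]. exists k. lra.
Qed.

Lemma expi_eq (z w : C) : expi z = expi w -> exists k : Z, z = (w + RtoC (IZR k))%C.
Proof.
  intros H. assert (H1 : expi (z - w) = RtoC 1).
  { assert (E : (expi (z - w) * expi w)%C = expi w) by (rewrite <- expi_plus, <- H; f_equal; ring).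
    assert (E2 : expi (z - w) = (expi (z - w) * expi w / expi w)%C) by (field; apply expi_neq_0).
    rewrite E2, E. field. apply expi_neq_0. }
  unfold expi in H1. apply cexp_eq_1 in H1. rewrite expi_exponent in H1. simpl in H1.
  destruct H1 as [Hr [k Hk]]. exists k. assert (h := two_PI_pos).
  destruct z as [z1 z2], w as [w1 w2]. unfold Cplus, RtoC. simpl in *. 
  f_equal; nra.
Qed.

Lemma smooth1_cexp_0 : smooth1 cexp 0%C.
Proof.
  intros n. exists (fun w => exp_poly n (fst w)), 1, (3 * 2 ^ n).
  split; [apply poly2_exp_poly|]. split; [lra|]. split; [apply Rmult_le_pos; [lra|apply pow_le; lra]|].
  intros w Hw. assert (E : Cmod (fst w) <= nrm w) by (unfold nrm; assert (h := Cmod_ge_0 (snd w)); lra).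
  assert (T := cexp_taylor n (fst w) 1 ltac:(lra) ltac:(lra)).
  rewrite Cmult_1_l in T. simpl. replace (0 + fst w)%C with (fst w) by ring.
  eapply Rle_trans; [exact T|]. rewrite Rpow_mult_distr, Rmult_assoc.
  apply Rmult_le_compat_l; [lra|]. apply Rmult_le_compat_l; [apply pow_le; lra|].
  apply pow_incr. split; auto using Cmod_ge_0.
Qed.

Lemma smooth1_expi (z : C) : smooth1 expi z.
Proof.
  apply (smooth_ext (fun Q => (expi z * cexp (RtoC (2 * PI) * Ci * (fst Q - z)))%C)).
  { intros Q. change (cexp (RtoC (2 * PI) * Ci * (fst Q - z))) with (expi (fst Q - z)).
    rewrite <- expi_plus. f_equal. ring. }
  apply (smooth_mult (fun _ => expi z) (fun Q => cexp (RtoC (2 * PI) * Ci * (fst Q - z)))).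
  - apply (smooth_poly2 (fun _ => expi z)). constructor.
  - apply (smooth1_comp cexp (fun u => RtoC (2 * PI) * Ci * (u - z))%C z).
    + replace (RtoC (2 * PI) * Ci * (z - z))%C with (RtoC 0) by ring. apply smooth1_cexp_0.
    + apply (smooth_poly2 (fun Q => RtoC (2 * PI) * Ci * (fst Q - z))%C).
      apply (poly2_mult (fun _ => RtoC (2 * PI) * Ci)%C (fun Q => fst Q - z)%C); [constructor|].
      apply (poly2_minus (fun Q => fst Q) (fun _ => z)); constructor.
Qed.

(** Shows at once that the zeros of [expi z - e] are isolated and simple, which division by this
    factor uses. *)
Lemma expi_expansive : exists d, 0 < d /\ forall w, Cmod w < d -> Cmod w <= Cmod (expi w - 1).
Proof.
  exists (/ (24 * (2 * PI))). assert (h := two_PI_pos). assert (h3 : 2 <= 2 * PI).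
  { assert (h2 := PI2_3_2). lra. }
  split; [apply Rinv_0_lt_compat; lra|]. intros w Hw.
  set (u := (RtoC (2 * PI) * Ci * w)%C).
  assert (Hu : Cmod u = 2 * PI * Cmod w).
  { unfold u. rewrite !Cmod_mult, Cmod_R, Cmod_Ci, Rabs_pos_eq; lra. }
  assert (hw := Cmod_ge_0 w).
  assert (Hu' : Cmod u < / 24).
  { rewrite Hu. apply Rmult_lt_compat_l with (r := 2 * PI) in Hw; [|lra].
    replace (2 * PI * / (24 * (2 * PI))) with (/ 24) in Hw by (field; lra). exact Hw. }
  assert (T := cexp_taylor 2 u 1 ltac:(lra) ltac:(lra)). rewrite Cmult_1_l in T.
  simpl in T. rewrite Rmult_1_r, Rinv_1 in T.
  fold u in T. change (cexp u) with (expi w) in T.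
  replace (expi w - (0 + 1 * 1 + 1 * (u * 1)))%C with (expi w - 1 - u)%C in T by ring.
  assert (R := Cmod_reverse_triangle u (expi w - 1)).
  rewrite (Cmod_sub_sym u) in R. assert (hu := Cmod_ge_0 u).
  assert (2 * Cmod w <= Cmod u) by (rewrite Hu; apply Rmult_le_compat_r; lra).
  assert (Cmod u * Cmod u <= Cmod u * / 24) by (apply Rmult_le_compat_l; lra).
  lra.
Qed.

(** * Division by the zeros of a function *)

(** Removable singularity. Dividing a jet of [f] by [w] loses one order, which costs nothing as all
    orders are available. The value at [z0] has to suit all orders at once, hence the check [Hc]
    that the constant terms of the divided jets agree. *)
Lemma smooth1_div_linear (f : C -> C) (z0 : C) :
  smooth1 f z0 -> f z0 = 0%C ->
  exists F, smooth1 F z0 /\ forall z, z <> z0 -> F z = (f z / (z - z0))%C.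
Proof.
  intros Hf H0.
  assert (HJ : forall n, exists p1 d K, poly2 p1 /\ 0 < d <= 1 /\ 0 <= K /\
     forall w, Cmod w < d -> Cmod (f (z0 + w)%C - w * p1 (w, RtoC 0)) <= K * Cmod w ^ S n).
  { intros n. destruct (smooth1_poly f z0 (S n) ltac:(lia) Hf) as (p & d & K & Hp & Hd & HK & Hv & Hj).
    destruct (poly2_factor_fst p Hp) as (p1 & Hp1 & E). exists p1, d, K.
    repeat (split; [assumption|]). intros w Hw. specialize (Hj w Hw).
    rewrite E, Hv, H0 in Hj. rewrite Cplus_0_l in Hj. exact Hj. }
  destruct (HJ 1%nat) as (q & dq & Kq & Hq & Hdq & HKq & Hjq).
  destruct (poly2_lipschitz q Hq) as (Lq & HLq & Lipq).
  assert (En : forall w, nrm (w, RtoC 0) = Cmod w) by (intros; unfold nrm; simpl; rewrite Cmod_0; ring).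
  assert (Ed : forall w, nrm_diff (w, RtoC 0) (RtoC 0, RtoC 0) = Cmod w).
  { intros w. unfold nrm_diff. simpl. replace (w - 0)%C with w by ring. replace (0 - 0)%C with (RtoC 0) by ring. apply En. }
  set (c := q (RtoC 0, RtoC 0)).
  assert (Hc : forall n p1 d K, poly2 p1 -> 0 < d <= 1 -> 0 <= K ->
     (forall w, Cmod w < d -> Cmod (f (z0 + w)%C - w * p1 (w, RtoC 0)) <= K * Cmod w ^ S (S n)) ->
     p1 (RtoC 0, RtoC 0) = c).
  { intros n p1 d K Hp1 Hd HK Hj. destruct (poly2_lipschitz p1 Hp1) as (L & HL & Lip).
    assert (E : (p1 (RtoC 0, RtoC 0) - c)%C = RtoC 0).
    { apply Cmod_eq_0. apply Rle_antisym; [|apply Cmod_ge_0].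
      set (e := Rmin d dq). assert (He : 0 < e) by (apply Rmin_pos; lra).
      apply (le_of_le_plus_mult _ _ (K + Kq + L + Lq) e He). intros t Ht.
      assert (Ht1 : t < d) by (eapply Rlt_le_trans; [apply Ht|apply Rmin_l]).
      assert (Ht2 : t < dq) by (eapply Rlt_le_trans; [apply Ht|apply Rmin_r]).
      assert (Et : Cmod (RtoC t) = t) by (rewrite Cmod_R, Rabs_pos_eq; lra).
      specialize (Hj (RtoC t) ltac:(lra)). specialize (Hjq (RtoC t) ltac:(lra)).
      specialize (Lip (RtoC t, RtoC 0) (RtoC 0, RtoC 0) ltac:(rewrite En; lra) ltac:(rewrite nrm_0; lra)).
      specialize (Lipq (RtoC t, RtoC 0) (RtoC 0, RtoC 0) ltac:(rewrite En; lra) ltac:(rewrite nrm_0; lra)).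
      rewrite Ed, Et in Lip, Lipq. rewrite Et in Hj, Hjq. fold c in Lipq.
      assert (A1 : Cmod (RtoC t * p1 (RtoC t, RtoC 0) - RtoC t * q (RtoC t, RtoC 0)) <= (K + Kq) * (t * t)).
      { eapply Rle_trans; [apply (Cmod_triangle3 _ (f (z0 + RtoC t)%C))|].
        rewrite (Cmod_sub_sym _ (f (z0 + RtoC t)%C)).
        assert (t ^ S (S n) <= t * t).
        { assert (t ^ n <= 1) by (apply Rle_trans with (1 ^ n); [apply pow_incr; lra|rewrite pow1; lra]).
          assert (0 <= t ^ n) by (apply pow_le; lra).
          simpl. assert (0 <= t * t) by nra. nra. }
        assert (K * t ^ S (S n) <= K * (t * t)) by (apply Rmult_le_compat_l; lra).
        simpl in *. lra. }
      replace (RtoC t * p1 (RtoC t, RtoC 0) - RtoC t * q (RtoC t, RtoC 0))%C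
        with (RtoC t * (p1 (RtoC t, RtoC 0) - q (RtoC t, RtoC 0)))%C in A1 by ring.
      rewrite Cmod_mult, Et in A1.
      assert (A2 : Cmod (p1 (RtoC t, RtoC 0) - q (RtoC t, RtoC 0)) <= (K + Kq) * t).
      { apply Rmult_le_reg_l with t; [lra|]. lra. }
      assert (T1 := Cmod_triangle3 (p1 (RtoC 0, RtoC 0)) (p1 (RtoC t, RtoC 0)) c).
      assert (T2 := Cmod_triangle3 (p1 (RtoC t, RtoC 0)) (q (RtoC t, RtoC 0)) c).
      rewrite (Cmod_sub_sym (p1 (RtoC 0, RtoC 0)) (p1 (RtoC t, RtoC 0))) in T1. lra. }
    replace (p1 (RtoC 0, RtoC 0)) with ((p1 (RtoC 0, RtoC 0) - c) + c)%C by ring. rewrite E. ring. }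
  exists (fun z => if excluded_middle_informative (z = z0) then c else (f z / (z - z0))%C). split.
  2:{ intros z Hz. destruct (excluded_middle_informative (z = z0)); [contradiction|reflexivity]. }
  apply smooth_of_jets. intros n Hn. destruct n as [|n]; [lia|].
  destruct (HJ (S n)) as (p1 & d & K & Hp1 & Hd & HK & Hj).
  assert (Hpc := Hc n p1 d K Hp1 Hd HK Hj).
  exists (fun w => p1 (fst w, RtoC 0)), d, K.
  split; [apply (poly2_comp p1 (fun w => fst w) (fun _ => RtoC 0)); auto; constructor|].
  split; [lra|]. split; [auto|]. intros w Hw.
  assert (E : Cmod (fst w) <= nrm w) by (unfold nrm; assert (h := Cmod_ge_0 (snd w)); lra).
  assert (Hpw : Cmod (fst w) ^ S n <= nrm w ^ S n) by (apply pow_incr; split; auto using Cmod_ge_0).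
  apply Rle_trans with (K * Cmod (fst w) ^ S n); [|apply Rmult_le_compat_l; auto].
  assert (hw := Cmod_ge_0 (fst w)).
  simpl fst. destruct (excluded_middle_informative ((z0 + fst w)%C = z0)) as [Ez|Ez].
  - assert (Ew : fst w = RtoC 0).
    { replace (fst w) with (z0 + fst w - z0)%C by ring. rewrite Ez. ring. }
    rewrite Ew, Hpc. replace (c - c)%C with (RtoC 0) by ring. rewrite Cmod_0.
    apply Rmult_le_pos; auto. apply pow_le; lra.
  - assert (Ew : fst w <> RtoC 0) by (intros Ew; apply Ez; rewrite Ew; ring).
    assert (Hw0 : 0 < Cmod (fst w)) by (apply Cmod_gt_0; auto).
    specialize (Hj (fst w) ltac:(lra)).
    replace (f (z0 + fst w)%C / (z0 + fst w - z0) - p1 (fst w, RtoC 0))%C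
      with ((f (z0 + fst w)%C - fst w * p1 (fst w, RtoC 0)) * / fst w)%C.
    2:{ replace (z0 + fst w - z0)%C with (fst w) by ring. field. exact Ew. }
    rewrite Cmod_mult, Cmod_inv by exact Ew.
    apply Rmult_le_reg_r with (Cmod (fst w)); auto.
    rewrite Rmult_assoc, Rinv_l by lra. rewrite Rmult_1_r.
    eapply Rle_trans; [exact Hj|]. right. simpl. ring.
Qed.

Lemma smooth1_local (f g : C -> C) (z : C) (d : R) :
  0 < d -> (forall w, Cmod w < d -> f (z + w)%C = g (z + w)%C) -> smooth1 f z -> smooth1 g z.
Proof.
  intros Hd E. apply (smooth_ext_loc _ _ _ d Hd). intros w Hw. simpl. apply E.
  unfold nrm in Hw. assert (h := Cmod_ge_0 (snd w)). lra.
Qed.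

Lemma smooth1_lipschitz (f : C -> C) (z : C) :
  smooth1 f z -> exists d K, 0 < d <= 1 /\ 0 <= K /\
    forall w, Cmod w < d -> Cmod (f (z + w)%C - f z) <= K * Cmod w.
Proof.
  intros H. destruct (smooth_lipschitz _ _ H) as (d & K & Hd & HK & Hl).
  exists d, K. split; [auto|]. split; [auto|]. intros w Hw.
  assert (E : nrm (w, RtoC 0) = Cmod w) by (unfold nrm; simpl; rewrite Cmod_0; ring).
  specialize (Hl (w, RtoC 0)). rewrite E in Hl. apply (Hl Hw).
Qed.

Lemma smooth1_local_nonzero (f : C -> C) (z : C) :
  smooth1 f z -> f z <> 0%C -> exists d, 0 < d /\ forall w, Cmod w < d -> f (z + w)%C <> 0%C.
Proof.
  intros H H0. destruct (smooth1_lipschitz f z H) as (d & K & Hd & HK & Hl).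
  assert (Hf : 0 < Cmod (f z)) by (apply Cmod_gt_0; auto).
  set (e := Rmin d (Cmod (f z) / (2 * (K + 1)))).
  assert (Hq : 0 < Cmod (f z) / (2 * (K + 1))) by (apply Rdiv_lt_0_compat; lra).
  exists e. split; [apply Rmin_pos; lra|]. intros w Hw E.
  assert (W1 : Cmod w < d) by (eapply Rlt_le_trans; [exact Hw|apply Rmin_l]).
  assert (W2 : Cmod w < Cmod (f z) / (2 * (K + 1))) by (eapply Rlt_le_trans; [exact Hw|apply Rmin_r]).
  specialize (Hl w W1). rewrite E in Hl. 
  replace (0 - f z)%C with (- f z)%C in Hl by ring. rewrite Cmod_opp in Hl.
  assert ((K + 1) * Cmod w < Cmod (f z) / 2).
  { replace (Cmod (f z) / 2) with ((K + 1) * (Cmod (f z) / (2 * (K + 1)))) by (field; lra).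
    apply Rmult_lt_compat_l; lra. }
  assert (h := Cmod_ge_0 w). lra.
Qed.

Lemma smooth1_div (f g : C -> C) (z : C) :
  smooth1 f z -> smooth1 g z -> g z <> 0%C -> smooth1 (fun u => (f u / g u)%C) z.
Proof.
  intros Hf Hg H0. apply (smooth_mult (fun Q => f (fst Q)) (fun Q => / g (fst Q))%C); auto.
  apply (smooth_inv (fun Q => g (fst Q))); auto.
Qed.

Lemma smooth1_expi_minus (e z : C) : smooth1 (fun u => (expi u - e)%C) z.
Proof.
  apply (smooth_minus (fun Q => expi (fst Q)) (fun _ => e)).
  - apply smooth1_expi.
  - apply (smooth_poly2 (fun _ => e)). constructor.
Qed.

(** Both [f] and [expi - e] are divided by [z - z0]; the second quotient is bounded away from 0 by
    [expi_expansive], also at [z0] by continuity, so that the ratio of the two is smooth. *)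
Lemma smooth1_quotient_expi (f : C -> C) (e z0 : C) :
  smooth1 f z0 -> expi z0 = e -> f z0 = 0%C ->
  exists v, smooth1 (fun u => if excluded_middle_informative (u = z0) then v else (f u / (expi u - e))%C) z0.
Proof.
  intros Hf He H0.
  destruct (smooth1_div_linear f z0 Hf H0) as (F & HF & EF).
  destruct (smooth1_div_linear (fun u => expi u - e)%C z0 (smooth1_expi_minus e z0)) as (D & HD & ED).
  { rewrite He. ring. }
  destruct expi_expansive as (d & Hd & Hexp).
  assert (Hlow : forall w, w <> RtoC 0 -> Cmod w < d -> Cmod e <= Cmod (D (z0 + w)%C)).
  { intros w Hw Hwd. rewrite ED.
    2:{ intros E. apply Hw. replace w with (z0 + w - z0)%C by ring. rewrite E. ring. }
    replace (z0 + w - z0)%C with w by ring. rewrite expi_plus, He.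
    replace (e * expi w - e)%C with (e * (expi w - 1))%C by ring.
    rewrite Cmod_div by exact Hw. rewrite Cmod_mult.
    assert (Hw0 : 0 < Cmod w) by (apply Cmod_gt_0; auto).
    apply Rmult_le_reg_r with (Cmod w); auto. unfold Rdiv.
    rewrite (Rmult_assoc _ (/ Cmod w)), Rinv_l by lra. rewrite Rmult_1_r.
    apply Rmult_le_compat_l; [apply Cmod_ge_0|]. apply Hexp. auto. }
  assert (He0 : 0 < Cmod e) by (apply Cmod_gt_0; rewrite <- He; apply expi_neq_0).
  assert (HD0 : D z0 <> 0%C).
  { intros E0. destruct (smooth1_lipschitz D z0 HD) as (d1 & K & Hd1 & HK & Hl).
    set (t := Rmin (Rmin d d1 / 2) (Cmod e / (2 * (K + 1)))).
    assert (Hq : 0 < Cmod e / (2 * (K + 1))) by (apply Rdiv_lt_0_compat; lra).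
    assert (Hm : 0 < Rmin d d1) by (apply Rmin_pos; lra).
    assert (Ht : 0 < t) by (unfold t; apply Rmin_pos; lra).
    assert (Ht1 : t <= Rmin d d1 / 2) by apply Rmin_l.
    assert (Ht2 : t <= Cmod e / (2 * (K + 1))) by apply Rmin_r.
    assert (M1 := Rmin_l d d1). assert (M2 := Rmin_r d d1).
    assert (Et : Cmod (RtoC t) = t) by (rewrite Cmod_R, Rabs_pos_eq; lra).
    specialize (Hlow (RtoC t)). rewrite Et in Hlow.
    assert (Hnz : RtoC t <> RtoC 0) by (intros E; apply RtoC_inj in E; lra).
    specialize (Hlow Hnz ltac:(lra)).
    specialize (Hl (RtoC t) ltac:(lra)). rewrite E0, Et in Hl.
    replace (D (z0 + RtoC t) - 0)%C with (D (z0 + RtoC t)%C) in Hl by ring.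
    assert ((K + 1) * t <= Cmod e / 2).
    { replace (Cmod e / 2) with ((K + 1) * (Cmod e / (2 * (K + 1)))) by (field; lra).
      apply Rmult_le_compat_l; lra. }
    lra. }
  exists (F z0 / D z0)%C.
  apply (smooth1_local (fun u => (F u / D u)%C) _ z0 d Hd); [|apply smooth1_div; auto].
  intros w Hw. destruct (excluded_middle_informative ((z0 + w)%C = z0)) as [E|E].
  - rewrite E. reflexivity.
  - assert (Hw0 : w <> RtoC 0) by (intros E2; apply E; rewrite E2; ring).
    assert (Hz : (z0 + w - z0)%C <> RtoC 0) by (replace (z0 + w - z0)%C with w by ring; auto).
    rewrite EF, ED by auto.
    assert (HE : (expi (z0 + w) - e)%C <> RtoC 0).
    { rewrite expi_plus, He. intros E2.
      assert (h := Hexp w Hw). assert (hw : 0 < Cmod w) by (apply Cmod_gt_0; auto).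
      assert (E3 : (e * (expi w - 1))%C = RtoC 0) by (rewrite <- E2; ring).
      apply (f_equal Cmod) in E3. rewrite Cmod_mult, Cmod_0 in E3. nra. }
    field. auto.
Qed.

(** Dividing by [expi z - e] instead of a linear factor removes a zero together with its integer
    translates and keeps the quotient periodic. *)
Lemma divide_expi (f : C -> C) (e : C) (b : R) :
  (forall z, Rabs (Im z) <= b -> smooth1 f z) ->
  (forall z, Rabs (Im z) <= b -> f (z + 1)%C = f z) ->
  (forall z, Rabs (Im z) <= b -> expi z = e -> f z = 0%C) ->
  exists g, (forall z, Rabs (Im z) <= b -> smooth1 g z) /\
    (forall z, Rabs (Im z) <= b -> g (z + 1)%C = g z) /\
    (forall z, Rabs (Im z) <= b -> f z = ((expi z - e) * g z)%C).
Proof.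
  intros Hs Hp Hz.
  set (val := fun z0 => epsilon (inhabits (RtoC 0)) (fun v =>
     smooth1 (fun u => if excluded_middle_informative (u = z0) then v else (f u / (expi u - e))%C) z0)).
  set (g := fun z => if excluded_middle_informative (expi z = e) then val z else (f z / (expi z - e))%C).
  assert (Hg : forall z, Rabs (Im z) <= b -> smooth1 g z).
  { intros z Hzb. destruct (classic (expi z = e)) as [E|E].
    - assert (Hv := epsilon_spec (inhabits (RtoC 0)) _ (smooth1_quotient_expi f e z (Hs z Hzb) E (Hz z Hzb E))).
      fold (val z) in Hv.
      destruct expi_expansive as (d & Hd & Hexp).
      apply (smooth1_local _ g z d Hd) in Hv; auto.
      intros w Hw. unfold g. destruct (excluded_middle_informative ((z + w)%C = z)) as [E2|E2].
      + rewrite E2. destruct (excluded_middle_informative (expi z = e)); [reflexivity|contradiction].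
      + destruct (excluded_middle_informative (expi (z + w) = e)) as [E3|E3]; [|reflexivity].
        exfalso. apply E2. rewrite expi_plus, E in E3.
        assert (Hw0 : Cmod w <= 0).
        { eapply Rle_trans; [apply Hexp; auto|].
          assert (E4 : (expi w - 1)%C = RtoC 0).
          { assert (He : e <> 0%C) by (rewrite <- E; apply expi_neq_0).
            replace (expi w) with (e * expi w / e)%C by (field; auto). rewrite E3. field. auto. }
          rewrite E4, Cmod_0. lra. }
        assert (Ew : w = RtoC 0) by (apply Cmod_eq_0; assert (h := Cmod_ge_0 w); lra).
        rewrite Ew. ring.
    - assert (Hnz : (expi z - e)%C <> RtoC 0).
      { intros E2. apply E. replace (expi z) with ((expi z - e) + e)%C by ring. rewrite E2. ring. }
      destruct (smooth1_local_nonzero _ z (smooth1_expi_minus e z) Hnz) as (d & Hd & Hd').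
      apply (smooth1_local (fun u => (f u / (expi u - e))%C) g z d Hd).
      + intros w Hw. unfold g. destruct (excluded_middle_informative (expi (z + w) = e)) as [E2|E2]; [|reflexivity].
        exfalso. apply (Hd' w Hw). rewrite E2. ring.
      + apply smooth1_div; auto. apply smooth1_expi_minus. }
  exists g. split; [exact Hg|]. split.
  - intros z Hzb. destruct (classic (expi z = e)) as [E|E].
    + assert (Hzb1 : Rabs (Im (z + 1)%C) <= b) by (unfold Im in *; simpl in *; rewrite Rplus_0_r; auto).
      destruct (smooth1_lipschitz g z (Hg z Hzb)) as (d1 & K1 & Hd1 & HK1 & Hl1).
      destruct (smooth1_lipschitz g (z + 1)%C (Hg _ Hzb1)) as (d2 & K2 & Hd2 & HK2 & Hl2).
      destruct expi_expansive as (d & Hd & Hexp).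
      set (e0 := Rmin d (Rmin d1 d2)). assert (He0 : 0 < e0) by (unfold e0; repeat apply Rmin_pos; lra).
      (* The values of [g] at the zeros [z] and [z + 1] were chosen independently; they agree as
         limits of the values at nearby points, where [g] is the actual quotient. *)
      assert (Ez : (g (z + 1) - g z)%C = RtoC 0).
      { apply Cmod_eq_0. apply Rle_antisym; [|apply Cmod_ge_0].
        apply (le_of_le_plus_mult _ _ (K1 + K2) e0 He0). intros t Ht.
        assert (T1 : t < d) by (eapply Rlt_le_trans; [apply Ht|apply Rmin_l]).
        assert (T2 : t < d1) by (eapply Rlt_le_trans; [apply Ht|eapply Rle_trans; [apply Rmin_r|apply Rmin_l]]).
        assert (T3 : t < d2) by (eapply Rlt_le_trans; [apply Ht|eapply Rle_trans; [apply Rmin_r|apply Rmin_r]]).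
        assert (Et : Cmod (RtoC t) = t) by (rewrite Cmod_R, Rabs_pos_eq; lra).
        specialize (Hl1 (RtoC t) ltac:(lra)). specialize (Hl2 (RtoC t) ltac:(lra)).
        rewrite Et in Hl1, Hl2.
        assert (Eg : g (z + 1 + RtoC t)%C = g (z + RtoC t)%C).
        { assert (Ne : expi (z + RtoC t) <> e).
          { rewrite expi_plus, E. intros E3. specialize (Hexp (RtoC t) ltac:(lra)).
            assert (He : e <> 0%C) by (rewrite <- E; apply expi_neq_0).
            assert (E4 : (expi (RtoC t) - 1)%C = RtoC 0).
            { replace (expi (RtoC t)) with (e * expi (RtoC t) / e)%C by (field; auto). rewrite E3. field. auto. }
            rewrite E4, Cmod_0, Et in Hexp. lra. }
          replace (z + 1 + RtoC t)%C with (z + RtoC t + 1)%C by ring.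
          unfold g. rewrite expi_periodic. destruct (excluded_middle_informative (expi (z + RtoC t) = e)); [contradiction|].
          rewrite Hp; [reflexivity|]. unfold Im in *; simpl in *; rewrite Rplus_0_r; auto. }
        rewrite Eg in Hl2.
        assert (T := Cmod_triangle3 (g (z + 1)%C) (g (z + RtoC t)%C) (g z)).
        rewrite (Cmod_sub_sym (g (z + 1)%C) (g (z + RtoC t)%C)) in T. lra. }
      replace (g (z + 1)%C) with ((g (z + 1) - g z) + g z)%C by ring. rewrite Ez. ring.
    + unfold g. rewrite expi_periodic. destruct (excluded_middle_informative (expi z = e)); [contradiction|].
      rewrite Hp; auto.
  - intros z Hzb. unfold g. destruct (excluded_middle_informative (expi z = e)) as [E|E].
    + rewrite (Hz z Hzb E), E. ring.
    + field. intros E2. apply E. replace (expi z) with ((expi z - e) + e)%C by ring. rewrite E2. ring.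
Qed.

Definition prod_sub (l : list C) (Z : C) : C := fold_right (fun e acc => ((Z - e) * acc)%C) (RtoC 1) l.

Lemma prod_sub_app (l l' : list C) (Z : C) : prod_sub (l ++ l') Z = (prod_sub l Z * prod_sub l' Z)%C.
Proof. induction l as [|e l IH]; simpl; [ring|]. rewrite IH. ring. Qed.

(** Distinctness of the points carries the induction: at a later zero the factor already divided out
    does not vanish, so the quotient must. *)
Lemma divide_zeros (l : list C) (b : R) : NoDup l -> forall f,
  (forall z, Rabs (Im z) <= b -> smooth1 f z) ->
  (forall z, Rabs (Im z) <= b -> f (z + 1)%C = f z) ->
  (forall z, Rabs (Im z) <= b -> In (expi z) l -> f z = 0%C) ->
  exists g, (forall z, Rabs (Im z) <= b -> smooth1 g z) /\
    (forall z, Rabs (Im z) <= b -> g (z + 1)%C = g z) /\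
    (forall z, Rabs (Im z) <= b -> f z = (prod_sub l (expi z) * g z)%C).
Proof.
  induction l as [|e l IH]; intros Hl f Hs Hp Hz.
  - exists f. split; auto. split; auto. intros z _. simpl. ring.
  - inversion Hl as [|? ? He Hl']; subst.
    destruct (divide_expi f e b Hs Hp) as (g & Hg & Hgp & Hfg).
    { intros z Hzb E. apply Hz; auto. left; auto. }
    destruct (IH Hl' g Hg Hgp) as (g2 & Hg2 & Hgp2 & Hfg2).
    { intros z Hzb Hin.
      assert (E := Hz z Hzb (or_intror Hin)). rewrite Hfg in E by auto.
      assert (Hnz : (expi z - e)%C <> RtoC 0).
      { intros E2. apply He. replace e with (expi z - (expi z - e))%C by ring. rewrite E2.
        replace (expi z - 0)%C with (expi z) by ring. exact Hin. }
      replace (g z) with ((expi z - e) * g z / (expi z - e))%C by (field; auto). rewrite E. field. auto. }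
    exists g2. split; auto. split; auto. intros z Hzb. rewrite Hfg, Hfg2 by auto. simpl. ring.
Qed.

(** * Products over roots of unity *)

(** Horner form with exactly [n] coefficients, any of which may be zero: the space of polynomials of
    degree less than [n]. *)
Definition deg_lt (n : nat) (f : C -> C) : Prop :=
  exists l, length l = n /\ forall z, f z = fold_right (fun c acc => (c + z * acc)%C) (RtoC 0) l.

Lemma deg_lt_ext (n : nat) (f g : C -> C) : (forall z, f z = g z) -> deg_lt n f -> deg_lt n g.
Proof. intros E (l & Hl & H). exists l. split; auto. intros z. rewrite <- E. auto. Qed.

Lemma deg_lt_plus (n : nat) (f g : C -> C) :
  deg_lt n f -> deg_lt n g -> deg_lt n (fun z => (f z + g z)%C).
Proof.
  intros (l & Hl & Hf) (l' & Hl' & Hg). revert n f g l' Hl Hf Hl' Hg.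
  induction l as [|c l IH]; intros n f g l' Hl Hf Hl' Hg.
  - simpl in Hl. subst n. destruct l'; [|discriminate]. exists nil. split; auto.
    intros z. rewrite Hf, Hg. simpl. ring.
  - simpl in Hl. subst n. destruct l' as [|c' l']; [discriminate|]. simpl in Hl'. injection Hl' as Hl'.
    destruct (IH (length l) _ _ l' eq_refl (fun z => eq_refl) Hl' (fun z => eq_refl)) as (m & Hm & E).
    exists ((c + c')%C :: m). split; [simpl; auto|]. intros z. rewrite Hf, Hg. simpl. rewrite <- E. ring.
Qed.

Lemma deg_lt_scal (n : nat) (a : C) (f : C -> C) : deg_lt n f -> deg_lt n (fun z => (a * f z)%C).
Proof.
  intros (l & Hl & Hf). exists (map (fun c => a * c)%C l). split; [rewrite length_map; auto|].
  intros z. rewrite Hf. clear Hl Hf. induction l as [|c l IH]; simpl; [ring|]. rewrite <- IH. ring.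
Qed.

Lemma deg_lt_mulX (n : nat) (f : C -> C) : deg_lt n f -> deg_lt (S n) (fun z => (z * f z)%C).
Proof.
  intros (l & Hl & Hf). exists (RtoC 0 :: l). split; [simpl; auto|]. intros z. simpl. rewrite Hf. ring.
Qed.

Lemma deg_lt_0 (n : nat) : deg_lt n (fun _ => RtoC 0).
Proof.
  induction n as [|n IH]; [exists nil; auto|].
  apply (deg_lt_ext _ (fun z => z * 0)%C); [intros; ring|]. apply (deg_lt_mulX n (fun _ => RtoC 0)); auto.
Qed.

Lemma deg_lt_S (n : nat) (f : C -> C) : deg_lt n f -> deg_lt (S n) f.
Proof.
  intros (l & Hl & Hf). exists (l ++ RtoC 0 :: nil). split.
  - rewrite length_app. simpl. lia.
  - intros z. rewrite Hf. clear Hl Hf. induction l as [|c l IH]; simpl; [ring|]. rewrite IH. reflexivity.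
Qed.

Lemma deg_lt_pow (n : nat) : deg_lt (S n) (fun z => (z ^ n)%C).
Proof.
  induction n as [|n IH].
  - exists (RtoC 1 :: nil). split; auto. intros z. simpl. ring.
  - apply (deg_lt_mulX (S n) (fun z => z ^ n)%C IH).
Qed.

Lemma deg_lt_factor (n : nat) (f : C -> C) (a : C) :
  deg_lt (S n) f -> exists g, deg_lt n g /\ forall z, (f z - f a = (z - a) * g z)%C.
Proof.
  revert f. induction n as [|n IH]; intros f ([|c l] & Hl & Hf); try discriminate.
  - destruct l; [|discriminate]. exists (fun _ => RtoC 0). split; [apply deg_lt_0|].
    intros z. rewrite !Hf. simpl. ring.
  - simpl in Hl. injection Hl as Hl.
    set (h := fun z => fold_right (fun c acc => (c + z * acc)%C) (RtoC 0) l).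
    assert (Hh : deg_lt (S n) h) by (exists l; auto).
    destruct (IH h Hh) as (g & Hg & E).
    exists (fun z => h z + a * g z)%C. split.
    + apply (deg_lt_plus (S n) h (fun z => a * g z)%C); auto. apply deg_lt_S. apply deg_lt_scal; auto.
    + intros z. rewrite !Hf. simpl. fold (h z). fold (h a). specialize (E z).
      replace (c + z * h z - (c + a * h a))%C with ((z - a) * h z + a * (h z - h a))%C by ring.
      rewrite E. ring.
Qed.

Lemma deg_lt_roots (l : list C) : NoDup l -> forall f,
  deg_lt (length l) f -> (forall a, In a l -> f a = 0%C) -> forall z, f z = 0%C.
Proof.
  induction l as [|a l IH]; intros Hl f Hf H0 z.
  - destruct Hf as ([|? ?] & Hn & E); [|discriminate]. rewrite E. reflexivity.
  - inversion Hl as [|? ? Ha Hl']; subst.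
    destruct (deg_lt_factor (length l) f a Hf) as (g & Hg & E).
    rewrite (H0 a) in E by (left; auto).
    assert (Eg : forall z, g z = 0%C).
    { apply (IH Hl' g Hg). intros u Hu. specialize (E u). rewrite (H0 u) in E by (right; auto).
      assert (Hn : (u - a)%C <> RtoC 0).
      { intros E2. apply Ha. replace a with (u - (u - a))%C by ring. rewrite E2.
        replace (u - 0)%C with u by ring. exact Hu. }
      replace (g u) with ((u - a) * g u / (u - a))%C by (field; auto). rewrite <- E. field. auto. }
    replace (f z) with (f z - 0)%C by ring. rewrite E, Eg. ring.
Qed.

Lemma prod_sub_monic (l : list C) :
  deg_lt (length l) (fun z => (prod_sub l z - z ^ length l)%C).
Proof.
  induction l as [|a l IH].
  - exists nil. split; auto. intros z. simpl. ring.
  - simpl length. set (n := length l) in *.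
    apply (deg_lt_ext _ (fun z => z * (prod_sub l z - z ^ n)
       + ((- a) * (prod_sub l z - z ^ n) + (- a) * z ^ n))%C).
    { intros z. simpl. ring. }
    apply (deg_lt_plus (S n) (fun z => z * (prod_sub l z - z ^ n))%C
       (fun z => (- a) * (prod_sub l z - z ^ n) + (- a) * z ^ n)%C).
    + apply (deg_lt_mulX n (fun z => prod_sub l z - z ^ n)%C IH).
    + apply (deg_lt_plus (S n) (fun z => (- a) * (prod_sub l z - z ^ n))%C (fun z => (- a) * z ^ n)%C).
      * apply (deg_lt_scal (S n) (- a)%C (fun z => prod_sub l z - z ^ n)%C). apply deg_lt_S, IH.
      * apply (deg_lt_scal (S n) (- a)%C (fun z => z ^ n)%C). apply deg_lt_pow.
Qed.

(** The difference of the two sides has degree less than the number of points and vanishes at all of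
    them. The list is nonempty so that the constant [c] has admissible degree. *)
Lemma prod_sub_roots (l : list C) (c : C) :
  NoDup l -> l <> nil -> (forall a, In a l -> (a ^ length l)%C = c) ->
  forall z, prod_sub l z = (z ^ length l - c)%C.
Proof.
  intros Hl Hne Ha z.
  assert (G : (prod_sub l z - z ^ length l + c)%C = 0%C).
  { apply (deg_lt_roots l Hl (fun z => prod_sub l z - z ^ length l + c)%C).
    - apply (deg_lt_plus _ (fun z => prod_sub l z - z ^ length l)%C (fun _ => c)); [apply prod_sub_monic|].
      destruct l as [|a l]; [contradiction|]. simpl length.
      clear. induction (length l) as [|n IH].
      + exists (c :: nil). split; auto. intros z. simpl. ring.
      + apply deg_lt_S, IH.
    - intros a Hin. rewrite (Ha a Hin).
      assert (E : prod_sub l a = 0%C).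
      { clear -Hin. induction l as [|e l IH]; [destruct Hin|]. simpl. destruct Hin as [->|Hin]; [ring|].
        rewrite IH by auto. ring. }
      rewrite E. ring. }
  replace (prod_sub l z) with ((prod_sub l z - z ^ length l + c) + (z ^ length l - c))%C by ring.
  rewrite G. ring.
Qed.

(** * Functions with many real zeros *)

Definition expi_seq (x : nat -> R) (N : nat) : list C := map (fun j => expi (RtoC (x j))) (seq 0 N).

(** Each factor changes by a ratio of at most 1 + tau / k. With [tau] of order 1/N and N factors the
    total cost is bounded, so that deviations of size A/N from a rotation are harmless. *)
Lemma prod_sub_compare (a b : nat -> C) (l : list nat) (Z : C) (tau k : R) :
  0 < k -> 0 <= tau ->
  (forall j, In j l -> k <= Cmod (Z - b j) /\ Cmod (a j - b j) <= tau) ->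
  Cmod (prod_sub (map a l) Z) <= Cmod (prod_sub (map b l) Z) * (1 + tau / k) ^ length l.
Proof.
  intros Hk Ht H. induction l as [|j l IH].
  - simpl. rewrite Cmod_1. lra.
  - simpl. rewrite !Cmod_mult.
    destruct (H j (or_introl eq_refl)) as [H1 H2].
    assert (IH' := IH (fun i Hi => H i (or_intror Hi))).
    assert (A : Cmod (Z - a j) <= Cmod (Z - b j) * (1 + tau / k)).
    { eapply Rle_trans; [apply (Cmod_triangle3 Z (b j) (a j))|].
      rewrite (Cmod_sub_sym (b j)).
      assert (tau <= Cmod (Z - b j) * (tau / k)).
      { replace tau with (k * (tau / k)) at 1 by (field; lra). apply Rmult_le_compat_r; auto.
        apply Rdiv_le_0_compat; lra. }
      lra. }
    eapply Rle_trans; [apply Rmult_le_compat; [apply Cmod_ge_0|apply Cmod_ge_0|exact A|exact IH']|].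
    right. ring.
Qed.

Lemma pow_one_plus_le_exp (t : R) (N : nat) : 0 <= t -> (1 <= N)%nat -> (1 + t / INR N) ^ N <= exp t.
Proof.
  intros Ht HN. assert (HN' : 0 < INR N) by (apply lt_0_INR; lia).
  assert (Hq : 0 <= t / INR N) by (apply Rdiv_le_0_compat; lra).
  apply Rle_trans with (exp (t / INR N) ^ N).
  - apply pow_incr. split; [lra|]. apply exp_ineq1_le.
  - right. rewrite <- exp_pow || idtac.
    assert (G : forall n x, exp x ^ n = exp (INR n * x)).
    { induction n as [|n IH]; intros x; [simpl; rewrite Rmult_0_l, exp_0; reflexivity|].
      simpl pow. rewrite IH, <- exp_plus, S_INR. f_equal. ring. }
    rewrite G. f_equal. field. lra.
Qed.

Lemma exp_INR_mult (n : nat) (x : R) : exp (INR n * x) = exp x ^ n.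
Proof.
  induction n as [|n IH]; [simpl; rewrite Rmult_0_l, exp_0; reflexivity|].
  simpl pow. rewrite <- IH, <- exp_plus, S_INR. f_equal. ring.
Qed.

Lemma Cmod_expi_real (x : R) : Cmod (expi (RtoC x)) = 1.
Proof. rewrite Cmod_expi. simpl. rewrite Rmult_0_r, Ropp_0. apply exp_0. Qed.

Lemma expi_real_lipschitz (x y : R) :
  Cmod (expi (RtoC x) - expi (RtoC y)) <= 4 * PI * Rabs (x - y).
Proof.
  assert (hp := two_PI_pos).
  assert (V : forall f df : R -> R, (forall s, is_derive f s (df s) /\ Rabs (df s) <= 2 * PI) ->
     Rabs (f x - f y) <= 2 * PI * Rabs (x - y)).
  { intros f df H. destruct (Rle_dec x y) as [Hxy|Hxy].
    - rewrite (Rabs_minus_sym (f x)), (Rabs_minus_sym x), (Rabs_pos_eq (y - x)) by lra.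
      apply (mean_value_bound f df); auto.
    - rewrite (Rabs_pos_eq (x - y)) by lra. apply (mean_value_bound f df); auto. lra. }
  assert (F : forall s, expi (RtoC s) = (cos (2 * PI * s), sin (2 * PI * s))).
  { intros s. unfold expi. rewrite expi_exponent. unfold cexp. simpl.
    rewrite Rmult_0_r, Ropp_0, exp_0, !Rmult_1_l. reflexivity. }
  eapply Rle_trans; [apply Cmod_le_Re_Im|]. rewrite !F. simpl.
  assert (A : Rabs (cos (2 * PI * x) - cos (2 * PI * y)) <= 2 * PI * Rabs (x - y)).
  { apply (V (fun s => cos (2 * PI * s)) (fun s => - (2 * PI) * sin (2 * PI * s))).
    intros s. split; [auto_derive; auto; ring|].
    rewrite Rabs_mult, Rabs_Ropp, (Rabs_pos_eq (2 * PI)) by lra.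
    assert (h := SIN_bound (2 * PI * s)). assert (Rabs (sin (2 * PI * s)) <= 1) by (apply Rabs_le; lra). nra. }
  assert (B : Rabs (sin (2 * PI * x) - sin (2 * PI * y)) <= 2 * PI * Rabs (x - y)).
  { apply (V (fun s => sin (2 * PI * s)) (fun s => (2 * PI) * cos (2 * PI * s))).
    intros s. split; [auto_derive; auto; ring|].
    rewrite Rabs_mult, (Rabs_pos_eq (2 * PI)) by lra.
    assert (h := COS_bound (2 * PI * s)). assert (Rabs (cos (2 * PI * s)) <= 1) by (apply Rabs_le; lra). nra. }
  unfold Rminus in *. lra.
Qed.

Lemma expi_seq_length (x : nat -> R) (N : nat) : length (expi_seq x N) = N.
Proof. unfold expi_seq. rewrite length_map, length_seq. reflexivity. Qed.

Definition apart (x y : nat -> R) (N : nat) : Prop :=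
  forall j k (n : Z), (j < N)%nat -> (k < N)%nat -> x j <> y k + IZR n.

Definition mod1_injective (x : nat -> R) (N : nat) : Prop :=
  forall j k (n : Z), (j < N)%nat -> (k < N)%nat -> x j = x k + IZR n -> j = k.

Lemma expi_real_eq (x y : R) : expi (RtoC x) = expi (RtoC y) -> exists n : Z, x = y + IZR n.
Proof.
  intros H. destruct (expi_eq _ _ H) as [n Hn]. exists n.
  rewrite <- RtoC_plus in Hn. apply RtoC_inj in Hn. exact Hn.
Qed.

Lemma expi_seq_NoDup (x : nat -> R) (N : nat) : mod1_injective x N -> NoDup (expi_seq x N).
Proof.
  intros H. unfold expi_seq.
  assert (G : forall l, NoDup l -> (forall j, In j l -> (j < N)%nat) ->
    NoDup (map (fun j => expi (RtoC (x j))) l)).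
  { induction l as [|j l IH]; intros Hl Hb; simpl; [constructor|].
    inversion Hl as [|? ? Hj Hl']; subst. constructor.
    - intros Hin. apply in_map_iff in Hin. destruct Hin as (k & E & Hk).
      destruct (expi_real_eq _ _ E) as [n Hn].
      apply Hj. replace j with k; auto.
      apply (H k j n); auto; apply Hb; simpl; auto.
    - apply IH; auto. intros k Hk. apply Hb. right; auto. }
  apply G; [apply seq_NoDup|]. intros j Hj. apply in_seq in Hj. lia.
Qed.

Lemma rotation_mod1_injective (c : R) (m : Z) (N : nat) :
  (1 <= N)%nat -> rel_prime m (Z.of_nat N) ->
  mod1_injective (fun j => c + INR j * IZR m / INR N) N.
Proof.
  intros HN Hm j k n Hj Hk E.
  assert (HN' : INR N <> 0) by (apply not_0_INR; lia).
  assert (E2 : (Z.of_nat j * m = Z.of_nat k * m + n * Z.of_nat N)%Z).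
  { apply eq_IZR. rewrite plus_IZR, !mult_IZR, <- !INR_IZR_INZ.
    apply (f_equal (fun t => (t - c) * INR N)) in E.
    field_simplify in E; auto. lra. }
  assert (D : (Z.of_nat N | m * (Z.of_nat j - Z.of_nat k))%Z) by (exists n; lia).
  apply Gauss in D; [|apply rel_prime_sym; exact Hm].
  destruct D as [t Ht]. assert (t = 0%Z) by nia. lia.
Qed.

(** Coprimality makes the points of the rotation orbit all the N-th roots of one number of modulus
    1, so that their product is known exactly. *)
Lemma rotation_product (c : R) (m : Z) (N : nat) (Z0 : C) :
  (1 <= N)%nat -> rel_prime m (Z.of_nat N) ->
  prod_sub (expi_seq (fun j => c + INR j * IZR m / INR N) N) Z0
    = (Z0 ^ N - expi (RtoC (INR N * c)))%C.
Proof.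
  intros HN Hm.
  rewrite (prod_sub_roots _ (expi (RtoC (INR N * c)))).
  - rewrite expi_seq_length. reflexivity.
  - apply expi_seq_NoDup, rotation_mod1_injective; auto.
  - intros E. apply (f_equal (@length C)) in E. rewrite expi_seq_length in E. simpl in E. lia.
  - intros a Ha. rewrite expi_seq_length. unfold expi_seq in Ha. apply in_map_iff in Ha.
    destruct Ha as (j & <- & _). rewrite expi_pow.
    replace (INR N * (c + INR j * IZR m / INR N)) with (INR N * c + IZR (Z.of_nat j * m)).
    2:{ rewrite mult_IZR, <- INR_IZR_INZ. field. apply not_0_INR. lia. }
    rewrite RtoC_plus, expi_plus, expi_int. ring.
Qed.

Definition near_rotation (x : nat -> R) (m : Z) (N : nat) (A : R) : Prop :=
  forall j, (j < N)%nat -> Rabs (x j - (x 0%nat + INR j * IZR m / INR N)) <= A / INR N.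

Lemma near_rotation_product (x : nat -> R) (m : Z) (N : nat) (A k : R) (Z0 : C) :
  (1 <= N)%nat -> rel_prime m (Z.of_nat N) -> 0 <= A -> near_rotation x m N A ->
  0 < k -> k <= Rabs (Cmod Z0 - 1) ->
  Cmod (prod_sub (expi_seq x N) Z0)
    <= Cmod (Z0 ^ N - expi (RtoC (INR N * x 0%nat))) * exp (4 * PI * A / k) /\
  Cmod (Z0 ^ N - expi (RtoC (INR N * x 0%nat)))
    <= Cmod (prod_sub (expi_seq x N) Z0) * exp (4 * PI * A / k).
Proof.
  intros HN Hm HA Hx Hk HZ.
  rewrite <- (rotation_product (x 0%nat) m N Z0 HN Hm).
  assert (HN' : 0 < INR N) by (apply lt_0_INR; lia).
  set (a := fun j => expi (RtoC (x j))).
  set (b := fun j => expi (RtoC (x 0%nat + INR j * IZR m / INR N))).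
  assert (Hpi := two_PI_pos).
  set (tau := 4 * PI * A / INR N).
  assert (Htau : 0 <= tau) by (apply Rdiv_le_0_compat; [apply Rmult_le_pos; lra|lra]).
  assert (Hab : forall j, In j (seq 0 N) -> Cmod (a j - b j) <= tau).
  { intros j Hj. apply in_seq in Hj. eapply Rle_trans; [apply expi_real_lipschitz|].
    unfold tau. replace (4 * PI * A / INR N) with (4 * PI * (A / INR N)) by (field; lra).
    apply Rmult_le_compat_l; [lra|]. apply Hx. lia. }
  assert (Hfar : forall t, k <= Cmod (Z0 - expi (RtoC t))).
  { intros t. eapply Rle_trans; [exact HZ|]. rewrite <- (Cmod_expi_real t).
    apply Rabs_le. assert (h1 := Cmod_reverse_triangle Z0 (expi (RtoC t))).
    assert (h2 := Cmod_reverse_triangle (expi (RtoC t)) Z0). rewrite Cmod_sub_sym in h2. lra. }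
  assert (Hexp : (1 + tau / k) ^ length (seq 0 N) <= exp (4 * PI * A / k)).
  { rewrite length_seq. replace (tau / k) with ((4 * PI * A / k) / INR N) by (unfold tau; field; lra).
    apply pow_one_plus_le_exp; auto. apply Rdiv_le_0_compat; auto. apply Rmult_le_pos; lra. }
  split.
  - eapply Rle_trans; [apply (prod_sub_compare a b (seq 0 N) Z0 tau k Hk Htau)|].
    + intros j Hj. split; auto. apply Hfar.
    + apply Rmult_le_compat_l; [apply Cmod_ge_0|exact Hexp].
  - eapply Rle_trans; [apply (prod_sub_compare b a (seq 0 N) Z0 tau k Hk Htau)|].
    + intros j Hj. split; [apply Hfar|]. rewrite Cmod_sub_sym. auto.
    + apply Rmult_le_compat_l; [apply Cmod_ge_0|exact Hexp].
Qed.

Lemma Cmod_sub_radial (Z0 e : C) (lam : R) :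
  1 <= lam -> Cmod Z0 = 1 -> Cmod e = 1 -> Cmod (Z0 - e) <= Cmod (RtoC lam * Z0 - e).
Proof.
  intros Hl HZ He. apply Rsqr_incr_0; try apply Cmod_ge_0. unfold Rsqr. rewrite !Cmod_sq.
  assert (H1 := Cmod_sq Z0). assert (H2 := Cmod_sq e). rewrite HZ in H1. rewrite He in H2.
  destruct Z0 as [p q], e as [r s]. simpl in *.
  assert (S1 := Rle_0_sqr (p - r)). assert (S2 := Rle_0_sqr (q - s)). unfold Rsqr in S1, S2.
  assert (p * r + q * s <= 1) by lra.
  replace ((lam * p - 0 * q + - r) * (lam * p - 0 * q + - r) + (lam * q + 0 * p + - s) * (lam * q + 0 * p + - s))
    with (lam * lam * (p * p + q * q) - 2 * lam * (p * r + q * s) + (r * r + s * s)) by ring.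
  replace ((p + - r) * (p + - r) + (q + - s) * (q + - s))
    with ((p * p + q * q) - 2 * (p * r + q * s) + (r * r + s * s)) by ring.
  nra.
Qed.

(** The comparison with a rotation breaks down on the unit circle, where the zeros lie. Moving the
    point outwards to radius [lam] does not decrease its distance to any point of the circle, and
    there the comparison holds. *)
Lemma prod_sub_radial (l : list C) (Z0 : C) (lam : R) :
  1 <= lam -> Cmod Z0 = 1 -> (forall e, In e l -> Cmod e = 1) ->
  Cmod (prod_sub l Z0) <= Cmod (prod_sub l (RtoC lam * Z0)).
Proof.
  intros Hl HZ He. induction l as [|e l IH]; simpl; [apply Rle_refl|]. rewrite !Cmod_mult.
  apply Rmult_le_compat; try apply Cmod_ge_0.
  - apply Cmod_sub_radial; auto. apply He. left; auto.
  - apply IH. intros e' He'. apply He. right; auto.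
Qed.

(* The quotient [k = h E^N / prod (E - E_j)] is estimated on the boundary of the
   strip, hence inside. The zeros are close to two orbits of a rotation, so each
   half of the product is within a constant factor of [E^N - c]. *)
Lemma many_zeros_bound (alpha b A : R) :
  0 < alpha < b -> 0 <= A ->
  exists K, 0 < K /\ forall (N : nat) (m : Z) (h : C -> C) (x y : nat -> R),
    (1 <= N)%nat -> rel_prime m (Z.of_nat N) ->
    (forall z, Rabs (Im z) <= b -> smooth1 h z) ->
    (forall z, Rabs (Im z) <= b -> h (z + 1)%C = h z) ->
    (forall z, Rabs (Im z) <= b -> Cmod (h z) <= 1) ->
    (forall j, (j < N)%nat -> h (RtoC (x j)) = 0%C) ->
    (forall j, (j < N)%nat -> h (RtoC (y j)) = 0%C) ->
    near_rotation x m N A -> near_rotation y m N A ->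
    mod1_injective x N -> mod1_injective y N -> apart x y N ->
    forall t : R, Cmod (h (RtoC t)) <= K * exp (- (2 * PI * alpha * INR N)).
Proof.
  intros Hab HA. assert (Hpi := two_PI_pos).
  set (mu := exp (- (2 * PI * b))).
  (* The radius is chosen so that the two products, each of size lam^N, turn the gain exp(-2 pi b N)
     into exp(-2 pi alpha N). *)
  set (lam := exp (PI * (b - alpha))).
  assert (Hmu0 : 0 < mu) by apply exp_pos.
  assert (Hmu1 : mu < 1).
  { unfold mu. rewrite <- exp_0. apply exp_increasing. assert (0 < 2 * PI * b) by (apply Rmult_lt_0_compat; lra). lra. }
  assert (Hlam : 1 < lam).
  { unfold lam. rewrite <- exp_0. apply exp_increasing. apply Rmult_lt_0_compat; lra. }
  (* A lower bound for the distance to 1 of the moduli at which products are compared: mu and 1/mu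
     on the edges of the strip, and lam. *)
  set (k := Rmin (1 - mu) (lam - 1)).
  assert (Hk : 0 < k) by (apply Rmin_pos; lra).
  assert (Hk1 : k <= 1 - mu) by apply Rmin_l. assert (Hk2 : k <= lam - 1) by apply Rmin_r.
  set (Q := exp (4 * PI * A / k)).
  assert (HQ : 0 < Q) by apply exp_pos.
  set (D := Q / (1 - mu)). assert (HD : 0 < D) by (apply Rdiv_lt_0_compat; lra).
  exists (4 * (D * Q) * (D * Q)). split.
  { assert (0 < D * Q) by (apply Rmult_lt_0_compat; auto).
    apply Rmult_lt_0_compat; auto. apply Rmult_lt_0_compat; lra. }
  intros N m h x y HN Hm Hs Hp Hb Hx0 Hy0 Hnx Hny Hix Hiy Hxy t.
  set (l := expi_seq x N ++ expi_seq y N).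
  assert (Hl : NoDup l).
  { unfold l. apply NoDup_app; [apply expi_seq_NoDup; auto|apply expi_seq_NoDup; auto|].
    intros e He1 He2. unfold expi_seq in *. apply in_map_iff in He1. apply in_map_iff in He2.
    destruct He1 as (j & E1 & Hj). destruct He2 as (i & E2 & Hi).
    apply in_seq in Hj. apply in_seq in Hi.
    rewrite <- E2 in E1. destruct (expi_real_eq _ _ E1) as [n Hn].
    apply (Hxy j i n); auto; lia. }
  assert (Hpint : forall (n : Z) z, Rabs (Im z) <= b -> h (z + RtoC (IZR n))%C = h z).
  { assert (Hn : forall (n : nat) z, Rabs (Im z) <= b -> h (z + RtoC (INR n))%C = h z).
    { induction n as [|n IH]; intros z Hz.
      - simpl. f_equal. ring.
      - rewrite S_INR, RtoC_plus. replace (z + (RtoC (INR n) + RtoC 1))%C with ((z + RtoC (INR n)) + 1)%C by ring.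
        rewrite Hp, IH; auto. unfold Im in *. simpl in *. rewrite Rplus_0_r. auto. }
    intros n z Hz. destruct (Z_le_dec 0 n) as [H0|H0].
    - rewrite <- (Z2Nat.id n H0), <- INR_IZR_INZ. apply Hn; auto.
    - rewrite <- (Hn (Z.to_nat (- n)) (z + RtoC (IZR n))%C).
      + f_equal. rewrite INR_IZR_INZ, Z2Nat.id, opp_IZR, RtoC_opp by lia. ring.
      + unfold Im in *. simpl in *. rewrite Rplus_0_r. auto. }
  assert (Him : forall r, Rabs (Im (RtoC r)) <= b) by (intros r; simpl; rewrite Rabs_R0; lra).
  destruct (divide_zeros l b Hl h Hs Hp) as (g & Hg & Hgp & Hfg).
  { intros z Hz Hin. unfold l in Hin. apply in_app_or in Hin.
    destruct Hin as [Hin|Hin]; unfold expi_seq in Hin; apply in_map_iff in Hin;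
      destruct Hin as (j & E & Hj); apply in_seq in Hj; symmetry in E;
      destruct (expi_eq _ _ E) as [n Hn]; rewrite Hn, Hpint by apply Him.
    - apply Hx0. lia. - apply Hy0. lia. }
  (* The product of the 2 N factors has size 1 on the upper edge and mu^(-2N) on the lower one;
     multiplying the quotient by expi^N makes both edges yield the same bound mu^N, up to a
     constant. *)
  set (G := fun z => (g z * expi z ^ N)%C).
  assert (Hmax : forall z, Rabs (Im z) <= b -> Cmod (G z) <= mu ^ N * (D * D)).
  { assert (HmuN : 0 < mu ^ N) by (apply pow_lt; auto).
    assert (HmuN1 : mu ^ N <= mu).
    { destruct N as [|N]; [lia|]. simpl. 
      assert (mu ^ N <= 1) by (apply Rle_trans with (1 ^ N); [apply pow_incr; lra|rewrite pow1; lra]). nra. }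
    apply strip_max_principle; [lra|apply Rmult_le_pos; [lra|nra]| | |].
    - intros z Hz. apply (smooth_mult (fun Q => g (fst Q)) (fun Q => expi (fst Q) ^ N)%C); [apply Hg; auto|].
      clear. induction N as [|N IH]; simpl.
      + apply (smooth_poly2 (fun _ => RtoC 1)). constructor.
      + apply (smooth_mult (fun Q => expi (fst Q)) (fun Q => expi (fst Q) ^ N)%C); auto. apply smooth1_expi.
    - intros z Hz. unfold G. rewrite Hgp, expi_periodic by auto. reflexivity.
    - intros z Hz.
      assert (Hzb : Rabs (Im z) <= b) by lra.
      assert (Hprod := Hfg z Hzb). apply (f_equal Cmod) in Hprod. unfold l in Hprod.
      rewrite prod_sub_app, !Cmod_mult in Hprod.
      assert (Hh1 := Hb z Hzb). unfold G. rewrite Cmod_mult, Cmod_pow.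
      set (r := Cmod (expi z)) in *.
      assert (Hr : r = mu \/ r = / mu).
      { unfold r. rewrite Cmod_expi. destruct (Rcase_abs (Im z)) as [Hn|Hn].
        - right. rewrite Rabs_left in Hz by auto. unfold mu. rewrite <- exp_Ropp. f_equal.
          rewrite <- Hz. ring.
        - left. rewrite Rabs_pos_eq in Hz by lra. unfold mu. f_equal. rewrite Hz. reflexivity. }
      assert (Himu : 1 < / mu) by (rewrite <- Rinv_1; apply Rinv_lt_contravar; lra).
      assert (Hfar : k <= Rabs (r - 1)).
      { destruct Hr as [Hr|Hr]; rewrite Hr.
        - rewrite Rabs_left by lra. lra.
        - rewrite Rabs_pos_eq by lra.
          assert (1 - mu <= / mu - 1); [|lra].
          assert (E : mu * / mu = 1) by (field; lra). nra. }
      set (s := Rmax 1 (r ^ N)).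
      assert (Hlow : forall u, near_rotation u m N A -> s <= Cmod (prod_sub (expi_seq u N) (expi z)) * D).
      { intros u Hu. destruct (near_rotation_product u m N A k (expi z) HN Hm HA Hu Hk Hfar) as [_ H2].
        fold Q in H2.
        assert (H3 : s * (1 - mu) <= Cmod (expi z ^ N - expi (RtoC (INR N * u 0%nat)))).
        { assert (T1 := Cmod_reverse_triangle (expi z ^ N) (expi (RtoC (INR N * u 0%nat)))).
          assert (T2 := Cmod_reverse_triangle (expi (RtoC (INR N * u 0%nat))) (expi z ^ N)).
          rewrite (Cmod_sub_sym (expi (RtoC _))) in T2.
          rewrite Cmod_pow, Cmod_expi_real in T1, T2. fold r in T1, T2.
          unfold s. destruct Hr as [Hr|Hr]; rewrite Hr in *.
          - rewrite Rmax_left by lra. lra.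
          - rewrite pow_inv in *. assert (Hi : / mu <= / mu ^ N) by (apply Rinv_le_contravar; lra).
            rewrite Rmax_right by lra.
            assert (E : mu ^ N * / mu ^ N = 1) by (field; lra). nra. }
        unfold D. unfold Rdiv. rewrite <- Rmult_assoc.
        apply Rle_div_r; [lra|]. eapply Rle_trans; [exact H3|exact H2]. }
      assert (Hlx := Hlow x Hnx). assert (Hly := Hlow y Hny).
      set (px := Cmod (prod_sub (expi_seq x N) (expi z))) in *.
      set (py := Cmod (prod_sub (expi_seq y N) (expi z))) in *.
      assert (Hs1 : 1 <= s) by apply Rmax_l.
      assert (Hgz := Cmod_ge_0 (g z)).
      assert (Hpx : 0 <= px) by apply Cmod_ge_0. assert (Hpy : 0 <= py) by apply Cmod_ge_0.
      assert (Hgs : Cmod (g z) * (s * s) <= D * D).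
      { apply Rle_trans with (Cmod (g z) * ((px * D) * (py * D))).
        - apply Rmult_le_compat_l; auto. apply Rmult_le_compat; lra.
        - replace (Cmod (g z) * (px * D * (py * D))) with ((px * py * Cmod (g z)) * (D * D)) by ring.
          rewrite <- Hprod. assert (0 < D * D) by nra. nra. }
      assert (Hrs : r ^ N <= mu ^ N * (s * s)).
      { unfold s. destruct Hr as [Hr|Hr]; rewrite Hr.
        - rewrite Rmax_left by lra. lra.
        - rewrite pow_inv. assert (Hi : / mu <= / mu ^ N) by (apply Rinv_le_contravar; lra).
          rewrite Rmax_right by lra. right. field. lra. }
      apply Rle_trans with (Cmod (g z) * (mu ^ N * (s * s))); [apply Rmult_le_compat_l; auto|].
      replace (Cmod (g z) * (mu ^ N * (s * s))) with (mu ^ N * (Cmod (g z) * (s * s))) by ring.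
      apply Rmult_le_compat_l; lra. }
  specialize (Hmax (RtoC t) (Him t)). unfold G in Hmax.
  rewrite Cmod_mult, Cmod_pow, Cmod_expi_real, pow1, Rmult_1_r in Hmax.
  rewrite Hfg by apply Him. unfold l. rewrite prod_sub_app, !Cmod_mult.
  assert (Hup : forall u, near_rotation u m N A ->
    Cmod (prod_sub (expi_seq u N) (expi (RtoC t))) <= 2 * lam ^ N * Q).
  { intros u Hu.
    eapply Rle_trans; [apply (prod_sub_radial _ _ lam); [lra|apply Cmod_expi_real|]|].
    { intros e He. unfold expi_seq in He. apply in_map_iff in He. destruct He as (j & <- & _). apply Cmod_expi_real. }
    set (Z0 := (RtoC lam * expi (RtoC t))%C).
    assert (HZ0 : Cmod Z0 = lam).
    { unfold Z0. rewrite Cmod_mult, Cmod_R, Cmod_expi_real, Rabs_pos_eq; lra. }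
    destruct (near_rotation_product u m N A k Z0 HN Hm HA Hu Hk) as [H1 _].
    { rewrite HZ0, Rabs_pos_eq; lra. }
    fold Q in H1. eapply Rle_trans; [exact H1|]. apply Rmult_le_compat_r; [lra|].
    eapply Rle_trans; [apply Cmod_triangle_sub|]. rewrite Cmod_pow, HZ0, Cmod_expi_real.
    assert (1 <= lam ^ N) by (apply pow_R1_Rle; lra). lra. }
  assert (Hux := Hup x Hnx). assert (Huy := Hup y Hny).
  eapply Rle_trans; [apply Rmult_le_compat; [apply Rmult_le_pos; apply Cmod_ge_0|apply Cmod_ge_0|
     apply Rmult_le_compat; [apply Cmod_ge_0|apply Cmod_ge_0|exact Hux|exact Huy]|exact Hmax]|].
  right.
  replace (- (2 * PI * alpha * INR N)) with (INR N * (- (2 * PI * b)) + (INR N * (PI * (b - alpha)) + INR N * (PI * (b - alpha)))) by ring.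
  rewrite !exp_plus, !exp_INR_mult. fold mu. fold lam. ring.
Qed.

(** * Iteration of a map close to the integrable twist *)

(** [nt_lipschitz] is the expansion of [nt_order] after differentiation, with [W] bounding both
    heights; the horizontal distance is restricted to [d] because the constants come from local
    power series. The width [a2] will be taken smaller than that of the domain of analyticity, for
    uniformity. *)
Record near_twist (f : C * C -> C * C) (a2 y1 d A : R) : Prop := {
  nt_pos : 0 < y1 /\ 0 < d /\ 0 <= A;
  nt_order : forall x y, Rabs (Im x) <= a2 -> Cmod y <= y1 ->
    Cmod (fst (f (x, y)) - x - y) <= A * Cmod y ^ 2 /\
    Cmod (snd (f (x, y)) - y) <= A * Cmod y ^ 3;
  nt_lipschitz : forall x y x' y' W, Rabs (Im x) <= a2 -> Rabs (Im x') <= a2 ->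
    Cmod y <= W -> Cmod y' <= W -> W <= y1 -> Cmod (x - x') <= d ->
    Cmod (fst (f (x, y)) - fst (f (x', y')) - (x - x') - (y - y'))
      <= A * (W ^ 2 * Cmod (x - x') + W * Cmod (y - y')) /\
    Cmod (snd (f (x, y)) - snd (f (x', y')) - (y - y'))
      <= A * (W ^ 3 * Cmod (x - x') + W ^ 2 * Cmod (y - y'));
  nt_periodic : forall x y, Rabs (Im x) <= a2 -> Cmod y <= y1 ->
    f ((x + 1)%C, y) = ((fst (f (x, y)) + 1)%C, snd (f (x, y)));
  nt_smooth : forall x y, Rabs (Im x) <= a2 -> Cmod y <= y1 ->
    smooth (fun Q => fst (f Q)) (x, y) /\ smooth (fun Q => snd (f Q)) (x, y);
  nt_real : forall x y : R, Rabs y <= y1 ->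
    Im (fst (f (RtoC x, RtoC y))) = 0 /\ Im (snd (f (RtoC x, RtoC y))) = 0
}.

(** Horizontal deviation from the twist per step, in units of 1/N^2, for heights at most 2 C0 / N:
    the term in C0^2 is the error in [x], the term in C0^3 the change of height accumulated over N
    steps. *)
Definition drift (A C0 : R) : R := 8 * A * C0 ^ 3 + 4 * A * C0 ^ 2.

(** A sum of terms that are nonnegative in use, so that one lower bound on N yields all the
    smallness conditions of [threshold_consequences]. *)
Definition threshold (a1 a2 y1 d A C0 : R) : R :=
  1 + 2 * C0 / y1 + 8 * A * C0 ^ 2 + 8 * A * C0 ^ 3
  + (3 * drift A C0 + 1) / (a2 - a1)
  + 8 * A * (16 * C0 ^ 3 + 8 * C0 ^ 2) + 8 * A * (8 * C0 ^ 2 + 4 * C0)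
  + (2 * drift A C0 + 1) + 8 * (2 * drift A C0 + 1) / d.

Lemma threshold_consequences (a1 a2 y1 d A C0 : R) (N : nat) :
  0 < y1 -> 0 < d -> 0 <= A -> 1 <= C0 -> a1 < a2 -> threshold a1 a2 y1 d A C0 <= INR N ->
  let e := / INR N in
  1 <= INR N /\ 0 < e <= 1 /\ INR N * e = 1 /\ 2 * C0 * e <= y1 /\ 8 * A * C0 ^ 2 * e <= 1 /\
  8 * A * C0 ^ 3 * e <= 1 /\
  (3 * drift A C0 + 1) * e <= a2 - a1 /\ 8 * A * (16 * C0 ^ 3 + 8 * C0 ^ 2) * e <= 1 /\
  8 * A * (8 * C0 ^ 2 + 4 * C0) * e <= 1 /\ (2 * drift A C0 + 1) * e <= 1 /\
  8 * (2 * drift A C0 + 1) * e <= d /\ 0 <= drift A C0.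
Proof.
  intros Hy Hd HA HC0 Haa HN e.
  assert (P2 : 0 <= C0 ^ 2) by (apply pow_le; lra). assert (P3 : 0 <= C0 ^ 3) by (apply pow_le; lra).
  assert (Q2 : 0 <= A * C0 ^ 2) by (apply Rmult_le_pos; auto). assert (Q3 : 0 <= A * C0 ^ 3) by (apply Rmult_le_pos; auto).
  assert (Q1 : 0 <= A * C0) by (apply Rmult_le_pos; lra).
  assert (HD : 0 <= drift A C0) by (unfold drift; lra).
  assert (T1 : 0 <= 2 * C0 / y1) by (apply Rdiv_le_0_compat; lra).
  assert (T2 : 0 <= (3 * drift A C0 + 1) / (a2 - a1)) by (apply Rdiv_le_0_compat; lra).
  assert (T3 : 0 <= 8 * (2 * drift A C0 + 1) / d) by (apply Rdiv_le_0_compat; lra).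
  unfold threshold in HN. set (n := INR N) in *.
  assert (Hn : 1 <= n) by lra.
  assert (He : 0 < e) by (apply Rinv_0_lt_compat; lra).
  assert (Ene : n * e = 1) by (unfold e; field; lra).
  assert (Gen : forall c k, 0 < k -> c / k <= n -> c * e <= k).
  { intros c k Hk H. apply Rmult_le_reg_l with n; [lra|]. replace (n * (c * e)) with (c * (n * e)) by ring.
    rewrite Ene, Rmult_1_r. apply Rle_div_l in H; lra. }
  assert (Gen1 : forall c, c <= n -> c * e <= 1) by (intros c H; apply Gen; lra).
  split; [auto|]. split; [split; auto|].
  { assert (h := Gen1 1 Hn). lra. }
  split; [auto|]. split; [apply Gen; lra|]. split; [apply Gen1; lra|]. split; [apply Gen1; lra|].
  split; [apply Gen; lra|]. split; [apply Gen1; lra|]. split; [apply Gen1; lra|].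
  split; [apply Gen1; lra|]. split; [apply Gen; lra|auto].
Qed.

Lemma Rabs_Im_triangle (x y : C) : Rabs (Im x) <= Rabs (Im y) + Cmod (x - y).
Proof.
  assert (h := im_le_Cmod (x - y)%C).
  assert (E : Im x = Im y + Im (x - y)%C) by (unfold Im; simpl; ring). rewrite E.
  eapply Rle_trans; [apply Rabs_triang|]. lra.
Qed.

(** All claims are proved in one induction, since the expansion may be applied only as long as the
    orbit stays in the domain. The imaginary part of [y] has to be O(1/N^2): multiplied by N steps
    it then moves the imaginary part of [x] by O(1/N), which fits between [a1] and [a2]. *)
Lemma one_orbit (f : C * C -> C * C) (a1 a2 y1 d A C0 : R) (N : nat) (x y : C) :
  near_twist f a2 y1 d A -> 1 <= C0 -> a1 < a2 -> threshold a1 a2 y1 d A C0 <= INR N ->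
  Rabs (Im x) <= a1 -> Cmod y <= C0 * / INR N ->
  Rabs (Im y) <= (2 * drift A C0 + 1) * (/ INR N * / INR N) ->
  forall j, (j <= N)%nat ->
    Rabs (Im (fst (Nat.iter j f (x, y)))) <= a2 /\
    Cmod (snd (Nat.iter j f (x, y))) <= 2 * C0 * / INR N /\
    Cmod (snd (Nat.iter j f (x, y)) - y) <= INR j * (8 * A * C0 ^ 3 * / INR N ^ 3) /\
    Cmod (fst (Nat.iter j f (x, y)) - x - RtoC (INR j) * y) <= INR j * (drift A C0 * (/ INR N * / INR N)).
Proof.
  intros Hf HC0 Haa HN Hx Hy HIy. destruct (nt_pos _ _ _ _ _ Hf) as (Hy1 & Hd & HA).
  destruct (threshold_consequences a1 a2 y1 d A C0 N Hy1 Hd HA HC0 Haa HN)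
    as (Hn & He & Ene & K1 & K2 & K3 & K4 & K5 & K6 & K7 & K8 & HD).
  rewrite <- pow_inv. set (e := / INR N) in *. set (n := INR N) in *.
  assert (P2 : 0 <= A * C0 ^ 2) by (apply Rmult_le_pos; auto; apply pow_le; lra).
  assert (P3 : 0 <= A * C0 ^ 3) by (apply Rmult_le_pos; auto; apply pow_le; lra).
  assert (Hee : 0 < e * e) by nra.
  assert (Ejn : forall j, (j <= N)%nat -> 0 <= INR j <= n).
  { intros j Hj. split; [apply pos_INR|apply le_INR; auto]. }
  induction j as [|j IH]; intros Hj.
  - simpl. replace (y - y)%C with (RtoC 0) by ring. replace (x - x - 0 * y)%C with (RtoC 0) by ring.
    rewrite Cmod_0. repeat split; try lra. nra.
  - destruct (IH ltac:(lia)) as (I1 & I2 & I3 & I4). destruct (Ejn j ltac:(lia)) as [Ej0 Ej1].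
    destruct (Ejn (S j) Hj) as [Es0 Es1]. rewrite S_INR in Es0, Es1.
    simpl Nat.iter. set (P := Nat.iter j f (x, y)) in *.
    replace P with (fst P, snd P) by (destruct P; reflexivity).
    destruct (nt_order _ _ _ _ _ Hf (fst P) (snd P) I1 ltac:(lra)) as [O1 O2].
    set (x' := fst (f (fst P, snd P))) in *. set (y' := snd (f (fst P, snd P))) in *.
    assert (hyp := Cmod_ge_0 (snd P)).
    assert (B2 : Cmod (snd P) ^ 2 <= 4 * C0 ^ 2 * (e * e)).
    { replace (4 * C0 ^ 2 * (e * e)) with ((2 * C0 * e) ^ 2) by ring. apply pow_incr. lra. }
    assert (B3 : Cmod (snd P) ^ 3 <= 8 * C0 ^ 3 * e ^ 3).
    { replace (8 * C0 ^ 3 * e ^ 3) with ((2 * C0 * e) ^ 3) by ring. apply pow_incr. lra. }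
    assert (O1' : Cmod (x' - fst P - snd P) <= 4 * (A * C0 ^ 2) * (e * e)).
    { eapply Rle_trans; [exact O1|]. replace (4 * (A * C0 ^ 2) * (e * e)) with (A * (4 * C0 ^ 2 * (e * e))) by ring.
      apply Rmult_le_compat_l; auto. }
    assert (O2' : Cmod (y' - snd P) <= 8 * A * C0 ^ 3 * e ^ 3).
    { eapply Rle_trans; [exact O2|]. replace (8 * A * C0 ^ 3 * e ^ 3) with (A * (8 * C0 ^ 3 * e ^ 3)) by ring.
      apply Rmult_le_compat_l; auto. }
    set (q := 8 * A * C0 ^ 3 * e ^ 3) in *.
    assert (Hq : 0 <= q) by (eapply Rle_trans; [apply Cmod_ge_0|exact O2']).
    assert (Hnq : n * q = 8 * A * C0 ^ 3 * (e * e)).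
    { unfold q. replace (n * (8 * A * C0 ^ 3 * e ^ 3)) with ((n * e) * (8 * A * C0 ^ 3 * (e * e))) by ring.
      rewrite Ene. ring. }
    assert (J3 : Cmod (y' - y) <= INR (S j) * q).
    { rewrite S_INR. eapply Rle_trans; [apply (Cmod_triangle3 _ (snd P))|]. lra. }
    assert (Hjq : INR j * q <= 8 * A * C0 ^ 3 * (e * e)) by (rewrite <- Hnq; apply Rmult_le_compat_r; auto).
    assert (J4 : Cmod (x' - x - RtoC (INR (S j)) * y) <= INR (S j) * (drift A C0 * (e * e))).
    { rewrite S_INR, RtoC_plus.
      replace (x' - x - (RtoC (INR j) + 1) * y)%C
        with ((fst P - x - RtoC (INR j) * y) + ((x' - fst P - snd P) + (snd P - y)))%C by ring.
      eapply Rle_trans; [apply Cmod_triangle|].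
      assert (T := Cmod_triangle (x' - fst P - snd P) (snd P - y)).
      unfold drift in *. lra. }
    assert (J1 : Rabs (Im x') <= a2).
    { assert (T := Rabs_Im_triangle x' (x + RtoC (INR (S j)) * y)).
      replace (x' - (x + RtoC (INR (S j)) * y))%C with (x' - x - RtoC (INR (S j)) * y)%C in T by ring.
      assert (E : Im (x + RtoC (INR (S j)) * y) = Im x + INR (S j) * Im y) by (unfold Im; simpl; ring).
      rewrite E in T.
      assert (T2 := Rabs_triang (Im x) (INR (S j) * Im y)).
      rewrite Rabs_mult in T2. rewrite S_INR in *. rewrite (Rabs_pos_eq (INR j + 1)) in T2 by lra.
      assert (T3 : (INR j + 1) * Rabs (Im y) <= n * ((2 * drift A C0 + 1) * (e * e))).
      { apply Rmult_le_compat; auto. apply Rabs_pos. }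
      assert (T4 : (INR j + 1) * (drift A C0 * (e * e)) <= n * (drift A C0 * (e * e))).
      { apply Rmult_le_compat_r; auto. apply Rmult_le_pos; lra. }
      assert (T5 : n * ((2 * drift A C0 + 1) * (e * e)) = (2 * drift A C0 + 1) * e).
      { replace (n * ((2 * drift A C0 + 1) * (e * e))) with ((n * e) * ((2 * drift A C0 + 1) * e)) by ring. rewrite Ene. ring. }
      assert (T6 : n * (drift A C0 * (e * e)) = drift A C0 * e).
      { replace (n * (drift A C0 * (e * e))) with ((n * e) * (drift A C0 * e)) by ring. rewrite Ene. ring. }
      lra. }
    assert (J2 : Cmod y' <= 2 * C0 * e).
    { assert (T := Cmod_triangle (y' - y) y). replace (y' - y + y)%C with y' in T by ring.
      assert (T2 : INR (S j) * q <= 8 * A * C0 ^ 3 * (e * e)).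
      { rewrite <- Hnq. apply Rmult_le_compat_r; auto. rewrite S_INR. auto. }
      assert (8 * A * C0 ^ 3 * (e * e) <= C0 * e).
      { replace (8 * A * C0 ^ 3 * (e * e)) with ((8 * A * C0 ^ 2 * e) * (C0 * e)) by ring.
        rewrite <- (Rmult_1_l (C0 * e)) at 2. apply Rmult_le_compat_r; auto. apply Rmult_le_pos; lra. }
      lra. }
    auto.
Qed.

(* With [Q = |y - y'| + |x - x'| / N], the differences of [N] iterates follow those
   of the integrable twist up to a small multiple of [Q]. *)
Lemma two_orbits (f : C * C -> C * C) (a1 a2 y1 d A C0 : R) (N : nat) (x y x' y' : C) :
  near_twist f a2 y1 d A -> 1 <= C0 -> a1 < a2 -> threshold a1 a2 y1 d A C0 <= INR N ->
  Rabs (Im x) <= a1 -> Cmod y <= C0 * / INR N ->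
  Rabs (Im y) <= (2 * drift A C0 + 1) * (/ INR N * / INR N) ->
  Rabs (Im x') <= a1 -> Cmod y' <= C0 * / INR N ->
  Rabs (Im y') <= (2 * drift A C0 + 1) * (/ INR N * / INR N) ->
  let Q := Cmod (y - y') + Cmod (x - x') * / INR N in
  2 * (INR N * Q) <= d ->
  forall j, (j <= N)%nat ->
    let P := Nat.iter j f (x, y) in let P' := Nat.iter j f (x', y') in
    Cmod (snd P - snd P' - (y - y')) <= INR j * / INR N * (Q / 8) /\
    Cmod (fst P - fst P' - (x - x') - RtoC (INR j) * (y - y')) <= INR j * (Q / 4).
Proof.
  intros Hf HC0 Haa HN Hx Hy HIy Hx' Hy' HIy' Q HQd.
  assert (O := one_orbit f a1 a2 y1 d A C0 N x y Hf HC0 Haa HN Hx Hy HIy).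
  assert (O' := one_orbit f a1 a2 y1 d A C0 N x' y' Hf HC0 Haa HN Hx' Hy' HIy').
  destruct (nt_pos _ _ _ _ _ Hf) as (Hy1 & Hd & HA).
  destruct (threshold_consequences a1 a2 y1 d A C0 N Hy1 Hd HA HC0 Haa HN)
    as (Hn & He & Ene & K1 & K2 & K3 & K4 & K5 & K6 & K7 & K8 & HD).
  set (e := / INR N) in *. set (n := INR N) in *.
  assert (HQ : 0 <= Q).
  { unfold Q. assert (h1 := Cmod_ge_0 (y - y')). assert (h2 := Cmod_ge_0 (x - x')). nra. }
  assert (Hee : 0 < e * e) by nra.
  assert (ED : Cmod (x - x') + n * Cmod (y - y') = n * Q).
  { unfold Q. replace (n * (Cmod (y - y') + Cmod (x - x') * e)) with (n * Cmod (y - y') + Cmod (x - x') * (n * e)) by ring.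
    rewrite Ene. ring. }
  assert (HDy : Cmod (y - y') <= Q).
  { unfold Q. assert (h2 := Cmod_ge_0 (x - x')). nra. }
  induction j as [|j IH]; intros Hj P P'.
  - unfold P, P'. simpl. replace (y - y' - (y - y'))%C with (RtoC 0) by ring.
    replace (x - x' - (x - x') - 0 * (y - y'))%C with (RtoC 0) by ring. rewrite Cmod_0. lra.
  - destruct (IH ltac:(lia)) as (I1 & I2).
    destruct (O j ltac:(lia)) as (U1 & U2 & _ & _). destruct (O' j ltac:(lia)) as (V1 & V2 & _ & _).
    assert (Ej : 0 <= INR j /\ INR j + 1 <= n).
    { split; [apply pos_INR|]. rewrite <- S_INR. apply le_INR; auto. }
    unfold P, P'. simpl Nat.iter. clear P P'.
    set (P := Nat.iter j f (x, y)) in *. set (P' := Nat.iter j f (x', y')) in *.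
    assert (Eje : 0 <= INR j * e <= 1).
    { split; [apply Rmult_le_pos; lra|]. rewrite <- Ene. apply Rmult_le_compat_r; lra. }
    assert (By : Cmod (snd P - snd P') <= 2 * Q).
    { replace (snd P - snd P')%C with ((snd P - snd P' - (y - y')) + (y - y'))%C by ring.
      eapply Rle_trans; [apply Cmod_triangle|]. 
      assert (INR j * e * (Q / 8) <= 1 * (Q / 8)) by (apply Rmult_le_compat_r; lra). lra. }
    assert (Bx : Cmod (fst P - fst P') <= 2 * (n * Q)).
    { replace (fst P - fst P')%C with ((fst P - fst P' - (x - x') - RtoC (INR j) * (y - y'))
         + ((x - x') + RtoC (INR j) * (y - y')))%C by ring.
      eapply Rle_trans; [apply Cmod_triangle|].
      assert (T := Cmod_triangle (x - x') (RtoC (INR j) * (y - y'))).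
      rewrite Cmod_mult, Cmod_R, Rabs_pos_eq in T by lra.
      assert (INR j * Cmod (y - y') <= n * Cmod (y - y')) by (apply Rmult_le_compat_r; [apply Cmod_ge_0|lra]).
      assert (INR j * (Q / 4) <= n * (Q / 4)) by (apply Rmult_le_compat_r; lra).
      assert (0 <= n * Q) by (apply Rmult_le_pos; lra). lra. }
    replace P with (fst P, snd P) in |- * by (destruct P; reflexivity).
    replace P' with (fst P', snd P') in |- * by (destruct P'; reflexivity).
    destruct (nt_lipschitz _ _ _ _ _ Hf (fst P) (snd P) (fst P') (snd P') (2 * C0 * e) U1 V1 U2 V2 K1 ltac:(lra)) as [L1 L2].
    set (X := fst (f (fst P, snd P))) in *. set (X' := fst (f (fst P', snd P'))) in *.
    set (Z := snd (f (fst P, snd P))) in *. set (Z' := snd (f (fst P', snd P'))) in *.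
    assert (W0 : 0 <= 2 * C0 * e) by (apply Rmult_le_pos; lra).
    assert (L1' : Cmod (X - X' - (fst P - fst P') - (snd P - snd P')) <= Q / 8).
    { eapply Rle_trans; [exact L1|].
      apply Rle_trans with (A * ((2 * C0 * e) ^ 2 * (2 * (n * Q)) + (2 * C0 * e) * (2 * Q))).
      - apply Rmult_le_compat_l; auto. apply Rplus_le_compat; apply Rmult_le_compat_l; auto. apply pow_le; auto.
      - replace (A * ((2 * C0 * e) ^ 2 * (2 * (n * Q)) + 2 * C0 * e * (2 * Q)))
          with (A * Q * e * (8 * C0 ^ 2 * (n * e) + 4 * C0)) by ring. rewrite Ene.
        replace (A * Q * e * (8 * C0 ^ 2 * 1 + 4 * C0)) with ((8 * A * (8 * C0 ^ 2 + 4 * C0) * e) * (Q / 8)) by field.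
        rewrite <- (Rmult_1_l (Q / 8)) at 2. apply Rmult_le_compat_r; lra. }
    assert (L2' : Cmod (Z - Z' - (snd P - snd P')) <= e * (Q / 8)).
    { eapply Rle_trans; [exact L2|].
      apply Rle_trans with (A * ((2 * C0 * e) ^ 3 * (2 * (n * Q)) + (2 * C0 * e) ^ 2 * (2 * Q))).
      - apply Rmult_le_compat_l; auto. apply Rplus_le_compat; apply Rmult_le_compat_l; auto; apply pow_le; auto.
      - replace (A * ((2 * C0 * e) ^ 3 * (2 * (n * Q)) + (2 * C0 * e) ^ 2 * (2 * Q)))
          with (A * Q * (e * e) * (16 * C0 ^ 3 * (n * e) + 8 * C0 ^ 2)) by ring. rewrite Ene.
        replace (A * Q * (e * e) * (16 * C0 ^ 3 * 1 + 8 * C0 ^ 2))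
          with ((8 * A * (16 * C0 ^ 3 + 8 * C0 ^ 2) * e) * (e * (Q / 8))) by field.
        rewrite <- (Rmult_1_l (e * (Q / 8))) at 2. apply Rmult_le_compat_r; auto. apply Rmult_le_pos; lra. }
    rewrite S_INR. split.
    + replace (Z - Z' - (y - y'))%C with ((Z - Z' - (snd P - snd P')) + (snd P - snd P' - (y - y')))%C by ring.
      eapply Rle_trans; [apply Cmod_triangle|]. lra.
    + rewrite RtoC_plus.
      replace (X - X' - (x - x') - (RtoC (INR j) + 1) * (y - y'))%C with
        ((X - X' - (fst P - fst P') - (snd P - snd P')) + ((snd P - snd P' - (y - y'))
          + (fst P - fst P' - (x - x') - RtoC (INR j) * (y - y'))))%C by ring.
      eapply Rle_trans; [apply Cmod_triangle|].
      assert (T := Cmod_triangle (snd P - snd P' - (y - y')) (fst P - fst P' - (x - x') - RtoC (INR j) * (y - y'))).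
      assert (INR j * e * (Q / 8) <= 1 * (Q / 8)) by (apply Rmult_le_compat_r; lra). lra.
Qed.

Lemma pow_half_small (eps : R) : 0 < eps -> exists n, forall m, (n <= m)%nat -> (1/2) ^ m < eps.
Proof.
  intros He. destruct (pow_lt_1_zero (1/2) ltac:(rewrite Rabs_pos_eq; lra) eps He) as [n Hn].
  exists n. intros m Hm. specialize (Hn m Hm). rewrite Rabs_pos_eq in Hn; auto. apply pow_le; lra.
Qed.

Lemma geometric_limit (u : nat -> C) (c : R) :
  0 <= c -> (forall n, Cmod (u (S n) - u n) <= c * (1/2) ^ n) ->
  exists l, forall n, Cmod (u n - l) <= 2 * c * (1/2) ^ n.
Proof.
  intros Hc H.
  assert (Ht : forall n k, Cmod (u (k + n)%nat - u n) <= 2 * c * (1/2) ^ n).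
  { intros n k.
    assert (G : Cmod (u (k + n)%nat - u n) <= 2 * c * (1/2) ^ n * (1 - (1/2) ^ k)).
    { induction k as [|k IH].
      - simpl. replace (u n - u n)%C with (RtoC 0) by ring. rewrite Cmod_0. lra.
      - change (S k + n)%nat with (S (k + n)). eapply Rle_trans; [apply (Cmod_triangle3 _ (u (k + n)%nat))|].
        specialize (H (k + n)%nat). rewrite pow_add in H. simpl pow. lra. }
    assert (0 <= (1/2) ^ k) by (apply pow_le; lra). assert (0 <= (1/2) ^ n) by (apply pow_le; lra).
    assert (0 <= 2 * c * (1/2) ^ n) by (repeat apply Rmult_le_pos; lra). nra. }
  assert (HC : forall g : C -> R, (forall x y, Rabs (g x - g y) <= Cmod (x - y)) ->
    { l : R | Un_cv (fun n => g (u n)) l }).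
  { intros g Hg. apply Rcomplete.R_complete. intros eps He.
    destruct (pow_half_small (eps / (4 * (c + 1)))) as [n0 Hn0]; [apply Rdiv_lt_0_compat; lra|].
    exists n0. intros n m Hn Hm. unfold Rdist.
    assert (Hsm : 2 * c * (1/2) ^ n0 < eps / 2).
    { specialize (Hn0 n0 (Nat.le_refl _)).
      assert (0 <= (1/2) ^ n0) by (apply pow_le; lra).
      apply Rle_lt_trans with (2 * (c + 1) * (1/2) ^ n0); [nra|].
      replace (eps / 2) with (2 * (c + 1) * (eps / (4 * (c + 1)))) by (field; lra).
      apply Rmult_lt_compat_l; lra. }
    assert (A1 := Ht n0 (n - n0)%nat). assert (A2 := Ht n0 (m - n0)%nat).
    replace (n - n0 + n0)%nat with n in A1 by lia. replace (m - n0 + n0)%nat with m in A2 by lia.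
    assert (B1 := Hg (u n) (u n0)). assert (B2 := Hg (u m) (u n0)).
    assert (T := Rabs_triang (g (u n) - g (u n0)) (- (g (u m) - g (u n0)))).
    replace (g (u n) - g (u n0) + - (g (u m) - g (u n0))) with (g (u n) - g (u m)) in T by ring.
    rewrite Rabs_Ropp in T. lra. }
  destruct (HC Re) as [p Hp]; [intros x y; apply (re_le_Cmod (x - y)%C)|].
  destruct (HC Im) as [q Hq]; [intros x y; apply (im_le_Cmod (x - y)%C)|].
  exists (p, q). intros n.
  apply (le_of_le_plus_mult _ _ 2 1 Rlt_0_1). intros t Ht0.
  destruct (Hp t ltac:(lra)) as [n1 Hn1]. destruct (Hq t ltac:(lra)) as [n2 Hn2].
  set (k := Nat.max n1 n2). specialize (Hn1 (k + n)%nat ltac:(lia)). specialize (Hn2 (k + n)%nat ltac:(lia)).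
  unfold Rdist in *.
  eapply Rle_trans; [apply (Cmod_triangle3 _ (u (k + n)%nat))|]. rewrite (Cmod_sub_sym (u n)).
  assert (h := Cmod_le_Re_Im (u (k + n)%nat - (p, q))). 
  assert (E1 : Re (u (k + n)%nat - (p, q))%C = Re (u (k + n)%nat) - p) by reflexivity.
  assert (E2 : Im (u (k + n)%nat - (p, q))%C = Im (u (k + n)%nat) - q) by reflexivity.
  rewrite E1, E2 in h. specialize (Ht n k). lra.
Qed.

(** The last clause is for real data: the iterates started at a real centre stay real, and so does
    their limit. *)
Lemma contraction_fixpoint (T : C -> C) (c : C) (rho : R) :
  0 <= rho ->
  (forall y, Cmod (y - c) <= rho -> Cmod (T y - c) <= rho) ->
  (forall y y', Cmod (y - c) <= rho -> Cmod (y' - c) <= rho -> Cmod (T y - T y') <= 1/2 * Cmod (y - y')) ->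
  exists y, Cmod (y - c) <= rho /\ T y = y /\
    (Im c = 0 -> (forall z, Cmod (z - c) <= rho -> Im z = 0 -> Im (T z) = 0) -> Im y = 0).
Proof.
  intros Hr Hb Hc. set (u := fun n => Nat.iter n T c).
  assert (Hu : forall n, Cmod (u n - c) <= rho).
  { induction n as [|n IH]; [|apply Hb; auto].
    simpl. replace (c - c)%C with (RtoC 0) by ring. rewrite Cmod_0. auto. }
  assert (Hg : forall n, Cmod (u (S n) - u n) <= rho * (1/2) ^ n).
  { induction n as [|n IH].
    - simpl. rewrite Rmult_1_r. apply (Hu 1%nat).
    - change (u (S (S n))) with (T (u (S n))). change (u (S n)) with (T (u n)) at 2.
      eapply Rle_trans; [apply Hc; auto|]. simpl pow. lra. }
  destruct (geometric_limit u rho Hr Hg) as [y Hy].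
  assert (Hsmall : forall A x, (forall n, x <= A * (1/2) ^ n) -> x <= 0).
  { intros A x H. apply (le_of_le_plus_mult _ _ 1 1 Rlt_0_1). intros t Ht.
    destruct (pow_half_small (t / (Rabs A + 1))) as [n Hn].
    { apply Rdiv_lt_0_compat; [lra|]. assert (h := Rabs_pos A). lra. }
    specialize (Hn n (Nat.le_refl _)). specialize (H n).
    assert (h1 := Rle_abs A). assert (h2 := Rabs_pos A). assert (h3 : 0 <= (1/2) ^ n) by (apply pow_le; lra).
    assert (A * (1/2) ^ n <= (Rabs A + 1) * (1/2) ^ n) by (apply Rmult_le_compat_r; lra).
    assert ((Rabs A + 1) * (1/2) ^ n <= t).
    { replace t with ((Rabs A + 1) * (t / (Rabs A + 1))) by (field; lra). apply Rmult_le_compat_l; lra. }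
    lra. }
  assert (Hyc : Cmod (y - c) <= rho).
  { enough (Cmod (y - c) - rho <= 0) by lra. apply (Hsmall (2 * rho)). intros n.
    specialize (Hy n). specialize (Hu n).
    assert (T2 := Cmod_triangle3 y (u n) c). rewrite (Cmod_sub_sym y (u n)) in T2. lra. }
  exists y. split; [auto|]. split.
  - assert (E : (T y - y)%C = RtoC 0).
    { apply Cmod_eq_0. apply Rle_antisym; [|apply Cmod_ge_0]. apply (Hsmall (4 * rho)). intros n.
      assert (T2 := Cmod_triangle3 (T y) (T (u n)) y).
      assert (C1 := Hc y (u n) Hyc (Hu n)). rewrite (Cmod_sub_sym y (u n)) in C1.
      assert (C2 := Hy n). assert (C3 := Hy (S n)). change (u (S n)) with (T (u n)) in C3. simpl pow in C3.
      assert (0 <= rho * (1/2) ^ n) by (apply Rmult_le_pos; auto; apply pow_le; lra). lra. }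
    replace (T y) with ((T y - y) + y)%C by ring. rewrite E. ring.
  - intros Hc0 HT. assert (Hi : forall n, Im (u n) = 0).
    { induction n as [|n IH]; [exact Hc0|]. apply (HT (u n)); auto. }
    assert (E : Rabs (Im y) <= 0).
    { apply (Hsmall (2 * rho)). intros n. eapply Rle_trans; [|apply (Hy n)].
      assert (h := im_le_Cmod (u n - y)%C). replace (Im (u n - y)%C) with (- Im y) in h.
      - rewrite Rabs_Ropp in h. exact h.
      - assert (h2 := Hi n). unfold Im in *. simpl. rewrite h2. ring. }
    assert (h := Rabs_pos (Im y)). apply Rabs_eq_0. lra.
Qed.

Lemma real_orbit (f : C * C -> C * C) (a1 a2 y1 d A C0 : R) (N : nat) (x y : C) :
  near_twist f a2 y1 d A -> 1 <= C0 -> 0 <= a1 -> a1 < a2 -> threshold a1 a2 y1 d A C0 <= INR N ->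
  Im x = 0 -> Im y = 0 -> Cmod y <= C0 * / INR N ->
  forall j, (j <= N)%nat -> Im (fst (Nat.iter j f (x, y))) = 0 /\ Im (snd (Nat.iter j f (x, y))) = 0.
Proof.
  intros Hf HC0 Ha Haa HN Hx Hy Hyb. destruct (nt_pos _ _ _ _ _ Hf) as (Hy1 & Hd & HA).
  destruct (threshold_consequences a1 a2 y1 d A C0 N Hy1 Hd HA HC0 Haa HN)
    as (Hn & He & Ene & K1 & K2 & K3 & K4 & K5 & K6 & K7 & K8 & HD).
  assert (O := one_orbit f a1 a2 y1 d A C0 N x y Hf HC0 Haa HN ltac:(rewrite Hx, Rabs_R0; auto) Hyb
    ltac:(rewrite Hy, Rabs_R0; apply Rmult_le_pos; [lra|nra])).
  induction j as [|j IH]; intros Hj; [auto|].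
  destruct (IH ltac:(lia)) as [I1 I2]. destruct (O j ltac:(lia)) as (_ & O2 & _ & _). simpl.
  set (P := Nat.iter j f (x, y)) in *.
  assert (E : P = (RtoC (Re (fst P)), RtoC (Re (snd P)))).
  { destruct P as [[p1 p2] [q1 q2]]. simpl in *. subst. reflexivity. }
  rewrite E. apply (nt_real _ _ _ _ _ Hf). rewrite <- Cmod_R.
  replace (RtoC (Re (snd P))) with (snd P); [lra|]. rewrite E at 1. reflexivity.
Qed.

Lemma smooth_orbit (f : C * C -> C * C) (a2 y1 d A : R) (N : nat) (P : C * C) :
  near_twist f a2 y1 d A ->
  (forall j, (j < N)%nat -> Rabs (Im (fst (Nat.iter j f P))) <= a2 /\ Cmod (snd (Nat.iter j f P)) <= y1) ->
  forall j, (j <= N)%nat -> smooth (fun Q => fst (Nat.iter j f Q)) P /\ smooth (fun Q => snd (Nat.iter j f Q)) P.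
Proof.
  intros Hf H. induction j as [|j IH]; intros Hj.
  - simpl. split; apply smooth_poly2; constructor.
  - destruct (IH ltac:(lia)) as [I1 I2]. destruct (H j ltac:(lia)) as [H1 H2].
    destruct (nt_smooth _ _ _ _ _ Hf _ _ H1 H2) as [S1 S2]. simpl.
    assert (Ep : forall Q : C * C, (fst Q, snd Q) = Q) by (intros []; reflexivity).
    split.
    + apply (smooth_ext (fun Q => fst (f (fst (Nat.iter j f Q), snd (Nat.iter j f Q))))).
      { intros Q. rewrite Ep. reflexivity. }
      apply (smooth_comp (fun Q => fst (f Q)) (fun Q => fst (Nat.iter j f Q)) (fun Q => snd (Nat.iter j f Q))); auto.
    + apply (smooth_ext (fun Q => snd (f (fst (Nat.iter j f Q), snd (Nat.iter j f Q))))).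
      { intros Q. rewrite Ep. reflexivity. }
      apply (smooth_comp (fun Q => snd (f Q)) (fun Q => fst (Nat.iter j f Q)) (fun Q => snd (Nat.iter j f Q))); auto.
Qed.

Lemma periodic_orbit_shift (f : C * C -> C * C) (a2 y1 d A : R) (N : nat) (x y : C) :
  near_twist f a2 y1 d A ->
  (forall j, (j < N)%nat -> Rabs (Im (fst (Nat.iter j f (x, y)))) <= a2 /\ Cmod (snd (Nat.iter j f (x, y))) <= y1) ->
  forall j, (j <= N)%nat ->
    Nat.iter j f ((x + 1)%C, y) = ((fst (Nat.iter j f (x, y)) + 1)%C, snd (Nat.iter j f (x, y))).
Proof.
  intros Hf H. induction j as [|j IH]; intros Hj; [reflexivity|].
  simpl. rewrite IH by lia. destruct (H j ltac:(lia)) as [H1 H2].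
  rewrite (nt_periodic _ _ _ _ _ Hf _ _ H1 H2). destruct (Nat.iter j f (x, y)); reflexivity.
Qed.

(** * The curve of points that close up horizontally *)

Lemma rotation_ball (C0 D e : R) (m : R) (y : C) :
  0 <= e -> (2 * D + 1) * e <= 1 -> Rabs m <= C0 - 1 ->
  Cmod (y - RtoC (m * e)) <= (2 * D + 1) * (e * e) ->
  Cmod y <= C0 * e /\ Rabs (Im y) <= (2 * D + 1) * (e * e).
Proof.
  intros He HD Hm Hy. split.
  - replace y with ((y - RtoC (m * e)) + RtoC (m * e))%C by ring.
    eapply Rle_trans; [apply Cmod_triangle|]. rewrite Cmod_R, Rabs_mult, (Rabs_pos_eq e) by auto.
    assert ((2 * D + 1) * (e * e) <= 1 * e) by (rewrite <- Rmult_assoc; apply Rmult_le_compat_r; auto).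
    assert (Rabs m * e <= (C0 - 1) * e) by (apply Rmult_le_compat_r; auto). lra.
  - assert (T := Rabs_Im_triangle y (RtoC (m * e))). simpl in T. rewrite Rabs_R0 in T. lra.
Qed.

(** To first order the height is m / N. Uniqueness holds in a ball twice as large as the one in
    which [Y x] is located, so that points of periodic orbits, known less precisely, can be
    recognized as points of the curve. *)
Record closing_curve (f : C * C -> C * C) (a1 d D : R) (N : nat) (m : Z) (Y : C -> C) : Prop := {
  cc_close : forall x, Rabs (Im x) <= a1 ->
    Cmod (Y x - RtoC (IZR m * / INR N)) <= (2 * D + 1) / 2 * (/ INR N * / INR N) /\
    fst (Nat.iter N f (x, Y x)) = (x + RtoC (IZR m))%C;
  cc_unique : forall x y, Rabs (Im x) <= a1 ->
    Cmod (y - RtoC (IZR m * / INR N)) <= (2 * D + 1) * (/ INR N * / INR N) ->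
    fst (Nat.iter N f (x, y)) = (x + RtoC (IZR m))%C -> y = Y x;
  cc_periodic : forall x, Rabs (Im x) <= a1 -> Y (x + 1)%C = Y x;
  cc_real : forall x : R, Im (Y (RtoC x)) = 0;
  cc_lipschitz : forall x x', Rabs (Im x) <= a1 -> Rabs (Im x') <= a1 -> Cmod (x - x') <= d / 4 ->
    Cmod (Y x - Y x') <= Cmod (x - x') * / INR N;
  cc_smooth : forall x, Rabs (Im x) < a1 -> smooth1 Y x
}.

Lemma closing_curve_exists (f : C * C -> C * C) (a1 a2 y1 d A C0 : R) (N : nat) (m : Z) :
  near_twist f a2 y1 d A -> 1 <= C0 -> 0 < a1 -> a1 < a2 -> threshold a1 a2 y1 d A C0 <= INR N ->
  Rabs (IZR m) <= C0 - 1 -> exists Y, closing_curve f a1 d (drift A C0) N m Y.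
Proof.
  intros Hf HC0 Ha1 Haa HN Hm. set (e := / INR N). destruct (nt_pos _ _ _ _ _ Hf) as (Hy1 & Hd & HA).
  destruct (threshold_consequences a1 a2 y1 d A C0 N Hy1 Hd HA HC0 Haa HN)
    as (Hn & He & Ene & K1 & K2 & K3 & K4 & K5 & K6 & K7 & K8 & HD).
  fold e in He, Ene, K1, K2, K3, K4, K5, K6, K7, K8. set (n := INR N) in *.
  set (D := drift A C0) in *. set (om := RtoC (IZR m * e)).
  (* The correction to the height m / N is at most D / N^2, [D] being the drift; with this radius
     the contraction maps the ball into the ball of half the radius. *)
  set (rho := (2 * D + 1) * (e * e)).
  assert (Hee : 0 < e * e) by nra.
  assert (Hrho : 0 < rho) by (apply Rmult_lt_0_compat; lra).
  assert (Hnrho : 8 * (n * rho) <= d).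
  { unfold rho. replace (8 * (n * ((2 * D + 1) * (e * e)))) with ((n * e) * (8 * (2 * D + 1) * e)) by ring. rewrite Ene. lra. }
  assert (Hball : forall y, Cmod (y - om) <= rho -> Cmod y <= C0 * e /\ Rabs (Im y) <= rho).
  { intros y Hy. apply (rotation_ball C0 D e (IZR m)); auto; lra. }
  set (X := fun x y => fst (Nat.iter N f (x, y))).
  assert (Hone : forall x y, Rabs (Im x) <= a1 -> Cmod (y - om) <= rho ->
     Cmod (X x y - x - RtoC n * y) <= D * e).
  { intros x y Hx Hy. destruct (Hball y Hy) as [B1 B2].
    destruct (one_orbit f a1 a2 y1 d A C0 N x y Hf HC0 Haa HN Hx B1 B2 N (Nat.le_refl N)) as (_ & _ & _ & O).
    fold n in O. fold e in O. fold D in O. fold (X x y) in O.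
    replace (n * (D * (e * e))) with ((n * e) * (D * e)) in O by ring. rewrite Ene in O. lra. }
  assert (Htwo : forall x y x' y', Rabs (Im x) <= a1 -> Rabs (Im x') <= a1 ->
     Cmod (y - om) <= rho -> Cmod (y' - om) <= rho -> Cmod (x - x') <= d / 4 ->
     Cmod (X x y - X x' y' - (x - x') - RtoC n * (y - y')) <= n * Cmod (y - y') / 4 + Cmod (x - x') / 4).
  { intros x y x' y' Hx Hx' Hy Hy' Hxx.
    destruct (Hball y Hy) as [B1 B2]. destruct (Hball y' Hy') as [B1' B2'].
    assert (Hyy : Cmod (y - y') <= 2 * rho).
    { eapply Rle_trans; [apply (Cmod_triangle3 _ om)|]. rewrite (Cmod_sub_sym om). lra. }
    assert (EQ : n * (Cmod (y - y') + Cmod (x - x') * e) = n * Cmod (y - y') + Cmod (x - x')).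
    { replace (n * (Cmod (y - y') + Cmod (x - x') * e)) with (n * Cmod (y - y') + Cmod (x - x') * (n * e)) by ring.
      rewrite Ene. ring. }
    assert (n * Cmod (y - y') <= n * (2 * rho)) by (apply Rmult_le_compat_l; lra).
    destruct (two_orbits f a1 a2 y1 d A C0 N x y x' y' Hf HC0 Haa HN Hx B1 B2 Hx' B1' B2') with (j := N) as [_ O]; auto.
    { fold n. fold e. rewrite EQ. lra. }
    fold n in O. fold e in O. fold (X x y) in O. fold (X x' y') in O.
    eapply Rle_trans; [exact O|]. right. lra. }
  assert (Hdz : forall x : C, Cmod (x - x) <= d / 4).
  { intros x. replace (x - x)%C with (RtoC 0) by ring. rewrite Cmod_0. lra. }
  assert (Uniq : forall x y x' y', Rabs (Im x) <= a1 -> Rabs (Im x') <= a1 ->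
     Cmod (y - om) <= rho -> Cmod (y' - om) <= rho -> Cmod (x - x') <= d / 4 ->
     X x y = (x + RtoC (IZR m))%C -> X x' y' = (x' + RtoC (IZR m))%C -> Cmod (y - y') <= Cmod (x - x') * e).
  { intros x y x' y' Hx Hx' Hy Hy' Hxx E E'.
    assert (T := Htwo x y x' y' Hx Hx' Hy Hy' Hxx). rewrite E, E' in T.
    replace (x + RtoC (IZR m) - (x' + RtoC (IZR m)) - (x - x') - RtoC n * (y - y'))%C
      with (- (RtoC n * (y - y')))%C in T by ring.
    rewrite Cmod_opp, Cmod_mult, Cmod_R, Rabs_pos_eq in T by lra.
    assert (h := Cmod_ge_0 (x - x')).
    apply Rmult_le_reg_l with n; [lra|]. replace (n * (Cmod (x - x') * e)) with (Cmod (x - x') * (n * e)) by ring.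
    rewrite Ene. lra. }
  (* Newton's method with the derivative of the pure twist: [X x y] is close to x + N y, with an
     error whose Lipschitz constant in [y] is N / 4, so that the map contracts by 1/4. *)
  set (T := fun x y => (y - RtoC e * (X x y - x - RtoC (IZR m)))%C).
  assert (ETe : forall x y, (T x y - om)%C = (- (RtoC e * (X x y - x - RtoC n * y)))%C).
  { intros x y. unfold T, om. rewrite RtoC_mult.
    assert (E : (RtoC e * RtoC n)%C = RtoC 1) by (rewrite <- RtoC_mult; f_equal; lra).
    replace (- (RtoC e * (X x y - x - RtoC n * y)))%C with ((RtoC e * RtoC n) * y - RtoC e * (X x y - x))%C by ring.
    rewrite E. ring. }
  assert (HTb : forall x y, Rabs (Im x) <= a1 -> Cmod (y - om) <= rho -> Cmod (T x y - om) <= rho / 2).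
  { intros x y Hx Hy. rewrite ETe, Cmod_opp, Cmod_mult, Cmod_R, Rabs_pos_eq by lra.
    assert (O := Hone x y Hx Hy). apply Rle_trans with (e * (D * e)); [apply Rmult_le_compat_l; lra|].
    unfold rho. replace (e * (D * e)) with (D * (e * e)) by ring. lra. }
  assert (Ex : forall x, Rabs (Im x) <= a1 -> exists y, Cmod (y - om) <= rho /\ T x y = y /\
     (Im x = 0 -> Im y = 0)).
  { intros x Hx. destruct (contraction_fixpoint (T x) om rho) as (y & Hy1' & Hy2 & Hy3).
    - lra.
    - intros y Hy. specialize (HTb x y Hx Hy). lra.
    - intros y y' Hy Hy'.
      assert (O := Htwo x y x y' Hx Hx Hy Hy' (Hdz x)).
      replace (T x y - T x y')%C with (- (RtoC e * (X x y - X x y' - (x - x) - RtoC n * (y - y'))))%C.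
      2:{ assert (E : (RtoC e * RtoC n)%C = RtoC 1) by (rewrite <- RtoC_mult; f_equal; lra).
          unfold T. replace (- (RtoC e * (X x y - X x y' - (x - x) - RtoC n * (y - y'))))%C
           with ((RtoC e * RtoC n) * (y - y') - RtoC e * (X x y - X x y'))%C by ring. rewrite E. ring. }
      replace (Cmod (x - x)) with 0 in O by (replace (x - x)%C with (RtoC 0) by ring; rewrite Cmod_0; reflexivity).
      rewrite Cmod_opp, Cmod_mult, Cmod_R, Rabs_pos_eq by lra.
      apply Rle_trans with (e * (n * Cmod (y - y') / 4 + 0 / 4)); [apply Rmult_le_compat_l; lra|].
      replace (e * (n * Cmod (y - y') / 4 + 0 / 4)) with ((n * e) * (Cmod (y - y') / 4)) by field.
      rewrite Ene. assert (h := Cmod_ge_0 (y - y')). lra.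
    - exists y. split; auto. split; auto. intros Hx0. apply Hy3.
      + reflexivity.
      + intros z Hz Hz0. destruct (Hball z Hz) as [B1 B2].
        destruct (real_orbit f a1 a2 y1 d A C0 N x z Hf HC0 ltac:(lra) Haa HN Hx0 Hz0 B1 N (Nat.le_refl N)) as [R1 _].
        fold (X x z) in R1. unfold T. revert Hx0 Hz0 R1. unfold Im. simpl. intros -> -> ->. ring. }
  (* The value does not depend on the choice, by [HU] below. Reality is part of the chosen property
     because it is read off the iteration that produces the fixed point. *)
  set (Y := fun x => epsilon (inhabits (RtoC 0)) (fun y => Cmod (y - om) <= rho /\ T x y = y /\ (Im x = 0 -> Im y = 0))).
  assert (HY : forall x, Rabs (Im x) <= a1 -> Cmod (Y x - om) <= rho /\ T x (Y x) = Y x /\ (Im x = 0 -> Im (Y x) = 0)).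
  { intros x Hx. apply (epsilon_spec (inhabits (RtoC 0)) _ (Ex x Hx)). }
  assert (HYX : forall x, Rabs (Im x) <= a1 -> X x (Y x) = (x + RtoC (IZR m))%C).
  { intros x Hx. destruct (HY x Hx) as (_ & E & _). unfold T in E.
    assert (E2 : (RtoC e * (X x (Y x) - x - RtoC (IZR m)))%C = RtoC 0).
    { replace (RtoC e * (X x (Y x) - x - RtoC (IZR m)))%C with
       (Y x - (Y x - RtoC e * (X x (Y x) - x - RtoC (IZR m))))%C by ring. rewrite E. ring. }
    assert (He0 : RtoC e <> RtoC 0) by (intros E3; apply RtoC_inj in E3; lra).
    replace (X x (Y x)) with ((RtoC e * (X x (Y x) - x - RtoC (IZR m))) / RtoC e + (x + RtoC (IZR m)))%C by (field; auto).
    rewrite E2. field. auto. }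
  assert (HYb : forall x, Rabs (Im x) <= a1 -> Cmod (Y x - om) <= rho / 2).
  { intros x Hx. destruct (HY x Hx) as (B & E & _). rewrite <- E. apply HTb; auto. }
  assert (HU : forall x y, Rabs (Im x) <= a1 -> Cmod (y - om) <= rho -> X x y = (x + RtoC (IZR m))%C -> y = Y x).
  { intros x y Hx Hy E. destruct (HY x Hx) as (B & _ & _).
    assert (U := Uniq x y x (Y x) Hx Hx Hy B (Hdz x) E (HYX x Hx)).
    replace (Cmod (x - x)) with 0 in U by (replace (x - x)%C with (RtoC 0) by ring; rewrite Cmod_0; reflexivity).
    assert (E0 : (y - Y x)%C = RtoC 0) by (apply Cmod_eq_0; assert (h := Cmod_ge_0 (y - Y x)); lra).
    replace y with ((y - Y x) + Y x)%C by ring. rewrite E0. ring. }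
  assert (HL : forall x x', Rabs (Im x) <= a1 -> Rabs (Im x') <= a1 -> Cmod (x - x') <= d / 4 ->
       Cmod (Y x - Y x') <= Cmod (x - x') * e).
  { intros x x' Hx Hx' Hxx. apply Uniq; auto; apply HY; auto. }
  exists Y. constructor; fold n; fold e; fold om; fold rho.
  - intros x Hx. split; [|apply HYX; auto]. specialize (HYb x Hx). unfold rho in HYb. lra.
  - exact HU.
  - intros x Hx. symmetry. assert (Hx1 : Rabs (Im (x + 1)%C) <= a1) by (unfold Im in *; simpl in *; rewrite Rplus_0_r; auto).
    apply HU; [auto|apply HY; auto|].
    destruct (HY x Hx) as (B & _ & _). destruct (Hball _ B) as [B1 B2].
    assert (HNO : forall j, (j < N)%nat -> Rabs (Im (fst (Nat.iter j f (x, Y x)))) <= a2 /\ Cmod (snd (Nat.iter j f (x, Y x))) <= y1).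
    { intros j Hj. destruct (one_orbit f a1 a2 y1 d A C0 N x (Y x) Hf HC0 Haa HN Hx B1 B2 j ltac:(lia)) as (O1 & O2 & _).
      fold n in O2. fold e in O2. split; [auto|lra]. }
    unfold X. rewrite (periodic_orbit_shift f a2 y1 d A N x (Y x) Hf HNO N (Nat.le_refl N)).
    simpl fst. fold (X x (Y x)). rewrite HYX by auto. ring.
  - intros x. apply HY; [simpl; rewrite Rabs_R0; lra|reflexivity].
  - exact HL.
  - intros x Hx.
    destruct (HY x ltac:(lra)) as (B & _ & _). destruct (Hball _ B) as [B1 B2].
    assert (HNO : forall j, (j <= N)%nat -> Rabs (Im (fst (Nat.iter j f (x, Y x)))) <= a2 /\ Cmod (snd (Nat.iter j f (x, Y x))) <= y1).
    { intros j Hj. destruct (one_orbit f a1 a2 y1 d A C0 N x (Y x) Hf HC0 Haa HN ltac:(lra) B1 B2 j Hj) as (O1 & O2 & _).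
      fold n in O2. fold e in O2. split; [auto|lra]. }
    destruct (smooth_orbit f a2 y1 d A N (x, Y x) Hf ltac:(intros j Hj; apply HNO; lia) N (Nat.le_refl N)) as [S1 _].
    set (dd := Rmin (a1 - Rabs (Im x)) (Rmin (d / 4) (rho / 2))).
    assert (Hdd : 0 < dd) by (unfold dd; repeat apply Rmin_pos; lra).
    assert (D1 : dd <= a1 - Rabs (Im x)) by apply Rmin_l.
    assert (D2 : dd <= d / 4) by (eapply Rle_trans; [apply Rmin_r|apply Rmin_l]).
    assert (D3 : dd <= rho / 2) by (eapply Rle_trans; [apply Rmin_r|apply Rmin_r]).
    assert (Hxw : forall w, Cmod w < dd -> Rabs (Im (x + w)%C) <= a1 /\ Cmod (x + w - x) = Cmod w).
    { intros w Hw. assert (E : (x + w - x)%C = w) by ring. split; [|rewrite E; reflexivity].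
      assert (T1 := Rabs_Im_triangle (x + w)%C x). rewrite E in T1. lra. }
    apply (smooth1_implicit (fun Q => fst (Nat.iter N f Q) - fst Q - RtoC (IZR m))%C Y x dd (n / 2) 1); try lra.
    + apply (smooth_minus (fun Q => fst (Nat.iter N f Q) - fst Q)%C (fun _ => RtoC (IZR m))).
      * apply (smooth_minus (fun Q => fst (Nat.iter N f Q)) (fun Q => fst Q)); auto. apply smooth_poly2. constructor.
      * apply (smooth_poly2 (fun _ => RtoC (IZR m))). constructor.
    + intros w Hw. destruct (Hxw w Hw) as [W1 W2]. cbn [fst]. fold (X (x + w)%C (Y (x + w)%C)).
      rewrite HYX by auto. ring.
    + intros w Hw. destruct (Hxw w Hw) as [W1 W2].
      eapply Rle_trans; [apply HL; auto; lra|]. rewrite W2. assert (h := Cmod_ge_0 w). nra.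
    + intros w Hw. cbn [fst]. fold (X x (Y x + w)%C).
      assert (Hb2 : Cmod (Y x + w - om) <= rho).
      { replace (Y x + w - om)%C with ((Y x - om) + w)%C by ring. eapply Rle_trans; [apply Cmod_triangle|].
        specialize (HYb x ltac:(lra)). lra. }
      assert (O := Htwo x (Y x + w)%C x (Y x) ltac:(lra) ltac:(lra) Hb2 B (Hdz x)).
      rewrite HYX in O by lra.
      replace (Cmod (x - x)) with 0 in O by (replace (x - x)%C with (RtoC 0) by ring; rewrite Cmod_0; reflexivity).
      replace (Y x + w - Y x)%C with w in O by ring.
      replace (X x (Y x + w)%C - (x + RtoC (IZR m)) - (x - x) - RtoC n * w)%C with
        ((X x (Y x + w)%C - x - RtoC (IZR m)) - RtoC n * w)%C in O by ring.
      assert (R := Cmod_reverse_triangle (RtoC n * w) (X x (Y x + w)%C - x - RtoC (IZR m))).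
      rewrite (Cmod_sub_sym (RtoC n * w)) in R. rewrite Cmod_mult, Cmod_R, Rabs_pos_eq in R by lra.
      assert (h := Cmod_ge_0 w). assert (0 <= n * Cmod w) by (apply Rmult_le_pos; lra). lra.
Qed.

(** * Propagation of the resonance conditions to the complex strip *)

Definition has_series (g : C -> C -> C) (x y : C) : Prop :=
  exists c rho B, coef_bound c rho B /\
    forall z w, Cmod z < rho -> Cmod w < rho -> psum_cv c z w (g (x + z)%C (y + w)%C).

Lemma psum_minus_single (c : nat -> nat -> C) (v : C) (m k N : nat) (z w : C) :
  (m <= N)%nat -> (k <= N)%nat ->
  psum (fun m' k' => (c m' k' - if (Nat.eqb m' m && Nat.eqb k' k)%bool then v else RtoC 0)%C) N z w
    = (psum c N z w - v * (z ^ m * w ^ k))%C.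
Proof.
  intros Hm Hk. rewrite <- (dsum_single (v * (z ^ m * w ^ k)) m k N Hm Hk).
  unfold psum. rewrite dsum_minus. apply dsum_ext. intros m' k'.
  destruct (Nat.eqb_spec m' m); destruct (Nat.eqb_spec k' k); cbn [andb]; subst; ring.
Qed.

Lemma has_series_minus_monomial (g : C -> C -> C) (x y v : C) (m k : nat) :
  has_series g x y -> has_series (fun z w => g z w - v * ((z - x) ^ m * (w - y) ^ k))%C x y.
Proof.
  intros (c & rho & B & (Hr & HB & Hb) & Hcv).
  exists (fun m' k' => (c m' k' - if (Nat.eqb m' m && Nat.eqb k' k)%bool then v else RtoC 0)%C), rho,
    (B + Cmod v * rho ^ (m + k)).
  assert (hv := Cmod_ge_0 v). assert (hp : forall n, 0 < rho ^ n) by (intros; apply pow_lt; auto).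
  assert (hvp : 0 <= Cmod v * rho ^ (m + k)) by (apply Rmult_le_pos; auto; apply Rlt_le; auto).
  split; [split; [auto|split; [lra|]]|].
  - intros m' k'. eapply Rle_trans; [apply Rmult_le_compat_r; [apply Rlt_le; auto|apply Cmod_triangle_sub]|].
    rewrite Rmult_plus_distr_r. apply Rplus_le_compat; [auto|].
    destruct (Nat.eqb_spec m' m); destruct (Nat.eqb_spec k' k); cbn [andb]; subst; try lra;
      rewrite Cmod_0; lra.
  - intros z w Hz Hw eps He. destruct (Hcv z w Hz Hw eps He) as [N0 HN0].
    exists (Nat.max N0 (Nat.max m k)). intros N HN. rewrite psum_minus_single by lia.
    replace (x + z - x)%C with z by ring. replace (y + w - y)%C with w by ring.
    replace (psum c N z w - v * (z ^ m * w ^ k) - (g (x + z) (y + w) - v * (z ^ m * w ^ k)))%C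
      with (psum c N z w - g (x + z) (y + w))%C by ring.
    apply HN0. lia.
Qed.

Lemma has_series_minus_affine (g : C -> C -> C) (x y p q r : C) :
  has_series g x y -> has_series (fun z w => g z w - (p + q * z + r * w))%C x y.
Proof.
  intros H.
  assert (H1 := has_series_minus_monomial _ x y (p + q * x + r * y)%C 0 0 H).
  assert (H2 := has_series_minus_monomial _ x y q 1 0 H1).
  assert (H3 := has_series_minus_monomial _ x y r 0 1 H2).
  destruct H3 as (c & rho & B & Hc & Hcv). exists c, rho, B. split; auto.
  intros z w Hz Hw. specialize (Hcv z w Hz Hw). cbv beta in Hcv.
  replace (g (x + z) (y + w) - (p + q * (x + z) + r * (y + w)))%C with
    (g (x + z) (y + w) - (p + q * x + r * y) * ((x + z - x) ^ 0 * (y + w - y) ^ 0)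
      - q * ((x + z - x) ^ 1 * (y + w - y) ^ 0) - r * ((x + z - x) ^ 0 * (y + w - y) ^ 1))%C by (simpl; ring).
  exact Hcv.
Qed.

(** Divisibility by y^k0 near (x0, 0), in the quantitative form that [near_twist] needs. In this
    form it passes to nearby centres, so that it is an open condition on [x0]. *)
Definition order_near (k0 : nat) (g : C -> C -> C) (x0 : C) : Prop :=
  exists d K, 0 < d /\ 0 < K /\ forall x y x' y' W,
    Cmod (x - x0) <= d -> Cmod (x' - x0) <= d -> W <= d -> Cmod y <= W -> Cmod y' <= W ->
    Cmod (g x y - g x' y') <= K * (W ^ k0 * Cmod (x - x') + W ^ (pred k0) * Cmod (y - y')) /\
    Cmod (g x y) <= K * Cmod y ^ k0.

(** The power series at [x0] sees all directions, so a bound on one ray is enough to annihilate the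
    coefficients of low order and hence to control a full neighbourhood. *)
Lemma order_near_of_direction (k0 : nat) (g : C -> C -> C) (x0 e : C) (delta : R) :
  has_series g x0 (RtoC 0) -> Cmod e = 1 -> 0 < delta ->
  (forall t, 0 < t < delta -> exists A d, 0 < d /\ forall y, 0 < y < d ->
     Cmod (g (x0 + RtoC t * e)%C (RtoC y)) <= A * y ^ k0) ->
  order_near k0 g x0.
Proof.
  intros (c & rho & B & Hc & Hcv) He Hd H. assert (Hr := proj1 Hc).
  assert (Hv : forall m k, (k < k0)%nat -> c m k = 0%C).
  { apply (coef_vanish c rho B (Rmin delta rho) k0 e Hc He); [apply Rmin_pos; auto|].
    intros t Ht. assert (Ht1 : t < delta) by (eapply Rlt_le_trans; [apply Ht|apply Rmin_l]).
    assert (Ht2 : t < rho) by (eapply Rlt_le_trans; [apply Ht|apply Rmin_r]).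
    destruct (H t ltac:(lra)) as (A & d & Hdd & HA).
    exists A, (Rmin d rho). split; [apply Rmin_pos; auto|]. intros y Hy eps Heps.
    assert (Hy1 : y < d) by (eapply Rlt_le_trans; [apply Hy|apply Rmin_l]).
    assert (Hy2 : y < rho) by (eapply Rlt_le_trans; [apply Hy|apply Rmin_r]).
    destruct (Hcv (RtoC t * e)%C (RtoC y)) with (eps := eps) as [N0 HN0]; auto.
    { rewrite Cmod_mult, He, Cmod_R, Rabs_pos_eq; lra. }
    { rewrite Cmod_R, Rabs_pos_eq; lra. }
    exists N0. intros N HN. specialize (HN0 N HN). rewrite Cplus_0_l in HN0.
    specialize (HA y ltac:(lra)).
    assert (T := Cmod_reverse_triangle (psum c N (RtoC t * e) (RtoC y)) (g (x0 + RtoC t * e)%C (RtoC y))). lra. }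
  destruct (psum_lipschitz c rho B k0 Hc Hv) as (K1 & HK1 & HL).
  destruct (psum_vanishing_order c rho B k0 Hc Hv) as (K2 & HK2 & HO).
  exists (rho / 4), (K1 + K2). split; [lra|]. split; [lra|].
  intros x y x' y' W Hx Hx' HW Hy Hy'.
  assert (HW0 : 0 <= W) by (eapply Rle_trans; [apply Cmod_ge_0|exact Hy]).
  assert (C1 := Hcv (x - x0)%C y ltac:(lra) ltac:(lra)).
  assert (C2 := Hcv (x' - x0)%C y' ltac:(lra) ltac:(lra)).
  replace (x0 + (x - x0))%C with x in C1 by ring. replace (x0 + (x' - x0))%C with x' in C2 by ring.
  rewrite Cplus_0_l in C1, C2.
  assert (P0 : 0 <= W ^ k0) by (apply pow_le; auto). assert (P1 : 0 <= W ^ pred k0) by (apply pow_le; auto).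
  assert (h1 := Cmod_ge_0 (x - x')). assert (h2 := Cmod_ge_0 (y - y')).
  assert (S0 : 0 <= W ^ k0 * Cmod (x - x') + W ^ pred k0 * Cmod (y - y')).
  { apply Rplus_le_le_0_compat; apply Rmult_le_pos; auto. }
  split.
  - apply Rle_trans with (K1 * (W ^ k0 * Cmod (x - x') + W ^ pred k0 * Cmod (y - y'))).
    + apply (psum_cv_diff_le c _ _ _ _ _ _ _ C1 C2). intros N.
      assert (Q := HL N (x - x0)%C y (x' - x0)%C y' W Hx Hx' HW Hy Hy').
      replace (x - x0 - (x' - x0))%C with (x - x')%C in Q by ring. exact Q.
    + apply Rmult_le_compat_r; auto. lra.
  - apply Rle_trans with (K2 * Cmod y ^ k0).
    + replace (g x y) with (g x y - RtoC 0)%C by ring. apply (psum_cv_le c _ _ _ _ _ 0 C1). intros N _.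
      replace (psum c N (x - x0) y - RtoC 0)%C with (psum c N (x - x0) y) by ring. apply HO; auto. lra.
    + apply Rmult_le_compat_r; [apply pow_le, Cmod_ge_0|lra].
Qed.

Lemma real_induction (P : R -> Prop) (T : R) :
  P 0 ->
  (forall t, 0 < t < T -> (forall s, 0 <= s < t -> P s) -> P t) ->
  (forall t, 0 <= t < T -> P t -> exists d, 0 < d /\ forall s, t <= s < t + d -> P s) ->
  forall t, 0 <= t < T -> P t.
Proof.
  intros H0 Hlim Hopen t Ht. apply NNPP. intros Hn.
  set (E := fun s => 0 <= s <= t /\ forall r, 0 <= r <= s -> P r).
  destruct (completeness E) as (m & Hm1 & Hm2).
  { exists t. intros s [Hs _]. lra. }
  { exists 0. split; [lra|]. intros r Hr. replace r with 0 by lra. auto. }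
  assert (Hm0 : 0 <= m) by (apply Hm1; split; [lra|intros r Hr; replace r with 0 by lra; auto]).
  assert (Hmt : m <= t) by (apply Hm2; intros s [Hs _]; lra).
  assert (Hbelow : forall s, 0 <= s < m -> P s).
  { intros s Hs. apply NNPP. intros Hs'. assert (m <= s); [|lra].
    apply Hm2. intros r [Hr1 Hr2]. apply Rnot_lt_le. intros Hlt. apply Hs'. apply Hr2. lra. }
  assert (HPm : P m).
  { destruct (Req_dec m 0) as [->|Hne]; auto. apply Hlim; auto. lra. }
  destruct (Hopen m ltac:(lra) HPm) as (d & Hd & Hd').
  destruct (Rle_dec t (m + d / 2)) as [Hle|Hgt].
  - apply Hn. apply Hd'. lra.
  - assert (Hx : m + d / 2 <= m); [|lra]. apply Hm1. split; [lra|]. intros r Hr.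
    destruct (Rlt_dec r m); [apply Hbelow; lra|apply Hd'; lra].
Qed.

(** Identity theorem by continuous induction along vertical segments. The property is open; at a
    limit point it follows from the bounds on the part already covered, along the ray that points
    back to the real axis. *)
Lemma order_near_strip (k0 : nat) (g : C -> C -> C) (a c d0 : R) :
  0 < d0 ->
  (forall x, Rabs (Im x) < a -> has_series g x (RtoC 0)) ->
  (forall x y : R, 0 < y < d0 -> Cmod (g (RtoC x) (RtoC y)) <= c * y ^ k0) ->
  forall x, Rabs (Im x) < a -> order_near k0 g x.
Proof.
  intros Hd0 Hs Hreal.
  assert (Hopen : forall x0, order_near k0 g x0 -> exists d, 0 < d /\ forall x1, Cmod (x1 - x0) < d -> order_near k0 g x1).
  { intros x0 (d & K & Hd & HK & H). exists (d / 2). split; [lra|]. intros x1 Hx1.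
    exists (d / 2), K. split; [lra|]. split; [auto|]. intros x y x' y' W Hx Hx' HW Hy Hy'.
    apply H; auto; try lra.
    - assert (T := Cmod_triangle3 x x1 x0). lra.
    - assert (T := Cmod_triangle3 x' x1 x0). lra. }
  assert (Hbase : forall p : R, 0 < a -> order_near k0 g (RtoC p)).
  { intros p Ha. apply (order_near_of_direction k0 g (RtoC p) (RtoC 1) 1).
    - apply Hs. simpl. rewrite Rabs_R0. auto.
    - apply Cmod_1.
    - lra.
    - intros t Ht. exists c, d0. split; auto. intros y Hy. rewrite Cmult_1_r, <- RtoC_plus. apply Hreal. auto. }
  assert (Hdir : forall (p : R) (e : C), Cmod e = 1 -> (forall t : R, Rabs (Im (RtoC p + RtoC t * e)) = Rabs t) ->
     forall t, 0 <= t < a -> order_near k0 g (RtoC p + RtoC t * e)%C).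
  { intros p e He Hie t Ht. apply (real_induction (fun t => order_near k0 g (RtoC p + RtoC t * e)%C) a); auto.
    - replace (RtoC p + RtoC 0 * e)%C with (RtoC p) by ring. apply Hbase. lra.
    - intros s Hs' Hbelow. apply (order_near_of_direction k0 g _ (- e)%C s).
      + apply Hs. rewrite Hie, Rabs_pos_eq; lra.
      + rewrite Cmod_opp. auto.
      + lra.
      + intros r Hr. destruct (Hbelow (s - r) ltac:(lra)) as (d & K & Hd & HK & H).
        exists K, d. split; auto. intros y Hy.
        replace (RtoC p + RtoC s * e + RtoC r * - e)%C with (RtoC p + RtoC (s - r) * e)%C by (rewrite RtoC_minus; ring).
        assert (Ey : Cmod (RtoC y) = y) by (rewrite Cmod_R, Rabs_pos_eq; lra).
        set (X := (RtoC p + RtoC (s - r) * e)%C) in *.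
        assert (EX : Cmod (X - X) <= d) by (replace (X - X)%C with (RtoC 0) by ring; rewrite Cmod_0; lra).
        destruct (H X (RtoC y) X (RtoC y) y EX EX ltac:(lra) ltac:(lra) ltac:(lra)) as [_ H2].
        rewrite Ey in H2. exact H2.
    - intros s Hs' HP. destruct (Hopen _ HP) as (d & Hd & Hd'). exists d. split; auto.
      intros r Hr. apply Hd'.
      replace (RtoC p + RtoC r * e - (RtoC p + RtoC s * e))%C with (RtoC (r - s) * e)%C by (rewrite RtoC_minus; ring).
      rewrite Cmod_mult, He, Cmod_R, Rabs_pos_eq; lra. }
  intros [p q] Hx. simpl in Hx.
  destruct (Rle_dec 0 q) as [Hq|Hq].
  - rewrite Rabs_pos_eq in Hx by auto.
    replace (p, q) with (RtoC p + RtoC q * Ci)%C by (unfold RtoC, Ci, Cplus, Cmult; simpl; f_equal; ring).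
    apply Hdir; [apply Cmod_Ci| |lra]. intros t. f_equal. unfold Im; simpl. ring.
  - rewrite Rabs_left in Hx by lra.
    replace (p, q) with (RtoC p + RtoC (- q) * - Ci)%C by (unfold RtoC, Ci, Cplus, Cmult, Copp; simpl; f_equal; ring).
    apply Hdir; [rewrite Cmod_opp; apply Cmod_Ci| |lra]. intros t. rewrite <- (Rabs_Ropp t). f_equal. unfold Im; simpl. ring.
Qed.

Lemma order_uniform (k0 : nat) (g : C -> C -> C) (a2 b : R) :
  0 < b ->
  (forall x, Rabs (Im x) <= a2 -> order_near k0 g x) ->
  (forall x y, Rabs (Im x) <= a2 -> Cmod y < b -> g (x + 1)%C y = g x y) ->
  exists d A, 0 < d < b /\ 0 < A /\ forall x y x' y' W,
    Rabs (Im x) <= a2 -> Rabs (Im x') <= a2 -> Cmod (x - x') <= d -> W <= d -> Cmod y <= W -> Cmod y' <= W ->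
    Cmod (g x y - g x' y') <= A * (W ^ k0 * Cmod (x - x') + W ^ (pred k0) * Cmod (y - y')) /\
    Cmod (g x y) <= A * Cmod y ^ k0.
Proof.
  intros Hb Ho Hp.
  (* One number [e] serves as scale and, through [/ e], as constant; a lower bound on [e] then
     controls both at once. The factor 4 leaves room for the second point x'. *)
  destruct (rectangle_compactness 0 1 (- a2) a2 (fun u v e => forall x y x' y' W,
     Cmod (x - (u, v)) <= 4 * e -> Cmod (x' - (u, v)) <= 4 * e -> W <= 4 * e -> Cmod y <= W -> Cmod y' <= W ->
    Cmod (g x y - g x' y') <= / e * (W ^ k0 * Cmod (x - x') + W ^ (pred k0) * Cmod (y - y')) /\
    Cmod (g x y) <= / e * Cmod y ^ k0)) as (d & Hd & H).
  { intros u v Hu Hv. destruct (Ho (u, v) ltac:(simpl; apply Rabs_le; lra)) as (d & K & Hd & HK & H).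
    set (e := Rmin (d / 4) (/ K)). assert (HiK : 0 < / K) by (apply Rinv_0_lt_compat; auto).
    assert (He : 0 < e) by (apply Rmin_pos; lra).
    assert (E1 : e <= d / 4) by apply Rmin_l. assert (E2 : e <= / K) by apply Rmin_r.
    assert (E3 : K <= / e) by (rewrite <- (Rinv_inv K); apply Rinv_le_contravar; auto).
    exists e. split; auto. intros x y x' y' W Hx Hx' HW Hy Hy'.
    assert (HW0 : 0 <= W) by (eapply Rle_trans; [apply Cmod_ge_0|exact Hy]).
    destruct (H x y x' y' W ltac:(lra) ltac:(lra) ltac:(lra) Hy Hy') as [H1 H2]. split.
    - eapply Rle_trans; [exact H1|]. apply Rmult_le_compat_r; auto.
      apply Rplus_le_le_0_compat; apply Rmult_le_pos; auto using Cmod_ge_0; apply pow_le; auto.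
    - eapply Rle_trans; [exact H2|]. apply Rmult_le_compat_r; auto. apply pow_le, Cmod_ge_0. }
  set (d' := Rmin d (b / 2)). assert (Hd' : 0 < d') by (apply Rmin_pos; lra).
  assert (D1 : d' <= d) by apply Rmin_l. assert (D2 : d' <= b / 2) by apply Rmin_r.
  exists d', (/ d). split; [lra|]. split; [apply Rinv_0_lt_compat; auto|].
  assert (G : forall r x y x' y' W, Re x = r ->
    Rabs (Im x) <= a2 -> Rabs (Im x') <= a2 -> Cmod (x - x') <= d' -> W <= d' -> Cmod y <= W -> Cmod y' <= W ->
    Cmod (g x y - g x' y') <= / d * (W ^ k0 * Cmod (x - x') + W ^ (pred k0) * Cmod (y - y')) /\
    Cmod (g x y) <= / d * Cmod y ^ k0).
  2:{ intros x y x' y' W. apply (G (Re x)). reflexivity. }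
  apply (periodic_ind (fun r => forall x y x' y' W, Re x = r ->
    Rabs (Im x) <= a2 -> Rabs (Im x') <= a2 -> Cmod (x - x') <= d' -> W <= d' -> Cmod y <= W -> Cmod y' <= W ->
    Cmod (g x y - g x' y') <= / d * (W ^ k0 * Cmod (x - x') + W ^ (pred k0) * Cmod (y - y')) /\
    Cmod (g x y) <= / d * Cmod y ^ k0)).
  - intros r Hr x y x' y' W Ex Hx Hx' Hxx HW Hy Hy'. subst r.
    destruct (H (Re x) (Im x) Hr (proj1 (Rabs_le_between _ _) Hx)) as (u & v & e & Hu & Hv & H1 & H2 & H3 & H4).
    assert (HW0 : 0 <= W) by (eapply Rle_trans; [apply Cmod_ge_0|exact Hy]).
    assert (Hxe : Cmod (x - (u, v)) <= 2 * e).
    { eapply Rle_trans; [apply Cmod_le_Re_Im|].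
      assert (E1 : Re (x - (u, v))%C = Re x - u) by reflexivity.
      assert (E2 : Im (x - (u, v))%C = Im x - v) by reflexivity. rewrite E1, E2. lra. }
    assert (T := Cmod_triangle3 x' x (u, v)). rewrite (Cmod_sub_sym x' x) in T.
    destruct (H4 x y x' y' W ltac:(lra) ltac:(lra) ltac:(lra) Hy Hy') as [G1 G2].
    assert (Hie : / e <= / d) by (apply Rinv_le_contravar; auto). split.
    + eapply Rle_trans; [exact G1|]. apply Rmult_le_compat_r; auto.
      apply Rplus_le_le_0_compat; apply Rmult_le_pos; auto using Cmod_ge_0; apply pow_le; auto.
    + eapply Rle_trans; [exact G2|]. apply Rmult_le_compat_r; auto. apply pow_le, Cmod_ge_0.
  - intros r. split; intros G x y x' y' W Ex Hx Hx' Hxx HW Hy Hy'.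
    + set (z := (x - 1)%C). set (z' := (x' - 1)%C).
      assert (Ez : x = (z + 1)%C) by (unfold z; ring). assert (Ez' : x' = (z' + 1)%C) by (unfold z'; ring).
      assert (Hz : Rabs (Im z) <= a2) by (unfold z, Im in *; simpl in *; replace (snd x + - 0) with (snd x) by ring; auto).
      assert (Hz' : Rabs (Im z') <= a2) by (unfold z', Im in *; simpl in *; replace (snd x' + - 0) with (snd x') by ring; auto).
      assert (Ed : (x - x')%C = (z - z')%C) by (rewrite Ez, Ez'; ring).
      rewrite Ed in Hxx |- *. rewrite Ez, Ez', !Hp by (auto; lra).
      apply (G z y z' y' W); auto. unfold z, Re in *. simpl in *. rewrite Ex. ring.
    + assert (Hz : Rabs (Im (x + 1)%C) <= a2) by (unfold Im in *; simpl in *; rewrite Rplus_0_r; auto).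
      assert (Hz' : Rabs (Im (x' + 1)%C) <= a2) by (unfold Im in *; simpl in *; rewrite Rplus_0_r; auto).
      assert (Ed : (x - x')%C = (x + 1 - (x' + 1))%C) by ring.
      rewrite <- (Hp x y), <- (Hp x' y') by (auto; lra).
      rewrite Ed in Hxx |- *. apply (G (x + 1)%C y (x' + 1)%C y' W); auto. unfold Re in *. simpl. rewrite Ex. ring.
Qed.

Lemma near_twist_of_analytic (F : R * R -> R * R) (Fc : C * C -> C * C) (a b c d0 a2 : R) :
  0 < b -> 0 < d0 <= b -> a2 < a ->
  analytic_map_on (K := C_AbsRing) (complex_strip a b) Fc ->
  (forall x y, complex_strip a b (x, y) ->
     Fc ((x + 1)%C, y) = ((fst (Fc (x, y)) + 1)%C, snd (Fc (x, y)))) ->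
  (forall x y, strip b (x, y) ->
     Fc (RtoC x, RtoC y) = (RtoC (fst (F (x, y))), RtoC (snd (F (x, y))))) ->
  (forall x y, Rabs y < d0 ->
     Rabs (fst (F (x, y)) - (x + y)) <= c * Rabs y ^ 2 /\ Rabs (snd (F (x, y)) - y) <= c * Rabs y ^ 3) ->
  exists y1 d A, y1 < b /\ near_twist Fc a2 y1 d A.
Proof.
  intros Hb Hd0 Ha2 Han Hper HF Hord.
  (* The remainders after the linear twist, of orders 2 and 3 in [y] at real points; subtracting an
     affine function preserves the existence of a power series. *)
  set (u := fun x y => (fst (Fc (x, y)) - (0 + 1 * x + 1 * y))%C).
  set (v := fun x y => (snd (Fc (x, y)) - (0 + 0 * x + 1 * y))%C).
  assert (Hstrip : forall x, Rabs (Im x) < a -> complex_strip a b (x, RtoC 0)).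
  { intros x Hx. split; simpl; auto. rewrite Cmod_0. auto. }
  assert (Hreal : forall x y : R, 0 < y < d0 -> Fc (RtoC x, RtoC y) = (RtoC (fst (F (x, y))), RtoC (snd (F (x, y))))).
  { intros x y Hy. apply HF. unfold strip. simpl. rewrite Rabs_pos_eq; lra. }
  destruct (order_uniform 2 u a2 b Hb) as (d1 & A1 & Hd1 & HA1 & HU).
  { intros x Hx. apply (order_near_strip 2 u a c d0); try lra.
    - intros z Hz. destruct (Han _ (Hstrip z Hz)) as [H1 _].
      apply (has_series_minus_affine (fun x y => fst (Fc (x, y)))). exact (analytic2_at_C _ _ _ H1).
    - intros s y Hy. unfold u. rewrite Hreal by auto. cbn [fst].
      destruct (Hord s y ltac:(rewrite Rabs_pos_eq; lra)) as [O1 _].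
      rewrite (Rabs_pos_eq y) in O1 by lra.
      replace (RtoC (fst (F (s, y))) - (0 + 1 * RtoC s + 1 * RtoC y))%C with (RtoC (fst (F (s, y)) - (s + y)))
        by (rewrite RtoC_minus, RtoC_plus; ring).
      rewrite Cmod_R. exact O1. }
  { intros x y Hx Hy. unfold u. rewrite Hper by (split; simpl; lra). cbn [fst]. ring. }
  destruct (order_uniform 3 v a2 b Hb) as (d2 & A2 & Hd2 & HA2 & HV).
  { intros x Hx. apply (order_near_strip 3 v a c d0); try lra.
    - intros z Hz. destruct (Han _ (Hstrip z Hz)) as [_ H1].
      apply (has_series_minus_affine (fun x y => snd (Fc (x, y)))). exact (analytic2_at_C _ _ _ H1).
    - intros s y Hy. unfold v. rewrite Hreal by auto. cbn [snd].
      destruct (Hord s y ltac:(rewrite Rabs_pos_eq; lra)) as [_ O1].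
      rewrite (Rabs_pos_eq y) in O1 by lra.
      replace (RtoC (snd (F (s, y))) - (0 + 0 * RtoC s + 1 * RtoC y))%C with (RtoC (snd (F (s, y)) - y))
        by (rewrite RtoC_minus; ring).
      rewrite Cmod_R. exact O1. }
  { intros x y Hx Hy. unfold v. rewrite Hper by (split; simpl; lra). cbn [snd]. ring. }
  set (d := Rmin d1 d2). assert (Hd : 0 < d) by (apply Rmin_pos; lra).
  assert (D1 : d <= d1) by apply Rmin_l. assert (D2 : d <= d2) by apply Rmin_r.
  exists d, d, (A1 + A2). split; [lra|]. split.
  - repeat split; lra.
  - intros x y Hx Hy. assert (Hxx : Cmod (x - x) <= d) by (replace (x - x)%C with (RtoC 0) by ring; rewrite Cmod_0; lra).
    destruct (HU x y x y d Hx Hx ltac:(lra) ltac:(lra) Hy Hy) as [_ U].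
    destruct (HV x y x y d Hx Hx ltac:(lra) ltac:(lra) Hy Hy) as [_ V].
    unfold u in U. unfold v in V. assert (h := Cmod_ge_0 y).
    split.
    + replace (fst (Fc (x, y)) - x - y)%C with (fst (Fc (x, y)) - (0 + 1 * x + 1 * y))%C by ring.
      eapply Rle_trans; [exact U|]. apply Rmult_le_compat_r; [apply pow_le; auto|lra].
    + replace (snd (Fc (x, y)) - y)%C with (snd (Fc (x, y)) - (0 + 0 * x + 1 * y))%C by ring.
      eapply Rle_trans; [exact V|]. apply Rmult_le_compat_r; [apply pow_le; auto|lra].
  - intros x y x' y' W Hx Hx' Hy Hy' HW Hxx.
    destruct (HU x y x' y' W Hx Hx' ltac:(lra) ltac:(lra) Hy Hy') as [U _].
    destruct (HV x y x' y' W Hx Hx' ltac:(lra) ltac:(lra) Hy Hy') as [V _].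
    assert (HW0 : 0 <= W) by (eapply Rle_trans; [apply Cmod_ge_0|exact Hy]).
    unfold u in U. unfold v in V. simpl pred in U, V. rewrite pow_1 in U.
    assert (h1 := Cmod_ge_0 (x - x')). assert (h2 := Cmod_ge_0 (y - y')).
    assert (q2 : 0 <= W ^ 2) by (apply pow_le; auto). assert (q3 : 0 <= W ^ 3) by (apply pow_le; auto).
    split.
    + replace (fst (Fc (x, y)) - fst (Fc (x', y')) - (x - x') - (y - y'))%C with
       (fst (Fc (x, y)) - (0 + 1 * x + 1 * y) - (fst (Fc (x', y')) - (0 + 1 * x' + 1 * y')))%C by ring.
      eapply Rle_trans; [exact U|]. apply Rmult_le_compat_r; [|lra].
      apply Rplus_le_le_0_compat; apply Rmult_le_pos; auto.
    + replace (snd (Fc (x, y)) - snd (Fc (x', y')) - (y - y'))%C with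
       (snd (Fc (x, y)) - (0 + 0 * x + 1 * y) - (snd (Fc (x', y')) - (0 + 0 * x' + 1 * y')))%C by ring.
      eapply Rle_trans; [exact V|]. apply Rmult_le_compat_r; [|lra].
      apply Rplus_le_le_0_compat; apply Rmult_le_pos; auto.
  - intros x y Hx Hy. apply Hper. split; simpl; lra.
  - intros x y Hx Hy. destruct (Han (x, y)) as [S1 S2]; [split; simpl; lra|].
    split; apply analytic2_smooth; auto.
  - intros x y Hy. rewrite HF by (unfold strip; simpl; lra). simpl. auto.
Qed.

(** * Strictly convex curves *)

Lemma is_derive_lipschitz_at (f : R -> R) (x l : R) :
  is_derive f x l -> exists d, 0 < d /\ forall h, Rabs h < d -> Rabs (f (x + h) - f x) <= (Rabs l + 1) * Rabs h.
Proof.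
  intros H. apply is_derive_Reals in H. destruct (H 1 Rlt_0_1) as [d Hd].
  exists d. split; [apply cond_pos|]. intros h Hh. destruct (Req_dec h 0) as [->|Hn].
  - rewrite Rplus_0_r, Rminus_diag, Rabs_R0. lra.
  - specialize (Hd h Hn Hh).
    assert (E : f (x + h) - f x = ((f (x + h) - f x) / h - l) * h + l * h) by (field; auto).
    rewrite E. eapply Rle_trans; [apply Rabs_triang|]. rewrite !Rabs_mult.
    assert (h0 := Rabs_pos h). nra.
Qed.

(** Near the centre the derivative is again the sum of a power series, hence differentiable there,
    hence Lipschitz at the centre. *)
Lemma analytic1_derive (f : R -> R) (s0 : R) :
  analytic1_at f s0 -> is_derive f s0 (Derive f s0) /\
  exists d K, 0 < d /\ 0 <= K /\ forall h, Rabs h < d -> Rabs (Derive f (s0 + h) - Derive f s0) <= K * Rabs h.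
Proof.
  intros (rho & c & H). assert (Hr := cond_pos rho).
  assert (Hcv : Rbar_le (Rbar.Finite (rho / 2)) (CV_radius c)).
  { destruct (Rbar_le_lt_dec (Rbar.Finite (rho / 2)) (CV_radius c)) as [Hle|Hlt]; auto. exfalso.
    assert (Ea : Rabs (rho / 2) = rho / 2) by (apply Rabs_pos_eq; lra).
    apply (CV_disk_outside c (rho / 2)); [rewrite Ea; exact Hlt|].
    assert (P := H (s0 + rho / 2)). replace (s0 + rho / 2 - s0) with (rho / 2) in P by ring.
    specialize (P ltac:(rewrite Ea; lra)). apply is_pseries_R in P.
    apply ex_series_lim_0. eexists. exact P. }
  assert (Hin : forall h, Rabs h < rho / 2 -> Rbar_lt (Rbar.Finite (Rabs h)) (CV_radius c)).
  { intros h Hh. eapply Rbar_lt_le_trans; [|exact Hcv]. exact Hh. }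
  assert (Hf : forall s, Rabs (s - s0) < rho / 2 -> f s = PSeries c (s - s0)).
  { intros s Hs. symmetry. apply is_pseries_unique. apply H. lra. }
  assert (HD : forall s, Rabs (s - s0) < rho / 2 -> is_derive f s (PSeries (PS_derive c) (s - s0))).
  { intros s Hs. apply is_derive_ext_loc with (fun s => PSeries c (s - s0)).
    - assert (He : 0 < rho / 2 - Rabs (s - s0)) by lra.
      exists (mkposreal _ He). intros t Ht. symmetry. apply Hf.
      unfold ball in Ht. simpl in Ht. unfold AbsRing_ball, abs, minus, plus, opp in Ht. simpl in Ht.
      replace (t - s0) with ((t + - s) + (s - s0)) by ring. eapply Rle_lt_trans; [apply Rabs_triang|]. lra.
    - assert (Q := is_derive_PSeries c (s - s0) (Hin _ Hs)).
      assert (Q2 := is_derive_comp (PSeries c) (fun s => s - s0) s (PSeries (PS_derive c) (s - s0)) 1 Q).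
      replace (PSeries (PS_derive c) (s - s0)) with (scal 1 (PSeries (PS_derive c) (s - s0))) by (unfold scal; simpl; unfold mult; simpl; ring).
      apply Q2. auto_derive; auto; ring. }
  assert (H00 : Rabs (s0 - s0) < rho / 2) by (rewrite Rminus_diag, Rabs_R0; lra).
  split.
  - assert (Q := HD s0 H00). rewrite (is_derive_unique _ _ _ Q). exact Q.
  - assert (Q : Rbar_lt (Rbar.Finite (Rabs 0)) (CV_radius (PS_derive c))).
    { rewrite CV_radius_derive. apply Hin. rewrite Rabs_R0. lra. }
    destruct (is_derive_lipschitz_at _ _ _ (is_derive_PSeries _ _ Q)) as (d & Hd & HL).
    exists (Rmin d (rho / 2)), (Rabs (PSeries (PS_derive (PS_derive c)) 0) + 1).
    split; [apply Rmin_pos; lra|]. split; [assert (h := Rabs_pos (PSeries (PS_derive (PS_derive c)) 0)); lra|].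
    intros h Hh.
    assert (H1 : Rabs h < d) by (eapply Rlt_le_trans; [exact Hh|apply Rmin_l]).
    assert (H2 : Rabs h < rho / 2) by (eapply Rlt_le_trans; [exact Hh|apply Rmin_r]).
    rewrite (is_derive_unique _ _ _ (HD (s0 + h) ltac:(replace (s0 + h - s0) with h by ring; auto))).
    rewrite (is_derive_unique _ _ _ (HD s0 H00)).
    replace (s0 + h - s0) with (0 + h) by ring. replace (s0 - s0) with 0 by ring. apply HL. auto.
Qed.

Lemma inner_plus_l (u v w : C) : inner (u + v) w = inner u w + inner v w.
Proof. unfold inner, Re, Im. simpl. ring. Qed.
Lemma inner_minus_l (u v w : C) : inner (u - v) w = inner u w - inner v w.
Proof. unfold inner, Re, Im. simpl. ring. Qed.
Lemma inner_minus_r (u v w : C) : inner w (u - v) = inner w u - inner w v.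
Proof. unfold inner, Re, Im. simpl. ring. Qed.
Lemma inner_scal_l (t : R) (u w : C) : inner (RtoC t * u) w = t * inner u w.
Proof. unfold inner, Re, Im. simpl. ring. Qed.
Lemma inner_scal_r (t : R) (u w : C) : inner w (RtoC t * u) = t * inner w u.
Proof. unfold inner, Re, Im. simpl. ring. Qed.
Lemma inner_sym (u w : C) : inner u w = inner w u.
Proof. unfold inner. ring. Qed.
Lemma inner_self (u : C) : inner u u = Cmod u * Cmod u.
Proof. rewrite Cmod_sq. unfold inner. ring. Qed.

Lemma inner_le (u w : C) : Rabs (inner u w) <= Cmod u * Cmod w.
Proof.
  apply Rsqr_incr_0; [|apply Rabs_pos|apply Rmult_le_pos; apply Cmod_ge_0].
  rewrite <- Rsqr_abs. unfold Rsqr.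
  replace (Cmod u * Cmod w * (Cmod u * Cmod w)) with ((Cmod u * Cmod u) * (Cmod w * Cmod w)) by ring.
  rewrite !Cmod_sq. unfold inner.
  assert (h := Rle_0_sqr (Re u * Im w - Im u * Re w)). unfold Rsqr in h. nra.
Qed.

(** Convexity is kept in the form [sc_ray]: a ray from a point of the curve meets it again at most
    once. Regularity is kept as a Lipschitz bound on the velocity at each point, made uniform by
    compactness where necessary. *)
Record smooth_curve (M : R -> C) (l : R) : Prop := {
  sc_length : 0 < l;
  sc_periodic : forall s, M (s + 1) = M s;
  sc_injective : forall s t, M s = M t -> exists k : Z, t = s + IZR k;
  sc_derive : forall s, is_derive (fun t => Re (M t)) s (Re (velocity M s)) /\
    is_derive (fun t => Im (M t)) s (Im (velocity M s));
  sc_speed : forall s, Cmod (velocity M s) = l;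
  sc_velocity_lipschitz : forall s, exists d K, 0 < d /\ 0 <= K /\
    forall h, Rabs h < d -> Cmod (velocity M (s + h) - velocity M s) <= K * Rabs h;
  sc_ray : forall s t t' tau tau' (u : C), 0 < tau -> 0 < tau' ->
    (M t - M s)%C = (RtoC tau * u)%C -> (M t' - M s)%C = (RtoC tau' * u)%C -> M t = M t'
}.

Lemma analytic_convex_smooth_curve (M : R -> C) :
  analytic_convex_curve M -> exists l, smooth_curve M l.
Proof.
  intros (Han & Hinj & (l & Hl & Hsp) & _ & (Om & Hconv & Hbd)). exists l. constructor; auto.
  - intros s. symmetry. apply Hinj. exists 1%Z. reflexivity.
  - intros s t H. apply Hinj. exact H.
  - intros s. destruct (Han s) as [H1 H2]. split; apply analytic1_derive; auto.
  - intros s. destruct (Han s) as [H1 H2].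
    destruct (analytic1_derive _ _ H1) as [_ (d1 & K1 & Hd1 & HK1 & L1)].
    destruct (analytic1_derive _ _ H2) as [_ (d2 & K2 & Hd2 & HK2 & L2)].
    exists (Rmin d1 d2), (K1 + K2). split; [apply Rmin_pos; auto|]. split; [lra|]. intros h Hh.
    eapply Rle_trans; [apply Cmod_le_Re_Im|]. rewrite Rmult_plus_distr_r. apply Rplus_le_compat.
    + apply L1. eapply Rlt_le_trans; [exact Hh|apply Rmin_l].
    + apply L2. eapply Rlt_le_trans; [exact Hh|apply Rmin_r].
  (* The nearer of two points on a ray from [M s] is a strict convex combination of [M s] and the
     farther one, hence interior to [Om] and not on the boundary. *)
  - assert (Ray : forall s t t' tau tau' (u : C), 0 < tau -> tau < tau' ->
      (M t - M s)%C = (RtoC tau * u)%C -> (M t' - M s)%C = (RtoC tau' * u)%C -> u <> RtoC 0 -> False).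
    { intros s t t' tau tau' u Ht Htt E E' Hu.
      destruct Hconv as (Hclosed & _ & _ & Hstrict).
      assert (HOm : forall r, Om (M r)).
      { intros r. apply Hclosed. apply Hbd. exists r. reflexivity. }
      assert (Hb : boundary Om (M t)) by (apply Hbd; exists t; reflexivity).
      apply (proj1 Hb).
      assert (Et : M t = (RtoC (1 - tau / tau') * M s + RtoC (tau / tau') * M t')%C).
      { replace (M t) with (M s + RtoC tau * u)%C by (rewrite <- E; ring).
        replace (M t') with (M s + RtoC tau' * u)%C by (rewrite <- E'; ring).
        rewrite RtoC_minus. replace (RtoC tau) with (RtoC (tau / tau') * RtoC tau')%C; [ring|].
        rewrite <- RtoC_mult. f_equal. field. lra. }
      rewrite Et. apply Hstrict; auto.
      - intros E0. apply Hu. assert (E2 : (RtoC tau' * u)%C = RtoC 0) by (rewrite <- E', <- E0; ring).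
        assert (Hn : RtoC tau' <> RtoC 0) by (intros E3; apply RtoC_inj in E3; lra).
        replace u with (RtoC tau' * u / RtoC tau')%C by (field; auto). rewrite E2. field. auto.
      - split; [apply Rdiv_lt_0_compat; lra|]. apply (Rdiv_lt_1 tau tau'); lra. }
    intros s t t' tau tau' u Ht Ht' E E'.
    destruct (classic (u = RtoC 0)) as [->|Hu].
    { replace (M t) with (M t - M s + M s)%C by ring. replace (M t') with (M t' - M s + M s)%C by ring.
      rewrite E, E'. ring. }
    destruct (Rtotal_order tau tau') as [Hlt|[Heq|Hgt]].
    + exfalso. apply (Ray s t t' tau tau' u); auto.
    + subst tau'. replace (M t) with (M t - M s + M s)%C by ring. rewrite E, <- E'. ring.
    + exfalso. apply (Ray s t' t tau' tau u); auto.
Qed.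

Lemma curve_int (M : R -> C) (l : R) : smooth_curve M l -> forall (k : Z) s, M (s + IZR k) = M s.
Proof.
  intros HM.
  assert (Hn : forall (n : nat) s, M (s + INR n) = M s).
  { induction n as [|n IH]; intros s; [simpl; rewrite Rplus_0_r; reflexivity|].
    rewrite S_INR, <- Rplus_assoc, (sc_periodic M l HM). apply IH. }
  intros k s. destruct (Z_le_dec 0 k) as [H|H].
  - rewrite <- (Z2Nat.id k H), <- INR_IZR_INZ. apply Hn.
  - rewrite <- (Hn (Z.to_nat (- k)) (s + IZR k)). f_equal.
    rewrite INR_IZR_INZ, Z2Nat.id, opp_IZR by lia. ring.
Qed.

Lemma velocity_periodic (M : R -> C) (l : R) : smooth_curve M l -> forall s, velocity M (s + 1) = velocity M s.
Proof.
  intros HM s. destruct (sc_derive M l HM s) as [D1 D2]. destruct (sc_derive M l HM (s + 1)) as [D3 D4].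
  assert (G : forall g : C -> R, forall d1 d2, is_derive (fun t => g (M t)) s d1 ->
     is_derive (fun t => g (M t)) (s + 1) d2 -> d2 = d1).
  { intros g d1 d2 H1 H2.
    assert (H3 : is_derive (fun t => g (M t)) s d2).
    { apply is_derive_ext with (fun t => g (M (t + 1))); [intros t; rewrite (sc_periodic M l HM); reflexivity|].
      assert (Q := is_derive_comp (fun t => g (M t)) (fun t => t + 1) s d2 1 H2).
      replace d2 with (scal 1 d2) by (unfold scal; simpl; unfold mult; simpl; ring).
      apply Q. auto_derive; auto; ring. }
    rewrite <- (is_derive_unique _ _ _ H1), <- (is_derive_unique _ _ _ H3). reflexivity. }
  assert (E1 := G Re _ _ D1 D3). assert (E2 := G Im _ _ D2 D4).
  destruct (velocity M (s + 1)), (velocity M s). simpl in *. subst. reflexivity.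
Qed.

Lemma velocity_int (M : R -> C) (l : R) : smooth_curve M l -> forall (k : Z) s, velocity M (s + IZR k) = velocity M s.
Proof.
  intros HM.
  assert (Hn : forall (n : nat) s, velocity M (s + INR n) = velocity M s).
  { induction n as [|n IH]; intros s; [simpl; rewrite Rplus_0_r; reflexivity|].
    rewrite S_INR, <- Rplus_assoc, (velocity_periodic M l HM). apply IH. }
  intros k s. destruct (Z_le_dec 0 k) as [H|H].
  - rewrite <- (Z2Nat.id k H), <- INR_IZR_INZ. apply Hn.
  - rewrite <- (Hn (Z.to_nat (- k)) (s + IZR k)). f_equal.
    rewrite INR_IZR_INZ, Z2Nat.id, opp_IZR by lia. ring.
Qed.

Lemma unit_tangent_int (M : R -> C) (l : R) : smooth_curve M l -> forall (k : Z) s, unit_tangent M (s + IZR k) = unit_tangent M s.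
Proof. intros HM k s. unfold unit_tangent. rewrite (velocity_int M l HM). reflexivity. Qed.

Lemma velocity_tangent (M : R -> C) (l s : R) :
  smooth_curve M l -> velocity M s = (RtoC l * unit_tangent M s)%C.
Proof.
  intros HM. unfold unit_tangent. rewrite (sc_speed M l HM). assert (h := sc_length M l HM).
  field. intros E. apply RtoC_inj in E. lra.
Qed.

Lemma unit_tangent_mod (M : R -> C) (l s : R) : smooth_curve M l -> Cmod (unit_tangent M s) = 1.
Proof.
  intros HM. assert (h := sc_length M l HM). assert (E := velocity_tangent M l s HM).
  apply (f_equal Cmod) in E. rewrite Cmod_mult, Cmod_R, Rabs_pos_eq, (sc_speed M l HM) in E by lra. nra.
Qed.

Lemma inner_derive (M : R -> C) (l : R) (w : C) (s : R) :
  smooth_curve M l -> is_derive (fun t => inner (M t) w) s (inner (velocity M s) w).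
Proof.
  intros HM. destruct (sc_derive M l HM s) as [D1 D2]. unfold inner.
  apply (is_derive_plus (fun t => Re (M t) * Re w) (fun t => Im (M t) * Im w)).
  - assert (Q := is_derive_mult (fun t => Re (M t)) (fun _ => Re w) s _ 0 D1 (is_derive_const _ s) Rmult_comm).
    unfold plus, mult in Q. simpl in Q. rewrite Rmult_0_r, Rplus_0_r in Q. exact Q.
  - assert (Q := is_derive_mult (fun t => Im (M t)) (fun _ => Im w) s _ 0 D2 (is_derive_const _ s) Rmult_comm).
    unfold plus, mult in Q. simpl in Q. rewrite Rmult_0_r, Rplus_0_r in Q. exact Q.
Qed.

(** The mean value theorem fails for vector-valued maps; it is applied to the component along a
    fixed [w], often the very vector whose length is to be bounded. *)
Lemma inner_mean_value (M : R -> C) (l : R) (w : C) (s t : R) :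
  smooth_curve M l -> s <= t ->
  exists c, s <= c <= t /\ inner (M t - M s) w = inner (velocity M c) w * (t - s).
Proof.
  intros HM Hst. destruct (MVT_gen (fun t => inner (M t) w) s t (fun c => inner (velocity M c) w)) as (c & Hc & E).
  - intros x _. apply (inner_derive M l); auto.
  - intros x _. apply derivable_continuous_pt. exists (inner (velocity M x) w). apply is_derive_Reals. apply (inner_derive M l); auto.
  - rewrite Rmin_left, Rmax_right in Hc by auto. exists c. split; auto. rewrite inner_minus_l. exact E.
Qed.

Lemma chord_le (M : R -> C) (l s t : R) : smooth_curve M l -> Cmod (M t - M s) <= l * Rabs (t - s).
Proof.
  intros HM. assert (hl := sc_length M l HM).
  assert (G : forall s t, s <= t -> Cmod (M t - M s) <= l * (t - s)).
  { intros s' t' Hst. set (v := (M t' - M s')%C).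
    destruct (inner_mean_value M l v s' t' HM Hst) as (c & Hc & E). fold v in E. rewrite inner_self in E.
    assert (h := inner_le (velocity M c) v). rewrite (sc_speed M l HM) in h.
    assert (hv := Cmod_ge_0 v). assert (h2 := Rle_abs (inner (velocity M c) v)).
    destruct (Req_dec (Cmod v) 0) as [E0|E0].
    - rewrite E0. apply Rmult_le_pos; lra.
    - apply Rmult_le_reg_l with (Cmod v); [lra|].
      assert (inner (velocity M c) v * (t' - s') <= l * Cmod v * (t' - s')) by (apply Rmult_le_compat_r; lra). lra. }
  destruct (Rle_dec s t) as [H|H].
  - rewrite Rabs_pos_eq by lra. apply G; auto.
  - rewrite Cmod_sub_sym, Rabs_minus_sym, Rabs_pos_eq by lra. apply G. lra.
Qed.

Lemma velocity_close (M : R -> C) (l : R) :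
  smooth_curve M l -> exists e0, 0 < e0 < 1/2 /\
    forall s t, Rabs (t - s) <= e0 -> l * l / 2 <= inner (velocity M t) (velocity M s).
Proof.
  intros HM. assert (hl := sc_length M l HM).
  destruct (rectangle_compactness 0 1 0 0 (fun u v e => forall h, Rabs h <= 2 * e ->
     Cmod (velocity M (u + h) - velocity M u) <= l / 4)) as (d & Hd & H).
  { intros u v _ _. destruct (sc_velocity_lipschitz M l HM u) as (d & K & Hd & HK & HL).
    set (e := Rmin (d / 4) (l / (8 * (K + 1)))).
    assert (Hq : 0 < l / (8 * (K + 1))) by (apply Rdiv_lt_0_compat; lra).
    exists e. split; [apply Rmin_pos; lra|]. intros h Hh.
    assert (E1 : e <= d / 4) by apply Rmin_l. assert (E2 : e <= l / (8 * (K + 1))) by apply Rmin_r.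
    eapply Rle_trans; [apply HL; lra|].
    assert (E3 : (K + 1) * (2 * e) <= l / 4).
    { replace (l / 4) with ((K + 1) * (2 * (l / (8 * (K + 1))))) by (field; lra). apply Rmult_le_compat_l; lra. }
    assert (hh := Rabs_pos h).
    assert (K * Rabs h <= (K + 1) * (2 * e)) by (apply Rmult_le_compat; lra). lra. }
  exists (Rmin (d / 2) (1/4)). 
  assert (Hm1 := Rmin_l (d / 2) (1/4)). assert (Hm2 := Rmin_r (d / 2) (1/4)).
  assert (Hm3 : 0 < Rmin (d / 2) (1/4)) by (apply Rmin_pos; lra).
  split; [lra|].
  apply (periodic_ind (fun s => forall t, Rabs (t - s) <= Rmin (d / 2) (1/4) -> l * l / 2 <= inner (velocity M t) (velocity M s))).
  - intros s Hs t Ht. destruct (H s 0 Hs ltac:(lra)) as (u & v & e & Hu & Hv & H1 & H2 & H3 & H4).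
    assert (B1 := H4 (s - u) ltac:(lra)). replace (u + (s - u)) with s in B1 by ring.
    assert (B2 : Cmod (velocity M t - velocity M u) <= l / 4).
    { replace t with (u + (t - u)) by ring. apply H4. replace (t - u) with ((t - s) + (s - u)) by ring.
      eapply Rle_trans; [apply Rabs_triang|]. lra. }
    assert (B3 := Cmod_triangle3 (velocity M t) (velocity M u) (velocity M s)).
    rewrite (Cmod_sub_sym (velocity M u)) in B3.
    replace (velocity M t) with ((velocity M t - velocity M s) + velocity M s)%C by ring.
    rewrite inner_plus_l, inner_self, (sc_speed M l HM).
    assert (B4 := inner_le (velocity M t - velocity M s) (velocity M s)). rewrite (sc_speed M l HM) in B4.
    assert (B5 := Rabs_le_between (inner (velocity M t - velocity M s) (velocity M s)) (Cmod (velocity M t - velocity M s) * l)).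
    assert (B6 := proj1 B5 B4). nra.
  - intros s. split; intros G t Ht.
    + rewrite (velocity_periodic M l HM). replace t with ((t - 1) + 1) by ring. rewrite (velocity_periodic M l HM).
      apply G. replace (t - 1 - s) with (t - (s + 1)) by ring. auto.
    + rewrite <- (velocity_periodic M l HM s), <- (velocity_periodic M l HM t). apply G.
      replace (t + 1 - (s + 1)) with (t - s) by ring. auto.
Qed.

(** The chord integrates velocities that all have a component of at least l / 2 along the tangent at
    [c], while its length is at most l (t - s). *)
Lemma short_chord_angle (M : R -> C) (l e0 : R) :
  smooth_curve M l ->
  (forall s t, Rabs (t - s) <= e0 -> l * l / 2 <= inner (velocity M t) (velocity M s)) ->
  forall s t c tau (u : C), s < t <= s + e0 -> s <= c <= t -> 0 < tau -> Cmod u = 1 ->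
    (M t - M s)%C = (RtoC tau * u)%C -> 1/2 <= inner u (unit_tangent M c).
Proof.
  intros HM He s t c tau u Hst Hc Ht Hu E. assert (hl := sc_length M l HM).
  destruct (inner_mean_value M l (velocity M c) s t HM ltac:(lra)) as (b & Hb & E1).
  rewrite E, inner_scal_l in E1.
  assert (B1 := He c b ltac:(apply Rabs_le; lra)).
  assert (B2 := chord_le M l s t HM). rewrite E, Cmod_mult, Hu, Cmod_R in B2.
  rewrite !Rabs_pos_eq in B2 by lra.
  rewrite (velocity_tangent M l c HM), inner_scal_r in E1.
  assert (B3 : l * l / 2 * (t - s) <= tau * (l * inner u (unit_tangent M c))).
  { rewrite E1, <- (velocity_tangent M l c HM). apply Rmult_le_compat_r; lra. }
  assert (B4 : tau * (l / 2) <= l * (t - s) * (l / 2)) by (apply Rmult_le_compat_r; lra).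
  apply Rmult_le_reg_l with (tau * l); [apply Rmult_lt_0_compat; lra|]. lra.
Qed.

(** A minimum over a compact set of pairs, positive because the chord vanishes only when the
    parameters differ by an integer. *)
Lemma long_chord (M : R -> C) (l e : R) :
  smooth_curve M l -> 0 < e < 1/2 -> exists c, 0 < c /\
    forall s t, s + e <= t <= s + 1 - e -> c <= Cmod (M t - M s).
Proof.
  intros HM He. assert (hl := sc_length M l HM).
  destruct (rectangle_max 0 1 e (1 - e) (fun s h => - Cmod (M (s + h) - M s))) as (u & v & Hu & Hv & Hmax); try lra.
  { intros u v _ _ eps Heps. exists (eps / (3 * l)). split; [apply Rdiv_lt_0_compat; lra|].
    intros x y Hx Hy.
    assert (T1 := Cmod_triangle3 (M (u + v) ) (M (x + y)) (M u)).
    assert (T2 := Cmod_triangle3 (M (x + y)) (M x) (M u)).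
    assert (L1 := chord_le M l (x + y) (u + v) HM). assert (L2 := chord_le M l u x HM).
    assert (B : Rabs (u + v - (x + y)) <= Rabs (x - u) + Rabs (y - v)).
    { replace (u + v - (x + y)) with (- (x - u) + - (y - v)) by ring.
      eapply Rle_trans; [apply Rabs_triang|]. rewrite !Rabs_Ropp. lra. }
    assert (B2 : l * Rabs (u + v - (x + y)) <= l * (Rabs (x - u) + Rabs (y - v))) by (apply Rmult_le_compat_l; lra).
    assert (B3 : l * (eps / (3 * l)) = eps / 3) by (field; lra).
    assert (B4 : l * Rabs (x - u) <= l * (eps / (3 * l))) by (apply Rmult_le_compat_l; lra).
    assert (B5 : l * Rabs (y - v) <= l * (eps / (3 * l))) by (apply Rmult_le_compat_l; lra). lra. }
  exists (Cmod (M (u + v) - M u)). split.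
  - apply Cmod_gt_0. intros E. assert (E2 : M u = M (u + v)).
    { replace (M (u + v)) with ((M (u + v)%R - M u) + M u)%C by ring. rewrite E. ring. }
    destruct (sc_injective M l HM _ _ E2) as [k Hk].
    assert (Hk1 : IZR k = v) by lra.
    assert (H1 : IZR 0 < IZR k) by lra. assert (H2 : IZR k < IZR 1) by lra.
    apply lt_IZR in H1. apply lt_IZR in H2. lia.
  - apply (periodic_ind (fun s => forall t, s + e <= t <= s + 1 - e -> Cmod (M (u + v) - M u) <= Cmod (M t - M s))).
    + intros s Hs t Ht. specialize (Hmax s (t - s) Hs ltac:(lra)). cbv beta in Hmax.
      replace (s + (t - s)) with t in Hmax by ring. lra.
    + intros s. split; intros G t Ht.
      * rewrite (sc_periodic M l HM). replace t with ((t - 1) + 1) by ring. rewrite (sc_periodic M l HM). apply G. lra.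
      * rewrite <- (sc_periodic M l HM s), <- (sc_periodic M l HM t). apply G. lra.
Qed.

(** * Billiard map *)

Definition ray (M : R -> C) (s r : R) : C := (unit_tangent M s * cis r)%C.

Lemma Cmod_cis (r : R) : Cmod (cis r) = 1.
Proof.
  apply Rsqr_inj; [apply Cmod_ge_0|lra|]. unfold Rsqr. rewrite Cmod_sq. unfold cis. simpl.
  assert (h := sin2_cos2 r). unfold Rsqr in h. lra.
Qed.

Lemma Cmod_ray (M : R -> C) (l s r : R) : smooth_curve M l -> Cmod (ray M s r) = 1.
Proof. intros HM. unfold ray. rewrite Cmod_mult, Cmod_cis, (unit_tangent_mod M l s HM). ring. Qed.

Lemma inner_rotation (T : C) (r : R) : Cmod T = 1 -> inner (T * cis r) T = cos r.
Proof.
  intros H. assert (E := Cmod_sq T). rewrite H in E. unfold inner, cis. destruct T as [a b]. simpl in *.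
  replace ((a * cos r - b * sin r) * a + (a * sin r + b * cos r) * b) with (cos r * (a * a + b * b)) by ring.
  rewrite <- E. ring.
Qed.

Lemma ray_int (M : R -> C) (l : R) (k : Z) (s r : R) : smooth_curve M l -> ray M (s + IZR k) r = ray M s r.
Proof. intros HM. unfold ray. rewrite (unit_tangent_int M l HM). reflexivity. Qed.

Lemma billiard_step (M : R -> C) (G : R * R -> R * R) (l s r : R) :
  smooth_curve M l -> billiard_lift M G -> 0 < r < PI ->
  let s1 := fst (G (s, r)) in let r1 := snd (G (s, r)) in
  s < s1 < s + 1 /\ 0 < r1 < PI /\
  inner (ray M s r) (unit_tangent M s) = cos r /\
  inner (ray M s r) (unit_tangent M s1) = cos r1 /\
  ray M s r = (unit_tangent M s1 * cis (- r1))%C /\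
  exists tau, 0 < tau /\ (M s1 - M s)%C = (RtoC tau * ray M s r)%C.
Proof.
  intros HM HG Hr s1 r1. destruct (HG s r Hr) as (H1 & H2 & H3 & H4).
  fold s1 r1 in H1, H2, H3, H4. fold (ray M s r) in H3, H4.
  set (T := unit_tangent M s1) in *. assert (HT : Cmod T = 1) by apply (unit_tangent_mod M l s1 HM).
  assert (E : inner (ray M s r) T = cos r1).
  { rewrite <- (inner_rotation T r1 HT), <- H4, inner_minus_l, inner_scal_l, inner_self, HT. ring. }
  repeat (split; [assumption|]). split; [apply inner_rotation, (unit_tangent_mod M l s HM)|].
  split; [exact E|]. split; [|exact H3].
  replace (ray M s r) with (RtoC (2 * inner (ray M s r) T) * T - (RtoC (2 * inner (ray M s r) T) * T - ray M s r))%C by ring.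
  rewrite H4, E. unfold cis. rewrite cos_neg, sin_neg. destruct T as [x y].
  unfold Cmult, Cminus, Cplus, Copp, RtoC. simpl. f_equal; ring.
Qed.

Lemma curve_injective_period (M : R -> C) (l s t t' : R) :
  smooth_curve M l -> s < t < s + 1 -> s < t' < s + 1 -> M t = M t' -> t = t'.
Proof.
  intros HM Ht Ht' E. destruct (sc_injective M l HM _ _ E) as [k Hk].
  assert (H1 : IZR (-1) < IZR k) by (simpl; lra). assert (H2 : IZR k < IZR 1) by (simpl; lra).
  apply lt_IZR in H1. apply lt_IZR in H2. replace k with 0%Z in Hk by lia. lra.
Qed.

Lemma billiard_ray_unique (M : R -> C) (G : R * R -> R * R) (l s r t tau : R) :
  smooth_curve M l -> billiard_lift M G -> 0 < r < PI -> s < t < s + 1 -> 0 < tau ->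
  (M t - M s)%C = (RtoC tau * ray M s r)%C -> fst (G (s, r)) = t.
Proof.
  intros HM HG Hr Ht Htau E.
  destruct (billiard_step M G l s r HM HG Hr) as (H1 & _ & _ & _ & _ & (tau' & Htau' & E')).
  apply (curve_injective_period M l s); auto.
  apply (sc_ray M l HM s _ _ tau' tau (ray M s r)); auto.
Qed.

Lemma billiard_shift (M : R -> C) (G : R * R -> R * R) (l s r : R) (k : Z) :
  smooth_curve M l -> billiard_lift M G -> 0 < r < PI ->
  G (s + IZR k, r) = (fst (G (s, r)) + IZR k, snd (G (s, r))).
Proof.
  intros HM HG Hr.
  destruct (billiard_step M G l s r HM HG Hr) as (H1 & H2 & _ & H3 & _ & (tau & Htau & E)).
  destruct (billiard_step M G l (s + IZR k) r HM HG Hr) as (H1' & H2' & _ & H3' & _).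
  assert (E1 : fst (G (s + IZR k, r)) = fst (G (s, r)) + IZR k).
  { apply (billiard_ray_unique M G l _ _ _ tau); auto; [lra|].
    rewrite !(curve_int M l HM), (ray_int M l) by auto. exact E. }
  assert (E2 : snd (G (s + IZR k, r)) = snd (G (s, r))).
  { apply cos_inj; try lra. rewrite <- H3, <- H3', E1, (ray_int M l), (unit_tangent_int M l HM) by auto. reflexivity. }
  destruct (G (s + IZR k, r)) as [p1 p2]. simpl in *. subst. reflexivity.
Qed.

(** A ray at more than pi/3 from the tangent line cannot follow a short chord, whether the impact is
    shortly after [s] or shortly before s + 1, the latter being a short chord traversed
    backwards. *)
Lemma billiard_chord_range (M : R -> C) (G : R * R -> R * R) (l e0 s r : R) :
  smooth_curve M l -> billiard_lift M G ->
  (forall s t, Rabs (t - s) <= e0 -> l * l / 2 <= inner (velocity M t) (velocity M s)) ->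
  0 < r < PI -> Rabs (cos r) < 1/2 -> s + e0 <= fst (G (s, r)) <= s + 1 - e0.
Proof.
  intros HM HG He Hr Hc.
  destruct (billiard_step M G l s r HM HG Hr) as (H1 & _ & H3 & _ & _ & (tau & Htau & E)).
  set (t := fst (G (s, r))) in *. apply Rabs_def2 in Hc.
  split; apply Rnot_lt_le; intros Hlt.
  - assert (B := short_chord_angle M l e0 HM He s t s tau (ray M s r) ltac:(lra) ltac:(lra) Htau (Cmod_ray M l s r HM) E). lra.
  - assert (E2 : (M (s + 1)%R - M t)%C = (RtoC tau * (- ray M s r))%C).
    { rewrite (sc_periodic M l HM).
      replace (RtoC tau * - ray M s r)%C with (- (RtoC tau * ray M s r))%C by ring. rewrite <- E. ring. }
    assert (Hu : Cmod (- ray M s r) = 1) by (rewrite Cmod_opp; apply (Cmod_ray M l s r HM)).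
    assert (B := short_chord_angle M l e0 HM He t (s + 1) (s + 1) tau _ ltac:(lra) ltac:(lra) Htau Hu E2).
    assert (Ei : inner (- ray M s r) (unit_tangent M (s + 1)) = - inner (ray M s r) (unit_tangent M s)).
    { rewrite (unit_tangent_int M l HM 1). unfold inner, Re, Im. simpl. ring. }
    lra.
Qed.

(* Reflection gives [(tau + tau') cos r1 = <M s2 - M s0, T>]. *)
Lemma nearly_closed_chord (M : R -> C) (G : R * R -> R * R) (l : R) :
  smooth_curve M l -> billiard_lift M G -> exists e1 K, 0 < e1 /\ 0 < K /\
  forall s0 r0, 0 < r0 < PI ->
    let s1 := fst (G (s0, r0)) in let r1 := snd (G (s0, r0)) in let s2 := fst (G (s1, r1)) in
    Rabs (s2 - s0 - 1) <= e1 -> Rabs (cos r1) <= K * Rabs (s2 - s0 - 1).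
Proof.
  intros HM HG. assert (hl := sc_length M l HM).
  destruct (velocity_close M l HM) as (e0 & He0 & He).
  destruct (long_chord M l (e0 / 2) HM ltac:(lra)) as (c & Hc & Hlong).
  exists (e0 / 2), (l / c). split; [lra|]. split; [apply Rdiv_lt_0_compat; lra|].
  intros s0 r0 Hr0 s1 r1 s2 Hs2.
  destruct (billiard_step M G l s0 r0 HM HG Hr0) as (A1 & A2 & _ & A4 & _ & (tau & Htau & E)).
  fold s1 r1 in A1, A2, A4, E.
  destruct (billiard_step M G l s1 r1 HM HG A2) as (B1 & _ & B3 & _ & _ & (tau' & Htau' & E')).
  fold s2 in B1, E'.
  set (u := ray M s0 r0) in *. set (v := ray M s1 r1) in *.
  assert (Hu : Cmod u = 1) by apply (Cmod_ray M l _ _ HM). assert (Hv : Cmod v = 1) by apply (Cmod_ray M l _ _ HM).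
  assert (Hs2' := proj1 (Rabs_le_between _ _) Hs2).
  set (T := unit_tangent M s1) in *.
  assert (Hopp : forall w, inner (- w) T = - inner w T) by (intros w; unfold inner, Re, Im; simpl; ring).
  (* If [s1] were close to [s0] or to s0 + 1, the incoming and outgoing chords would be short and
     run along the curve in opposite directions, whereas reflection gives both the same component
     [cos r1] along the tangent. *)
  destruct (Rlt_dec (s1 - s0) (e0 / 2)) as [Hsmall|Hsmall].
  { exfalso.
    assert (F1 := short_chord_angle M l e0 HM He s0 s1 s1 tau u ltac:(lra) ltac:(lra) Htau Hu E).
    assert (E2 : (M (s1 + 1)%R - M s2)%C = (RtoC tau' * (- v))%C).
    { rewrite (sc_periodic M l HM). replace (RtoC tau' * - v)%C with (- (RtoC tau' * v))%C by ring. rewrite <- E'. ring. }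
    assert (F2 := short_chord_angle M l e0 HM He s2 (s1 + 1) (s1 + 1) tau' (- v)%C ltac:(lra) ltac:(lra) Htau'
       ltac:(rewrite Cmod_opp; auto) E2).
    rewrite (unit_tangent_int M l HM 1) in F2. fold T in F1, F2. rewrite Hopp in F2. lra. }
  destruct (Rlt_dec (s0 + 1 - e0 / 2) s1) as [Hbig|Hbig].
  { exfalso.
    assert (E2 : (M (s0 + 1)%R - M s1)%C = (RtoC tau * (- u))%C).
    { rewrite (sc_periodic M l HM). replace (RtoC tau * - u)%C with (- (RtoC tau * u))%C by ring. rewrite <- E. ring. }
    assert (F1 := short_chord_angle M l e0 HM He s1 (s0 + 1) s1 tau (- u)%C ltac:(lra) ltac:(lra) Htau
       ltac:(rewrite Cmod_opp; auto) E2).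
    assert (F2 := short_chord_angle M l e0 HM He s1 s2 s1 tau' v ltac:(lra) ltac:(lra) Htau' Hv E').
    fold T in F1, F2. rewrite Hopp in F1. lra. }
  assert (Hch := Hlong s0 s1 ltac:(lra)). rewrite E, Cmod_mult, Hu, Cmod_R, Rabs_pos_eq in Hch by lra.
  assert (Eq : (tau + tau') * cos r1 = inner (M s2 - M (s0 + 1)%R) T).
  { rewrite (sc_periodic M l HM).
    replace (M s2 - M s0)%C with (RtoC tau * u + RtoC tau' * v)%C by (rewrite <- E, <- E'; ring).
    rewrite inner_plus_l, !inner_scal_l. fold T in A4, B3. rewrite A4, B3. ring. }
  assert (B := inner_le (M s2 - M (s0 + 1)%R)%C T). rewrite <- Eq in B.
  unfold T in B at 1. rewrite (unit_tangent_mod M l s1 HM) in B.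
  assert (B2 := chord_le M l (s0 + 1) s2 HM). replace (s2 - (s0 + 1)) with (s2 - s0 - 1) in B2 by ring.
  rewrite Rabs_mult, Rabs_pos_eq in B by lra.
  assert (B4 : c * Rabs (cos r1) <= (tau + tau') * Rabs (cos r1)) by (apply Rmult_le_compat_r; [apply Rabs_pos|lra]).
  apply Rmult_le_reg_l with c; auto. replace (c * (l / c * Rabs (s2 - s0 - 1))) with (l * Rabs (s2 - s0 - 1)) by (field; lra). lra.
Qed.

(** * Dependence of the impact point on the initial data *)

Definition normal (u : C) : C := (- Im u, Re u).

Lemma normal_decomposition (u w : C) :
  Cmod u = 1 -> inner w (normal u) = 0 -> w = (RtoC (inner w u) * u)%C.
Proof.
  intros Hu H. assert (E := Cmod_sq u). rewrite Hu in E.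
  unfold inner, normal, Re, Im in *. destruct u as [a b], w as [x y].
  unfold Cmult, RtoC. simpl in *. f_equal.
  - replace x with (x * (a * a + b * b) + b * (x * - b + y * a) - b * (x * - b + y * a)) at 1 by (rewrite <- E; ring). rewrite H. 
    replace (x * (a * a + b * b) + b * 0 - b * 0) with (x * (a * a + b * b)) by ring.
    replace (x * (a * a + b * b)) with ((x * a + y * b) * a - 0 * b + - b * (x * - b + y * a)) by ring. rewrite H. ring.
  - replace y with (y * (a * a + b * b)) at 1 by (rewrite <- E; ring).
    replace (y * (a * a + b * b)) with ((x * a + y * b) * b + 0 * a + a * (x * - b + y * a)) by ring. rewrite H. ring.
Qed.

Lemma Cmod_normal_diff (u v : C) : Cmod (normal u - normal v) = Cmod (u - v).
Proof.
  apply Rsqr_inj; try apply Cmod_ge_0. unfold Rsqr. rewrite !Cmod_sq.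
  unfold normal, Re, Im. simpl. ring.
Qed.

Lemma ray_lipschitz (M : R -> C) (l s r : R) :
  smooth_curve M l -> exists d K, 0 < d /\ 0 < K /\ forall s' r', Rabs (s' - s) < d ->
    Cmod (ray M s' r' - ray M s r) <= K * (Rabs (s' - s) + Rabs (r' - r)).
Proof.
  intros HM. assert (hl := sc_length M l HM).
  destruct (sc_velocity_lipschitz M l HM s) as (d & K & Hd & HK & HL).
  exists d, (K / l + 2). assert (HKl : 0 <= K / l) by (apply Rdiv_le_0_compat; lra).
  split; [auto|]. split; [lra|]. intros s' r' Hs.
  specialize (HL (s' - s) Hs). replace (s + (s' - s)) with s' in HL by ring.
  rewrite !(velocity_tangent M l) in HL by auto.
  replace (RtoC l * unit_tangent M s' - RtoC l * unit_tangent M s)%C with (RtoC l * (unit_tangent M s' - unit_tangent M s))%C in HL by ring.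
  rewrite Cmod_mult, Cmod_R, Rabs_pos_eq in HL by lra.
  unfold ray.
  replace (unit_tangent M s' * cis r' - unit_tangent M s * cis r)%C with
    ((unit_tangent M s' - unit_tangent M s) * cis r' + unit_tangent M s * (cis r' - cis r))%C by ring.
  eapply Rle_trans; [apply Cmod_triangle|]. rewrite !Cmod_mult, Cmod_cis, (unit_tangent_mod M l s HM).
  assert (B1 : Cmod (unit_tangent M s' - unit_tangent M s) <= K / l * Rabs (s' - s)).
  { apply Rmult_le_reg_l with l; auto. replace (l * (K / l * Rabs (s' - s))) with (K * Rabs (s' - s)) by (field; lra). exact HL. }
  assert (B2 : Cmod (cis r' - cis r) <= 2 * Rabs (r' - r)).
  { eapply Rle_trans; [apply Cmod_le_Re_Im|]. unfold cis. simpl.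
    assert (V : forall f df : R -> R, (forall s, is_derive f s (df s) /\ Rabs (df s) <= 1) -> Rabs (f r' - f r) <= Rabs (r' - r)).
    { intros f df H. destruct (Rle_dec r r') as [Hxy|Hxy].
      - rewrite (Rabs_pos_eq (r' - r)) by lra. rewrite <- (Rmult_1_l (r' - r)). apply (mean_value_bound f df); auto.
      - rewrite (Rabs_minus_sym (f r')), (Rabs_minus_sym r'), (Rabs_pos_eq (r - r')) by lra.
        rewrite <- (Rmult_1_l (r - r')). apply (mean_value_bound f df); auto. lra. }
    assert (V1 := V cos (fun s => - sin s)). assert (V2 := V sin cos).
    assert (W1 : Rabs (cos r' - cos r) <= Rabs (r' - r)).
    { apply V1. intros x. split; [auto_derive; auto; ring|]. rewrite Rabs_Ropp. assert (h := SIN_bound x). apply Rabs_le. lra. }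
    assert (W2 : Rabs (sin r' - sin r) <= Rabs (r' - r)).
    { apply V2. intros x. split; [auto_derive; auto; ring|]. assert (h := COS_bound x). apply Rabs_le. lra. }
    unfold Rminus in *. lra. }
  assert (h1 := Rabs_pos (s' - s)). assert (h2 := Rabs_pos (r' - r)).
  assert (0 <= K / l * Rabs (r' - r)) by (apply Rmult_le_pos; auto). lra.
Qed.

Lemma Cmod_normal (u : C) : Cmod (normal u) = Cmod u.
Proof.
  apply Rsqr_inj; try apply Cmod_ge_0. unfold Rsqr. rewrite !Cmod_sq. destruct u. simpl. ring.
Qed.

(* The impact point is a zero of [t |-> <M t - M s, normal u>], simple because
   its derivative there is [l sin r1 > 0]. *)
Lemma billiard_lipschitz (M : R -> C) (G : R * R -> R * R) (l s r : R) :
  smooth_curve M l -> billiard_lift M G -> 0 < r < PI ->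
  exists d K, 0 < d /\ 0 < K /\ forall s' r', Rabs (s' - s) + Rabs (r' - r) < d ->
    Rabs (fst (G (s', r')) - fst (G (s, r))) <= K * (Rabs (s' - s) + Rabs (r' - r)).
Proof.
  intros HM HG Hr. assert (hl := sc_length M l HM).
  destruct (billiard_step M G l s r HM HG Hr) as (A1 & A2 & _ & _ & A5 & (tau & Htau & E)).
  set (t0 := fst (G (s, r))) in *. set (r1 := snd (G (s, r))) in *.
  set (u := ray M s r) in *. assert (Hu : Cmod u = 1) by apply (Cmod_ray M l _ _ HM).
  assert (Hsin : 0 < sin r1) by (apply sin_gt_0; lra).
  assert (Hslope : inner (velocity M t0) (normal u) = l * sin r1).
  { rewrite (velocity_tangent M l t0 HM), inner_scal_l. f_equal.
    assert (HT := unit_tangent_mod M l t0 HM). assert (HT2 := Cmod_sq (unit_tangent M t0)). rewrite HT in HT2.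
    rewrite A5. unfold inner, normal, cis. rewrite cos_neg, sin_neg.
    destruct (unit_tangent M t0) as [p q]. simpl in *.
    replace (p * - (p * - sin r1 + q * cos r1) + q * (p * cos r1 - q * - sin r1)) with (sin r1 * (p * p + q * q)) by ring.
    rewrite <- HT2. ring. }
  destruct (sc_velocity_lipschitz M l HM t0) as (d1 & K1 & Hd1 & HK1 & HL1).
  set (kap := l * sin r1 / 2). assert (Hkap : 0 < kap) by (unfold kap; apply Rmult_lt_0_compat; [apply Rmult_lt_0_compat|]; lra).
  assert (Hn1 : Cmod (normal u) = 1) by (rewrite Cmod_normal; auto).
  set (e1 := Rmin (d1 / 2) (kap / (K1 + 1))).
  assert (Hq1 : 0 < kap / (K1 + 1)) by (apply Rdiv_lt_0_compat; lra).
  assert (He1 : 0 < e1) by (apply Rmin_pos; lra).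
  assert (Hv : forall h, Rabs h <= e1 -> kap <= inner (velocity M (t0 + h)) (normal u)).
  { intros h Hh. assert (E1 : e1 <= d1 / 2) by apply Rmin_l. assert (E2 : e1 <= kap / (K1 + 1)) by apply Rmin_r.
    specialize (HL1 h ltac:(lra)).
    assert (B := inner_le (velocity M (t0 + h) - velocity M t0) (normal u)). rewrite Hn1 in B.
    rewrite inner_minus_l, Hslope in B. assert (B2 := proj1 (Rabs_le_between _ _) B).
    assert ((K1 + 1) * e1 <= kap).
    { replace kap with ((K1 + 1) * (kap / (K1 + 1))) at 1 by (field; lra). apply Rmult_le_compat_l; lra. }
    assert (hh := Rabs_pos h). assert (K1 * Rabs h <= (K1 + 1) * e1) by (apply Rmult_le_compat; lra).
    assert (l * sin r1 = 2 * kap) by (unfold kap; field). lra. }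
  assert (H0 : inner (M t0 - M s) (normal u) = 0).
  { rewrite E, inner_scal_l. replace (inner u (normal u)) with 0 by (unfold inner, normal, Re, Im; simpl; ring). ring. }
  assert (Hup : forall h, 0 <= h <= e1 -> kap * h <= inner (M (t0 + h)%R - M s) (normal u)).
  { intros h Hh. destruct (inner_mean_value M l (normal u) t0 (t0 + h) HM ltac:(lra)) as (c & Hc & Ec).
    replace (M (t0 + h)%R - M s)%C with ((M (t0 + h)%R - M t0) + (M t0 - M s))%C by ring.
    rewrite inner_plus_l, H0, Ec. replace (t0 + h - t0) with h by ring.
    assert (B := Hv (c - t0) ltac:(rewrite Rabs_pos_eq; lra)). replace (t0 + (c - t0)) with c in B by ring. nra. }
  assert (Hdn : forall h, 0 <= h <= e1 -> inner (M (t0 - h)%R - M s) (normal u) <= - (kap * h)).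
  { intros h Hh. destruct (inner_mean_value M l (normal u) (t0 - h) t0 HM ltac:(lra)) as (c & Hc & Ec).
    replace (M (t0 - h)%R - M s)%C with (- (M t0 - M (t0 - h)%R) + (M t0 - M s))%C by ring.
    rewrite inner_plus_l, H0. replace (inner (- (M t0 - M (t0 - h)%R)) (normal u)) with (- inner (M t0 - M (t0 - h)%R) (normal u))
      by (unfold inner, Re, Im; simpl; ring).
    rewrite Ec. replace (t0 - (t0 - h)) with h by ring.
    assert (B := Hv (c - t0) ltac:(apply Rabs_le; lra)). replace (t0 + (c - t0)) with c in B by ring. nra. }
  destruct (ray_lipschitz M l s r HM) as (d2 & K2 & Hd2 & HK2 & HL2).
  set (K3 := l + 3 * l * K2). assert (HlK : 0 < l * K2) by (apply Rmult_lt_0_compat; auto).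
  assert (HK3 : 0 < K3) by (unfold K3; lra).
  set (K4 := (K3 + 1) / kap). assert (HK4 : 0 < K4) by (apply Rdiv_lt_0_compat; lra).
  set (K5 := l * (K4 + 1) + 3 * l * K2). assert (HK5 : 0 < K5) by (unfold K5; nra).
  set (gap := Rmin (t0 - s) (s + 1 - t0)). assert (Hgap : 0 < gap) by (apply Rmin_pos; lra).
  assert (G1 : gap <= t0 - s) by apply Rmin_l. assert (G2 : gap <= s + 1 - t0) by apply Rmin_r.
  (* Small enough to keep, in particular, [r'] between 0 and [PI], the bracket of the zero within
     the range of [Hv], the zero between s' and s' + 1, and the chord at positive length. *)
  set (D := Rmin (Rmin (Rmin d2 (1/2)) (Rmin r (PI - r))) (Rmin (Rmin (e1 / K4) (gap / (K4 + 1))) (tau / K5))).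
  assert (HD : 0 < D).
  { unfold D. repeat apply Rmin_pos; try lra; apply Rdiv_lt_0_compat; lra. }
  exists D, K4. split; [auto|]. split; [auto|]. intros s' r' HDel.
  set (del := Rabs (s' - s) + Rabs (r' - r)) in *.
  assert (hs := Rabs_pos (s' - s)). assert (hr := Rabs_pos (r' - r)).
  assert (Hdel0 : 0 <= del) by (unfold del; lra).
  assert (L1 : del < d2) by (eapply Rlt_le_trans; [exact HDel|]; eapply Rle_trans; [apply Rmin_l|]; eapply Rle_trans; [apply Rmin_l|apply Rmin_l]).
  assert (L2 : del < 1/2) by (eapply Rlt_le_trans; [exact HDel|]; eapply Rle_trans; [apply Rmin_l|]; eapply Rle_trans; [apply Rmin_l|apply Rmin_r]).
  assert (L3 : del < r) by (eapply Rlt_le_trans; [exact HDel|]; eapply Rle_trans; [apply Rmin_l|]; eapply Rle_trans; [apply Rmin_r|apply Rmin_l]).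
  assert (L4 : del < PI - r) by (eapply Rlt_le_trans; [exact HDel|]; eapply Rle_trans; [apply Rmin_l|]; eapply Rle_trans; [apply Rmin_r|apply Rmin_r]).
  assert (L5 : del < e1 / K4) by (eapply Rlt_le_trans; [exact HDel|]; eapply Rle_trans; [apply Rmin_r|]; eapply Rle_trans; [apply Rmin_l|apply Rmin_l]).
  assert (L6 : del < gap / (K4 + 1)) by (eapply Rlt_le_trans; [exact HDel|]; eapply Rle_trans; [apply Rmin_r|]; eapply Rle_trans; [apply Rmin_l|apply Rmin_r]).
  assert (L7 : del < tau / K5) by (eapply Rlt_le_trans; [exact HDel|]; eapply Rle_trans; [apply Rmin_r|apply Rmin_r]).
  clear HDel.
  (* With [del = 0] the interval on which the intermediate value theorem is used would shrink to a
     point. *)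
  destruct (Req_dec del 0) as [Ed|Ed].
  { assert (Es : s' - s = 0) by (apply Rabs_eq_0; unfold del in Ed; lra).
    assert (Er : r' - r = 0) by (apply Rabs_eq_0; unfold del in Ed; lra).
    replace s' with s by lra. replace r' with r by lra. fold t0.
    rewrite Rminus_diag, Rabs_R0, Ed. lra. }
  assert (Hr' : 0 < r' < PI).
  { assert (h := Rabs_le_between (r' - r) del). destruct h as [h _]. specialize (h ltac:(unfold del; lra)). lra. }
  assert (M5 : K4 * del < e1).
  { apply Rmult_lt_compat_l with (r := K4) in L5; auto. replace (K4 * (e1 / K4)) with e1 in L5 by (field; lra). exact L5. }
  assert (M6 : (K4 + 1) * del < gap).
  { apply Rmult_lt_compat_l with (r := K4 + 1) in L6; [|lra]. replace ((K4 + 1) * (gap / (K4 + 1))) with gap in L6 by (field; lra). exact L6. }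
  assert (M7 : K5 * del < tau).
  { apply Rmult_lt_compat_l with (r := K5) in L7; auto. replace (K5 * (tau / K5)) with tau in L7 by (field; lra). exact L7. }
  set (u' := ray M s' r'). assert (Hu' : Cmod u' = 1) by apply (Cmod_ray M l _ _ HM).
  assert (Huu : Cmod (u' - u) <= K2 * del) by (apply HL2; unfold del in L1; lra).
  assert (Hss : Rabs (s' - s) <= del) by (unfold del; lra).
  assert (Hss' := proj1 (Rabs_le_between _ _) Hss).
  set (h := K4 * del). assert (Hh0 : 0 < h) by (apply Rmult_lt_0_compat; lra).
  assert (Hfar : forall t, Rabs (t - t0) <= h -> Cmod (M t - M s') <= 3 * l).
  { intros t Ht. eapply Rle_trans; [apply (chord_le M l _ _ HM)|].
    assert (Ht' := proj1 (Rabs_le_between _ _) Ht).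
    assert (h <= 1) by (unfold h; lra).
    assert (Rabs (t - s') <= 3) by (apply Rabs_le; lra). nra. }
  set (chi := fun t => inner (M t - M s') (normal u')).
  assert (Hchi : forall t, Rabs (t - t0) <= h -> Rabs (chi t - inner (M t - M s) (normal u)) <= K3 * del).
  { intros t Ht. unfold chi.
    replace (inner (M t - M s') (normal u') - inner (M t - M s) (normal u)) with
      (inner (M t - M s') (normal u' - normal u) + inner (M s - M s') (normal u)).
    2:{ unfold inner, Re, Im. simpl. ring. }
    eapply Rle_trans; [apply Rabs_triang|].
    assert (B1 := inner_le (M t - M s') (normal u' - normal u)). rewrite Cmod_normal_diff in B1.
    assert (B2 := inner_le (M s - M s') (normal u)). rewrite Hn1 in B2.
    assert (B3 := chord_le M l s' s HM). rewrite Rabs_minus_sym in B3.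
    assert (B4 : l * Rabs (s' - s) <= l * del) by (apply Rmult_le_compat_l; lra).
    assert (B5 : Cmod (M t - M s') * Cmod (u' - u) <= 3 * l * (K2 * del)).
    { apply Rmult_le_compat; auto using Cmod_ge_0. }
    unfold K3. lra. }
  assert (Ekh : kap * h = (K3 + 1) * del) by (unfold h, K4; field; lra).
  assert (Hc1 : 0 < chi (t0 + h)).
  { assert (B1 := Hup h ltac:(unfold h in *; lra)).
    assert (B2 := Hchi (t0 + h) ltac:(replace (t0 + h - t0) with h by ring; rewrite Rabs_pos_eq; lra)).
    apply Rabs_le_between in B2. lra. }
  assert (Hc2 : chi (t0 - h) < 0).
  { assert (B1 := Hdn h ltac:(unfold h in *; lra)).
    assert (B2 := Hchi (t0 - h) ltac:(replace (t0 - h - t0) with (- h) by ring; rewrite Rabs_Ropp, Rabs_pos_eq; lra)).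
    apply Rabs_le_between in B2. lra. }
  assert (Hcont : continuity chi).
  { intros t. apply derivable_continuous_pt. exists (inner (velocity M t) (normal u')). apply is_derive_Reals.
    unfold chi. apply is_derive_ext with (fun t => inner (M t) (normal u') - inner (M s') (normal u')).
    { intros x. rewrite inner_minus_l. reflexivity. }
    replace (inner (velocity M t) (normal u')) with (minus (inner (velocity M t) (normal u')) (zero : R))
      by (unfold minus, plus, opp, zero; simpl; ring).
    apply (is_derive_minus (fun t => inner (M t) (normal u')) (fun _ => inner (M s') (normal u'))).
    - apply (inner_derive M l); auto.
    - apply (is_derive_const (inner (M s') (normal u')) t). }
  destruct (IVT_gen chi (t0 - h) (t0 + h) 0 Hcont) as (t & Ht & Et).
  { rewrite Rmin_left, Rmax_right by lra. lra. }
  rewrite Rmin_left, Rmax_right in Ht by lra.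
  assert (Htt : Rabs (t - t0) <= h) by (apply Rabs_le; lra).
  assert (Eray := normal_decomposition u' _ Hu' Et).
  set (tau' := inner (M t - M s') u') in *.
  (* A zero of [chi] lies on the line that carries the ray; the sign of [tau'] places it on the ray
     itself. *)
  assert (Htau' : 0 < tau').
  { assert (Einn : inner (M t0 - M s) u = tau) by (rewrite E, inner_scal_l, inner_self, Hu; ring).
    assert (B : tau - tau' = inner (M t0 - M t) u + inner (M s' - M s) u - inner (M t - M s') (u' - u)).
    { rewrite <- Einn. unfold tau', inner, Re, Im. simpl. ring. }
    assert (B1 := inner_le (M t0 - M t) u). assert (B2 := inner_le (M s' - M s) u). assert (B3 := inner_le (M t - M s') (u' - u)).
    rewrite Hu in B1, B2.
    assert (B4 := chord_le M l t t0 HM). rewrite Rabs_minus_sym in B4. assert (B5 := chord_le M l s s' HM).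
    assert (B6 : l * Rabs (t - t0) <= l * h) by (apply Rmult_le_compat_l; lra).
    assert (B7 : l * Rabs (s' - s) <= l * del) by (apply Rmult_le_compat_l; lra).
    assert (B8 : Cmod (M t - M s') * Cmod (u' - u) <= 3 * l * (K2 * del)) by (apply Rmult_le_compat; auto using Cmod_ge_0).
    assert (C1 := Rle_abs (inner (M t0 - M t) u)). assert (C2 := Rle_abs (inner (M s' - M s) u)).
    assert (C3 := Rle_abs (- inner (M t - M s') (u' - u))). rewrite Rabs_Ropp in C3.
    unfold K5 in M7. unfold h in B6. lra. }
  assert (EG : fst (G (s', r')) = t).
  { apply (billiard_ray_unique M G l s' r' t tau'); auto. unfold h in *. lra. }
  rewrite EG. exact Htt.
Qed.

(** * Derivative of the length along a curve of orbits *)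

(** Differentiability at one point with a quadratic remainder. It passes through compositions and
    chord lengths without information on derivatives at neighbouring points, and jets and power
    series provide it directly. *)
Definition qdiff (f : R -> R) (x D : R) : Prop :=
  exists d K, 0 < d <= 1 /\ 0 <= K /\ forall h, Rabs h < d -> Rabs (f (x + h) - f x - D * h) <= K * (h * h).

Lemma qdiff_lipschitz (f : R -> R) (x D : R) :
  qdiff f x D -> exists d K, 0 < d <= 1 /\ 0 <= K /\ forall h, Rabs h < d -> Rabs (f (x + h) - f x) <= K * Rabs h.
Proof.
  intros (d & K & Hd & HK & H). exists d, (K + Rabs D). split; [auto|]. split; [assert (h := Rabs_pos D); lra|].
  intros h Hh. specialize (H h Hh).
  replace (f (x + h) - f x) with ((f (x + h) - f x - D * h) + D * h) by ring.
  eapply Rle_trans; [apply Rabs_triang|]. rewrite Rabs_mult.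
  assert (E : h * h = Rabs h * Rabs h) by (rewrite <- Rabs_mult, Rabs_pos_eq; [ring|apply Rle_0_sqr]).
  rewrite E in H. assert (h0 := Rabs_pos h). 
  assert (K * (Rabs h * Rabs h) <= K * Rabs h) by (apply Rmult_le_compat_l; nra). lra.
Qed.

Lemma qdiff_is_derive (f : R -> R) (x D : R) : qdiff f x D -> is_derive f x D.
Proof.
  intros (d & K & Hd & HK & H). apply is_derive_Reals. intros eps Heps.
  assert (Hp : 0 < Rmin d (eps / (K + 1))) by (apply Rmin_pos; [lra|apply Rdiv_lt_0_compat; lra]).
  exists (mkposreal _ Hp). intros h Hn Hh. simpl in Hh.
  assert (H1 : Rabs h < d) by (eapply Rlt_le_trans; [exact Hh|apply Rmin_l]).
  assert (H2 : Rabs h < eps / (K + 1)) by (eapply Rlt_le_trans; [exact Hh|apply Rmin_r]).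
  specialize (H h H1).
  assert (E : h * h = Rabs h * Rabs h) by (rewrite <- Rabs_mult, Rabs_pos_eq; [ring|apply Rle_0_sqr]).
  replace ((f (x + h) - f x) / h - D) with ((f (x + h) - f x - D * h) * / h) by (field; auto).
  rewrite Rabs_mult, Rabs_inv.
  assert (h0 : 0 < Rabs h) by (apply Rabs_pos_lt; auto).
  apply Rmult_lt_reg_r with (Rabs h); auto. rewrite Rmult_assoc, Rinv_l by lra. rewrite Rmult_1_r.
  eapply Rle_lt_trans; [exact H|]. rewrite E.
  assert ((K + 1) * Rabs h < eps).
  { apply Rmult_lt_compat_l with (r := K + 1) in H2; [|lra]. replace ((K + 1) * (eps / (K + 1))) with eps in H2 by (field; lra). exact H2. }
  nra.
Qed.

(** The distance grows by the component of the displacement along [u]; the transverse component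
    enters only quadratically, divided by [tau]. *)
Lemma norm_expansion (u v' : C) (tau : R) :
  Cmod u = 1 -> 0 < tau -> Cmod (v' - RtoC tau * u) <= tau / 2 ->
  Rabs (Cmod v' - tau - inner (v' - RtoC tau * u) u) <= / tau * (Cmod (v' - RtoC tau * u) * Cmod (v' - RtoC tau * u)).
Proof.
  intros Hu Ht Hd. set (D := Cmod (v' - RtoC tau * u)) in *.
  assert (HD : 0 <= D) by apply Cmod_ge_0.
  set (p := inner v' u). set (q := inner v' (normal u)).
  assert (Hu2 := Cmod_sq u). rewrite Hu in Hu2.
  assert (Epq : Cmod v' * Cmod v' = p * p + q * q).
  { rewrite Cmod_sq. unfold p, q, inner, normal, Re, Im in *. destruct u as [a b], v' as [x y]. simpl in *.
    replace ((x * a + y * b) * (x * a + y * b) + (x * - b + y * a) * (x * - b + y * a))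
      with ((x * x + y * y) * (a * a + b * b)) by ring. rewrite <- Hu2. ring. }
  assert (Ep : inner (v' - RtoC tau * u) u = p - tau).
  { rewrite inner_minus_l, inner_scal_l, inner_self, Hu. unfold p. ring. }
  assert (Eq : inner (v' - RtoC tau * u) (normal u) = q).
  { rewrite inner_minus_l, inner_scal_l. unfold q. replace (inner u (normal u)) with 0 by (unfold inner, normal, Re, Im; simpl; ring). ring. }
  assert (Hn1 : Cmod (normal u) = 1) by (rewrite Cmod_normal; auto).
  assert (Bq := inner_le (v' - RtoC tau * u) (normal u)). rewrite Eq, Hn1 in Bq. fold D in Bq.
  assert (Bp := inner_le (v' - RtoC tau * u) u). rewrite Ep, Hu in Bp. fold D in Bp.
  apply Rabs_le_between in Bp. apply Rabs_le_between in Bq.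
  assert (hv := Cmod_ge_0 v'). assert (Hp : tau / 2 <= p) by lra.
  assert (Hvp : p <= Cmod v') by nra.
  rewrite Ep. replace (Cmod v' - tau - (p - tau)) with (Cmod v' - p) by ring.
  rewrite Rabs_pos_eq by lra.
  apply Rmult_le_reg_l with tau; auto. rewrite <- Rmult_assoc, Rinv_r, Rmult_1_l by lra.
  assert (Hqq : q * q <= D * D) by nra.
  assert (Ef : (Cmod v' - p) * (Cmod v' + p) = q * q) by (ring_simplify; simpl; lra).
  assert (Hge : tau <= Cmod v' + p) by lra.
  assert (Hge2 : tau * (Cmod v' - p) <= (Cmod v' + p) * (Cmod v' - p)) by (apply Rmult_le_compat_r; lra). lra.
Qed.

(** The remainder [w] is tested against itself: the mean value theorem for the component along [w]
    bounds |w|^2 by a quadratic term times |w|. *)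
Lemma curve_expansion (M : R -> C) (l s : R) :
  smooth_curve M l -> exists d K, 0 < d /\ 0 <= K /\ forall h, Rabs h < d ->
    Cmod (M (s + h)%R - M s - RtoC h * velocity M s) <= K * (h * h).
Proof.
  intros HM. destruct (sc_velocity_lipschitz M l HM s) as (d & K & Hd & HK & HL).
  exists d, K. split; [auto|]. split; [auto|]. intros h Hh.
  set (w := (M (s + h)%R - M s - RtoC h * velocity M s)%C).
  assert (Hc : exists c, Rabs (c - s) <= Rabs h /\ inner w w = inner (velocity M c - velocity M s) w * h).
  { destruct (Rle_dec 0 h) as [H0|H0].
    - destruct (inner_mean_value M l w s (s + h) HM ltac:(lra)) as (c & Hc & E). exists c. split.
      + rewrite !Rabs_pos_eq; lra.
      + unfold w at 1. rewrite inner_minus_l, E, inner_scal_l, inner_minus_l. ring.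
    - destruct (inner_mean_value M l w (s + h) s HM ltac:(lra)) as (c & Hc & E). exists c. split.
      + rewrite !Rabs_left1; lra.
      + unfold w at 1. replace (M (s + h)%R - M s)%C with (RtoC (-(1)) * (M s - M (s + h)%R))%C by (rewrite RtoC_opp; ring).
        rewrite inner_minus_l, !inner_scal_l, E, inner_minus_l. ring. }
  destruct Hc as (c & Hc & E). rewrite inner_self in E.
  assert (B := HL (c - s) ltac:(lra)). replace (s + (c - s)) with c in B by ring.
  assert (B2 := inner_le (velocity M c - velocity M s) w). assert (hw := Cmod_ge_0 w).
  assert (Eh : h * h = Rabs h * Rabs h) by (rewrite <- Rabs_mult, Rabs_pos_eq; [ring|apply Rle_0_sqr]).
  assert (h0 := Rabs_pos h).
  assert (B3 : Cmod w * Cmod w <= K * (Rabs h * Rabs h) * Cmod w).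
  { rewrite E. eapply Rle_trans; [apply Rle_abs|]. rewrite Rabs_mult.
    apply Rle_trans with (Cmod (velocity M c - velocity M s) * Cmod w * Rabs h); [apply Rmult_le_compat_r; auto|].
    assert (Cmod (velocity M c - velocity M s) <= K * Rabs h).
    { eapply Rle_trans; [exact B|]. apply Rmult_le_compat_l; auto. }
    replace (K * (Rabs h * Rabs h) * Cmod w) with ((K * Rabs h) * (Cmod w * Rabs h)) by ring.
    rewrite Rmult_assoc. apply Rmult_le_compat_r; auto. apply Rmult_le_pos; auto. }
  rewrite Eh. destruct (Req_dec (Cmod w) 0) as [E0|E0].
  - rewrite E0. apply Rmult_le_pos; auto. apply Rmult_le_pos; auto.
  - apply Rmult_le_reg_r with (Cmod w); lra.
Qed.

Lemma curve_lipschitz_expansion (M : R -> C) (l : R) (S : R -> R) (x K : R) (d : R) :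
  smooth_curve M l -> 0 < d -> 0 <= K -> (forall h, Rabs h < d -> Rabs (S (x + h) - S x) <= K * Rabs h) ->
  exists d' K', 0 < d' /\ 0 <= K' /\ forall h, Rabs h < d' ->
    Cmod (M (S (x + h)) - M (S x)) <= K' * Rabs h /\
    Cmod (M (S (x + h)) - M (S x) - RtoC (S (x + h) - S x) * velocity M (S x)) <= K' * (h * h).
Proof.
  intros HM Hd HK HS. assert (hl := sc_length M l HM).
  destruct (curve_expansion M l (S x) HM) as (d1 & K1 & Hd1 & HK1 & H1).
  set (d' := Rmin d (d1 / (K + 1))).
  assert (Hq : 0 < d1 / (K + 1)) by (apply Rdiv_lt_0_compat; lra).
  exists d', (l * K + K1 * (K * K)). split; [apply Rmin_pos; auto|].
  assert (P1 : 0 <= l * K) by (apply Rmult_le_pos; lra). assert (P2 : 0 <= K1 * (K * K)) by (apply Rmult_le_pos; nra).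
  split; [lra|]. intros h Hh.
  assert (L1 : Rabs h < d) by (eapply Rlt_le_trans; [exact Hh|apply Rmin_l]).
  assert (L2 : Rabs h < d1 / (K + 1)) by (eapply Rlt_le_trans; [exact Hh|apply Rmin_r]).
  specialize (HS h L1). assert (h0 := Rabs_pos h).
  assert (Eh : h * h = Rabs h * Rabs h) by (rewrite <- Rabs_mult, Rabs_pos_eq; [ring|apply Rle_0_sqr]).
  split.
  - eapply Rle_trans; [apply (chord_le M l _ _ HM)|].
    assert (l * Rabs (S (x + h) - S x) <= l * (K * Rabs h)) by (apply Rmult_le_compat_l; lra).
    assert (0 <= K1 * (K * K) * Rabs h) by (apply Rmult_le_pos; auto). lra.
  - set (k := S (x + h) - S x) in *.
    assert (Hk : Rabs k < d1).
    { assert ((K + 1) * Rabs h < d1).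
      { apply Rmult_lt_compat_l with (r := K + 1) in L2; [|lra]. replace ((K + 1) * (d1 / (K + 1))) with d1 in L2 by (field; lra). exact L2. }
      lra. }
    specialize (H1 k Hk). replace (S x + k) with (S (x + h)) in H1 by (unfold k; ring).
    eapply Rle_trans; [exact H1|].
    assert (Ek : k * k = Rabs k * Rabs k) by (rewrite <- Rabs_mult, Rabs_pos_eq; [ring|apply Rle_0_sqr]).
    rewrite Ek, Eh. assert (hk := Rabs_pos k).
    assert (Rabs k * Rabs k <= (K * Rabs h) * (K * Rabs h)) by (apply Rmult_le_compat; auto).
    assert (K1 * (Rabs k * Rabs k) <= K1 * ((K * Rabs h) * (K * Rabs h))) by (apply Rmult_le_compat_l; auto).
    assert (0 <= l * K * (Rabs h * Rabs h)) by (apply Rmult_le_pos; nra). lra.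
Qed.

(* The middle point does not contribute to first order, by the reflection law. *)
Lemma two_chords_qdiff (M : R -> C) (l : R) (S0 S1 S2 : R -> R) (x D0 D2 d K tau tau' : R) (u v : C) :
  smooth_curve M l -> qdiff S0 x D0 -> qdiff S2 x D2 ->
  0 < d -> 0 <= K -> (forall h, Rabs h < d -> Rabs (S1 (x + h) - S1 x) <= K * Rabs h) ->
  Cmod u = 1 -> Cmod v = 1 -> 0 < tau -> 0 < tau' ->
  (M (S1 x) - M (S0 x))%C = (RtoC tau * u)%C -> (M (S2 x) - M (S1 x))%C = (RtoC tau' * v)%C ->
  inner u (unit_tangent M (S1 x)) = inner v (unit_tangent M (S1 x)) ->
  qdiff (fun y => Cmod (M (S1 y) - M (S0 y)) + Cmod (M (S2 y) - M (S1 y))) x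
    (l * (inner v (unit_tangent M (S2 x)) * D2 - inner u (unit_tangent M (S0 x)) * D0)).
Proof.
  intros HM Q0 Q2 Hd HK H1 Hu Hv Ht Ht' E E' Hrefl. assert (hl := sc_length M l HM).
  destruct (qdiff_lipschitz _ _ _ Q0) as (d0 & K0 & Hd0 & HK0 & L0).
  destruct (qdiff_lipschitz _ _ _ Q2) as (d2 & K2 & Hd2 & HK2 & L2).
  destruct Q0 as (d0' & J0 & Hd0' & HJ0 & Q0). destruct Q2 as (d2' & J2 & Hd2' & HJ2 & Q2).
  destruct (curve_lipschitz_expansion M l S0 x K0 d0 HM ltac:(lra) HK0 L0) as (a0 & B0 & Ha0 & HB0 & X0).
  destruct (curve_lipschitz_expansion M l S1 x K d HM Hd HK H1) as (a1 & B1 & Ha1 & HB1 & X1).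
  destruct (curve_lipschitz_expansion M l S2 x K2 d2 HM ltac:(lra) HK2 L2) as (a2 & B2 & Ha2 & HB2 & X2).
  set (m := Rmin tau tau'). assert (Hm : 0 < m) by (apply Rmin_pos; auto).
  assert (Hm1 : m <= tau) by apply Rmin_l. assert (Hm2 : m <= tau') by apply Rmin_r.
  set (B := B0 + B1 + B2). 
  set (e := Rmin (Rmin (Rmin d0' d2') (Rmin a0 a1)) (Rmin a2 (m / (2 * (B + 1))))).
  assert (HB : 0 <= B) by (unfold B; lra).
  assert (Hqq : 0 < m / (2 * (B + 1))) by (apply Rdiv_lt_0_compat; lra).
  assert (He : 0 < e) by (unfold e; repeat apply Rmin_pos; lra).
  exists e, (2 * (/ m * (B * B)) + 2 * B + l * (J0 + J2) + 1 * B).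
  assert (He1 : e <= 1).
  { eapply Rle_trans; [apply Rmin_l|]. eapply Rle_trans; [apply Rmin_l|]. eapply Rle_trans; [apply Rmin_l|]. lra. }
  assert (Him : 0 < / m) by (apply Rinv_0_lt_compat; auto).
  assert (Hbb : 0 <= / m * (B * B)) by (apply Rmult_le_pos; nra).
  assert (HlJ : 0 <= l * (J0 + J2)) by (apply Rmult_le_pos; lra).
  split; [lra|]. split; [lra|]. intros h Hh.
  assert (F1 : Rabs h < d0') by (eapply Rlt_le_trans; [exact Hh|]; eapply Rle_trans; [apply Rmin_l|]; eapply Rle_trans; [apply Rmin_l|apply Rmin_l]).
  assert (F2 : Rabs h < d2') by (eapply Rlt_le_trans; [exact Hh|]; eapply Rle_trans; [apply Rmin_l|]; eapply Rle_trans; [apply Rmin_l|apply Rmin_r]).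
  assert (F3 : Rabs h < a0) by (eapply Rlt_le_trans; [exact Hh|]; eapply Rle_trans; [apply Rmin_l|]; eapply Rle_trans; [apply Rmin_r|apply Rmin_l]).
  assert (F4 : Rabs h < a1) by (eapply Rlt_le_trans; [exact Hh|]; eapply Rle_trans; [apply Rmin_l|]; eapply Rle_trans; [apply Rmin_r|apply Rmin_r]).
  assert (F5 : Rabs h < a2) by (eapply Rlt_le_trans; [exact Hh|]; eapply Rle_trans; [apply Rmin_r|apply Rmin_l]).
  assert (F6 : Rabs h < m / (2 * (B + 1))) by (eapply Rlt_le_trans; [exact Hh|]; eapply Rle_trans; [apply Rmin_r|apply Rmin_r]).
  destruct (X0 h F3) as [Y0 Z0]. destruct (X1 h F4) as [Y1 Z1]. destruct (X2 h F5) as [Y2 Z2].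
  specialize (Q0 h F1). specialize (Q2 h F2).
  set (P0 := (M (S0 (x + h)%R) - M (S0 x))%C) in *. set (P1 := (M (S1 (x + h)%R) - M (S1 x))%C) in *.
  set (P2 := (M (S2 (x + h)%R) - M (S2 x))%C) in *.
  assert (h0 := Rabs_pos h).
  assert (Eh : h * h = Rabs h * Rabs h) by (rewrite <- Rabs_mult, Rabs_pos_eq; [ring|apply Rle_0_sqr]).
  set (hh := h * h) in *. assert (Hhh : 0 <= hh) by (unfold hh; nra).
  assert (Bsmall : B * Rabs h <= m / 2).
  { assert ((B + 1) * Rabs h <= m / 2).
    { replace (m / 2) with ((B + 1) * (m / (2 * (B + 1)))) by (field; lra). apply Rmult_le_compat_l; lra. } lra. }
  assert (D1 : Cmod (P1 - P0) <= B * Rabs h).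
  { eapply Rle_trans; [apply Cmod_triangle_sub|]. unfold B. assert (0 <= B2 * Rabs h) by (apply Rmult_le_pos; auto). lra. }
  assert (D2' : Cmod (P2 - P1) <= B * Rabs h).
  { eapply Rle_trans; [apply Cmod_triangle_sub|]. unfold B. assert (0 <= B0 * Rabs h) by (apply Rmult_le_pos; auto). lra. }
  assert (V1 : (M (S1 (x + h)%R) - M (S0 (x + h)%R))%C = (RtoC tau * u + (P1 - P0))%C) by (rewrite <- E; unfold P1, P0; ring).
  assert (V2 : (M (S2 (x + h)%R) - M (S1 (x + h)%R))%C = (RtoC tau' * v + (P2 - P1))%C) by (rewrite <- E'; unfold P1, P2; ring).
  assert (Sq : forall w t, m <= t -> Cmod w <= B * Rabs h -> / t * (Cmod w * Cmod w) <= / m * (B * B) * hh).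
  { intros w t Hmt Hw. rewrite Eh. replace (/ m * (B * B) * (Rabs h * Rabs h)) with (/ m * ((B * Rabs h) * (B * Rabs h))) by ring.
    assert (hw := Cmod_ge_0 w). apply Rmult_le_compat.
    - apply Rlt_le, Rinv_0_lt_compat. lra.
    - nra.
    - apply Rinv_le_contravar; auto.
    - apply Rmult_le_compat; auto. }
  assert (N1 := norm_expansion u (RtoC tau * u + (P1 - P0))%C tau Hu Ht).
  replace (RtoC tau * u + (P1 - P0) - RtoC tau * u)%C with (P1 - P0)%C in N1 by ring.
  specialize (N1 ltac:(lra)).
  assert (N2 := norm_expansion v (RtoC tau' * v + (P2 - P1))%C tau' Hv Ht').
  replace (RtoC tau' * v + (P2 - P1) - RtoC tau' * v)%C with (P2 - P1)%C in N2 by ring.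
  specialize (N2 ltac:(lra)).
  assert (S1' := Sq _ tau Hm1 D1). assert (S2' := Sq _ tau' Hm2 D2').
  rewrite V1, V2.
  assert (C1 : Cmod (M (S1 x) - M (S0 x)) = tau) by (rewrite E, Cmod_mult, Hu, Cmod_R, Rabs_pos_eq; lra).
  assert (C2 : Cmod (M (S2 x) - M (S1 x)) = tau') by (rewrite E', Cmod_mult, Hv, Cmod_R, Rabs_pos_eq; lra).
  rewrite C1, C2.
  set (n1 := Cmod (RtoC tau * u + (P1 - P0))) in *. set (n2 := Cmod (RtoC tau' * v + (P2 - P1))) in *.
  rewrite inner_minus_l in N1, N2.
  (* Since u - v is orthogonal to the tangent at [S1 x], only the quadratic part of the displacement
     of the middle point survives, and the Lipschitz bound on [S1] controls it. *)
  assert (I1 : Rabs (inner P1 u - inner P1 v) <= 2 * B * hh).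
  { rewrite <- inner_minus_r. 
    set (k := S1 (x + h) - S1 x) in *.
    replace P1 with ((P1 - RtoC k * velocity M (S1 x)) + RtoC k * velocity M (S1 x))%C by ring.
    rewrite inner_plus_l, inner_scal_l, (velocity_tangent M l (S1 x) HM), inner_scal_l.
    assert (Z0' : inner (unit_tangent M (S1 x)) (u - v) = 0).
    { rewrite inner_minus_r, !(inner_sym (unit_tangent M (S1 x))). lra. }
    rewrite Z0', !Rmult_0_r, Rplus_0_r. rewrite <- (velocity_tangent M l (S1 x) HM).
    eapply Rle_trans; [apply inner_le|].
    assert (Cmod (u - v) <= 2) by (eapply Rle_trans; [apply Cmod_triangle_sub|]; lra).
    assert (Cmod (P1 - RtoC k * velocity M (S1 x)) * Cmod (u - v) <= (B1 * hh) * 2).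
    { apply Rmult_le_compat; auto using Cmod_ge_0. }
    assert (B1 * hh <= B * hh) by (apply Rmult_le_compat_r; unfold B; lra). lra. }
  assert (Gen : forall (P w : C) (S : R -> R) (D J Bi : R), Cmod w = 1 ->
     Cmod (P - RtoC (S (x + h) - S x) * velocity M (S x)) <= Bi * hh ->
     Rabs (S (x + h) - S x - D * h) <= J * hh ->
     Rabs (inner P w - l * (inner w (unit_tangent M (S x)) * D) * h) <= (Bi + l * J) * hh).
  { intros P w S D J Bi Hw HP HS. set (k := S (x + h) - S x) in *.
    replace P with ((P - RtoC k * velocity M (S x)) + RtoC k * velocity M (S x))%C by ring.
    rewrite inner_plus_l, inner_scal_l. set (q := inner w (unit_tangent M (S x))).
    replace (inner (velocity M (S x)) w) with (l * q)
      by (rewrite (velocity_tangent M l (S x) HM), inner_scal_l; unfold q; rewrite inner_sym; reflexivity).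
    replace (inner (P - RtoC k * velocity M (S x)) w + k * (l * q) - l * (q * D) * h)
      with (inner (P - RtoC k * velocity M (S x)) w + l * q * (k - D * h)) by ring.
    eapply Rle_trans; [apply Rabs_triang|].
    assert (U1 := inner_le (P - RtoC k * velocity M (S x)) w). rewrite Hw in U1.
    assert (U2 : Rabs q <= 1).
    { unfold q. eapply Rle_trans; [apply inner_le|]. rewrite Hw, (unit_tangent_mod M l (S x) HM). lra. }
    rewrite !Rabs_mult, (Rabs_pos_eq l) by lra.
    assert (U3 : l * Rabs q * Rabs (k - D * h) <= l * 1 * (J * hh)).
    { apply Rmult_le_compat; [apply Rmult_le_pos; [lra|apply Rabs_pos]|apply Rabs_pos| |auto].
      apply Rmult_le_compat_l; lra. }
    lra. }
  assert (I0 := Gen P0 u S0 D0 J0 B0 Hu Z0 Q0). assert (I2 := Gen P2 v S2 D2 J2 B2 Hv Z2 Q2).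
  set (q0 := inner u (unit_tangent M (S0 x))) in *. set (q2 := inner v (unit_tangent M (S2 x))) in *.
  replace (n1 + n2 - (tau + tau') - l * (q2 * D2 - q0 * D0) * h)
    with (((n1 - tau - (inner P1 u - inner P0 u)) + (n2 - tau' - (inner P2 v - inner P1 v)))
      + ((inner P1 u - inner P1 v) + ((inner P2 v - l * (q2 * D2) * h) + - (inner P0 u - l * (q0 * D0) * h)))) by ring.
  eapply Rle_trans; [apply Rabs_triang|].
  assert (T1 := Rabs_triang (n1 - tau - (inner P1 u - inner P0 u)) (n2 - tau' - (inner P2 v - inner P1 v))).
  assert (T2 := Rabs_triang (inner P1 u - inner P1 v) ((inner P2 v - l * (q2 * D2) * h) + - (inner P0 u - l * (q0 * D0) * h))).
  assert (T3 := Rabs_triang (inner P2 v - l * (q2 * D2) * h) (- (inner P0 u - l * (q0 * D0) * h))).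
  rewrite Rabs_Ropp in T3.
  assert (W : (B0 + l * J0) * hh + (B2 + l * J2) * hh <= (B + l * (J0 + J2)) * hh).
  { unfold B. assert (0 <= B1 * hh) by (apply Rmult_le_pos; auto). lra. }
  lra.
Qed.

(** * Analytic coordinates near the resonant curve *)

Lemma analytic2_R_lipschitz (f : R * R -> R) (x y : R) :
  analytic2_at (K := R_AbsRing) f (x, y) ->
  exists d K, 0 < d /\ 0 <= K /\ forall x1 y1 x2 y2, Rabs (x1 - x) <= d -> Rabs (y1 - y) <= d ->
    Rabs (x2 - x) <= d -> Rabs (y2 - y) <= d ->
    Rabs (f (x1, y1) - f (x2, y2)) <= K * (Rabs (x1 - x2) + Rabs (y1 - y2)).
Proof.
  intros H. destruct (analytic2_at_R f x y H) as (c & rho & B & Hc & Hcv). assert (Hr := proj1 Hc).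
  destruct (psum_lipschitz c rho B 0 Hc) as (K & HK & HL); [intros m k Hk; lia|].
  exists (rho / 4), K. split; [lra|]. split; [lra|]. intros x1 y1 x2 y2 H1 H2 H3 H4.
  assert (C1 := Hcv (x1 - x) (y1 - y) ltac:(lra) ltac:(lra)).
  assert (C2 := Hcv (x2 - x) (y2 - y) ltac:(lra) ltac:(lra)).
  replace (x + (x1 - x)) with x1 in C1 by ring. replace (y + (y1 - y)) with y1 in C1 by ring.
  replace (x + (x2 - x)) with x2 in C2 by ring. replace (y + (y2 - y)) with y2 in C2 by ring.
  rewrite <- Cmod_R, RtoC_minus. apply (psum_cv_diff_le c _ _ _ _ _ _ _ C1 C2). intros N.
  assert (Q := HL N (RtoC (x1 - x)) (RtoC (y1 - y)) (RtoC (x2 - x)) (RtoC (y2 - y)) (rho / 4)).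
  rewrite !Cmod_R in Q. specialize (Q H1 H3 ltac:(lra) H2 H4).
  rewrite <- !RtoC_minus, !Cmod_R in Q. simpl in Q.
  replace (x1 - x - (x2 - x)) with (x1 - x2) in Q by ring. replace (y1 - y - (y2 - y)) with (y1 - y2) in Q by ring.
  rewrite !Rmult_1_l in Q. exact Q.
Qed.

Definition qdiff2 (f : R * R -> R) (x y a b : R) : Prop :=
  exists d K, 0 < d /\ 0 <= K /\ forall h k, Rabs h < d -> Rabs k < d ->
    Rabs (f (x + h, y + k) - f (x, y) - (a * h + b * k)) <= K * ((Rabs h + Rabs k) * (Rabs h + Rabs k)).

Lemma analytic2_R_qdiff2 (f : R * R -> R) (x y : R) :
  analytic2_at (K := R_AbsRing) f (x, y) -> exists a b, qdiff2 f x y a b.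
Proof.
  intros H. destruct (analytic2_at_R f x y H) as (c & rho & B & Hc & Hcv). assert (Hr := proj1 Hc).
  destruct (poly2_linearization _ (poly2_tpoly c 2)) as (a & b & K & HK & HL).
  exists (Re a), (Re b), (Rmin (rho / 4) (1/2)), (4 * (B * (2 / rho) ^ 2) + K).
  assert (HB : 0 <= 4 * (B * (2 / rho) ^ 2)).
  { apply Rmult_le_pos; [lra|]. apply Rmult_le_pos; [apply Hc|]. apply pow_le. apply Rlt_le, Rdiv_lt_0_compat; lra. }
  split; [apply Rmin_pos; lra|]. split; [lra|]. intros h k Hh Hk.
  assert (m1 := Rmin_l (rho / 4) (1/2)). assert (m2 := Rmin_r (rho / 4) (1/2)).
  assert (h0 := Rabs_pos h). assert (k0 := Rabs_pos k).
  assert (C1 := Hcv h k ltac:(lra) ltac:(lra)).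
  assert (C0 := Hcv 0 0 ltac:(rewrite Rabs_R0; lra) ltac:(rewrite Rabs_R0; lra)). rewrite !Rplus_0_r in C0.
  assert (E1 : Cmod (RtoC (f (x + h, y + k)) - tpoly c 2 (RtoC h) (RtoC k)) <= 4 * (B * (2 / rho) ^ 2) * (Rabs h + Rabs k) ^ 2).
  { apply (psum_cv_le c _ _ _ _ _ 2 C1). intros N HN.
    assert (Q := psum_taylor c rho B 2 Hc N (RtoC h) (RtoC k) HN). rewrite !Cmod_R in Q. apply Q. lra. }
  assert (E0 : RtoC (f (x, y)) = tpoly c 2 (RtoC 0) (RtoC 0)).
  { assert (E : (RtoC (f (x, y)) - tpoly c 2 (RtoC 0) (RtoC 0))%C = RtoC 0).
    { apply Cmod_eq_0. apply Rle_antisym; [|apply Cmod_ge_0].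
      apply (psum_cv_le c _ _ _ _ _ 2 C0). intros N HN.
      assert (Q := psum_taylor c rho B 2 Hc N (RtoC 0) (RtoC 0) HN). rewrite !Cmod_R, Rabs_R0 in Q.
      eapply Rle_trans; [apply Q; lra|]. simpl. lra. }
    replace (RtoC (f (x, y))) with ((RtoC (f (x, y)) - tpoly c 2 (RtoC 0) (RtoC 0)) + tpoly c 2 (RtoC 0) (RtoC 0))%C by ring.
    rewrite E. ring. }
  assert (Nv : nrm (RtoC h, RtoC k) = Rabs h + Rabs k) by (unfold nrm; simpl; rewrite !Cmod_R; reflexivity).
  specialize (HL (RtoC h, RtoC k) (RtoC 0, RtoC 0) ltac:(lra) ltac:(rewrite nrm_0; lra)).
  rewrite Nv, nrm_0 in HL. unfold nrm_diff in HL. cbn [fst snd] in HL.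
  replace (RtoC h - RtoC 0)%C with (RtoC h) in HL by ring. replace (RtoC k - RtoC 0)%C with (RtoC k) in HL by ring.
  rewrite Nv, <- E0, Rplus_0_r in HL.
  set (v1 := f (x + h, y + k)) in *.
  assert (T := Cmod_triangle (RtoC (v1) - tpoly c 2 (RtoC h) (RtoC k))
    (tpoly c 2 (RtoC h) (RtoC k) - RtoC (f (x, y)) - (a * RtoC h + b * RtoC k))).
  set (W := (RtoC (v1) - tpoly c 2 (RtoC h) (RtoC k) + (tpoly c 2 (RtoC h) (RtoC k) - RtoC (f (x, y)) - (a * RtoC h + b * RtoC k)))%C) in *.
  assert (R1 := re_le_Cmod W).
  assert (ER : Re W = v1 - f (x, y) - (Re a * h + Re b * k)).
  { unfold W, Re. destruct a, b. simpl. ring. }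
  rewrite ER in R1. simpl in E1. lra.
Qed.

Lemma locally_constant_segment (g : R -> R) :
  (forall t, 0 <= t <= 1 -> exists d, 0 < d /\ forall s, 0 <= s <= 1 -> Rabs (s - t) < d -> g s = g t) -> g 1 = g 0.
Proof.
  intros H.
  assert (G : forall t, 0 <= t < 1 -> g t = g 0).
  { apply real_induction; auto.
    - intros t Ht Hb. destruct (H t ltac:(lra)) as (d & Hd & Hc).
      set (s := Rmax 0 (t - d / 2)). assert (Hs : 0 <= s < t) by (unfold s; split; [apply Rmax_l|apply Rmax_lub_lt; lra]).
      rewrite <- (Hb s Hs). symmetry. apply Hc; [lra|]. rewrite Rabs_left by lra.
      assert (t - d / 2 <= s) by apply Rmax_r. lra.
    - intros t Ht E. destruct (H t ltac:(lra)) as (d & Hd & Hc).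
      exists (Rmin d (1 - t)). split; [apply Rmin_pos; lra|]. intros s Hs. rewrite <- E.
      assert (m1 := Rmin_l d (1 - t)). assert (m2 := Rmin_r d (1 - t)).
      apply Hc; [lra|]. rewrite Rabs_pos_eq; lra. }
  destruct (H 1 ltac:(lra)) as (d & Hd & Hc).
  set (s := Rmax 0 (1 - d / 2)). assert (Hs : 0 <= s < 1) by (unfold s; split; [apply Rmax_l|apply Rmax_lub_lt; lra]).
  rewrite <- (G s Hs). symmetry. apply Hc; [lra|]. rewrite Rabs_left by lra.
  assert (1 - d / 2 <= s) by apply Rmax_r. lra.
Qed.

(** The coordinates may reverse the orientation of the circle, which [sigma] records. The constants
    [d] and [K] are uniform in [x] near the resonant curve, by periodicity and compactness, whereas
    conjugacy, injectivity and differentiability are kept on the whole strip of half-width [b]. *)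
Record chart (G : R * R -> R * R) (b : R) (H F : R * R -> R * R) (sigma : Z) (d K : R) : Prop := {
  ch_pos : 0 < d < b /\ 0 < K;
  ch_sigma : (sigma = 1 \/ sigma = -1)%Z;
  ch_shift : forall x y, Rabs y < b -> H (x + 1, y) = (fst (H (x, y)) + IZR sigma, snd (H (x, y)));
  ch_angle : forall x y, Rabs y < b -> 0 < snd (H (x, y)) < PI;
  ch_curve : forall x, snd (H (x, 0)) = PI / 2;
  ch_lipschitz : forall x y x' y', Rabs y <= d -> Rabs y' <= d -> Rabs (x - x') <= d ->
    Rabs (fst (H (x, y)) - fst (H (x', y'))) <= K * (Rabs (x - x') + Rabs (y - y')) /\
    Rabs (snd (H (x, y)) - snd (H (x', y'))) <= K * (Rabs (x - x') + Rabs (y - y'));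
  ch_qdiff : forall x y, Rabs y < b -> (exists p q, qdiff2 (fun P => fst (H P)) x y p q) /\
    (exists p q, qdiff2 (fun P => snd (H P)) x y p q);
  ch_injective : forall P P', Rabs (snd P) < b -> Rabs (snd P') < b -> cyl_eq (H P) (H P') -> cyl_eq P P';
  ch_onto : forall s r, Rabs (r - PI / 2) < d -> exists x y, Rabs y <= K * Rabs (r - PI / 2) /\ H (x, y) = (s, r);
  ch_conjugacy : forall P, Rabs (snd P) < b -> cyl_eq (G (G (H P))) (H (F P))
}.

Lemma uniform_lipschitz (f : R * R -> R) (b c y0 : R) :
  0 < b -> (forall x, analytic2_at (K := R_AbsRing) f (x, y0)) ->
  (forall x y, Rabs (y - y0) < b -> f (x + 1, y) = f (x, y) + c) ->
  exists d K, 0 < d < b /\ 0 <= K /\ forall x y x' y', Rabs (y - y0) <= d -> Rabs (y' - y0) <= d -> Rabs (x - x') <= d ->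
    Rabs (f (x, y) - f (x', y')) <= K * (Rabs (x - x') + Rabs (y - y')).
Proof.
  intros Hb Han Hp.
  destruct (rectangle_compactness 0 1 0 0 (fun u v e => forall x1 y1 x2 y2, Rabs (x1 - u) <= 2 * e -> Rabs (y1 - y0) <= 2 * e ->
    Rabs (x2 - u) <= 2 * e -> Rabs (y2 - y0) <= 2 * e ->
    Rabs (f (x1, y1) - f (x2, y2)) <= / e * (Rabs (x1 - x2) + Rabs (y1 - y2)))) as (d & Hd & Hc).
  { intros u v _ _. destruct (analytic2_R_lipschitz f u y0 (Han u)) as (d & K & Hd & HK & HL).
    set (e := Rmin (d / 2) (/ (K + 1))). assert (HiK : 0 < / (K + 1)) by (apply Rinv_0_lt_compat; lra).
    assert (He : 0 < e) by (apply Rmin_pos; lra).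
    assert (E1 : e <= d / 2) by apply Rmin_l. assert (E2 : e <= / (K + 1)) by apply Rmin_r.
    assert (E3 : K + 1 <= / e) by (rewrite <- (Rinv_inv (K + 1)); apply Rinv_le_contravar; auto).
    exists e. split; auto. intros x1 y1 x2 y2 H1 H2 H3 H4.
    eapply Rle_trans; [apply HL; lra|]. apply Rmult_le_compat_r; [|lra].
    assert (h1 := Rabs_pos (x1 - x2)). assert (h2 := Rabs_pos (y1 - y2)). lra. }
  set (d' := Rmin d (b / 2)). assert (Hd' : 0 < d') by (apply Rmin_pos; lra).
  assert (D1 : d' <= d) by apply Rmin_l. assert (D2 : d' <= b / 2) by apply Rmin_r.
  exists d', (/ d). split; [lra|]. split; [apply Rlt_le, Rinv_0_lt_compat; auto|].
  intros x. revert x.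
  apply (periodic_ind (fun x => forall y x' y', Rabs (y - y0) <= d' -> Rabs (y' - y0) <= d' -> Rabs (x - x') <= d' ->
    Rabs (f (x, y) - f (x', y')) <= / d * (Rabs (x - x') + Rabs (y - y')))).
  - intros x Hx y x' y' Hy Hy' Hxx.
    destruct (Hc x 0 Hx ltac:(lra)) as (u & v & e & Hu & Hv & H1 & H2 & H3 & H4).
    assert (B : Rabs (x' - u) <= 2 * e).
    { replace (x' - u) with (- (x - x') + (x - u)) by ring. eapply Rle_trans; [apply Rabs_triang|]. rewrite Rabs_Ropp. lra. }
    eapply Rle_trans; [apply H4; lra|]. apply Rmult_le_compat_r.
    + assert (h1 := Rabs_pos (x - x')). assert (h2 := Rabs_pos (y - y')). lra.
    + apply Rinv_le_contravar; auto.
  - intros x. split; intros Q y x' y' Hy Hy' Hxx.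
    + replace x' with ((x' - 1) + 1) at 1 by ring. rewrite !Hp by lra.
      replace (f (x, y) + c - (f (x' - 1, y') + c)) with (f (x, y) - f (x' - 1, y')) by ring.
      replace (x + 1 - x') with (x - (x' - 1)) in * by ring. apply Q; auto.
    + replace (f (x, y) - f (x', y')) with (f (x + 1, y) - f (x' + 1, y')) by (rewrite !Hp by lra; ring).
      replace (x - x') with (x + 1 - (x' + 1)) in * by ring. apply Q; auto.
Qed.

Lemma integer_gap (k k' : Z) : Rabs (IZR k - IZR k') < 1 -> k = k'.
Proof.
  intros H. apply Rabs_def2 in H. rewrite <- minus_IZR in H.
  assert (H1 : IZR (-1) < IZR (k - k')) by (simpl; lra). assert (H2 : IZR (k - k') < IZR 1) by (simpl; lra).
  apply lt_IZR in H1. apply lt_IZR in H2. lia.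
Qed.

Lemma cyl_eq_sym P Q : cyl_eq P Q -> cyl_eq Q P.
Proof. intros [[k Hk] E]. split; [exists (- k)%Z; rewrite opp_IZR; lra|auto]. Qed.

Lemma cyl_eq_trans P Q S : cyl_eq P Q -> cyl_eq Q S -> cyl_eq P S.
Proof. intros [[k Hk] E] [[k' Hk'] E']. split; [exists (k + k')%Z; rewrite plus_IZR; lra|congruence]. Qed.

(** The jump of the first coordinate over one period is an integer that varies continuously, hence
    is constant along segments from the origin. It is a unit because the inverse chart, followed
    over one period, provides an integer [j] with j sigma = 1. *)
Lemma chart_degree (V U : R * R -> Prop) (H Hi : R * R -> R * R) (b : R) :
  0 < b ->
  (forall P, V P -> U (H P) /\ Hi (H P) = P) -> (forall Q, U Q -> V (Hi Q) /\ H (Hi Q) = Q) ->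
  cyl_map V H -> cyl_map U Hi -> analytic_map_on (K := R_AbsRing) V H ->
  saturated U -> (forall P, V P -> (snd (H P) = PI / 2 <-> snd P = 0)) ->
  (forall P, strip b P -> V P) ->
  exists sigma : Z, (sigma = 1 \/ sigma = -1)%Z /\
    forall x y, Rabs y < b -> H (x + 1, y) = (fst (H (x, y)) + IZR sigma, snd (H (x, y))).
Proof.
  intros Hb HVU HUV HcH HcHi HaH HsU H0 HsV.
  assert (HV : forall x y, Rabs y < b -> V (x, y)) by (intros x y Hy; apply HsV; exact Hy).
  assert (Hshift : forall x y, Rabs y < b -> exists k : Z, fst (H (x + 1, y)) = fst (H (x, y)) + IZR k /\ snd (H (x + 1, y)) = snd (H (x, y))).
  { intros x y Hy. destruct (HcH (x, y) (x + 1, y) (HV x y Hy) (HV _ y Hy)) as [[k Hk] E].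
    - split; [exists 1%Z; reflexivity|reflexivity].
    - exists k. auto. }
  destruct (Hshift 0 0 ltac:(rewrite Rabs_R0; auto)) as (sigma & Hs0 & _).
  assert (Hconst : forall x y, Rabs y < b -> fst (H (x + 1, y)) = fst (H (x, y)) + IZR sigma).
  { intros x y Hy.
    set (g := fun t => fst (H (t * x + 1, t * y)) - fst (H (t * x, t * y))).
    assert (Hty : forall t, 0 <= t <= 1 -> Rabs (t * y) < b).
    { intros t Ht. rewrite Rabs_mult, (Rabs_pos_eq t) by lra. assert (h := Rabs_pos y). nra. }
    assert (E : g 1 = g 0).
    { apply locally_constant_segment. intros t Ht. specialize (Hty t Ht) as Hty'.
      destruct (HaH _ (HV (t * x + 1) (t * y) Hty')) as [Q1 _]. destruct (HaH _ (HV (t * x) (t * y) Hty')) as [Q2 _].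
      destruct (analytic2_R_lipschitz _ _ _ Q1) as (d1 & K1 & Hd1 & HK1 & L1).
      destruct (analytic2_R_lipschitz _ _ _ Q2) as (d2 & K2 & Hd2 & HK2 & L2).
      set (w := Rabs x + Rabs y + 1). assert (hx := Rabs_pos x). assert (hy := Rabs_pos y).
      set (e := Rmin (Rmin (d1 / w) (d2 / w)) (/ (4 * (K1 + K2 + 1) * w))).
      assert (Hw : 1 <= w) by (unfold w; lra).
      assert (P1 : 0 < d1 / w) by (apply Rdiv_lt_0_compat; lra). assert (P2 : 0 < d2 / w) by (apply Rdiv_lt_0_compat; lra).
      assert (P3 : 0 < 4 * (K1 + K2 + 1) * w) by nra.
      assert (P4 : 0 < / (4 * (K1 + K2 + 1) * w)) by (apply Rinv_0_lt_compat; auto).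
      exists e. split; [unfold e; repeat apply Rmin_pos; auto|]. intros s Hs Hst.
      assert (S1 : Rabs (s - t) < d1 / w) by (eapply Rlt_le_trans; [exact Hst|eapply Rle_trans; [apply Rmin_l|apply Rmin_l]]).
      assert (S2 : Rabs (s - t) < d2 / w) by (eapply Rlt_le_trans; [exact Hst|eapply Rle_trans; [apply Rmin_l|apply Rmin_r]]).
      assert (S3 : Rabs (s - t) < / (4 * (K1 + K2 + 1) * w)) by (eapply Rlt_le_trans; [exact Hst|apply Rmin_r]).
      apply (Rmult_lt_compat_l w) in S1; [|lra]. replace (w * (d1 / w)) with d1 in S1 by (field; lra).
      apply (Rmult_lt_compat_l w) in S2; [|lra]. replace (w * (d2 / w)) with d2 in S2 by (field; lra).
      apply (Rmult_lt_compat_l (4 * (K1 + K2 + 1) * w)) in S3; [|lra]. rewrite Rinv_r in S3 by lra.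
      assert (h := Rabs_pos (s - t)).
      assert (X1 : Rabs (s * x - t * x) <= w * Rabs (s - t)).
      { replace (s * x - t * x) with ((s - t) * x) by ring. rewrite Rabs_mult. unfold w. nra. }
      assert (Y1 : Rabs (s * y - t * y) <= w * Rabs (s - t)).
      { replace (s * y - t * y) with ((s - t) * y) by ring. rewrite Rabs_mult. unfold w. nra. }
      assert (X1' : Rabs (s * x + 1 - (t * x + 1)) <= w * Rabs (s - t)).
      { replace (s * x + 1 - (t * x + 1)) with (s * x - t * x) by ring. auto. }
      assert (Z1 : Rabs (t * x + 1 - (t * x + 1)) <= d1) by (rewrite Rminus_diag, Rabs_R0; lra).
      assert (Z2 : Rabs (t * y - t * y) <= d1) by (rewrite Rminus_diag, Rabs_R0; lra).
      assert (Z3 : Rabs (t * x - t * x) <= d2) by (rewrite Rminus_diag, Rabs_R0; lra).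
      assert (Z4 : Rabs (t * y - t * y) <= d2) by (rewrite Rminus_diag, Rabs_R0; lra).
      assert (B1 : Rabs (fst (H (s * x + 1, s * y)) - fst (H (t * x + 1, t * y)))
        <= K1 * (Rabs (s * x + 1 - (t * x + 1)) + Rabs (s * y - t * y))) by (apply L1; auto; lra).
      assert (B2 : Rabs (fst (H (s * x, s * y)) - fst (H (t * x, t * y)))
        <= K2 * (Rabs (s * x - t * x) + Rabs (s * y - t * y))) by (apply L2; auto; lra).
      destruct (Hshift (s * x) (s * y) (Hty s Hs)) as (ks & Eks & _).
      destruct (Hshift (t * x) (t * y) Hty') as (kt & Ekt & _).
      unfold g. rewrite Eks, Ekt. rewrite Eks, Ekt in B1.
      assert (ks = kt); [|subst; ring]. apply integer_gap.
      assert (C1 : K1 * (Rabs (s * x + 1 - (t * x + 1)) + Rabs (s * y - t * y)) <= K1 * (2 * (w * Rabs (s - t)))) by (apply Rmult_le_compat_l; lra).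
      assert (C2 : K2 * (Rabs (s * x - t * x) + Rabs (s * y - t * y)) <= K2 * (2 * (w * Rabs (s - t)))) by (apply Rmult_le_compat_l; lra).
      replace (IZR ks - IZR kt) with ((fst (H (s * x, s * y)) + IZR ks - (fst (H (t * x, t * y)) + IZR kt)) + - (fst (H (s * x, s * y)) - fst (H (t * x, t * y)))) by ring.
      eapply Rle_lt_trans; [apply Rabs_triang|]. rewrite Rabs_Ropp.
      assert (0 <= w * Rabs (s - t)) by (apply Rmult_le_pos; lra). lra. }
    unfold g in E. rewrite !Rmult_1_l, !Rmult_0_l, !Rplus_0_l in E. rewrite Rplus_0_l in Hs0. rewrite Hs0 in E. lra. }
  assert (Hfull : forall x y, Rabs y < b -> H (x + 1, y) = (fst (H (x, y)) + IZR sigma, snd (H (x, y)))).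
  { intros x y Hy. destruct (Hshift x y Hy) as (k & _ & E). rewrite (surjective_pairing (H (x + 1, y))), Hconst, E by auto. reflexivity. }
  exists sigma. split; [|exact Hfull].
  assert (Hb0 : Rabs 0 < b) by (rewrite Rabs_R0; auto).
  assert (Hz : forall k : Z, fst (H (IZR k, 0)) = fst (H (0, 0)) + IZR k * IZR sigma).
  { assert (Hn : forall n x, fst (H (x + INR n, 0)) = fst (H (x, 0)) + INR n * IZR sigma).
    { induction n as [|n IH]; intros x; [simpl; rewrite Rplus_0_r; ring|].
      rewrite S_INR, <- Rplus_assoc, Hconst, IH by auto. ring. }
    intros k. destruct (Z_le_dec 0 k) as [Hk|Hk].
    - replace (IZR k) with (0 + INR (Z.to_nat k)) at 1 by (rewrite INR_IZR_INZ, Z2Nat.id by lia; ring).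
      rewrite Hn, INR_IZR_INZ, Z2Nat.id by lia. reflexivity.
    - assert (E := Hn (Z.to_nat (- k)) (IZR k)). rewrite INR_IZR_INZ, Z2Nat.id, opp_IZR in E by lia.
      replace (IZR k + - IZR k) with 0 in E by ring. lra. }
  set (Q0 := H (0, 0)). destruct (HVU (0, 0) (HV 0 0 Hb0)) as [HU0 Hi0]. fold Q0 in HU0, Hi0.
  assert (Hc : cyl_eq Q0 (fst Q0 + 1, snd Q0)) by (split; [exists 1%Z; reflexivity|reflexivity]).
  assert (HU1 : U (fst Q0 + 1, snd Q0)) by (apply (HsU _ _ Hc HU0)).
  destruct (HUV _ HU1) as [HV1 HHi1].
  destruct (HcHi _ _ HU0 HU1 Hc) as [[j Hj] E2]. rewrite Hi0 in Hj, E2. simpl in Hj, E2.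
  assert (E3 : Hi (fst Q0 + 1, snd Q0) = (IZR j, 0)).
  { rewrite (surjective_pairing (Hi _)), Hj, E2. f_equal. ring. }
  rewrite E3 in HHi1. assert (E4 := Hz j). rewrite HHi1 in E4. simpl in E4. fold Q0 in E4.
  assert (E5 : (j * sigma = 1)%Z) by (apply eq_IZR; rewrite mult_IZR; lra).
  apply Z.mul_eq_1 in E5 as E6. destruct E6; subst; lia.
Qed.

Lemma chart_of_resonant_RIC (G : R * R -> R * R) (a b : R) (V U : R * R -> Prop) (H Hi F : R * R -> R * R) :
  0 < b ->
  (open V /\ saturated V /\ open U /\ saturated U) ->
  (forall P, U P -> 0 < snd P < PI) -> (forall s, U (s, PI / 2)) ->
  (forall P, V P -> U (H P) /\ Hi (H P) = P) -> (forall Q, U Q -> V (Hi Q) /\ H (Hi Q) = Q) ->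
  (cyl_map V H /\ cyl_map U Hi) ->
  (analytic_map_on (K := R_AbsRing) V H /\ analytic_map_on (K := R_AbsRing) U Hi) ->
  (forall P, V P -> (snd (H P) = PI / 2 <-> snd P = 0)) ->
  (forall P, strip b P -> V P /\ V (F P) /\ cyl_eq (G (G (H P))) (H (F P))) ->
  exists sigma d K, chart G b H F sigma d K.
Proof.
  intros Hb (HoV & HsV & HoU & HsU) HUr HUc HVU HUV [HcH HcHi] [HaH HaHi] H0 Hstrip.
  assert (HsVb : forall P, strip b P -> V P) by (intros P HP; apply Hstrip; auto).
  assert (HV : forall x y, Rabs y < b -> V (x, y)) by (intros x y Hy; apply HsVb; exact Hy).
  assert (Hb0 : Rabs 0 < b) by (rewrite Rabs_R0; auto).
  destruct (chart_degree V U H Hi b Hb HVU HUV HcH HcHi HaH HsU H0 HsVb) as (sigma & Hsig & Hsh).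
  destruct (uniform_lipschitz (fun P => fst (H P)) b (IZR sigma) 0 Hb) as (d1 & K1 & Hd1 & HK1 & L1).
  { intros x. apply (HaH _ (HV x 0 Hb0)). }
  { intros x y Hy. rewrite Rminus_0_r in Hy. rewrite Hsh by auto. reflexivity. }
  destruct (uniform_lipschitz (fun P => snd (H P)) b 0 0 Hb) as (d2 & K2 & Hd2 & HK2 & L2).
  { intros x. apply (HaH _ (HV x 0 Hb0)). }
  { intros x y Hy. rewrite Rminus_0_r in Hy. rewrite Hsh by auto. simpl. ring. }
  assert (HUn : exists d3, 0 < d3 /\ forall s r, Rabs (r - PI / 2) < d3 -> U (s, r)).
  { destruct (rectangle_compactness 0 1 0 0 (fun u v e => forall s r, Rabs (s - u) < e -> Rabs (r - PI / 2) < e -> U (s, r))) as (d & Hd & Hc).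
    { intros u v _ _. destruct (HoU (u, PI / 2) (HUc u)) as [e He]. exists e. split; [apply cond_pos|].
      intros s r Hs Hr. apply He. split; [exact Hs|exact Hr]. }
    exists d. split; auto. intros s r Hr. revert s. apply periodic_ind.
    - intros s Hs. destruct (Hc s 0 Hs ltac:(lra)) as (u & v & e & _ & _ & H1 & _ & H3 & H4). apply H4; auto. lra.
    - intros s. split; apply HsU; (split; [|reflexivity]); [exists 1%Z|exists (-1)%Z]; simpl; ring. }
  destruct HUn as (d3 & Hd3 & HU3).
  (* The height given by the inverse chart vanishes on the resonant curve and is Lipschitz near it,
     so that it is at most a constant times the deviation from the right angle; this is the bound of
     [ch_onto]. *)
  destruct (uniform_lipschitz (fun Q => snd (Hi Q)) d3 0 (PI / 2) Hd3) as (d4 & K4 & Hd4 & HK4 & L4).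
  { intros s. apply (HaHi _ (HUc s)). }
  { intros s r Hr. destruct (HcHi (s, r) (s + 1, r) (HU3 _ _ Hr) (HU3 _ _ Hr)) as [_ E].
    - split; [exists 1%Z; reflexivity|reflexivity].
    - rewrite E. ring. }
  set (d := Rmin d1 (Rmin d2 d4)). assert (D1 : d <= d1) by apply Rmin_l.
  assert (D2 : d <= d2) by (eapply Rle_trans; [apply Rmin_r|apply Rmin_l]).
  assert (D4 : d <= d4) by (eapply Rle_trans; [apply Rmin_r|apply Rmin_r]).
  assert (Hd : 0 < d) by (unfold d; repeat apply Rmin_pos; lra).
  exists sigma, d, (K1 + K2 + K4 + 1). constructor.
  - split; lra.
  - exact Hsig.
  - exact Hsh.
  - intros x y Hy. apply HUr. apply HVU. apply HV; auto.
  - intros x. apply H0; [apply HV; auto|reflexivity].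
  - intros x y x' y' Hy Hy' Hxx.
    assert (h1 := Rabs_pos (x - x')). assert (h2 := Rabs_pos (y - y')). split.
    + eapply Rle_trans; [apply L1; rewrite ?Rminus_0_r; lra|]. apply Rmult_le_compat_r; lra.
    + eapply Rle_trans; [apply L2; rewrite ?Rminus_0_r; lra|]. apply Rmult_le_compat_r; lra.
  - intros x y Hy. destruct (HaH _ (HV x y Hy)) as [Q1 Q2]. split; apply analytic2_R_qdiff2; auto.
  - intros P P' HP HP' E. destruct (HVU P (HsVb P HP)) as [U1 E1]. destruct (HVU P' (HsVb P' HP')) as [U2 E2].
    rewrite <- E1, <- E2. apply HcHi; auto.
  - intros s r Hr. assert (HU : U (s, r)) by (apply HU3; lra).
    destruct (HUV _ HU) as [HVq HHi].
    exists (fst (Hi (s, r))), (snd (Hi (s, r))). split; [|rewrite <- surjective_pairing; exact HHi].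
    assert (E0 : snd (Hi (s, PI / 2)) = 0).
    { destruct (HUV _ (HUc s)) as [V0 E]. apply H0; auto. rewrite E. reflexivity. }
    assert (B := L4 s r s (PI / 2) ltac:(lra) ltac:(rewrite Rminus_diag, Rabs_R0; lra) ltac:(rewrite Rminus_diag, Rabs_R0; lra)).
    cbv beta in B. rewrite E0, Rminus_0_r, Rminus_diag, Rabs_R0, Rplus_0_l in B.
    eapply Rle_trans; [exact B|]. apply Rmult_le_compat_r; [apply Rabs_pos|lra].
  - intros P HP. apply Hstrip. exact HP.
Qed.

(** * Periodic billiard trajectories as periodic points *)

Fixpoint rsum (f : nat -> R) (n : nat) : R :=
  match n with O => 0 | S n => rsum f n + f n end.

Lemma sum_n_rsum (f : nat -> R) (n : nat) : sum_n f n = rsum f (S n).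
Proof.
  induction n as [|n IH].
  - rewrite sum_O. simpl. ring.
  - rewrite sum_Sn, IH. reflexivity.
Qed.

Lemma rsum_ext (f g : nat -> R) (n : nat) : (forall k, (k < n)%nat -> f k = g k) -> rsum f n = rsum g n.
Proof. induction n as [|n IH]; intros H; simpl; [reflexivity|]. rewrite IH, H by auto. reflexivity. Qed.

Lemma rsum_shift (f : nat -> R) (n : nat) : rsum (fun k => f (S k)) n = rsum f n - f 0%nat + f n.
Proof. induction n as [|n IH]; simpl; [ring|]. rewrite IH. ring. Qed.

Lemma rsum_telescope (f : nat -> R) (n : nat) : rsum (fun k => f (S k) - f k) n = f n - f 0%nat.
Proof. induction n as [|n IH]; simpl; [ring|]. rewrite IH. ring. Qed.

Lemma rsum_add (f : nat -> R) (n m : nat) : rsum f (n + m) = rsum f n + rsum (fun k => f (n + k)%nat) m.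
Proof.
  induction m as [|m IH]; simpl; [rewrite Nat.add_0_r; ring|].
  rewrite Nat.add_succ_r. simpl. rewrite IH. ring.
Qed.

Lemma rsum_pairs (f : nat -> R) (n : nat) :
  rsum f (2 * n) = rsum (fun k => f (2 * k)%nat + f (2 * k + 1)%nat) n.
Proof.
  induction n as [|n IH]; [reflexivity|].
  replace (2 * S n)%nat with (S (S (2 * n))) by lia. 
  change (rsum f (S (S (2 * n)))) with (rsum f (2 * n) + f (2 * n)%nat + f (S (2 * n))).
  rewrite IH. cbn [rsum]. rewrite (Nat.add_1_r (2 * n)). ring.
Qed.

Lemma rsum_gt (f : nat -> R) (B : R) (n : nat) :
  (1 <= n)%nat -> (forall k, (k < n)%nat -> B < f k) -> INR n * B < rsum f n.
Proof.
  induction n as [|n IH]; intros Hn H; [lia|]. simpl rsum. rewrite S_INR.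
  assert (H1 := H n ltac:(lia)). destruct n as [|n]; [simpl; lra|].
  assert (H2 := IH ltac:(lia) ltac:(intros; apply H; lia)). lra.
Qed.

Lemma rsum_periodic (d : Z -> R) (n : nat) (c : Z) :
  (forall k, d (k + Z.of_nat n)%Z = d k) ->
  rsum (fun k => d (c + Z.of_nat k)%Z) n = rsum (fun k => d (Z.of_nat k)) n.
Proof.
  intros H.
  assert (Step : forall c, rsum (fun k => d (c + 1 + Z.of_nat k)%Z) n = rsum (fun k => d (c + Z.of_nat k)%Z) n).
  { intros c'. rewrite (rsum_ext _ (fun k => d (c' + Z.of_nat (S k))%Z)) by (intros; f_equal; lia).
    rewrite (rsum_shift (fun k => d (c' + Z.of_nat k)%Z)). rewrite H, Z.add_0_r. ring. }
  assert (Nat : forall (j : nat) c, rsum (fun k => d (c + Z.of_nat j + Z.of_nat k)%Z) n = rsum (fun k => d (c + Z.of_nat k)%Z) n).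
  { induction j as [|j IH]; intros c'.
    - apply rsum_ext. intros. f_equal. lia.
    - rewrite <- (IH c'), <- (Step (c' + Z.of_nat j)%Z). apply rsum_ext. intros. f_equal. lia. }
  destruct (Z_le_dec 0 c) as [Hc|Hc].
  - assert (Q := Nat (Z.to_nat c) 0%Z). cbn [Z.add] in Q. rewrite <- Q. apply rsum_ext. intros. f_equal. lia.
  - rewrite <- (Nat (Z.to_nat (- c)) c). apply rsum_ext. intros. f_equal. lia.
Qed.

Lemma angle_near_right (r : R) : 0 < r < PI -> Rabs (r - PI / 2) <= 4 * Rabs (cos r).
Proof.
  intros Hr.
  assert (G : forall t, 0 <= t <= PI / 2 -> t <= 4 * sin t).
  { intros t Ht. assert (hp := PI_4). assert (hp0 := PI_RGT_0).
    destruct (Rle_dec t (PI / 3)) as [H|H].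
    - destruct (MVT_gen sin 0 t cos) as (c & Hc & E).
      + intros x _. auto_derive; auto; ring.
      + intros x _. apply continuity_sin.
      + rewrite Rmin_left, Rmax_right in Hc by lra. rewrite sin_0 in E.
        assert (B : cos (PI / 3) <= cos c) by (apply cos_decr_1; lra). rewrite cos_PI3 in B. nra.
    - assert (B : sin (PI / 6) <= sin t) by (apply sin_incr_1; lra). rewrite sin_PI6 in B. lra. }
  replace r with (PI / 2 - (PI / 2 - r)) at 2 by ring. rewrite cos_shift.
  destruct (Rle_dec 0 (PI / 2 - r)) as [H|H].
  - rewrite Rabs_left1 by lra. rewrite Rabs_pos_eq by (apply sin_ge_0; lra).
    assert (B := G (PI / 2 - r) ltac:(lra)). lra.
  - rewrite Rabs_pos_eq by lra. replace (PI / 2 - r) with (- (r - PI / 2)) by ring.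
    rewrite sin_neg, Rabs_Ropp, Rabs_pos_eq by (apply sin_ge_0; lra). apply G. lra.
Qed.

Lemma cos_lipschitz (a b : R) : Rabs (cos a - cos b) <= Rabs (a - b).
Proof.
  assert (V : forall a b, a <= b -> Rabs (cos b - cos a) <= 1 * (b - a)).
  { intros u v Huv. apply (mean_value_bound cos (fun s => - sin s)); auto. intros s _. split; [auto_derive; auto; ring|].
    rewrite Rabs_Ropp. assert (h := SIN_bound s). apply Rabs_le. lra. }
  destruct (Rle_dec a b) as [H|H].
  - rewrite Rabs_minus_sym, (Rabs_left1 (a - b)) by lra. assert (B := V _ _ H). lra.
  - rewrite (Rabs_pos_eq (a - b)) by lra. assert (B := V b a ltac:(lra)). lra.
Qed.

Lemma cos_le_distance (r : R) : Rabs (cos r) <= Rabs (r - PI / 2).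
Proof. assert (B := cos_lipschitz r (PI / 2)). rewrite cos_PI2, Rminus_0_r in B. exact B. Qed.

Lemma billiard_cyl (M : R -> C) (G : R * R -> R * R) (l : R) (P Q : R * R) :
  smooth_curve M l -> billiard_lift M G -> 0 < snd P < PI -> cyl_eq P Q -> cyl_eq (G P) (G Q).
Proof.
  intros HM HG HP [[k Hk] E]. destruct P as [s r], Q as [s' r']. simpl in *. subst.
  rewrite (billiard_shift M G l) by auto. split; [exists k; reflexivity|reflexivity].
Qed.

Definition real_pair (P : R * R) : C * C := (RtoC (fst P), RtoC (snd P)).

(** Transfers [one_orbit] to the real map. The real and complex orbits agree as long as the heights
    stay below [b], and the estimates of [one_orbit] themselves guarantee this. *)
Lemma real_iterates (F : R * R -> R * R) (f : C * C -> C * C) (a1 a2 y1 d A C0 b : R) (N : nat) (P : R * R) :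
  near_twist f a2 y1 d A -> y1 < b -> 1 <= C0 -> 0 <= a1 -> a1 < a2 -> threshold a1 a2 y1 d A C0 <= INR N ->
  (forall P, Rabs (snd P) < b -> f (real_pair P) = real_pair (F P)) ->
  Rabs (snd P) <= C0 * / INR N ->
  forall j, (j <= N)%nat ->
    Nat.iter j f (real_pair P) = real_pair (Nat.iter j F P) /\
    Rabs (snd (Nat.iter j F P)) <= 2 * C0 * / INR N /\ Rabs (snd (Nat.iter j F P)) < b /\
    Rabs (snd (Nat.iter j F P) - snd P) <= INR j * (8 * A * C0 ^ 3 * / INR N ^ 3) /\
    Rabs (fst (Nat.iter j F P) - fst P - INR j * snd P) <= INR j * (drift A C0 * (/ INR N * / INR N)).
Proof.
  intros Hf Hyb HC0 Ha Haa HN Hreal HP. destruct (nt_pos _ _ _ _ _ Hf) as (Hy1 & Hd & HA).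
  destruct (threshold_consequences a1 a2 y1 d A C0 N Hy1 Hd HA HC0 Haa HN)
    as (Hn & He & Ene & K1 & _ & _ & _ & _ & _ & _ & _ & HD).
  assert (O := one_orbit f a1 a2 y1 d A C0 N (RtoC (fst P)) (RtoC (snd P)) Hf HC0 Haa HN
    ltac:(simpl; rewrite Rabs_R0; auto) ltac:(rewrite Cmod_R; auto)
    ltac:(simpl; rewrite Rabs_R0; apply Rmult_le_pos; [lra|nra])).
  change (RtoC (fst P), RtoC (snd P)) with (real_pair P) in O.
  assert (E : forall j, (j <= N)%nat -> Nat.iter j f (real_pair P) = real_pair (Nat.iter j F P)).
  { induction j as [|j IH]; intros Hj; [reflexivity|]. simpl. rewrite IH by lia.
    apply Hreal. destruct (O j ltac:(lia)) as (_ & O2 & _ & _). rewrite IH in O2 by lia.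
    simpl in O2. rewrite Cmod_R in O2. lra. }
  intros j Hj. split; [auto|]. destruct (O j Hj) as (_ & O2 & O3 & O4). rewrite E in O2, O3, O4 by auto.
  unfold real_pair in O2, O3, O4. cbn [fst snd] in O2, O3, O4.
  rewrite <- RtoC_mult, <- !RtoC_minus, Cmod_R in O4. rewrite <- RtoC_minus, Cmod_R in O3. rewrite Cmod_R in O2.
  repeat split; auto. lra.
Qed.

Lemma int_translation (T : R * R -> R * R) (b w : R) :
  (forall x y, Rabs y < b -> T (x + 1, y) = (fst (T (x, y)) + w, snd (T (x, y)))) ->
  forall (k : Z) x y, Rabs y < b -> T (x + IZR k, y) = (fst (T (x, y)) + IZR k * w, snd (T (x, y))).
Proof.
  intros Hc.
  assert (Hn : forall n x y, Rabs y < b -> T (x + INR n, y) = (fst (T (x, y)) + INR n * w, snd (T (x, y)))).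
  { induction n as [|n IH]; intros x y Hy.
    - simpl. rewrite Rplus_0_r, Rmult_0_l, Rplus_0_r. apply surjective_pairing.
    - rewrite S_INR, <- Rplus_assoc, Hc, IH by auto. cbn [fst snd]. f_equal. ring. }
  intros k x y Hy. destruct (Z_le_dec 0 k) as [Hk|Hk].
  - assert (E := Hn (Z.to_nat k) x y Hy). rewrite INR_IZR_INZ, Z2Nat.id in E by lia. exact E.
  - assert (E := Hn (Z.to_nat (- k)) (x + IZR k) y Hy). rewrite INR_IZR_INZ, Z2Nat.id, opp_IZR in E by lia.
    replace (x + IZR k + - IZR k) with x in E by ring. rewrite E. cbn [fst snd].
    rewrite (surjective_pairing (T (x + IZR k, y))) at 1. f_equal. ring.
Qed.

Lemma chart_shift_int (G : R * R -> R * R) (b : R) (H F : R * R -> R * R) (sigma : Z) (d K : R) :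
  chart G b H F sigma d K -> forall (k : Z) x y, Rabs y < b ->
    H (x + IZR k, y) = (fst (H (x, y)) + IZR (k * sigma), snd (H (x, y))).
Proof. intros Hc k x y Hy. rewrite mult_IZR. apply (int_translation H b (IZR sigma) (ch_shift _ _ _ _ _ _ _ Hc) k x y Hy). Qed.

Definition billiard_orbit (G : R * R -> R * R) (s r : Z -> R) : Prop :=
  forall k, 0 < r k < PI /\ G (s k, r k) = (s (k + 1)%Z, r (k + 1)%Z).

(** Two bounces on the resonant curve make exactly one turn; this is the deviation from it. *)
Definition excess (s : Z -> R) (k : Z) : R := s (k + 2)%Z - s k - 1.

(* The excesses of the double steps have a constant sign and add up to [kap], so
   one of them is at most [|kap| / N]; reflection makes the angle between them
   nearly right, which brings the trajectory into the chart. *)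
Lemma trajectory_periodic_point (M : R -> C) (G : R * R -> R * R) (l : R) (H F : R * R -> R * R)
    (f : C * C -> C * C) (sigma : Z) (b d K a1 a2 y1 df A L : R) :
  smooth_curve M l -> billiard_lift M G -> chart G b H F sigma d K ->
  near_twist f a2 y1 df A -> y1 < b -> 0 < a1 < a2 -> 1 <= L ->
  (forall P, Rabs (snd P) < b -> f (real_pair P) = real_pair (F P)) ->
  exists C0 T, L + 1 <= C0 /\ forall (N : nat) (kap : Z) (s r : Z -> R),
    T <= INR N -> threshold a1 a2 y1 df A C0 <= INR N ->
    Rabs (IZR kap) <= L -> billiard_orbit G s r ->
    (forall k, s (k + 2 * Z.of_nat N)%Z = s k + INR N + IZR kap /\ r (k + 2 * Z.of_nat N)%Z = r k) ->
    ((forall k, 0 < excess s k) \/ (forall k, excess s k < 0)) ->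
    exists (c : Z) (P : R * R), Rabs (snd P) <= C0 * / INR N /\
      (forall j, (j <= N)%nat -> cyl_eq (H (Nat.iter j F P)) (s (c + 2 * Z.of_nat j)%Z, r (c + 2 * Z.of_nat j)%Z)) /\
      Nat.iter N F P = (fst P + IZR (sigma * kap), snd P).
Proof.
  intros HM HG Hch Hf Hyb Ha HL Hreal.
  destruct (velocity_close M l HM) as (e0 & He0 & Hvel).
  destruct (nearly_closed_chord M G l HM HG) as (e1 & K1 & He1 & HK1 & Hclosed).
  destruct (ch_pos _ _ _ _ _ _ _ Hch) as [[Hd Hdb] HK].
  destruct (nt_pos _ _ _ _ _ Hf) as (Hy1 & Hdf & HA).
  (* Bound for N times the height of the point found below: K1 L / N bounds a cosine, 4 converts it
     into an angle, and [K] into a height in the chart. *)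
  set (C1 := K * (4 * (K1 * L))).
  assert (HK1L : 0 < K1 * L) by (apply Rmult_lt_0_compat; lra).
  assert (HC1 : 0 < C1) by (unfold C1; apply Rmult_lt_0_compat; lra).
  set (C0 := L + 1 + C1). set (D := drift A C0).
  (* Sum of the lower bounds on N that give [S1] to [S6]. *)
  set (T := 1 + L / e1 + (8 * (K1 * L)) / d + 2 * C0 / d + 5 * K * C0 + (C0 + 2 * D) / d + (K * (5 * C0 + 2 * D)) * (2 / e0)).
  exists C0, T. split; [unfold C0; lra|].
  intros N kap s r HT Hthr Hkap Horb Hper Hsign.
  assert (HC0 : 1 <= C0) by (unfold C0; lra).
  destruct (threshold_consequences a1 a2 y1 df A C0 N Hy1 Hdf HA HC0 ltac:(lra) Hthr)
    as (Hn & He & Ene & _ & _ & _ & _ & _ & _ & _ & _ & HD). fold D in HD.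
  assert (HN1 : (1 <= N)%nat) by (apply INR_le; simpl; lra).
  set (e := / INR N) in *. set (n := INR N) in *.
  assert (T1 : 0 <= L / e1) by (apply Rdiv_le_0_compat; lra).
  assert (T2 : 0 <= (8 * (K1 * L)) / d) by (apply Rdiv_le_0_compat; lra).
  assert (T3 : 0 <= 2 * C0 / d) by (apply Rdiv_le_0_compat; lra).
  assert (T4 : 0 <= 5 * K * C0) by (apply Rmult_le_pos; lra).
  assert (T5 : 0 <= (C0 + 2 * D) / d) by (apply Rdiv_le_0_compat; lra).
  assert (T6 : 0 <= (K * (5 * C0 + 2 * D)) * (2 / e0)).
  { apply Rmult_le_pos; [apply Rmult_le_pos; lra|]. apply Rdiv_le_0_compat; lra. }
  assert (Gen : forall c k, 0 < k -> c / k <= n -> c * e <= k).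
  { intros c k Hk Hck. apply Rmult_le_reg_l with n; [lra|]. replace (n * (c * e)) with (c * (n * e)) by ring.
    rewrite Ene, Rmult_1_r. apply Rle_div_l in Hck; lra. }
  assert (S1 : L * e <= e1) by (apply Gen; [auto|unfold T in HT; lra]).
  assert (S2 : 8 * (K1 * L) * e <= d) by (apply Gen; [auto|unfold T in HT; lra]).
  assert (S3 : 2 * C0 * e <= d) by (apply Gen; [auto|unfold T in HT; lra]).
  assert (S4 : 5 * K * C0 * e <= 1) by (apply Gen; [lra|unfold T in HT; lra]).
  assert (S5 : (C0 + 2 * D) * e <= d) by (apply Gen; [auto|unfold T in HT; lra]).
  assert (S6 : K * (5 * C0 + 2 * D) * e <= e0 / 2).
  { apply Gen; [lra|]. replace (K * (5 * C0 + 2 * D) / (e0 / 2)) with (K * (5 * C0 + 2 * D) * (2 / e0)) by (field; lra).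
    unfold T in HT. lra. }
  assert (Hsum : forall c, rsum (fun j => excess s (c + 2 * Z.of_nat j)%Z) N = IZR kap).
  { intros c. rewrite (rsum_ext _ (fun j => (fun j => s (c + 2 * Z.of_nat j)%Z - INR j) (S j) - (fun j => s (c + 2 * Z.of_nat j)%Z - INR j) j)).
    - rewrite (rsum_telescope (fun j => s (c + 2 * Z.of_nat j)%Z - INR j)).
      replace (c + 2 * Z.of_nat 0)%Z with c by lia. rewrite (proj1 (Hper c)). simpl. fold n. ring.
    - intros j _. cbv beta. unfold excess. rewrite S_INR.
      replace (c + 2 * Z.of_nat (S j))%Z with (c + 2 * Z.of_nat j + 2)%Z by lia. ring. }
  assert (Hsmall : exists i : Z, Rabs (excess s i) <= L * e).
  { apply NNPP. intros Hno.
    assert (Hbig : forall i, L * e < Rabs (excess s i)).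
    { intros i. apply Rnot_le_lt. intros Hle. apply Hno. exists i. exact Hle. }
    assert (HLn : n * (L * e) = L) by (replace (n * (L * e)) with (L * (n * e)) by ring; rewrite Ene; ring).
    apply Rabs_le_between in Hkap.
    destruct Hsign as [Hs|Hs].
    - assert (Q := rsum_gt (fun j => excess s (0 + 2 * Z.of_nat j)%Z) (L * e) N HN1).
      rewrite Hsum in Q. fold n in Q. rewrite HLn in Q.
      assert (L < IZR kap); [|lra]. apply Q. intros k _. specialize (Hbig (0 + 2 * Z.of_nat k)%Z).
      rewrite Rabs_pos_eq in Hbig; [auto|apply Rlt_le, Hs].
    - assert (Q := rsum_gt (fun j => - excess s (0 + 2 * Z.of_nat j)%Z) (L * e) N HN1).
      assert (En : rsum (fun j => - excess s (0 + 2 * Z.of_nat j)%Z) N = - IZR kap).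
      { rewrite <- (Hsum 0%Z). clear. induction N as [|N IH]; cbn [rsum]; [ring|]. rewrite IH. ring. }
      rewrite En in Q. fold n in Q. rewrite HLn in Q.
      assert (L < - IZR kap); [|lra]. apply Q. intros k _. specialize (Hbig (0 + 2 * Z.of_nat k)%Z).
      rewrite Rabs_left in Hbig; [auto|apply Hs]. }
  (* The angle is controlled at the bounce in the middle of the short double step, so the orbit in
     the chart starts at i + 1. *)
  destruct Hsmall as [i Hi]. set (c := (i + 1)%Z).
  assert (Hcos : Rabs (cos (r c)) <= K1 * L * e).
  { destruct (Horb i) as [Hri Gi]. destruct (Horb c) as [_ Gc].
    assert (Q := Hclosed (s i) (r i) Hri). rewrite Gi in Q. cbn [fst snd] in Q. fold c in Q. rewrite Gc in Q. cbn [fst] in Q.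
    replace (c + 1)%Z with (i + 2)%Z in Q by (unfold c; lia). fold (excess s i) in Q.
    eapply Rle_trans; [apply Q; lra|]. rewrite Rmult_assoc. apply Rmult_le_compat_l; lra. }
  assert (Hang : Rabs (r c - PI / 2) <= 4 * (K1 * L) * e).
  { eapply Rle_trans; [apply angle_near_right; apply Horb|]. lra. }
  destruct (ch_onto _ _ _ _ _ _ _ Hch (s c) (r c)) as (x0 & y0 & Hy0 & HH0).
  { assert (0 < K1 * L * e) by (apply Rmult_lt_0_compat; lra). lra. }
  assert (Hy0' : Rabs y0 <= C0 * e).
  { eapply Rle_trans; [exact Hy0|]. apply Rle_trans with (K * (4 * (K1 * L) * e)); [apply Rmult_le_compat_l; lra|].
    replace (K * (4 * (K1 * L) * e)) with (C1 * e) by (unfold C1; ring). apply Rmult_le_compat_r; [lra|unfold C0; lra]. }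
  set (P := (x0, y0)).
  assert (RI := real_iterates F f a1 a2 y1 df A C0 b N P Hf Hyb HC0 ltac:(lra) ltac:(lra) Hthr Hreal Hy0').
  fold n in RI. fold e in RI. fold D in RI.
  set (PP := fun j => Nat.iter j F P).
  assert (Hcyl : forall j, (j <= N)%nat -> cyl_eq (H (PP j)) (s (c + 2 * Z.of_nat j)%Z, r (c + 2 * Z.of_nat j)%Z)).
  { induction j as [|j IH]; intros Hj.
    - unfold PP, P. simpl Nat.iter. rewrite HH0. replace (c + 2 * Z.of_nat 0)%Z with c by lia.
      split; [exists 0%Z; simpl; ring|reflexivity].
    - specialize (IH ltac:(lia)). destruct (RI j ltac:(lia)) as (_ & _ & Rb & _). fold (PP j) in Rb.
      assert (Cj := ch_conjugacy _ _ _ _ _ _ _ Hch (PP j) Rb).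
      change (PP (S j)) with (F (PP j)).
      apply cyl_eq_trans with (G (G (H (PP j)))); [apply cyl_eq_sym; exact Cj|].
      set (k := (c + 2 * Z.of_nat j)%Z) in *. destruct (Horb k) as [Hrk Gk]. destruct (Horb (k + 1)%Z) as [Hrk1 Gk1].
      replace (c + 2 * Z.of_nat (S j))%Z with (k + 1 + 1)%Z by (unfold k; lia).
      assert (Hang0 : 0 < snd (H (PP j)) < PI) by (rewrite (surjective_pairing (PP j)); apply (ch_angle _ _ _ _ _ _ _ Hch); auto).
      assert (Q1 := billiard_cyl M G l _ _ HM HG Hang0 IH). rewrite Gk in Q1.
      assert (Hang1 : 0 < snd (G (H (PP j))) < PI).
      { rewrite (surjective_pairing (H (PP j))). apply (billiard_step M G l _ _ HM HG Hang0). }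
      assert (Q2 := billiard_cyl M G l _ _ HM HG Hang1 Q1). rewrite Gk1 in Q2. exact Q2. }
  (* The conjugacy holds modulo 1 only. The excess is at most 1 - e0 in modulus by the chord range,
     and the displacement in the chart at most e0 / 2, so that they cannot differ by a nonzero
     integer. *)
  assert (Hx : forall j, (j < N)%nat -> fst (H (PP (S j))) - fst (H (PP j)) = excess s (c + 2 * Z.of_nat j)%Z).
  { intros j Hj. destruct (RI j ltac:(lia)) as (_ & B2 & B3 & _ & B5). destruct (RI (S j) ltac:(lia)) as (_ & B2' & B3' & _ & B5').
    fold (PP j) in B2, B3, B5. fold (PP (S j)) in B2', B3', B5'. rewrite S_INR in B5'. change (fst P) with x0 in B5, B5'. change (snd P) with y0 in B5, B5'.
    assert (Hjn : 0 <= INR j /\ INR j + 1 <= n).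
    { split; [apply pos_INR|]. rewrite <- S_INR. apply le_INR; auto. }
    assert (HDe : 0 <= D * (e * e)) by (apply Rmult_le_pos; auto; nra).
    assert (EDe : n * (D * (e * e)) = D * e) by (replace (n * (D * (e * e))) with ((n * e) * (D * e)) by ring; rewrite Ene; ring).
    assert (J1 : INR j * (D * (e * e)) <= D * e) by (rewrite <- EDe; apply Rmult_le_compat_r; lra).
    assert (J2 : (INR j + 1) * (D * (e * e)) <= D * e) by (rewrite <- EDe; apply Rmult_le_compat_r; lra).
    assert (Bx : Rabs (fst (PP (S j)) - fst (PP j)) <= (C0 + 2 * D) * e).
    { replace (fst (PP (S j)) - fst (PP j)) with ((fst (PP (S j)) - x0 - (INR j + 1) * y0) + (- (fst (PP j) - x0 - INR j * y0) + y0)) by ring.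
      eapply Rle_trans; [apply Rabs_triang|].
      assert (Q := Rabs_triang (- (fst (PP j) - x0 - INR j * y0)) y0). rewrite Rabs_Ropp in Q. lra. }
    assert (By : Rabs (snd (PP (S j)) - snd (PP j)) <= 4 * C0 * e).
    { unfold Rminus. eapply Rle_trans; [apply Rabs_triang|]. rewrite Rabs_Ropp. lra. }
    destruct (ch_lipschitz _ _ _ _ _ _ _ Hch (fst (PP (S j))) (snd (PP (S j))) (fst (PP j)) (snd (PP j)) ltac:(lra) ltac:(lra) ltac:(lra)) as [Lf _].
    rewrite <- !surjective_pairing in Lf.
    assert (Lf2 : Rabs (fst (H (PP (S j))) - fst (H (PP j))) <= e0 / 2).
    { eapply Rle_trans; [exact Lf|]. eapply Rle_trans; [|exact S6]. rewrite Rmult_assoc. apply Rmult_le_compat_l; lra. }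
    set (k := (c + 2 * Z.of_nat j)%Z) in *.
    destruct (Hcyl j ltac:(lia)) as [[k1 E1] E2]. destruct (Hcyl (S j) ltac:(lia)) as [[k2 E3] E4].
    fold k in E1, E2. replace (c + 2 * Z.of_nat (S j))%Z with (k + 2)%Z in E3, E4 by (unfold k; lia).
    cbn [fst snd] in E1, E2, E3, E4.
    assert (Hrk : Rabs (cos (r k)) < 1/2).
    { eapply Rle_lt_trans; [apply cos_le_distance|]. rewrite E2.
      destruct (ch_lipschitz _ _ _ _ _ _ _ Hch (fst (PP j)) (snd (PP j)) (fst (PP j)) 0 ltac:(lra) ltac:(rewrite Rabs_R0; lra) ltac:(rewrite Rminus_diag, Rabs_R0; lra)) as [_ Ls].
      rewrite <- surjective_pairing, (ch_curve _ _ _ _ _ _ _ Hch), Rminus_diag, Rabs_R0, Rplus_0_l, Rminus_0_r in Ls.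
      eapply Rle_lt_trans; [exact Ls|].
      assert (K * Rabs (snd (PP j)) <= K * (2 * C0 * e)) by (apply Rmult_le_compat_l; lra). lra. }
    destruct (Horb k) as [Hrk0 Gk]. destruct (Horb (k + 1)%Z) as [Hrk1 Gk1].
    assert (Rg := billiard_chord_range M G l e0 (s k) (r k) HM HG Hvel Hrk0 Hrk). rewrite Gk in Rg. cbn [fst] in Rg.
    destruct (billiard_step M G l (s (k + 1)%Z) (r (k + 1)%Z) HM HG Hrk1) as (St & _). rewrite Gk1 in St. cbn [fst] in St.
    replace (k + 1 + 1)%Z with (k + 2)%Z in St by lia.
    assert (Hex : Rabs (excess s k) < 1 - e0 \/ Rabs (excess s k) <= 1 - e0).
    { right. unfold excess. apply Rabs_le. lra. }
    assert (Hex' : Rabs (excess s k) <= 1 - e0) by (destruct Hex; lra).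
    assert (Ez : (k2 - k1 - 1 = 0)%Z).
    { apply integer_gap. rewrite !minus_IZR.
      replace (IZR k2 - IZR k1 - 1 - 0) with (excess s k + - (fst (H (PP (S j))) - fst (H (PP j)))) by (unfold excess; lra).
      eapply Rle_lt_trans; [apply Rabs_triang|]. rewrite Rabs_Ropp. lra. }
    apply (f_equal IZR) in Ez. rewrite !minus_IZR in Ez. unfold excess. lra. }
  exists c, P. split; [exact Hy0'|]. split; [exact Hcyl|].
  assert (Etot : fst (H (PP N)) = fst (H (PP 0%nat)) + IZR kap).
  { assert (Q := rsum_telescope (fun j => fst (H (PP j))) N). cbv beta in Q.
    rewrite (rsum_ext _ (fun j => excess s (c + 2 * Z.of_nat j)%Z) N Hx), Hsum in Q. lra. }
  assert (Esnd : snd (H (PP N)) = snd (H (PP 0%nat))).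
  { destruct (Hcyl N (Nat.le_refl N)) as [_ Q1]. destruct (Hcyl 0%nat ltac:(lia)) as [_ Q2]. cbn [snd] in Q1, Q2.
    replace (c + 2 * Z.of_nat 0)%Z with c in Q2 by lia. rewrite (proj2 (Hper c)) in Q1. congruence. }
  destruct (RI N (Nat.le_refl N)) as (_ & _ & BN & _). destruct (RI 0%nat ltac:(lia)) as (_ & _ & B0 & _).
  fold (PP N) in BN. fold (PP 0%nat) in B0.
  (* The images of the two end points differ by [kap] turns and have the same angle, so injectivity
     on the cylinder makes the orbit of [P] close up in the chart; the translation there is
     [sigma kap] because the chart has degree [sigma]. *)
  destruct (ch_injective _ _ _ _ _ _ _ Hch (PP 0%nat) (PP N) B0 BN) as [[m Em] Es].
  { split; [exists kap; exact Etot|exact Esnd]. }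
  change (PP 0%nat) with P in *.
  assert (Eh := chart_shift_int _ _ _ _ _ _ _ Hch m (fst P) (snd P) B0).
  assert (EN : PP N = (fst P + IZR m, snd P)) by (rewrite (surjective_pairing (PP N)), Em, Es; reflexivity).
  rewrite <- EN in Eh. rewrite Eh in Etot. cbn [fst] in Etot. rewrite <- surjective_pairing in Etot.
  assert (Ek : kap = (m * sigma)%Z) by (apply eq_IZR; lra).
  fold (PP N). rewrite EN. f_equal. f_equal. f_equal.
  destruct (ch_sigma _ _ _ _ _ _ _ Hch) as [->| ->]; lia.
Qed.

(** * Variation of the length along the closing curve *)

Lemma Rabs_sq (h : R) : h * h = Rabs h * Rabs h.
Proof. rewrite <- Rabs_mult, Rabs_pos_eq; [ring|apply Rle_0_sqr]. Qed.

Lemma smooth1_qdiff (g : C -> C) (u : R -> R) (x : R) :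
  smooth1 g (RtoC x) -> (forall t, g (RtoC t) = RtoC (u t)) -> exists D, qdiff u x D.
Proof.
  intros Hg Hu. destruct (smooth1_taylor2 g (RtoC x) Hg) as (c1 & c2 & d & K & Hd & HK & HT).
  exists (Re c1), d, (Rabs (Re c2) + K). split; [exact Hd|].
  split; [assert (q := Rabs_pos (Re c2)); lra|]. intros h Hh.
  specialize (HT (RtoC h)). rewrite Cmod_R in HT. specialize (HT Hh).
  rewrite <- RtoC_plus, !Hu in HT.
  set (v := u (x + h)) in *. set (W := (RtoC v - (RtoC (u x) + RtoC h * (c1 + RtoC h * c2)))%C) in *.
  assert (R1 := re_le_Cmod W).
  assert (ER : Re W = v - u x - Re c1 * h - h * h * Re c2).
  { unfold W, Re. destruct c1, c2. simpl. ring. }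
  rewrite ER in R1.
  replace (v - u x - Re c1 * h) with ((v - u x - Re c1 * h - h * h * Re c2) + h * h * Re c2) by ring.
  eapply Rle_trans; [apply Rabs_triang|]. rewrite Rabs_mult, (Rabs_pos_eq (h * h)) by apply Rle_0_sqr.
  assert (h0 := Rabs_pos h).
  assert (B : K * Rabs h ^ 3 <= K * (Rabs h * Rabs h)).
  { apply Rmult_le_compat_l; auto. simpl. rewrite Rmult_1_r. apply Rmult_le_compat_l; auto.
    rewrite <- (Rmult_1_l (Rabs h)) at 3. apply Rmult_le_compat_r; lra. }
  rewrite <- (Rabs_sq h) in B. lra.
Qed.

Lemma qdiff_ext (f g : R -> R) (x D : R) : (forall t, f t = g t) -> qdiff f x D -> qdiff g x D.
Proof.
  intros E (d & K & Hd & HK & H). exists d, K. repeat (split; [assumption|]). intros h Hh. rewrite <- !E. auto.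
Qed.

Lemma qdiff2_comp (f : R * R -> R) (u v : R -> R) (x a b D E : R) :
  qdiff2 f (u x) (v x) a b -> qdiff u x D -> qdiff v x E -> qdiff (fun t => f (u t, v t)) x (a * D + b * E).
Proof.
  intros (df & Kf & Hdf & HKf & Hf) Qu Qv.
  destruct (qdiff_lipschitz _ _ _ Qu) as (d1 & K1 & Hd1 & HK1 & L1).
  destruct (qdiff_lipschitz _ _ _ Qv) as (d2 & K2 & Hd2 & HK2 & L2).
  destruct Qu as (d3 & J1 & Hd3 & HJ1 & Qu). destruct Qv as (d4 & J2 & Hd4 & HJ2 & Qv).
  set (e := Rmin (Rmin (Rmin d1 d2) (Rmin d3 d4)) (df / (K1 + K2 + 1))).
  assert (Hq : 0 < df / (K1 + K2 + 1)) by (apply Rdiv_lt_0_compat; lra).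
  assert (He : 0 < e) by (repeat apply Rmin_pos; lra).
  assert (M1 : e <= Rmin d1 d2) by (eapply Rle_trans; [apply Rmin_l|apply Rmin_l]).
  assert (M2 : e <= Rmin d3 d4) by (eapply Rle_trans; [apply Rmin_l|apply Rmin_r]).
  assert (M3 : e <= df / (K1 + K2 + 1)) by apply Rmin_r.
  assert (m1 := Rmin_l d1 d2). assert (m2 := Rmin_r d1 d2). assert (m3 := Rmin_l d3 d4). assert (m4 := Rmin_r d3 d4).
  assert (ha := Rabs_pos a). assert (hb := Rabs_pos b).
  exists e, (Kf * ((K1 + K2) * (K1 + K2)) + (Rabs a * J1 + Rabs b * J2)).
  split; [lra|]. split.
  { apply Rplus_le_le_0_compat; [apply Rmult_le_pos; [lra|apply Rle_0_sqr]|apply Rplus_le_le_0_compat; apply Rmult_le_pos; lra]. }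
  intros h Hh. specialize (L1 h ltac:(lra)). specialize (L2 h ltac:(lra)). specialize (Qu h ltac:(lra)). specialize (Qv h ltac:(lra)).
  assert (h0 := Rabs_pos h).
  set (p := u (x + h) - u x) in *. set (q := v (x + h) - v x) in *.
  assert (Hk : (K1 + K2 + 1) * Rabs h < df).
  { apply Rmult_lt_reg_r with (/ (K1 + K2 + 1)); [apply Rinv_0_lt_compat; lra|].
    replace ((K1 + K2 + 1) * Rabs h * / (K1 + K2 + 1)) with (Rabs h) by (field; lra). unfold Rdiv in M3. lra. }
  assert (k1 : K1 * Rabs h <= (K1 + K2 + 1) * Rabs h) by (apply Rmult_le_compat_r; lra).
  assert (k2 : K2 * Rabs h <= (K1 + K2 + 1) * Rabs h) by (apply Rmult_le_compat_r; lra).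
  specialize (Hf p q ltac:(lra) ltac:(lra)).
  replace (u x + p) with (u (x + h)) in Hf by (unfold p; ring).
  replace (v x + q) with (v (x + h)) in Hf by (unfold q; ring).
  replace (f (u (x + h), v (x + h)) - f (u x, v x) - (a * D + b * E) * h)
    with ((f (u (x + h), v (x + h)) - f (u x, v x) - (a * p + b * q)) + (a * (p - D * h) + b * (q - E * h))) by ring.
  eapply Rle_trans; [apply Rabs_triang|].
  assert (T := Rabs_triang (a * (p - D * h)) (b * (q - E * h))). rewrite !Rabs_mult in T.
  assert (B1 : Rabs a * Rabs (p - D * h) <= Rabs a * (J1 * (h * h))) by (apply Rmult_le_compat_l; auto).
  assert (B2 : Rabs b * Rabs (q - E * h) <= Rabs b * (J2 * (h * h))) by (apply Rmult_le_compat_l; auto).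
  assert (p0 := Rabs_pos p). assert (q0 := Rabs_pos q).
  assert (B3 : (Rabs p + Rabs q) * (Rabs p + Rabs q) <= ((K1 + K2) * Rabs h) * ((K1 + K2) * Rabs h)) by (apply Rmult_le_compat; lra).
  assert (B4 : Kf * ((Rabs p + Rabs q) * (Rabs p + Rabs q)) <= Kf * (((K1 + K2) * Rabs h) * ((K1 + K2) * Rabs h))) by (apply Rmult_le_compat_l; auto).
  replace (Kf * (((K1 + K2) * Rabs h) * ((K1 + K2) * Rabs h))) with (Kf * ((K1 + K2) * (K1 + K2)) * (h * h)) in B4 by (rewrite (Rabs_sq h); ring).
  lra.
Qed.

Lemma qdiff_le (f : R -> R) (x D B d : R) :
  qdiff f x D -> 0 < d -> (forall h, Rabs h < d -> Rabs (f (x + h) - f x) <= B * Rabs h) -> Rabs D <= B.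
Proof.
  intros (d' & K & Hd' & HK & H) Hd Hf.
  assert (Hm : 0 < Rmin d d') by (apply Rmin_pos; lra).
  assert (m1 := Rmin_l d d'). assert (m2 := Rmin_r d d').
  apply (le_of_le_plus_mult _ _ K (Rmin d d') Hm). intros t Ht.
  specialize (H t ltac:(rewrite Rabs_pos_eq; lra)). specialize (Hf t ltac:(rewrite Rabs_pos_eq; lra)).
  rewrite (Rabs_pos_eq t) in Hf by lra.
  apply Rmult_le_reg_r with t; [lra|].
  assert (E : Rabs D * t = Rabs (D * t)) by (rewrite Rabs_mult, (Rabs_pos_eq t); lra). rewrite E.
  replace (D * t) with ((f (x + t) - f x) - (f (x + t) - f x - D * t)) by ring.
  unfold Rminus at 1. eapply Rle_trans; [apply Rabs_triang|]. rewrite Rabs_Ropp. lra.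
Qed.

(** The third vertex is read in the chart, as [H (F P)], so that consecutive double steps share
    their end point exactly and the derivatives telescope. *)
Definition two_chords (M : R -> C) (G H F : R * R -> R * R) (P : R * R) : R :=
  Cmod (M (fst (G (H P))) - M (fst (H P)))%C + Cmod (M (fst (H (F P))) - M (fst (G (H P))))%C.

(** The middle bounce is controlled by [billiard_lipschitz], the end points through the chart. The
    conjugacy holds modulo 1, a difference that neither [M] nor its unit tangent sees. *)
Lemma double_step_qdiff (M : R -> C) (G H F : R * R -> R * R) (l b d K x D0 D1 D2 : R) (sigma : Z) (P : R -> R * R) :
  smooth_curve M l -> billiard_lift M G -> chart G b H F sigma d K -> Rabs (snd (P x)) < b ->
  qdiff (fun t => fst (H (P t))) x D0 -> qdiff (fun t => snd (H (P t))) x D1 ->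
  qdiff (fun t => fst (H (F (P t)))) x D2 ->
  qdiff (fun t => two_chords M G H F (P t)) x (l * (cos (snd (H (F (P x)))) * D2 - cos (snd (H (P x))) * D0)).
Proof.
  intros HM HG Hc Hb Q0 Q1 Q2.
  assert (Hr : 0 < snd (H (P x)) < PI) by (rewrite (surjective_pairing (P x)); apply (ch_angle _ _ _ _ _ _ _ Hc); auto).
  destruct (billiard_lipschitz M G l (fst (H (P x))) (snd (H (P x))) HM HG Hr) as (dG & KG & HdG & HKG & LG).
  assert (St := billiard_step M G l (fst (H (P x))) (snd (H (P x))) HM HG Hr). cbv zeta in St.
  rewrite <- (surjective_pairing (H (P x))) in St, LG.
  destruct St as (_ & Hr1 & A3 & A4 & _ & (tau & Htau & E)).
  destruct (ch_conjugacy _ _ _ _ _ _ _ Hc (P x) Hb) as [[n En] Er].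
  assert (St := billiard_step M G l (fst (G (H (P x)))) (snd (G (H (P x)))) HM HG Hr1). cbv zeta in St.
  rewrite <- (surjective_pairing (G (H (P x)))) in St.
  destruct St as (_ & _ & B3 & B4 & _ & (tau' & Htau' & E')).
  destruct (qdiff_lipschitz _ _ _ Q0) as (d0 & K0 & Hd0 & HK0 & L0).
  destruct (qdiff_lipschitz _ _ _ Q1) as (d1 & K1 & Hd1 & HK1 & L1).
  set (u := ray M (fst (H (P x))) (snd (H (P x)))) in *.
  set (v := ray M (fst (G (H (P x)))) (snd (G (H (P x))))) in *.
  assert (EM : M (fst (H (F (P x)))) = M (fst (G (G (H (P x)))))) by (rewrite En; apply (curve_int M l HM)).
  assert (ET : unit_tangent M (fst (H (F (P x)))) = unit_tangent M (fst (G (G (H (P x)))))) by (rewrite En; apply (unit_tangent_int M l HM)).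
  assert (EB : cos (snd (H (F (P x)))) = inner v (unit_tangent M (fst (H (F (P x)))))) by (rewrite ET, B4, Er; reflexivity).
  rewrite EB, <- A3.
  assert (Hq : 0 < dG / (K0 + K1 + 1)) by (apply Rdiv_lt_0_compat; lra).
  assert (He : 0 < Rmin (Rmin d0 d1) (dG / (K0 + K1 + 1))) by (repeat apply Rmin_pos; lra).
  assert (m1 := Rmin_l (Rmin d0 d1) (dG / (K0 + K1 + 1))). assert (m2 := Rmin_r (Rmin d0 d1) (dG / (K0 + K1 + 1))).
  assert (m3 := Rmin_l d0 d1). assert (m4 := Rmin_r d0 d1).
  apply (two_chords_qdiff M l (fun t => fst (H (P t))) (fun t => fst (G (H (P t)))) (fun t => fst (H (F (P t)))) x D0 D2
    (Rmin (Rmin d0 d1) (dG / (K0 + K1 + 1))) (KG * (K0 + K1)) tau tau' u v); auto.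
  - apply Rmult_le_pos; lra.
  - intros h Hh. specialize (L0 h ltac:(lra)). specialize (L1 h ltac:(lra)).
    assert (h0 := Rabs_pos h).
    assert (Hk : (K0 + K1 + 1) * Rabs h < dG).
    { apply Rmult_lt_reg_r with (/ (K0 + K1 + 1)); [apply Rinv_0_lt_compat; lra|].
      replace ((K0 + K1 + 1) * Rabs h * / (K0 + K1 + 1)) with (Rabs h) by (field; lra). unfold Rdiv in m2. unfold Rdiv in Hh. lra. }
    specialize (LG (fst (H (P (x + h)))) (snd (H (P (x + h)))) ltac:(lra)).
    rewrite <- surjective_pairing in LG. eapply Rle_trans; [exact LG|].
    rewrite Rmult_assoc. apply Rmult_le_compat_l; lra.
  - apply (Cmod_ray M l); auto.
  - apply (Cmod_ray M l); auto.
  - rewrite EM. exact E'.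
  - rewrite A4, B3. reflexivity.
Qed.

Definition defect (f : C * C -> C * C) (N : nat) (Y : C -> C) (z : C) : C :=
  (snd (Nat.iter N f (z, Y z)) - Y z)%C.

Lemma closing_curve_bounds (f : C * C -> C * C) (a1 a2 y1 d A C0 : R) (N : nat) (m : Z) (Y : C -> C) :
  near_twist f a2 y1 d A -> 1 <= C0 -> 0 < a1 -> a1 < a2 -> threshold a1 a2 y1 d A C0 <= INR N ->
  Rabs (IZR m) <= C0 - 1 -> closing_curve f a1 d (drift A C0) N m Y ->
  forall z, Rabs (Im z) <= a1 ->
    Cmod (Y z) <= C0 * / INR N /\ Rabs (Im (Y z)) <= (2 * drift A C0 + 1) * (/ INR N * / INR N) /\
    forall j, (j <= N)%nat -> Rabs (Im (fst (Nat.iter j f (z, Y z)))) <= a2 /\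
      Cmod (snd (Nat.iter j f (z, Y z))) <= 2 * C0 * / INR N /\ Cmod (snd (Nat.iter j f (z, Y z))) <= y1.
Proof.
  intros Hf HC0 Ha1 Haa HN Hm HY z Hz. destruct (nt_pos _ _ _ _ _ Hf) as (Hy1 & Hd & HA).
  destruct (threshold_consequences a1 a2 y1 d A C0 N Hy1 Hd HA HC0 Haa HN)
    as (Hn & He & Ene & K1 & K2 & K3 & K4 & K5 & K6 & K7 & K8 & HD).
  destruct (cc_close _ _ _ _ _ _ _ HY z Hz) as [B _].
  assert (Hee : 0 < / INR N * / INR N) by nra.
  destruct (rotation_ball C0 (drift A C0) (/ INR N) (IZR m) (Y z) ltac:(lra) ltac:(lra) Hm) as [B1 B2].
  { eapply Rle_trans; [exact B|]. apply Rmult_le_compat_r; lra. }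
  split; [exact B1|]. split; [exact B2|]. intros j Hj.
  destruct (one_orbit f a1 a2 y1 d A C0 N z (Y z) Hf HC0 Haa HN Hz B1 B2 j Hj) as (O1 & O2 & _).
  repeat split; auto. lra.
Qed.

Lemma closing_orbit_smooth (f : C * C -> C * C) (a1 a2 y1 d A C0 : R) (N : nat) (m : Z) (Y : C -> C) :
  near_twist f a2 y1 d A -> 1 <= C0 -> 0 < a1 -> a1 < a2 -> threshold a1 a2 y1 d A C0 <= INR N ->
  Rabs (IZR m) <= C0 - 1 -> closing_curve f a1 d (drift A C0) N m Y ->
  forall z j, Rabs (Im z) < a1 -> (j <= N)%nat ->
    smooth1 (fun x => fst (Nat.iter j f (x, Y x))) z /\ smooth1 (fun x => snd (Nat.iter j f (x, Y x))) z.
Proof.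
  intros Hf HC0 Ha1 Haa HN Hm HY z j Hz Hj.
  destruct (closing_curve_bounds f a1 a2 y1 d A C0 N m Y Hf HC0 Ha1 Haa HN Hm HY z ltac:(lra)) as (_ & _ & B).
  destruct (smooth_orbit f a2 y1 d A N (z, Y z) Hf ltac:(intros i Hi; destruct (B i ltac:(lia)) as (B1 & _ & B2); auto) j Hj) as [S1 S2].
  assert (SY := cc_smooth _ _ _ _ _ _ _ HY z Hz).
  split.
  - apply (smooth_comp (fun Q => fst (Nat.iter j f Q)) (fun Q => fst Q) (fun Q => Y (fst Q))); auto.
    apply smooth_poly2. constructor.
  - apply (smooth_comp (fun Q => snd (Nat.iter j f Q)) (fun Q => fst Q) (fun Q => Y (fst Q))); auto.
    apply smooth_poly2. constructor.
Qed.

(** The bound 1 is deliberately crude: the exponential factor comes from the zeros alone. *)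
Lemma defect_properties (f : C * C -> C * C) (a1 a2 y1 d A C0 : R) (N : nat) (m : Z) (Y : C -> C) :
  near_twist f a2 y1 d A -> 1 <= C0 -> 0 < a1 -> a1 < a2 -> threshold a1 a2 y1 d A C0 <= INR N ->
  Rabs (IZR m) <= C0 - 1 -> closing_curve f a1 d (drift A C0) N m Y ->
  forall z, Rabs (Im z) < a1 ->
    smooth1 (defect f N Y) z /\ defect f N Y (z + 1)%C = defect f N Y z /\ Cmod (defect f N Y z) <= 1.
Proof.
  intros Hf HC0 Ha1 Haa HN Hm HY z Hz. destruct (nt_pos _ _ _ _ _ Hf) as (Hy1 & Hd & HA).
  destruct (threshold_consequences a1 a2 y1 d A C0 N Hy1 Hd HA HC0 Haa HN)
    as (Hn & He & Ene & K1 & K2 & K3 & _).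
  destruct (closing_curve_bounds f a1 a2 y1 d A C0 N m Y Hf HC0 Ha1 Haa HN Hm HY z ltac:(lra)) as (B1 & B2 & B3).
  split; [|split].
  - apply (smooth_minus (fun Q => snd (Nat.iter N f (fst Q, Y (fst Q)))) (fun Q => Y (fst Q))).
    + apply (closing_orbit_smooth f a1 a2 y1 d A C0 N m Y Hf HC0 Ha1 Haa HN Hm HY z N Hz). lia.
    + apply (cc_smooth _ _ _ _ _ _ _ HY z Hz).
  - unfold defect. rewrite (cc_periodic _ _ _ _ _ _ _ HY z) by lra.
    rewrite (periodic_orbit_shift f a2 y1 d A N z (Y z) Hf ltac:(intros i Hi; destruct (B3 i ltac:(lia)) as (O1 & _ & O2); auto) N (Nat.le_refl N)).
    reflexivity.
  - destruct (one_orbit f a1 a2 y1 d A C0 N z (Y z) Hf HC0 Haa HN ltac:(lra) B1 B2 N (Nat.le_refl N)) as (_ & _ & O & _).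
    unfold defect. eapply Rle_trans; [exact O|]. rewrite <- pow_inv. set (e := / INR N) in *.
    replace (INR N * (8 * A * C0 ^ 3 * e ^ 3)) with ((INR N * e) * ((8 * A * C0 ^ 3 * e) * e)) by ring.
    rewrite Ene, Rmult_1_l. apply Rle_trans with (1 * 1); [|lra].
    apply Rmult_le_compat; try lra. apply Rmult_le_pos; [apply Rmult_le_pos; [lra|apply pow_le; lra]|lra].
Qed.

(** * Zeros of the defect given by a periodic trajectory *)

Record chart_map (F : R * R -> R * R) (f : C * C -> C * C) (b : R) : Prop := {
  cm_real : forall P, Rabs (snd P) < b -> f (real_pair P) = real_pair (F P);
  cm_periodic : forall x y, Rabs y < b -> F (x + 1, y) = (fst (F (x, y)) + 1, snd (F (x, y)))
}.

Lemma periodic_int (F : R * R -> R * R) (f : C * C -> C * C) (b : R) :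
  chart_map F f b -> forall (k : Z) x y, Rabs y < b -> F (x + IZR k, y) = (fst (F (x, y)) + IZR k, snd (F (x, y))).
Proof.
  intros Hc k x y Hy. rewrite (int_translation F b 1 (cm_periodic _ _ _ Hc) k x y Hy), Rmult_1_r. reflexivity.
Qed.

Lemma periodic_int_iter (F : R * R -> R * R) (f : C * C -> C * C) (b : R) (n : nat) (P : R * R) (k : Z) :
  chart_map F f b -> (forall j, (j < n)%nat -> Rabs (snd (Nat.iter j F P)) < b) ->
  forall j, (j <= n)%nat -> Nat.iter j F (fst P + IZR k, snd P) = (fst (Nat.iter j F P) + IZR k, snd (Nat.iter j F P)).
Proof.
  intros Hc HP. induction j as [|j IH]; intros Hj; [reflexivity|].
  cbn [Nat.iter nat_rect]. change (nat_rect (fun _ => (R * R)%type) ?p (fun _ => ?g) ?i) with (Nat.iter i g p).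
  rewrite IH by lia. rewrite (periodic_int F f b Hc) by (apply HP; lia). rewrite <- surjective_pairing. reflexivity.
Qed.

(** Every iterate of the periodic point is again translated horizontally by [m] after N steps, so
    uniqueness places it on the closing curve; its height being restored as well, the defect
    vanishes there. *)
Lemma periodic_point_zeros (F : R * R -> R * R) (f : C * C -> C * C) (a1 a2 y1 d A C0 b : R) (N : nat) (m : Z)
    (Y : C -> C) (P : R * R) :
  near_twist f a2 y1 d A -> y1 < b -> 1 <= C0 -> 0 < a1 -> a1 < a2 -> threshold a1 a2 y1 d A C0 <= INR N ->
  Rabs (IZR m) <= C0 - 1 -> closing_curve f a1 d (drift A C0) N m Y -> chart_map F f b ->
  Rabs (snd P) <= C0 * / INR N -> Nat.iter N F P = (fst P + IZR m, snd P) ->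
  near_rotation (fun j => fst (Nat.iter j F P)) m N (2 * drift A C0) /\
  forall j, (j <= N)%nat -> Rabs (snd (Nat.iter j F P)) < b /\
    Y (RtoC (fst (Nat.iter j F P))) = RtoC (snd (Nat.iter j F P)) /\
    defect f N Y (RtoC (fst (Nat.iter j F P))) = RtoC 0.
Proof.
  intros Hf Hyb HC0 Ha1 Haa HN Hm HY Hc HP EP. destruct (nt_pos _ _ _ _ _ Hf) as (Hy1 & Hd & HA).
  destruct (threshold_consequences a1 a2 y1 d A C0 N Hy1 Hd HA HC0 Haa HN)
    as (Hn & He & Ene & K1 & K2 & K3 & K4 & K5 & K6 & K7 & K8 & HD).
  assert (RI := real_iterates F f a1 a2 y1 d A C0 b N P Hf Hyb HC0 ltac:(lra) Haa HN (cm_real _ _ _ Hc) HP).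
  rewrite <- pow_inv in RI. set (e := / INR N) in *. set (n := INR N) in *. set (D := drift A C0) in *.
  assert (Hee : 0 < e * e) by nra.
  (* Being translated by exactly [m] in N steps forces the initial height to be m / N up to the
     drift; this keeps the whole orbit close to a rotation. *)
  assert (B0 : Rabs (snd P - IZR m * e) <= D * (e * e)).
  { destruct (RI N (Nat.le_refl N)) as (_ & _ & _ & _ & Q). rewrite EP in Q. cbn [fst] in Q. fold n in Q.
    replace (fst P + IZR m - fst P - n * snd P) with (- (n * (snd P - IZR m * e))) in Q.
    2:{ replace (n * (snd P - IZR m * e)) with (n * snd P - IZR m * (n * e)) by ring. rewrite Ene. ring. }
    rewrite Rabs_Ropp, Rabs_mult, (Rabs_pos_eq n) in Q by lra.
    apply Rmult_le_reg_l with n; [lra|exact Q]. }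
  assert (HA3 : 0 <= 8 * A * C0 ^ 3) by (apply Rmult_le_pos; [lra|apply pow_le; lra]).
  assert (HA2 : 0 <= 4 * A * C0 ^ 2) by (apply Rmult_le_pos; [lra|apply pow_le; lra]).
  assert (Bj : forall j, (j <= N)%nat -> 0 <= INR j <= n) by (intros j Hj; split; [apply pos_INR|apply le_INR; auto]).
  assert (By : forall j, (j <= N)%nat -> Rabs (snd (Nat.iter j F P) - IZR m * e) <= 2 * D * (e * e)).
  { intros j Hj. destruct (RI j Hj) as (_ & _ & _ & Q & _). specialize (Bj j Hj).
    assert (Q2 : INR j * (8 * A * C0 ^ 3 * e ^ 3) <= D * (e * e)).
    { apply Rle_trans with (n * (8 * A * C0 ^ 3 * e ^ 3)).
      - apply Rmult_le_compat_r; [|lra]. apply Rmult_le_pos; [auto|apply pow_le; lra].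
      - replace (n * (8 * A * C0 ^ 3 * e ^ 3)) with ((n * e) * (8 * A * C0 ^ 3 * (e * e))) by ring.
        rewrite Ene, Rmult_1_l. apply Rmult_le_compat_r; [lra|]. unfold D, drift. lra. }
    replace (snd (Nat.iter j F P) - IZR m * e) with ((snd (Nat.iter j F P) - snd P) + (snd P - IZR m * e)) by ring.
    eapply Rle_trans; [apply Rabs_triang|]. lra. }
  split.
  - intros j Hj. destruct (RI j ltac:(lia)) as (_ & _ & _ & _ & Q). specialize (Bj j ltac:(lia)).
    replace (INR j * IZR m / INR N) with (INR j * (IZR m * e)) by (unfold e, n; field; fold n; lra).
    cbn [Nat.iter nat_rect].
    replace (fst (Nat.iter j F P) - (fst P + INR j * (IZR m * e)))
      with ((fst (Nat.iter j F P) - fst P - INR j * snd P) + INR j * (snd P - IZR m * e)) by ring.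
    eapply Rle_trans; [apply Rabs_triang|]. rewrite Rabs_mult, (Rabs_pos_eq (INR j)) by lra.
    assert (Q1 : INR j * Rabs (snd P - IZR m * e) <= n * (D * (e * e))).
    { apply Rmult_le_compat; try lra. apply Rabs_pos. }
    assert (Q2 : INR j * (D * (e * e)) <= n * (D * (e * e))).
    { apply Rmult_le_compat_r; [apply Rmult_le_pos|]; lra. }
    replace (n * (D * (e * e))) with ((n * e) * (D * e)) in Q1, Q2 by ring. rewrite Ene, Rmult_1_l in Q1, Q2.
    unfold Rdiv. fold n. fold e. lra.
  - intros j Hj. destruct (RI j Hj) as (E1 & _ & Hb & _). split; [exact Hb|].
    specialize (By j Hj). set (Q := Nat.iter j F P) in *.
    destruct (rotation_ball C0 D e (IZR m) (RtoC (snd Q)) ltac:(lra) ltac:(lra) Hm) as [B1 _].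
    { rewrite <- RtoC_minus, Cmod_R. eapply Rle_trans; [exact By|]. apply Rmult_le_compat_r; lra. }
    rewrite Cmod_R in B1.
    assert (EQ : Nat.iter N F Q = (fst Q + IZR m, snd Q)).
    { unfold Q. rewrite <- Nat.iter_add, Nat.add_comm, Nat.iter_add, EP.
      apply (periodic_int_iter F f b N P m Hc); auto. intros i Hi. apply RI. lia. }
    destruct (real_iterates F f a1 a2 y1 d A C0 b N Q Hf Hyb HC0 ltac:(lra) Haa HN (cm_real _ _ _ Hc) B1 N (Nat.le_refl N)) as (E2 & _).
    rewrite EQ in E2. unfold real_pair in E2. cbn [fst snd] in E2.
    assert (EY : RtoC (snd Q) = Y (RtoC (fst Q))).
    { apply (cc_unique _ _ _ _ _ _ _ HY).
      - simpl. rewrite Rabs_R0. lra.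
      - fold n. fold e. rewrite <- RtoC_minus, Cmod_R. eapply Rle_trans; [exact By|]. apply Rmult_le_compat_r; lra.
      - rewrite E2. cbn [fst]. apply RtoC_plus. }
    split; [auto|]. unfold defect. rewrite <- EY, E2. cbn [snd]. ring.
Qed.

Lemma is_derive_rsum (g : nat -> R -> R) (D : nat -> R) (x : R) (n : nat) :
  (forall j, (j < n)%nat -> is_derive (g j) x (D j)) -> is_derive (fun t => rsum (fun j => g j t) n) x (rsum D n).
Proof.
  induction n as [|n IH]; intros H; cbn [rsum].
  - auto_derive; auto.
  - assert (D1 : is_derive (fun t => rsum (fun j => g j t) n) x (rsum D n)) by (apply IH; intros; apply H; lia).
    assert (D2 := H n ltac:(lia)).
    set (g1 := fun t => rsum (fun j => g j t) n) in *. set (g2 := g n) in *.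
    change (is_derive g1 x (rsum D n)) in D1. change (is_derive (fun t => g1 t + g2 t) x (rsum D n + D n)). clearbody g1 g2. auto_derive.
    + split; [|split; [|exact I]]; eexists; eassumption.
    + change (1 * Derive g1 x + 1 * Derive g2 x = rsum D n + D n).
      rewrite (is_derive_unique _ _ _ D1), (is_derive_unique _ _ _ D2). ring.
Qed.

(** The closing curve is real over real points, by [cc_real], so that taking the real part loses
    nothing. *)
Definition closing_point (Y : C -> C) (x : R) : R * R := (x, Re (Y (RtoC x))).

Definition closing_length (M : R -> C) (G H F : R * R -> R * R) (Y : C -> C) (N : nat) (x : R) : R :=
  rsum (fun j => two_chords M G H F (Nat.iter j F (closing_point Y x))) N.

(* Along the closing curve the chords telescope to
   [l (cos R_N dS_N - cos R_0 dS_0)], where [R_N - R_0] and [S_N - S_0 - kap]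
   are of the size of the defect: after subtracting
   [l cos R_0 (S_N - S_0 - kap)], which vanishes with the defect, the derivative
   is small. *)
Lemma closing_length_variation (M : R -> C) (G H F : R * R -> R * R) (f : C * C -> C * C) (l b dH KH : R) (sigma : Z)
    (a1 a2 y1 d A C0 : R) (N : nat) (kap : Z) (Y : C -> C) (E x0 x1 : R) :
  smooth_curve M l -> billiard_lift M G -> chart G b H F sigma dH KH -> chart_map F f b ->
  near_twist f a2 y1 d A -> y1 < b -> 1 <= C0 -> 0 < a1 -> a1 < a2 -> threshold a1 a2 y1 d A C0 <= INR N ->
  2 * C0 * / INR N <= dH ->
  Rabs (IZR (sigma * kap)) <= C0 - 1 -> closing_curve f a1 d (drift A C0) N (sigma * kap) Y ->
  (forall t : R, Cmod (defect f N Y (RtoC t)) <= E) ->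
  defect f N Y (RtoC x0) = RtoC 0 -> defect f N Y (RtoC x1) = RtoC 0 -> Rabs (x0 - x1) <= 1 ->
  Rabs (closing_length M G H F Y N x0 - closing_length M G H F Y N x1) <= 5 * l * KH ^ 2 * E.
Proof.
  intros HM HG Hch Hc Hf Hyb HC0 Ha1 Haa HN HdH Hm HY HE Hx0 Hx1 Hxx. assert (hl := sc_length M l HM).
  destruct (nt_pos _ _ _ _ _ Hf) as (Hy1 & Hd & HA). destruct (ch_pos _ _ _ _ _ _ _ Hch) as [[HdH0 HdHb] HKH].
  destruct (threshold_consequences a1 a2 y1 d A C0 N Hy1 Hd HA HC0 Haa HN) as (Hn & He & Ene & _).
  assert (HE0 : 0 <= E) by (eapply Rle_trans; [apply Cmod_ge_0|apply (HE 0)]).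
  set (PP := fun j x => Nat.iter j F (closing_point Y x)).
  assert (Im0 : forall x : R, Rabs (Im (RtoC x)) < a1) by (intros x; simpl; rewrite Rabs_R0; lra).
  assert (EY : forall x : R, Y (RtoC x) = RtoC (Re (Y (RtoC x)))).
  { intros x. assert (Q := cc_real _ _ _ _ _ _ _ HY x). destruct (Y (RtoC x)) as [p q]. simpl in *. subst. reflexivity. }
  assert (Bd : forall x : R, Rabs (snd (closing_point Y x)) <= C0 * / INR N).
  { intros x. destruct (closing_curve_bounds f a1 a2 y1 d A C0 N _ Y Hf HC0 Ha1 Haa HN Hm HY (RtoC x) ltac:(apply Rlt_le, Im0)) as (B & _).
    rewrite EY, Cmod_R in B. exact B. }
  assert (RI : forall x j, (j <= N)%nat -> Nat.iter j f (RtoC x, Y (RtoC x)) = real_pair (PP j x) /\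
    Rabs (snd (PP j x)) <= dH /\ Rabs (snd (PP j x)) < b).
  { intros x j Hj.
    destruct (real_iterates F f a1 a2 y1 d A C0 b N _ Hf Hyb HC0 ltac:(lra) Haa HN (cm_real _ _ _ Hc) (Bd x) j Hj) as (Q1 & Q2 & Q3 & _).
    unfold real_pair in Q1 at 1. unfold closing_point in Q1 at 1 2. cbn [fst snd] in Q1. rewrite <- EY in Q1.
    repeat split; auto. fold (PP j x) in Q2. lra. }
  assert (QP : forall x j, (j <= N)%nat -> (exists D, qdiff (fun t => fst (PP j t)) x D) /\ (exists D, qdiff (fun t => snd (PP j t)) x D)).
  { intros x j Hj.
    destruct (closing_orbit_smooth f a1 a2 y1 d A C0 N _ Y Hf HC0 Ha1 Haa HN Hm HY (RtoC x) j (Im0 x) Hj) as [S1 S2]. split.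
    - apply (smooth1_qdiff _ _ _ S1). intros t. rewrite (proj1 (RI t j Hj)). reflexivity.
    - apply (smooth1_qdiff _ _ _ S2). intros t. rewrite (proj1 (RI t j Hj)). reflexivity. }
  assert (QH : forall x j, (j <= N)%nat -> (exists D, qdiff (fun t => fst (H (PP j t))) x D) /\ (exists D, qdiff (fun t => snd (H (PP j t))) x D)).
  { intros x j Hj. destruct (QP x j Hj) as [[D1 Q1] [D2 Q2]]. destruct (RI x j Hj) as (_ & _ & B).
    destruct (ch_qdiff _ _ _ _ _ _ _ Hch (fst (PP j x)) (snd (PP j x)) B) as [(p & q & C1) (p' & q' & C2)]. split.
    - exists (p * D1 + q * D2). apply (qdiff_ext (fun t => fst (H (fst (PP j t), snd (PP j t))))).
      + intros t. rewrite <- surjective_pairing. reflexivity.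
      + apply (qdiff2_comp (fun P => fst (H P)) (fun t => fst (PP j t)) (fun t => snd (PP j t)) x p q D1 D2 C1 Q1 Q2).
    - exists (p' * D1 + q' * D2). apply (qdiff_ext (fun t => snd (H (fst (PP j t), snd (PP j t))))).
      + intros t. rewrite <- surjective_pairing. reflexivity.
      + apply (qdiff2_comp (fun P => snd (H P)) (fun t => fst (PP j t)) (fun t => snd (PP j t)) x p' q' D1 D2 C2 Q1 Q2). }
  (* Derivatives of the positions and angles along the curve of orbits, chosen once as functions so
     that the sum of the double steps telescopes. *)
  set (S' := fun j x => epsilon (inhabits 0) (fun D => qdiff (fun t => fst (H (PP j t))) x D)).
  set (R' := fun j x => epsilon (inhabits 0) (fun D => qdiff (fun t => snd (H (PP j t))) x D)).
  assert (HS' : forall j x, (j <= N)%nat -> qdiff (fun t => fst (H (PP j t))) x (S' j x)).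
  { intros j x Hj. apply (epsilon_spec (inhabits 0) _ (proj1 (QH x j Hj))). }
  assert (HR' : forall j x, (j <= N)%nat -> qdiff (fun t => snd (H (PP j t))) x (R' j x)).
  { intros j x Hj. apply (epsilon_spec (inhabits 0) _ (proj2 (QH x j Hj))). }
  assert (Hell : forall x, is_derive (closing_length M G H F Y N) x
    (l * (cos (snd (H (PP N x))) * S' N x - cos (snd (H (PP 0%nat x))) * S' 0%nat x))).
  { intros x. assert (Q := is_derive_rsum (fun j t => two_chords M G H F (PP j t))
      (fun j => (fun j => l * (cos (snd (H (PP j x))) * S' j x)) (S j) - (fun j => l * (cos (snd (H (PP j x))) * S' j x)) j) x N).
    rewrite (rsum_telescope (fun j => l * (cos (snd (H (PP j x))) * S' j x))) in Q.
    replace (l * (cos (snd (H (PP N x))) * S' N x - cos (snd (H (PP 0%nat x))) * S' 0%nat x))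
      with (l * (cos (snd (H (PP N x))) * S' N x) - l * (cos (snd (H (PP 0%nat x))) * S' 0%nat x)) by ring.
    apply Q. intros j Hj. apply qdiff_is_derive. cbv beta.
    replace (l * (cos (snd (H (PP (S j) x))) * S' (S j) x) - l * (cos (snd (H (PP j x))) * S' j x))
      with (l * (cos (snd (H (F (PP j x)))) * S' (S j) x - cos (snd (H (PP j x))) * S' j x)) by (change (PP (S j) x) with (F (PP j x)); ring).
    apply (double_step_qdiff M G H F l b dH KH x _ (R' j x) _ sigma (PP j)); auto.
    - apply RI. lia.
    - apply HS'. lia.
    - apply HR'. lia.
    - apply (HS' (S j)). lia. }
  assert (Efst : forall x, fst (PP N x) = x + IZR (sigma * kap)).
  { intros x. destruct (cc_close _ _ _ _ _ _ _ HY (RtoC x) ltac:(apply Rlt_le, Im0)) as [_ Q].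
    rewrite (proj1 (RI x N (Nat.le_refl N))) in Q. unfold real_pair in Q. cbn [fst] in Q.
    rewrite <- RtoC_plus in Q. apply RtoC_inj in Q. exact Q. }
  assert (Esnd : forall x, Cmod (defect f N Y (RtoC x)) = Rabs (snd (PP N x) - snd (PP 0%nat x))).
  { intros x. unfold defect. rewrite (proj1 (RI x N (Nat.le_refl N))), EY. unfold real_pair. cbn [snd]. rewrite <- RtoC_minus, Cmod_R. reflexivity. }
  (* The return point is compared with the translate of the initial point by [sigma kap], which has
     the same abscissa in the chart; only the heights differ, by the defect. *)
  assert (Hret : forall x, Rabs (fst (H (PP N x)) - fst (H (PP 0%nat x)) - IZR kap) <= KH * Cmod (defect f N Y (RtoC x)) /\
    Rabs (snd (H (PP N x)) - snd (H (PP 0%nat x))) <= KH * Cmod (defect f N Y (RtoC x))).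
  { intros x. destruct (RI x N (Nat.le_refl N)) as (_ & BN & _). destruct (RI x 0%nat ltac:(lia)) as (_ & B0 & B0b).
    destruct (ch_lipschitz _ _ _ _ _ _ _ Hch (x + IZR (sigma * kap)) (snd (PP N x)) (x + IZR (sigma * kap)) (snd (PP 0%nat x)) BN B0
      ltac:(rewrite Rminus_diag, Rabs_R0; lra)) as [L1 L2].
    rewrite Rminus_diag, Rabs_R0, Rplus_0_l, <- Esnd in L1, L2.
    rewrite (chart_shift_int _ _ _ _ _ _ _ Hch _ x (snd (PP 0%nat x)) B0b) in L1, L2. cbn [fst snd] in L1, L2.
    rewrite <- (Efst x) in L1, L2. rewrite <- surjective_pairing in L1, L2.
    change (x, snd (PP 0%nat x)) with (PP 0%nat x) in L1, L2.
    replace (sigma * kap * sigma)%Z with kap in L1 by (destruct (ch_sigma _ _ _ _ _ _ _ Hch) as [->| ->]; lia).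
    split; [|exact L2].
    replace (fst (H (PP N x)) - fst (H (PP 0%nat x)) - IZR kap) with (fst (H (PP N x)) - (fst (H (PP 0%nat x)) + IZR kap)) by ring.
    exact L1. }
  (* Crude Lipschitz constants 1 and 2 for the heights before and after N iterates. Through the
     chart, together with the unit speed in [x], they bound [R' 0] by 2 KH and [S' N] by 3 KH. *)
  assert (Hlip : forall x h, Rabs h < Rmin (d / 4) dH ->
    Rabs (snd (PP 0%nat (x + h)) - snd (PP 0%nat x)) <= Rabs h /\ Rabs (snd (PP N (x + h)) - snd (PP N x)) <= 2 * Rabs h).
  { intros x h Hh. assert (m1 := Rmin_l (d / 4) dH). assert (h0 := Rabs_pos h).
    assert (Exh : Cmod (RtoC (x + h) - RtoC x) = Rabs h) by (rewrite <- RtoC_minus, Cmod_R; f_equal; ring).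
    assert (LY := cc_lipschitz _ _ _ _ _ _ _ HY (RtoC (x + h)) (RtoC x) ltac:(apply Rlt_le, Im0) ltac:(apply Rlt_le, Im0) ltac:(lra)).
    rewrite Exh in LY.
    destruct (closing_curve_bounds f a1 a2 y1 d A C0 N _ Y Hf HC0 Ha1 Haa HN Hm HY (RtoC (x + h)) ltac:(apply Rlt_le, Im0)) as (B1 & B2 & _).
    destruct (closing_curve_bounds f a1 a2 y1 d A C0 N _ Y Hf HC0 Ha1 Haa HN Hm HY (RtoC x) ltac:(apply Rlt_le, Im0)) as (B1' & B2' & _).
    set (e := / INR N) in *.
    assert (HQ : Cmod (Y (RtoC (x + h)) - Y (RtoC x)) + Cmod (RtoC (x + h) - RtoC x) * e <= 2 * (Rabs h * e)) by (rewrite Exh; lra).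
    assert (HQd : 2 * (INR N * (Cmod (Y (RtoC (x + h)) - Y (RtoC x)) + Cmod (RtoC (x + h) - RtoC x) * e)) <= d).
    { apply Rle_trans with (2 * (INR N * (2 * (Rabs h * e)))).
      - apply Rmult_le_compat_l; [lra|]. apply Rmult_le_compat_l; lra.
      - replace (2 * (INR N * (2 * (Rabs h * e)))) with (4 * Rabs h * (INR N * e)) by ring. rewrite Ene. lra. }
    destruct (two_orbits f a1 a2 y1 d A C0 N _ _ _ _ Hf HC0 Haa HN (Rlt_le _ _ (Im0 (x + h))) B1 B2 (Rlt_le _ _ (Im0 x)) B1' B2' HQd N (Nat.le_refl N)) as [T _].
    rewrite (proj1 (RI (x + h) N (Nat.le_refl N))), (proj1 (RI x N (Nat.le_refl N))) in T. unfold real_pair in T. cbn [snd] in T.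
    fold e in T. rewrite Ene, Rmult_1_l in T.
    assert (E0 : Cmod (Y (RtoC (x + h)) - Y (RtoC x)) = Rabs (snd (PP 0%nat (x + h)) - snd (PP 0%nat x))).
    { rewrite (EY (x + h)), (EY x), <- RtoC_minus, Cmod_R. reflexivity. }
    assert (Hhe : Rabs h * e <= Rabs h) by (rewrite <- (Rmult_1_r (Rabs h)) at 2; apply Rmult_le_compat_l; lra).
    split; [rewrite <- E0; lra|].
    rewrite <- Cmod_R, RtoC_minus.
    set (z := (RtoC (snd (PP N (x + h)%R)) - RtoC (snd (PP N x)))%C) in *. set (w := (Y (RtoC (x + h)) - Y (RtoC x))%C) in *.
    replace z with ((z - w) + w)%C by ring. eapply Rle_trans; [apply Cmod_triangle|]. lra. }
  assert (Hmin : 0 < Rmin (d / 4) dH) by (apply Rmin_pos; lra).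
  assert (HSN : forall x, Rabs (S' N x) <= 3 * KH).
  { intros x. apply (qdiff_le _ x _ _ _ (HS' N x (Nat.le_refl N)) Hmin). intros h Hh.
    destruct (Hlip x h Hh) as [_ B]. assert (m2 := Rmin_r (d / 4) dH).
    destruct (ch_lipschitz _ _ _ _ _ _ _ Hch (fst (PP N (x + h))) (snd (PP N (x + h))) (fst (PP N x)) (snd (PP N x))
       ltac:(apply RI; lia) ltac:(apply RI; lia)) as [L1 _].
    - rewrite !Efst. replace (x + h + IZR (sigma * kap) - (x + IZR (sigma * kap))) with h by ring. lra.
    - rewrite <- !surjective_pairing in L1. eapply Rle_trans; [exact L1|]. rewrite !Efst.
      replace (x + h + IZR (sigma * kap) - (x + IZR (sigma * kap))) with h by ring.
      replace (3 * KH * Rabs h) with (KH * (3 * Rabs h)) by ring. apply Rmult_le_compat_l; lra. }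
  assert (HR0 : forall x, Rabs (R' 0%nat x) <= 2 * KH).
  { intros x. apply (qdiff_le _ x _ _ _ (HR' 0%nat x ltac:(lia)) Hmin). intros h Hh.
    destruct (Hlip x h Hh) as [B _]. assert (m2 := Rmin_r (d / 4) dH).
    destruct (ch_lipschitz _ _ _ _ _ _ _ Hch (x + h) (snd (PP 0%nat (x + h))) x (snd (PP 0%nat x))
       ltac:(apply RI; lia) ltac:(apply RI; lia)) as [_ L1].
    - replace (x + h - x) with h by ring. lra.
    - change (x + h, snd (PP 0%nat (x + h))) with (PP 0%nat (x + h)) in L1. change (x, snd (PP 0%nat x)) with (PP 0%nat x) in L1.
      eapply Rle_trans; [exact L1|]. replace (x + h - x) with h by ring.
      replace (2 * KH * Rabs h) with (KH * (2 * Rabs h)) by ring. apply Rmult_le_compat_l; lra. }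
  set (Phi := fun t => closing_length M G H F Y N t - l * (cos (snd (H (PP 0%nat t))) * (fst (H (PP N t)) - fst (H (PP 0%nat t)) - IZR kap))).
  set (dPhi := fun x => l * ((cos (snd (H (PP N x))) - cos (snd (H (PP 0%nat x)))) * S' N x)
     + l * (sin (snd (H (PP 0%nat x))) * R' 0%nat x * (fst (H (PP N x)) - fst (H (PP 0%nat x)) - IZR kap))).
  assert (HPhi : forall x, is_derive Phi x (dPhi x)).
  { intros x.
    assert (D1 := Hell x). assert (D2 := qdiff_is_derive _ _ _ (HR' 0%nat x ltac:(lia))).
    assert (D3 := qdiff_is_derive _ _ _ (HS' N x (Nat.le_refl N))). assert (D4 := qdiff_is_derive _ _ _ (HS' 0%nat x ltac:(lia))).
    unfold Phi, dPhi.
    set (f1 := closing_length M G H F Y N) in *. set (f2 := fun t => snd (H (PP 0%nat t))) in *.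
    set (f3 := fun t => fst (H (PP N t))) in *. set (f4 := fun t => fst (H (PP 0%nat t))) in *.
    change (is_derive (fun t => f1 t - l * (cos (f2 t) * (f3 t - f4 t - IZR kap))) x
      (l * ((cos (snd (H (PP N x))) - cos (f2 x)) * S' N x) + l * (sin (f2 x) * R' 0%nat x * (f3 x - f4 x - IZR kap)))).
    change (snd (H (PP 0%nat x))) with (f2 x) in D1.
    clearbody f1 f2 f3 f4. auto_derive.
    - do 3 (split; [eexists; eassumption|]). split; [eexists; eassumption|exact I].
    - apply is_derive_unique in D1, D2, D3, D4.
      change (Derive (fun t => f1 t) x = l * (cos (snd (H (PP N x))) * S' N x - cos (f2 x) * S' 0%nat x)) in D1.
      change (Derive (fun t => f2 t) x = R' 0%nat x) in D2. change (Derive (fun t => f3 t) x = S' N x) in D3.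
      change (Derive (fun t => f4 t) x = S' 0%nat x) in D4. rewrite D1, D2, D3, D4. ring. }
  (* The constant is 5 = 3 + 2: the first term pairs [S' N] with the change of angle, the second
     [R' 0] with the error in position. *)
  assert (HB : forall x, Rabs (dPhi x) <= 5 * l * KH ^ 2 * E).
  { intros x. destruct (Hret x) as [B1 B2]. specialize (HE x).
    assert (KE : KH * Cmod (defect f N Y (RtoC x)) <= KH * E) by (apply Rmult_le_compat_l; lra).
    unfold dPhi. eapply Rle_trans; [apply Rabs_triang|]. rewrite !Rabs_mult, (Rabs_pos_eq l) by lra.
    assert (Hcos := cos_lipschitz (snd (H (PP N x))) (snd (H (PP 0%nat x)))).
    assert (Hsin : Rabs (sin (snd (H (PP 0%nat x)))) <= 1) by (assert (q := SIN_bound (snd (H (PP 0%nat x)))); apply Rabs_le; lra).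
    assert (T1 : Rabs (cos (snd (H (PP N x))) - cos (snd (H (PP 0%nat x)))) * Rabs (S' N x) <= (KH * E) * (3 * KH)).
    { apply Rmult_le_compat; try apply Rabs_pos; [lra|apply HSN]. }
    assert (T2 : Rabs (sin (snd (H (PP 0%nat x)))) * Rabs (R' 0%nat x) <= 1 * (2 * KH)).
    { apply Rmult_le_compat; try apply Rabs_pos; [lra|apply HR0]. }
    assert (T3 : Rabs (sin (snd (H (PP 0%nat x)))) * Rabs (R' 0%nat x) * Rabs (fst (H (PP N x)) - fst (H (PP 0%nat x)) - IZR kap) <= (1 * (2 * KH)) * (KH * E)).
    { apply Rmult_le_compat; try apply Rabs_pos; [apply Rmult_le_pos; apply Rabs_pos|lra|lra]. }
    apply Rmult_le_compat_l with (r := l) in T1; [|lra]. apply Rmult_le_compat_l with (r := l) in T3; [|lra].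
    replace (5 * l * KH ^ 2 * E) with (l * ((KH * E) * (3 * KH)) + l * ((1 * (2 * KH)) * (KH * E))) by ring. lra. }
  assert (HP0 : forall x, defect f N Y (RtoC x) = RtoC 0 -> Phi x = closing_length M G H F Y N x).
  { intros x Hx. destruct (Hret x) as [B _]. rewrite Hx, Cmod_0, Rmult_0_r in B.
    unfold Phi. assert (Q := Rabs_pos (fst (H (PP N x)) - fst (H (PP 0%nat x)) - IZR kap)).
    rewrite (Rabs_eq_0 (fst (H (PP N x)) - fst (H (PP 0%nat x)) - IZR kap)) by lra. ring. }
  rewrite <- (HP0 x0 Hx0), <- (HP0 x1 Hx1).
  assert (HBE : 0 <= 5 * l * KH ^ 2 * E) by (eapply Rle_trans; [apply Rabs_pos|apply (HB 0)]).
  apply Rabs_le_between in Hxx.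
  assert (MV : forall u v, u <= v -> v - u <= 1 -> Rabs (Phi v - Phi u) <= 5 * l * KH ^ 2 * E).
  { intros u v Huv Hv. eapply Rle_trans; [apply (mean_value_bound Phi dPhi (5 * l * KH ^ 2 * E) u v Huv)|].
    - intros s _. split; [apply HPhi|apply HB].
    - rewrite <- (Rmult_1_r (5 * l * KH ^ 2 * E)) at 2. apply Rmult_le_compat_l; lra. }
  destruct (Rle_dec x0 x1) as [Hle|Hle].
  - rewrite Rabs_minus_sym. apply MV; lra.
  - apply MV; lra.
Qed.

(** * Comparison of two periodic trajectories *)

Definition chord (M : R -> C) (s : Z -> R) (k : Z) : R := Cmod (M (s (k + 1)%Z) - M (s k))%C.

Definition tracks (H F : R * R -> R * R) (N : nat) (m : Z) (s r : Z -> R) (c : Z) (P : R * R) : Prop :=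
  (forall j, (j <= N)%nat -> cyl_eq (H (Nat.iter j F P)) (s (c + 2 * Z.of_nat j)%Z, r (c + 2 * Z.of_nat j)%Z)) /\
  Nat.iter N F P = (fst P + IZR m, snd P).

(** Chord lengths see positions modulo 1 only, so tracking up to [cyl_eq] is enough; the odd
    positions are recovered by one application of the billiard map. *)
Lemma tracked_length (M : R -> C) (G H F : R * R -> R * R) (f : C * C -> C * C) (l b dH KH : R) (sigma : Z)
    (N : nat) (m : Z) (s r : Z -> R) (c : Z) (P : R * R) (Y : C -> C) :
  smooth_curve M l -> billiard_lift M G -> chart G b H F sigma dH KH -> billiard_orbit G s r ->
  tracks H F N m s r c P -> (forall j, (j <= N)%nat -> Rabs (snd (Nat.iter j F P)) < b) ->
  Y (RtoC (fst P)) = RtoC (snd P) ->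
  closing_length M G H F Y N (fst P) = rsum (fun k => chord M s (c + Z.of_nat k)) (2 * N).
Proof.
  intros HM HG Hch Horb [Htr _] Hb EY. unfold closing_length.
  assert (EP : closing_point Y (fst P) = P) by (unfold closing_point; rewrite EY; destruct P; reflexivity).
  rewrite EP, rsum_pairs. apply rsum_ext. intros j Hj.
  assert (Hcm : forall Q s0 r0, cyl_eq Q (s0, r0) -> M (fst Q) = M s0).
  { intros Q s0 r0 [[k E] _]. cbn [fst] in E. rewrite E. symmetry. apply (curve_int M l HM). }
  assert (C0 := Htr j ltac:(lia)). assert (C2 := Htr (S j) ltac:(lia)).
  assert (Hang : 0 < snd (H (Nat.iter j F P)) < PI).
  { rewrite (surjective_pairing (Nat.iter j F P)). apply (ch_angle _ _ _ _ _ _ _ Hch). apply Hb. lia. }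
  assert (C1 := billiard_cyl M G l _ _ HM HG Hang C0). rewrite (proj2 (Horb _)) in C1.
  unfold two_chords, chord. rewrite (Hcm _ _ _ C0), (Hcm _ _ _ C1).
  change (F (Nat.iter j F P)) with (Nat.iter (S j) F P). rewrite (Hcm _ _ _ C2).
  replace (c + Z.of_nat (2 * j))%Z with (c + 2 * Z.of_nat j)%Z by lia.
  replace (c + Z.of_nat (2 * j + 1))%Z with (c + 2 * Z.of_nat j + 1)%Z by lia.
  replace (c + 2 * Z.of_nat (S j))%Z with (c + 2 * Z.of_nat j + 1 + 1)%Z by lia. reflexivity.
Qed.

Lemma tracks_shift (H F G : R * R -> R * R) (f : C * C -> C * C) (b dH KH : R) (sigma : Z)
    (N : nat) (m : Z) (s r : Z -> R) (c : Z) (P : R * R) (n : Z) :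
  chart G b H F sigma dH KH -> chart_map F f b -> (forall j, (j <= N)%nat -> Rabs (snd (Nat.iter j F P)) < b) ->
  tracks H F N m s r c P -> tracks H F N m s r c (fst P + IZR n, snd P).
Proof.
  intros Hch Hc Hb [H1 H2].
  assert (E := periodic_int_iter F f b N P n Hc ltac:(intros; apply Hb; lia)). split.
  - intros j Hj. rewrite E by auto. apply cyl_eq_trans with (H (Nat.iter j F P)); [|auto].
    rewrite (chart_shift_int _ _ _ _ _ _ _ Hch) by auto. rewrite <- surjective_pairing.
    split; [|reflexivity]. exists (- (n * sigma))%Z. cbn [fst]. rewrite opp_IZR. ring.
  - rewrite E, H2 by lia. cbn [fst snd]. f_equal. ring.
Qed.

(** The billiard map is deterministic, so a shared phase point makes all later chords equal, and a
    sum over one period does not depend on where it starts. *)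
Lemma merging_trajectories_length (M : R -> C) (G : R * R -> R * R) (l : R) (s r s' r' : Z -> R) (i i' n : Z) (per : nat)
    (w : Z) :
  smooth_curve M l -> billiard_lift M G -> billiard_orbit G s r -> billiard_orbit G s' r' ->
  (forall k, s (k + Z.of_nat per)%Z = s k + IZR w) -> (forall k, s' (k + Z.of_nat per)%Z = s' k + IZR w) ->
  s i = s' i' + IZR n -> r i = r' i' ->
  rsum (fun k => chord M s (Z.of_nat k)) per = rsum (fun k => chord M s' (Z.of_nat k)) per.
Proof.
  intros HM HG Ho Ho' Hp Hp' Es Er.
  assert (E : forall k, s (i + Z.of_nat k)%Z = s' (i' + Z.of_nat k)%Z + IZR n /\ r (i + Z.of_nat k)%Z = r' (i' + Z.of_nat k)%Z).
  { induction k as [|k [IH1 IH2]]; [rewrite !Z.add_0_r; auto|].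
    replace (i + Z.of_nat (S k))%Z with (i + Z.of_nat k + 1)%Z by lia.
    replace (i' + Z.of_nat (S k))%Z with (i' + Z.of_nat k + 1)%Z by lia.
    destruct (Ho (i + Z.of_nat k)%Z) as [A1 A2]. destruct (Ho' (i' + Z.of_nat k)%Z) as [B1 B2].
    rewrite IH1, IH2, (billiard_shift M G l _ _ _ HM HG B1), B2 in A2. cbn [fst snd] in A2.
    injection A2. intros. split; symmetry; auto. }
  assert (Q : forall t, (forall k, t (k + Z.of_nat per)%Z = t k + IZR w) -> forall k, chord M t (k + Z.of_nat per)%Z = chord M t k).
  { intros t Ht k. unfold chord. replace (k + Z.of_nat per + 1)%Z with (k + 1 + Z.of_nat per)%Z by lia.
    rewrite !Ht, !(curve_int M l HM). reflexivity. }
  rewrite <- (rsum_periodic (chord M s) per i (Q s Hp)), <- (rsum_periodic (chord M s') per i' (Q s' Hp')).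
  apply rsum_ext. intros k _. unfold chord.
  replace (i + Z.of_nat k + 1)%Z with (i + Z.of_nat (S k))%Z by lia.
  replace (i' + Z.of_nat k + 1)%Z with (i' + Z.of_nat (S k))%Z by lia.
  rewrite (proj1 (E k)), (proj1 (E (S k))), !(curve_int M l HM). reflexivity.
Qed.

(** Period 2 N with N + kap turns. The Birkhoff property is kept through two consequences: the
    constant sign of the excess, which brings the trajectory near the resonant curve, and the
    distinctness modulo 1 of N consecutive even positions, which gives distinct zeros. *)
Definition periodic_trajectory (G : R * R -> R * R) (N : nat) (kap : Z) (s r : Z -> R) : Prop :=
  billiard_orbit G s r /\
  (forall k, s (k + 2 * Z.of_nat N)%Z = s k + INR N + IZR kap /\ r (k + 2 * Z.of_nat N)%Z = r k) /\
  ((forall k, 0 < excess s k) \/ (forall k, excess s k < 0)) /\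
  (forall c j k n, (j < N)%nat -> (k < N)%nat ->
     s (c + 2 * Z.of_nat j)%Z = s (c + 2 * Z.of_nat k)%Z + IZR n -> j = k).

Lemma trajectories_length_bound (M : R -> C) (G H F : R * R -> R * R) (f : C * C -> C * C) (l b dH KH : R) (sigma : Z)
    (a2 y1 d A L alpha : R) :
  smooth_curve M l -> billiard_lift M G -> chart G b H F sigma dH KH -> chart_map F f b ->
  near_twist f a2 y1 d A -> y1 < b -> 1 <= L -> 0 < alpha < a2 ->
  exists K T, 0 < K /\ forall (N : nat) (kap : Z) (s r s' r' : Z -> R),
    T <= INR N -> Rabs (IZR kap) <= L -> rel_prime kap (Z.of_nat N) ->
    periodic_trajectory G N kap s r -> periodic_trajectory G N kap s' r' ->
    Rabs (rsum (fun k => chord M s (Z.of_nat k)) (2 * N) - rsum (fun k => chord M s' (Z.of_nat k)) (2 * N))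
      <= K * exp (- (2 * PI * alpha * INR N)).
Proof.
  intros HM HG Hch Hc Hf Hyb HL Hal. assert (hl := sc_length M l HM).
  destruct (nt_pos _ _ _ _ _ Hf) as (Hy1 & Hd & HA). destruct (ch_pos _ _ _ _ _ _ _ Hch) as [[HdH0 HdHb] HKH].
  (* Nested widths alpha < a0 < a1 < a2: the maximum principle is applied on the strip [a0], the
     closing curve lives on [a1], and its iterates stay in [a2]. *)
  set (a1 := (alpha + 2 * a2) / 3). set (a0 := (2 * alpha + a2) / 3).
  destruct (trajectory_periodic_point M G l H F f sigma b dH KH a1 a2 y1 d A L HM HG Hch Hf Hyb ltac:(unfold a1; lra) HL (cm_real _ _ _ Hc))
    as (C0 & T & HC0 & Hpt).
  assert (HD : 0 <= drift A C0).
  { unfold drift. apply Rplus_le_le_0_compat; (apply Rmult_le_pos; [lra|apply pow_le; lra]). }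
  destruct (many_zeros_bound alpha a0 (2 * drift A C0) ltac:(unfold a0; lra) ltac:(lra)) as (K0 & HK0 & HZ).
  exists (5 * l * KH ^ 2 * K0), (Rmax (Rmax 1 T) (Rmax (threshold a1 a2 y1 d A C0) (2 * C0 / dH))).
  split; [repeat apply Rmult_lt_0_compat; try lra; apply pow_lt; auto|].
  intros N kap s r s' r' HN Hkap Hrp (Ho & Hper & Hex & Hdis) (Ho' & Hper' & Hex' & Hdis').
  assert (N1 : Rmax 1 T <= INR N) by (eapply Rle_trans; [apply Rmax_l|exact HN]).
  assert (N2 : Rmax (threshold a1 a2 y1 d A C0) (2 * C0 / dH) <= INR N) by (eapply Rle_trans; [apply Rmax_r|exact HN]).
  assert (N3 : 1 <= INR N) by (eapply Rle_trans; [apply Rmax_l|exact N1]).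
  assert (N4 : T <= INR N) by (eapply Rle_trans; [apply Rmax_r|exact N1]).
  assert (N5 : threshold a1 a2 y1 d A C0 <= INR N) by (eapply Rle_trans; [apply Rmax_l|exact N2]).
  assert (N6 : 2 * C0 / dH <= INR N) by (eapply Rle_trans; [apply Rmax_r|exact N2]).
  assert (HN1 : (1 <= N)%nat) by (apply INR_le; simpl; lra).
  destruct (Hpt N kap s r N4 N5 Hkap Ho Hper Hex) as (c & P & HP & Htr & Hret).
  destruct (Hpt N kap s' r' N4 N5 Hkap Ho' Hper' Hex') as (c' & P0 & HP0 & Htr0 & Hret0).
  assert (Hm : Rabs (IZR (sigma * kap)) <= C0 - 1).
  { rewrite mult_IZR, Rabs_mult. destruct (ch_sigma _ _ _ _ _ _ _ Hch) as [->| ->]; rewrite ?Rabs_R1; [lra|].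
    replace (Rabs (-1)) with 1 by (rewrite Rabs_left; lra). lra. }
  assert (Hrm : rel_prime (sigma * kap) (Z.of_nat N)).
  { destruct (ch_sigma _ _ _ _ _ _ _ Hch) as [->| ->]; [rewrite Z.mul_1_l; auto|].
    replace (-1 * kap)%Z with (- kap)%Z by ring. apply Zis_gcd_minus. rewrite Z.opp_involutive. apply Zis_gcd_sym, Hrp. }
  assert (Ha1 : 0 < a1) by (unfold a1; lra). assert (Haa : a1 < a2) by (unfold a1; lra).
  destruct (closing_curve_exists f a1 a2 y1 d A C0 N (sigma * kap) Hf ltac:(lra) Ha1 Haa N5 Hm) as (Y & HY).
  assert (HdN : 2 * C0 * / INR N <= dH).
  { apply Rmult_le_reg_r with (INR N); [lra|]. rewrite Rmult_assoc, Rinv_l, Rmult_1_r by lra.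
    apply Rle_div_l in N6; [lra|auto]. }
  assert (Hwind : forall t : Z -> R, (forall k, t (k + 2 * Z.of_nat N)%Z = t k + INR N + IZR kap) ->
    forall k, t (k + Z.of_nat (2 * N))%Z = t k + IZR (Z.of_nat N + kap)).
  { intros t Ht k. replace (k + Z.of_nat (2 * N))%Z with (k + 2 * Z.of_nat N)%Z by lia.
    rewrite Ht, plus_IZR, <- INR_IZR_INZ. ring. }
  assert (HbK : 0 <= 5 * l * KH ^ 2 * K0 * exp (- (2 * PI * alpha * INR N))).
  { apply Rmult_le_pos; [|apply Rlt_le, exp_pos]. apply Rmult_le_pos; [|lra]. apply Rmult_le_pos; [lra|apply pow_le; lra]. }
  assert (Hzer := fun P HP Hret => periodic_point_zeros F f a1 a2 y1 d A C0 b N (sigma * kap) Y P Hf Hyb ltac:(lra) Ha1 Haa N5 Hm HY Hc HP Hret).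
  destruct (Hzer P HP Hret) as [Z1 Z2]. destruct (Hzer P0 HP0 Hret0) as [_ Z3].
  (* An integer translation brings the abscissae of the two periodic points within 1 of each other,
     so that the derivative of the length is used on an interval of bounded length. *)
  set (P' := (fst P0 + IZR (up (fst P - fst P0)), snd P0)).
  assert (Tr : tracks H F N (sigma * kap) s r c P) by (split; auto).
  assert (Tr' : tracks H F N (sigma * kap) s' r' c' P').
  { apply (tracks_shift H F G f b dH KH sigma); auto; [intros; apply Z3; auto|split; auto]. }
  destruct (Hzer P' HP0 (proj2 Tr')) as [Z1' Z2'].
  assert (Hclose : Rabs (fst P - fst P') <= 1).
  { unfold P'. cbn [fst]. destruct (archimed (fst P - fst P0)) as [U1 U2]. apply Rabs_le. lra. }
  (* On the closing curve the height is a periodic function of the abscissa, so equal abscissae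
     modulo 1 mean equal phase points. Applied to a single trajectory this gives distinct zeros;
     applied to both it tells when they meet. *)
  assert (Hinj : forall s r c P, tracks H F N (sigma * kap) s r c P ->
     (forall j, (j <= N)%nat -> Rabs (snd (Nat.iter j F P)) < b /\ Y (RtoC (fst (Nat.iter j F P))) = RtoC (snd (Nat.iter j F P)) /\
       defect f N Y (RtoC (fst (Nat.iter j F P))) = RtoC 0) ->
     forall s' r' c' P', tracks H F N (sigma * kap) s' r' c' P' ->
     (forall j, (j <= N)%nat -> Rabs (snd (Nat.iter j F P')) < b /\ Y (RtoC (fst (Nat.iter j F P'))) = RtoC (snd (Nat.iter j F P')) /\
       defect f N Y (RtoC (fst (Nat.iter j F P'))) = RtoC 0) ->
     forall j k n, (j < N)%nat -> (k < N)%nat -> fst (Nat.iter j F P) = fst (Nat.iter k F P') + IZR n ->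
       exists n', s (c + 2 * Z.of_nat j)%Z = s' (c' + 2 * Z.of_nat k)%Z + IZR n' /\ r (c + 2 * Z.of_nat j)%Z = r' (c' + 2 * Z.of_nat k)%Z).
  { clear - HY Hch Ha1. intros s r c P [Tr _] Z2 s' r' c' P' [Tr' _] Z2' j k n Hj Hk E.
    destruct (Z2 j ltac:(lia)) as (B1 & B2 & _). destruct (Z2' k ltac:(lia)) as (B1' & B2' & _).
    specialize (Tr j ltac:(lia)). specialize (Tr' k ltac:(lia)).
    set (Q := Nat.iter j F P) in *. set (Q' := Nat.iter k F P') in *.
    assert (YP : forall (n : nat) (x : R), Y (RtoC (x + INR n)) = Y (RtoC x)).
    { induction n0 as [|p IH]; intros x; [simpl; rewrite Rplus_0_r; reflexivity|].
      rewrite S_INR, <- Rplus_assoc, RtoC_plus, (cc_periodic _ _ _ _ _ _ _ HY) by (simpl; rewrite Rabs_R0; lra). apply IH. }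
    assert (YPZ : forall x : R, Y (RtoC (x + IZR n)) = Y (RtoC x)).
    { intros x. destruct (Z_le_dec 0 n) as [Hn|Hn].
      - rewrite <- (YP (Z.to_nat n) x), INR_IZR_INZ, Z2Nat.id by lia. reflexivity.
      - rewrite <- (YP (Z.to_nat (- n)) (x + IZR n)), INR_IZR_INZ, Z2Nat.id, opp_IZR by lia. do 2 f_equal. ring. }
    assert (Es : snd Q = snd Q').
    { apply RtoC_inj. rewrite <- B2, <- B2', E. apply YPZ. }
    assert (EQ : Q = (fst Q' + IZR n, snd Q')) by (rewrite (surjective_pairing Q), E, Es; reflexivity).
    rewrite EQ, (chart_shift_int _ _ _ _ _ _ _ Hch) in Tr by auto. rewrite <- surjective_pairing in Tr.
    destruct Tr as [[k1 E1] E2]. destruct Tr' as [[k2 E3] E4]. cbn [fst snd] in E1, E2, E3, E4.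
    exists (n * sigma + k1 - k2)%Z. rewrite minus_IZR, plus_IZR. split; [lra|congruence]. }
  destruct (classic (apart (fun j => fst (Nat.iter j F P)) (fun j => fst (Nat.iter j F P')) N)) as [Hap|Hap].
  - assert (Hdef : forall z, Rabs (Im z) <= a0 -> smooth1 (defect f N Y) z /\ defect f N Y (z + 1)%C = defect f N Y z /\ Cmod (defect f N Y z) <= 1).
    { intros z Hz. apply (defect_properties f a1 a2 y1 d A C0 N (sigma * kap) Y Hf ltac:(lra) Ha1 Haa N5 Hm HY).
      unfold a0, a1 in *. lra. }
    assert (HE : forall t : R, Cmod (defect f N Y (RtoC t)) <= K0 * exp (- (2 * PI * alpha * INR N))).
    { apply (HZ N (sigma * kap)%Z (defect f N Y) (fun j => fst (Nat.iter j F P)) (fun j => fst (Nat.iter j F P'))); auto.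
      - intros z Hz. apply Hdef, Hz.
      - intros z Hz. apply Hdef, Hz.
      - intros z Hz. apply Hdef, Hz.
      - intros j Hj. apply Z2. lia.
      - intros j Hj. apply Z2'. lia.
      - intros j k n Hj Hk E. destruct (Hinj s r c P Tr Z2 s r c P Tr Z2 j k n Hj Hk E) as (n' & E' & _).
        apply (Hdis c j k n' Hj Hk E').
      - intros j k n Hj Hk E. destruct (Hinj s' r' c' P' Tr' Z2' s' r' c' P' Tr' Z2' j k n Hj Hk E) as (n' & E' & _).
        apply (Hdis' c' j k n' Hj Hk E'). }
    assert (HV := closing_length_variation M G H F f l b dH KH sigma a1 a2 y1 d A C0 N kap Y _ (fst P) (fst P')
      HM HG Hch Hc Hf Hyb ltac:(lra) Ha1 Haa N5 HdN Hm HY HE (proj2 (proj2 (Z2 0%nat ltac:(lia)))) (proj2 (proj2 (Z2' 0%nat ltac:(lia)))) Hclose).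
    rewrite (tracked_length M G H F f l b dH KH sigma N (sigma * kap) s r c P Y HM HG Hch Ho Tr) in HV;
      [|intros; apply Z2; auto|apply (Z2 0%nat); lia].
    rewrite (tracked_length M G H F f l b dH KH sigma N (sigma * kap) s' r' c' P' Y HM HG Hch Ho' Tr') in HV;
      [|intros; apply Z2'; auto|apply (Z2' 0%nat); lia].
    assert (Hpc : forall t : Z -> R, (forall k, t (k + 2 * Z.of_nat N)%Z = t k + INR N + IZR kap) ->
       forall k, chord M t (k + Z.of_nat (2 * N))%Z = chord M t k).
    { intros t Ht k. unfold chord. replace (k + Z.of_nat (2 * N) + 1)%Z with (k + 1 + Z.of_nat (2 * N))%Z by lia.
      rewrite !(Hwind t Ht), !(curve_int M l HM). reflexivity. }
    rewrite (rsum_periodic (chord M s)), (rsum_periodic (chord M s')) in HV by (apply Hpc; intros; first [apply Hper|apply Hper']).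
    rewrite Rmult_assoc. exact HV.
  - assert (Hmeet : exists j k n, (j < N)%nat /\ (k < N)%nat /\ fst (Nat.iter j F P) = fst (Nat.iter k F P') + IZR n).
    { apply NNPP. intros Hno. apply Hap. intros j k n Hj Hk E. apply Hno. exists j, k, n. auto. }
    destruct Hmeet as (j & k & n & Hj & Hk & E).
    destruct (Hinj s r c P Tr Z2 s' r' c' P' Tr' Z2' j k n Hj Hk E) as (n' & Es & Er).
    rewrite (merging_trajectories_length M G l s r s' r' _ _ n' (2 * N) (Z.of_nat N + kap) HM HG Ho Ho'
      (Hwind s (fun k => proj1 (Hper k))) (Hwind s' (fun k => proj1 (Hper' k))) Es Er).
    rewrite Rminus_diag, Rabs_R0. exact HbK.
Qed.

(** * Exponential smallness of the length gap *)

(* [2 N] is the smallest even multiple of the period. *)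
Lemma even_period (p q : Z) :
  rel_prime p q -> (1 <= q)%Z ->
  exists (N : nat) (mu kap : Z), (mu = 1 \/ mu = 2)%Z /\ (2 * Z.of_nat N = mu * q)%Z /\
    (kap = mu * p - Z.of_nat N)%Z /\ rel_prime kap (Z.of_nat N).
Proof.
  intros Hpq Hq. destruct (rel_prime_bezout _ _ Hpq) as [u v E].
  destruct (Z.Even_or_Odd q) as [[t Ht]|[t Ht]].
  - exists (Z.to_nat t), 1%Z, (p - t)%Z. rewrite Z2Nat.id by lia. split; [auto|]. split; [lia|]. split; [lia|].
    apply bezout_rel_prime. apply (Bezout_intro _ _ _ u (2 * v + u)). rewrite <- E, Ht. ring.
  - exists (Z.to_nat q), 2%Z, (2 * p - q)%Z. rewrite Z2Nat.id by lia. split; [auto|]. split; [lia|]. split; [lia|].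
    apply bezout_rel_prime. apply (Bezout_intro _ _ _ (- t * u) (v + u * p - t * u)).
    replace (- t * u * (2 * p - q) + (v + u * p - t * u) * q)%Z with (u * p * (q - 2 * t) + v * q)%Z by ring.
    rewrite <- E, Ht. ring.
Qed.

(** The order condition is used twice. Comparing k with k + 2 gives the sign of the excess; and a
    coincidence of two positions modulo 1 is a coincidence of their labels k p / q modulo 1, which
    coprimality of [kap] and N excludes among N consecutive even positions. *)
Lemma birkhoff_periodic_trajectory (G : R * R -> R * R) (p q mu kap : Z) (N : nat) (s r : Z -> R) :
  (1 <= q)%Z -> (2 * p <> q)%Z -> (mu = 1 \/ mu = 2)%Z -> (2 * Z.of_nat N = mu * q)%Z ->
  (kap = mu * p - Z.of_nat N)%Z -> rel_prime kap (Z.of_nat N) ->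
  birkhoff_trajectory G p q s r -> periodic_trajectory G N kap s r.
Proof.
  intros Hq Hpq Hmu HN Hkap Hrp (Horb & Hper & Hbir).
  assert (Hq0 : 0 < IZR q) by (apply IZR_lt; lia).
  split; [exact Horb|]. split; [|split].
  - intros k. assert (E : IZR kap = IZR mu * IZR p - INR N) by (rewrite Hkap, minus_IZR, mult_IZR, <- INR_IZR_INZ; reflexivity).
    rewrite E, HN. destruct Hmu as [->| ->].
    + rewrite Z.mul_1_l, (proj1 (Hper k)), (proj2 (Hper k)). split; [ring|reflexivity].
    + replace (k + 2 * q)%Z with (k + q + q)%Z by ring.
      rewrite (proj1 (Hper (k + q)%Z)), (proj2 (Hper (k + q)%Z)), (proj1 (Hper k)), (proj2 (Hper k)). split; [ring|reflexivity].
  - destruct (Z.lt_total (2 * p) q) as [H|[H|H]]; [right|contradiction|left]; intros k; unfold excess;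
      apply IZR_lt in H; rewrite mult_IZR in H;
      assert (Estep : IZR (k + 2) * IZR p / IZR q = IZR k * IZR p / IZR q + 2 * IZR p / IZR q) by (rewrite plus_IZR; field; lra).
    + assert (Q : s (k + 2)%Z < s k + IZR 1); [|simpl in Q; lra]. apply Hbir. rewrite Estep.
      assert (2 * IZR p / IZR q < 1) by (apply Rlt_div_l; lra). lra.
    + assert (Q : s k < s (k + 2)%Z + IZR (-1)); [|simpl in Q; lra]. apply Hbir. rewrite Estep.
      assert (1 < 2 * IZR p / IZR q) by (apply Rlt_div_r; lra). lra.
  - intros c j k n Hj Hk E.
    set (i := (c + 2 * Z.of_nat j)%Z) in *. set (i' := (c + 2 * Z.of_nat k)%Z) in *.
    assert (Eq : IZR i * IZR p / IZR q = IZR i' * IZR p / IZR q + IZR n).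
    { apply Rle_antisym; apply Rnot_lt_le; intros Hlt.
      - assert (Q : s i' < s i + IZR (- n)); [|rewrite opp_IZR in Q; lra]. apply Hbir. rewrite opp_IZR. lra.
      - apply Hbir in Hlt. lra. }
    assert (Ez : (i * p = i' * p + n * q)%Z).
    { apply eq_IZR. rewrite plus_IZR, !mult_IZR.
      replace (IZR i * IZR p) with (IZR i * IZR p / IZR q * IZR q) by (field; lra). rewrite Eq. field. lra. }
    assert (Hdiv : (Z.of_nat N | kap * (Z.of_nat j - Z.of_nat k))%Z).
    { exists (n - (Z.of_nat j - Z.of_nat k))%Z. unfold i, i' in Ez. rewrite Hkap.
      assert (X : ((Z.of_nat j - Z.of_nat k) * (2 * (mu * p)) = n * (2 * Z.of_nat N))%Z) by (rewrite HN; nia). nia. }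
    apply Gauss in Hdiv; [|apply rel_prime_sym; exact Hrp].
    destruct Hdiv as [w Hw]. assert (w = 0)%Z by nia. subst w. lia.
Qed.

(** With [mu = 2] the 2 N steps cover the trajectory twice. As [mu] is at least 1, a bound for the
    doubled difference also bounds the difference itself. *)
Lemma rsum_chord_trajectory_length (M : R -> C) (l : R) (p q mu : Z) (N : nat) (s : Z -> R) :
  smooth_curve M l -> (1 <= q)%Z -> (mu = 1 \/ mu = 2)%Z -> (2 * Z.of_nat N = mu * q)%Z ->
  (forall k, s (k + q)%Z = s k + IZR p) ->
  rsum (fun k => chord M s (Z.of_nat k)) (2 * N) = IZR mu * trajectory_length M q s.
Proof.
  intros HM Hq Hmu HN Hper.
  assert (E : trajectory_length M q s = rsum (fun k => chord M s (Z.of_nat k)) (Z.to_nat q)).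
  { unfold trajectory_length. rewrite sum_n_rsum. replace (S (Z.to_nat q - 1)) with (Z.to_nat q) by lia. reflexivity. }
  rewrite E. destruct Hmu as [->| ->].
  - replace (2 * N)%nat with (Z.to_nat q) by lia. simpl. ring.
  - replace (2 * N)%nat with (Z.to_nat q + Z.to_nat q)%nat by lia. rewrite rsum_add.
    rewrite (rsum_ext (fun k => chord M s (Z.of_nat (Z.to_nat q + k))) (fun k => chord M s (q + Z.of_nat k)%Z)) by (intros; f_equal; lia).
    rewrite (rsum_periodic (chord M s)); [simpl; ring|].
    intros k. rewrite Z2Nat.id by lia. unfold chord. replace (k + q + 1)%Z with (k + 1 + q)%Z by lia.
    rewrite !Hper, !(curve_int M l HM). reflexivity.
Qed.

Theorem theorem7 (M : R -> C) (G : R * R -> R * R) (a alpha L : R)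
  (hM : analytic_convex_curve M)
  (hwidth : constant_width M)
  (hG : billiard_lift M G)
  (ha : 0 < a)
  (hC : exists b : R, 0 < b /\ analytic_resonant_RIC G a b)
  (halpha : 0 < alpha < a)
  (hL : 1 <= L) :
  exists (K : R) (qs : Z), 0 < K /\ (1 <= qs)%Z /\
    forall p q : Z, rel_prime p q ->
      1 <= IZR (Z.abs (2 * p - q)) <= L -> (qs <= q)%Z ->
      Rbar_le (length_gap M G p q)
        (Finite (K * exp (- (PI * alpha / Rabs (IZR p / IZR q - 1 / 2))))).
Proof.
  destruct (analytic_convex_smooth_curve M hM) as [l HM].
  destruct hC as (b & Hb & _ & _ & V & U & H & Hi & F & Fc & Hop & HUr & HUc & HVU & HUV & Hcyl & Han & H0 & Hstrip
    & HFper & HFan & HFcan & HFcper & HFc & _ & (c & d0 & Hd0 & Hord)).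
  destruct (chart_of_resonant_RIC G a b V U H Hi F Hb Hop HUr HUc HVU HUV Hcyl Han H0 Hstrip) as (sigma & dH & KH & Hch).
  set (a2 := (alpha + a) / 2).
  destruct (near_twist_of_analytic F Fc a b c d0 a2 Hb Hd0 ltac:(unfold a2; lra) HFcan HFcper HFc Hord) as (y1 & d & A & Hyb & Hf).
  assert (Hcm : chart_map F Fc b).
  { constructor.
    - intros [x y] HP. apply HFc. exact HP.
    - intros x y Hy. apply HFper. exact Hy. }
  destruct (trajectories_length_bound M G H F Fc l b dH KH sigma a2 y1 d A L alpha HM hG Hch Hcm Hf Hyb hL ltac:(unfold a2; lra))
    as (K & T & HK & Hbound).
  (* Since 2 N is at least q, the condition q >= 2 T ensures N >= T. *)
  exists K, (Z.max 1 (up (2 * T))). split; [exact HK|]. split; [lia|]. intros p q Hrp HL Hq.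
  assert (Hq1 : (1 <= q)%Z) by lia. assert (Hq0 : 0 < IZR q) by (apply IZR_lt; lia).
  assert (HqT : 2 * T <= IZR q).
  { destruct (archimed (2 * T)) as [U1 _]. assert (IZR (up (2 * T)) <= IZR q) by (apply IZR_le; lia). lra. }
  destruct (even_period p q Hrp Hq1) as (N & mu & kap & Hmu & HN & Hkap & Hrel).
  assert (HNR : 2 * INR N = IZR mu * IZR q).
  { rewrite INR_IZR_INZ, <- mult_IZR. rewrite <- mult_IZR. f_equal. exact HN. }
  assert (Hmu1 : 1 <= IZR mu <= 2) by (destruct Hmu as [->| ->]; simpl; lra).
  assert (Habs : 2 * Rabs (IZR kap) = IZR mu * IZR (Z.abs (2 * p - q))).
  { assert (E : 2 * IZR kap = IZR mu * IZR (2 * p - q)) by (rewrite <- !mult_IZR; f_equal; lia).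
    rewrite abs_IZR, <- (Rabs_pos_eq (IZR mu)), <- Rabs_mult, <- E, Rabs_mult, (Rabs_pos_eq 2) by lra. reflexivity. }
  assert (HTN : T <= INR N) by nra.
  assert (HkL : Rabs (IZR kap) <= L) by nra.
  assert (Hk1 : 1 <= Rabs (IZR kap)).
  { rewrite <- abs_IZR. apply IZR_le. destruct (Z.eq_dec kap 0) as [E|E]; [|lia].
    rewrite E, Rabs_R0 in Habs. nra. }
  assert (Hne : (2 * p <> q)%Z).
  { intros E. rewrite E, Z.sub_diag in HL. simpl in HL. lra. }
  assert (HN0 : 0 < INR N) by nra.
  (* The distance |p/q - 1/2| equals |kap| / (2 N), so the claimed exponent is 2 pi alpha N / |kap|,
     and |kap| >= 1. *)
  assert (Hexp : exp (- (2 * PI * alpha * INR N)) <= exp (- (PI * alpha / Rabs (IZR p / IZR q - 1 / 2)))).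
  { assert (E : Rabs (IZR p / IZR q - 1 / 2) = Rabs (IZR kap) / (2 * INR N)).
    { replace (IZR p / IZR q - 1 / 2) with (IZR kap / (2 * INR N)).
      - unfold Rdiv. rewrite Rabs_mult, Rabs_inv, (Rabs_pos_eq (2 * INR N)) by lra. reflexivity.
      - rewrite Hkap, minus_IZR, mult_IZR, <- INR_IZR_INZ, HNR.
        replace (INR N) with (IZR mu * IZR q / 2) by lra. field. lra. }
    rewrite E. apply exp_monotone. apply Ropp_le_contravar.
    replace (PI * alpha / (Rabs (IZR kap) / (2 * INR N))) with (2 * PI * alpha * INR N * / Rabs (IZR kap)) by (field; lra).
    rewrite <- (Rmult_1_r (2 * PI * alpha * INR N)) at 2. assert (hp := PI_RGT_0).
    apply Rmult_le_compat_l.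
    - apply Rmult_le_pos; [|lra]. apply Rmult_le_pos; lra.
    - rewrite <- Rinv_1. apply Rinv_le_contravar; lra. }
  assert (Hex0 := exp_pos (- (2 * PI * alpha * INR N))).
  (* The adjoined value 0 is dealt with first; it lies below the bound because the latter is
     positive. *)
  unfold length_gap. apply Lub_Rbar_correct. intros x [->|(s & r & s' & r' & Ht & Ht' & ->)].
  - simpl. apply Rmult_le_pos; [lra|]. apply Rlt_le, exp_pos.
  - simpl. assert (B := Hbound N kap s r s' r' HTN HkL Hrel
      (birkhoff_periodic_trajectory G p q mu kap N s r Hq1 Hne Hmu HN Hkap Hrel Ht)
      (birkhoff_periodic_trajectory G p q mu kap N s' r' Hq1 Hne Hmu HN Hkap Hrel Ht')).
    destruct Ht as (_ & Hp & _). destruct Ht' as (_ & Hp' & _).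
    rewrite (rsum_chord_trajectory_length M l p q mu N s HM Hq1 Hmu HN (fun k => proj1 (Hp k))),
      (rsum_chord_trajectory_length M l p q mu N s' HM Hq1 Hmu HN (fun k => proj1 (Hp' k))) in B.
    rewrite <- Rmult_minus_distr_l, Rabs_mult, (Rabs_pos_eq (IZR mu)) in B by lra.
    set (D := Rabs (trajectory_length M q s - trajectory_length M q s')) in *.
    assert (HD : 0 <= D) by apply Rabs_pos.
    apply Rle_trans with (K * exp (- (2 * PI * alpha * INR N))); [nra|]. apply Rmult_le_compat_l; lra.
Qed.
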